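(* Let $\mathbb{T}^1=\mathbb{C}/\Lambda$ be a complex elliptic curve and let $(X,\mathcal{L})$ be a lamination by Riemann surfaces holomorphically embedded in $M=\mathbb{T}^1\times\mathbb{CP}^1$, without compact leaves and having only one minimal set. For $\epsilon\in\mathbb{C}$ let $\Phi_\epsilon([z_1],[w_1:w_2])=([z_1+\epsilon],[w_1:w_2])$. Then there exist a covering of $\mathcal{L}$ by flow boxes and constants $N\in\mathbb{N}$, $\epsilon_0>0$, $A>0$ such that for every $\epsilon$ with $0<|\epsilon|<\epsilon_0$, if $\Gamma_\alpha,\Gamma_\beta$ are plaques of the same flow box and $\Gamma_\beta^\epsilon=\Phi_\epsilon(\Gamma_\beta)$, then: (1) if $(X,\mathcal{L})$ is transversally Lipschitz, $\mathrm{Card}(\Gamma_\alpha\cap\Gamma_\beta^\epsilon)<N$; (2) without the Lipschitz assumption, $\mathrm{Card}(\Gamma_\alpha\cap\Gamma_\beta^\epsilon)<A\log(1/|\epsilon|)$.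
   Context: $[z_1]$ denotes the class in $\mathbb{T}^1$ of $z_1\in\mathbb{C}$. Local charts are restrictions of the projection $\mathbb{C}\to\mathbb{T}^1$ to small discs and $w\mapsto[1:w]$, $z\mapsto[z:1]$ for $\mathbb{CP}^1$. A horizontal flow box centered at $q$ is given by a product chart $\varphi$ with $\varphi(z_0,w_0)=q$, a disc $D_1$ centered at $0$ and a set $A$ in a disc centered at $0$ such that the plaques are $\{\varphi(z_0+z,\,w_0+\alpha+f_\alpha(z)):z\in D_1\}$, $\alpha\in A$, with $f_\alpha$ holomorphic, $f_\alpha(0)=0$; vertical flow boxes are defined symmetrically. The transversal distance is $d_z(\Gamma_\alpha,\Gamma_\beta)=|\alpha+f_\alpha(z)-\beta-f_\beta(z)|$; the lamination is transversally Lipschitz if $|\alpha-\beta|/C<d_z(\Gamma_\alpha,\Gamma_\beta)<C|\alpha-\beta|$ for a global constant $C$. A minimal set is a nonempty closed union of leaves minimal with this property. *)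

(* Defs.v *)
From mathcomp Require Import all_boot all_algebra.
From mathcomp Require Import complex.
From mathcomp Require Import all_classical all_reals all_analysis.
From Stdlib Require Import Relations.Relation_Operators.
Set Implicit Arguments. Unset Strict Implicit. Unset Printing Implicit Defensive.
Import GRing.Theory Num.Theory.
Local Open Scope ring_scope.

Section Lam.
Variable R : realType.
Local Notation C := (R[i]).

Definition cabs (z : C) : R := let: Complex a b := z in Num.sqrt (a ^+ 2 + b ^+ 2).
Definition cim (z : C) : R := let: Complex _ b := z in b.

Definition holo_disc (f : C -> C) (r : R) : Prop :=
  forall z, cabs z < r -> exists l : C, forall e : R, 0 < e ->
    exists d : R, 0 < d /\ forall h : C, 0 < cabs h -> cabs h < d ->
      cabs ((f (z + h) - f z) / h - l) < e.

Definition inLat (om1 om2 : C) (z : C) : Prop :=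
  exists m n : int, z = m%:~R * om1 + n%:~R * om2.

(* CP^1 via the affine coordinate w2/w1 : Some u = [1:u], None = [0:1] *)
Definition P1 := option C.
(* the two charts : w |-> [1:w]  and  z |-> [z:1] *)
Definition p1chart (k : bool) (w : C) : P1 :=
  if k then (if w == 0 then None else Some w^-1) else Some w.

Definition chordal (u v : P1) : R :=
  match u, v with
  | Some a, Some b => cabs (a - b) / (Num.sqrt (1 + cabs a ^+ 2) * Num.sqrt (1 + cabs b ^+ 2))
  | Some a, None | None, Some a => 1 / Num.sqrt (1 + cabs a ^+ 2)
  | None, None => 0
  end.

(* points of M are represented by pairs (z, u), z a representative in C of [z] *)
Definition Mpt := (C * P1)%type.

Variables om1 om2 : C.

Definition Meq (p q : Mpt) : Prop := inLat om1 om2 (p.1 - q.1) /\ p.2 = q.2.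

Definition Mclose (p q : Mpt) (d : R) : Prop :=
  exists l, inLat om1 om2 l /\ cabs (p.1 + l - q.1) < d /\ chordal p.2 q.2 < d.

Definition Mset := Mpt -> Prop.
Definition Minvariant (S : Mset) := forall p q, S p -> Meq p q -> S q.

Definition Mconv (u : nat -> Mpt) (p : Mpt) : Prop :=
  forall e : R, 0 < e -> exists N, forall n, (N <= n)%N -> Mclose (u n) p e.
Definition Mclosed (S : Mset) : Prop :=
  forall u p, (forall n, S (u n)) -> Mconv u p -> S p.
(* M is metrizable: (sequential) compactness *)
Definition Mcompact (S : Mset) : Prop :=
  forall u, (forall n, S (u n)) -> exists (phi : nat -> nat) p,
    (forall n, (phi n < phi n.+1)%N) /\ S p /\ Mconv (u \o phi) p.

Definition Phi (eps : C) (p : Mpt) : Mpt := (p.1 + eps, p.2).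

(* fb_vert = false : horizontal box, plaques {phi(z0+z, w0+a+f_a(z)) : |z|<r1};
   fb_vert = true  : vertical box,   plaques {phi(z0+a+f_a(w), w0+w) : |w|<r1};
   phi(z,w) = ([z], p1chart fb_chart w), a product chart on D(z0,rz) x D(w0,rw). *)
Record FlowBox := {
  fb_vert : bool; fb_chart : bool;
  fb_z0 : C; fb_w0 : C;
  fb_rz : R; fb_rw : R;
  fb_r1 : R;
  fb_A : C -> Prop;     (* the transversal parameter set *)
  fb_f : C -> C -> C
}.

Definition fb_coord (B : FlowBox) (a t : C) : C * C :=
  if fb_vert B then (a + fb_f B a t, t) else (t, a + fb_f B a t).

Definition fb_phi (B : FlowBox) (zw : C * C) : Mpt :=
  (fb_z0 B + zw.1, p1chart (fb_chart B) (fb_w0 B + zw.2)).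

Definition inPlaque (B : FlowBox) (a : C) (p : Mpt) : Prop :=
  exists t, cabs t < fb_r1 B /\ Meq p (fb_phi B (fb_coord B a t)).

Definition good_box (X : Mset) (B : FlowBox) : Prop :=
  0 < fb_r1 B /\ 0 < fb_rz B /\ 0 < fb_rw B /\
      (forall z z', cabs (z - fb_z0 B) < fb_rz B -> cabs (z' - fb_z0 B) < fb_rz B ->
         inLat om1 om2 (z - z') -> z = z') /\
      (forall a, fb_A B a -> cabs a < fb_rw B) /\
      (forall a t, fb_A B a -> cabs t < fb_r1 B ->
         cabs (fb_coord B a t).1 < fb_rz B /\ cabs (fb_coord B a t).2 < fb_rw B) /\
      (forall a, fb_A B a -> fb_f B a 0 = 0 /\ holo_disc (fb_f B a) (fb_r1 B)) /\
      (forall a e, fb_A B a -> 0 < e -> exists d, 0 < d /\ forall b t, fb_A B b ->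
         cabs (a - b) < d -> cabs t < fb_r1 B -> cabs (fb_f B a t - fb_f B b t) < e) /\
      (forall a p, fb_A B a -> inPlaque B a p -> X p) /\
      (forall a b p, fb_A B a -> fb_A B b -> a <> b -> inPlaque B a p -> ~ inPlaque B b p).

Definition box_nbhd (X : Mset) (B : FlowBox) (q : Mpt) : Prop :=
  exists d : R, 0 < d /\ forall p, X p -> Mclose p q d ->
    exists a, fb_A B a /\ inPlaque B a p.

Record Lamination := { lam_X : Mset; lam_atlas : FlowBox -> Prop }.

Definition is_lamination (L : Lamination) : Prop :=
  [/\ Mclosed (lam_X L), Minvariant (lam_X L),
      (forall B, lam_atlas L B -> good_box (lam_X L) B),
      (forall q, lam_X L q -> exists B, lam_atlas L B /\ box_nbhd (lam_X L) B q) &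
      (forall B B' a a' p, lam_atlas L B -> lam_atlas L B' -> fb_A B a -> fb_A B' a' ->
         inPlaque B a p -> inPlaque B' a' p ->
         exists d : R, 0 < d /\ forall x, Mclose x p d -> (inPlaque B a x <-> inPlaque B' a' x))].

Definition same_plaque (L : Lamination) (p q : Mpt) : Prop :=
  exists B a, lam_atlas L B /\ fb_A B a /\ inPlaque B a p /\ inPlaque B a q.

Definition leaf (L : Lamination) (p : Mpt) : Mset :=
  fun q => clos_refl_trans Mpt (same_plaque L) p q.

Definition saturated (L : Lamination) (K : Mset) : Prop :=
  forall p q, K p -> leaf L p q -> K q.

Definition no_compact_leaf (L : Lamination) : Prop :=
  forall p, lam_X L p -> ~ Mcompact (leaf L p).

Definition minimal_set (L : Lamination) (K : Mset) : Prop :=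
  [/\ (exists p, K p), (forall p, K p -> lam_X L p), Mclosed K, saturated L K &
      forall K' : Mset, (exists p, K' p) -> (forall p, K' p -> K p) ->
        Mclosed K' -> saturated L K' -> forall p, K p -> K' p].

Definition unique_minimal_set (L : Lamination) : Prop :=
  exists K, minimal_set L K /\ forall K', minimal_set L K' -> forall p, K p <-> K' p.

Definition flow_box_of (L : Lamination) (B : FlowBox) : Prop :=
  good_box (lam_X L) B /\
  forall a p q, fb_A B a -> inPlaque B a p -> inPlaque B a q -> leaf L p q.

Definition flow_box_cover (L : Lamination) (n : nat) (cov : 'I_n -> FlowBox) : Prop :=
  (forall i, flow_box_of L (cov i)) /\
  (forall q, lam_X L q -> exists i, box_nbhd (lam_X L) (cov i) q).

Definition dtrans (B : FlowBox) (a b t : C) : R :=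
  cabs (a + fb_f B a t - b - fb_f B b t).

Definition transversally_lipschitz (L : Lamination) : Prop :=
  exists n (cov : 'I_n -> FlowBox) (K : R), 0 < K /\ flow_box_cover L cov /\
    forall i a b t, fb_A (cov i) a -> fb_A (cov i) b -> a <> b -> cabs t < fb_r1 (cov i) ->
      cabs (a - b) / K < dtrans (cov i) a b t /\ dtrans (cov i) a b t < K * cabs (a - b).

Definition card_lt (S : Mset) (c : R) : Prop :=
  forall n (g : 'I_n -> Mpt), (forall i, S (g i)) ->
    (forall i j, Meq (g i) (g j) -> i = j) -> n%:R < c.

Definition plaque_inter (B : FlowBox) (a b eps : C) : Mset :=
  fun p => inPlaque B a p /\ exists p', inPlaque B b p' /\ Meq p (Phi eps p').

End Lam.

(* Main.v *)
From HB Require Import structures.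
From Stdlib Require Import Relations.Relation_Operators.
Require Import Defs.
From mathcomp Require Import all_boot all_order all_algebra.
From mathcomp Require Import complex.
From mathcomp Require Import all_classical all_reals all_analysis.
From mathcomp Require Import ring lra zify.
Set Implicit Arguments. Unset Strict Implicit. Unset Printing Implicit Defensive.
Import Order.TTheory GRing.Theory Num.Theory.
Import numFieldNormedType.Exports.
Local Open Scope classical_set_scope.
Local Open Scope ring_scope.

(* In a horizontal flow box with plaques w = g_a(z), the plaques of labels a and the translate by eps of the
   plaque of label b meet where h(t) = g_a(t + eps) - g_b(t) vanishes (in a vertical box, where h(t) = g_a(t) -
   g_b(t) - eps vanishes). If the bounds failed near a point of X, Jensen's inequality would give plaques and
   eps_n -> 0 with |h_n| <= C s_n 2^(-N_n) = o(|eps_n|) near that point, where s_n = |eps_n| in the Lipschitz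
   case and s_n = 1 otherwise. By the three circles theorem this smallness, with N_n replaced by N_n / j,
   propagates along plaques and through changes of flow boxes, hence along a leaf. Every leaf contains a point
   at which it is tangent to the first factor: otherwise the length of dz on the leaf, measured in the
   spherical metric of the second factor, would be bounded and would attain its supremum on a limit leaf, where
   subharmonicity would make w constant; a leaf on which one coordinate is constant is compact. At a tangency
   of a horizontal box, (g_a - g_b) / eps_n tends to - g', which has an isolated zero there, whereas g_a - g_b
   has no zero unless a = b: this contradicts Hurwitz's theorem. *)

(** Both bounds come from one argument with a scale [sc] and a gauge [om]. Each use of the three
    circles theorem divides the exponent by a constant, and the number of uses needed to reach a
    tangency is not known beforehand: hence 2^(-N_n / j) must win for every j. Starting from h_n =
    O(1), N_n has to outgrow log(1 / |eps_n|). Under the Lipschitz condition a zero of h_n already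
    makes g_a - g_b, hence h_n, O(eps_n) on the box, so that N_n only has to tend to infinity. The
    boxes of the Lipschitz condition may lie outside the atlas, and a flow box only promises that
    each plaque stays in one leaf. That plaques of different boxes coincide locally is recovered
    from countability: a leaf has countably many labels in an atlas box, and a continuous path of
    labels with countably many values is constant. Harnack's inequality, for the zero-free
    difference of two plaques, makes the continuity of the lamination uniform in the labels. The
    complex analysis rests on a maximum principle that tolerates finitely many exceptional points;
    applied to difference quotients it takes the place of Cauchy's formula. *)

Ltac flra := repeat match goal with
  | H : ?T |- _ => lazymatch type of T with Prop =>
      lazymatch T with is_true _ => fail | _ = _ => fail | _ /\ _ => fail | _ => clear H end end
  end;
  repeat match goal with
  | H : context [cabs ?x] |- _ => let v := fresh "v" in set v := (cabs x) in *; clearbody v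
  | |- context [cabs ?x] => let v := fresh "v" in set v := (cabs x) in *; clearbody v
  end; lra.

(** * The modulus of a complex number *)

Section Cabs.
Variable R : realType.
Local Notation C := R[i].
Implicit Types z w : C.

Lemma cabsE z : cabs z = Normc.normc z. Proof. by case: z. Qed.

Lemma cabs0 : cabs (0 : C) = 0. Proof. by rewrite cabsE Normc.normc0. Qed.
Lemma cabs1 : cabs (1 : C) = 1. Proof. by rewrite cabsE Normc.normc1. Qed.
Lemma cabsM z w : cabs (z * w) = cabs z * cabs w.
Proof. by rewrite !cabsE Normc.normcM. Qed.
Lemma cabsV z : cabs z^-1 = (cabs z)^-1.
Proof. by rewrite !cabsE Normc.normcV. Qed.
Lemma cabsD z w : cabs (z + w) <= cabs z + cabs w.
Proof. by rewrite !cabsE le_normcD. Qed.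
Lemma cabsN z : cabs (- z) = cabs z.
Proof. by rewrite !cabsE normcN. Qed.
Lemma cabsB z w : cabs (z - w) = cabs (w - z).
Proof. by rewrite -cabsN opprB. Qed.
Lemma cabs_ge0 z : 0 <= cabs z. Proof. by case: z => a b; exact: sqrtr_ge0. Qed.
Lemma cabs_eq0 z : (cabs z == 0) = (z == 0).
Proof.
apply/eqP/eqP => [|->]; last exact: cabs0.
by rewrite cabsE => /Normc.eq0_normc.
Qed.
Lemma cabs_gt0 z : (0 < cabs z) = (z != 0).
Proof. by rewrite lt0r cabs_ge0 andbT cabs_eq0. Qed.
Lemma cabs_div z w : cabs (z / w) = cabs z / cabs w.
Proof. by rewrite cabsM cabsV. Qed.
Lemma cabsX z n : cabs (z ^+ n) = cabs z ^+ n.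
Proof. by elim: n => [|n IH]; rewrite ?expr0 ?cabs1 // !exprS cabsM IH. Qed.
Lemma cabsR (r : R) : cabs (r%:C)%C = `|r|.
Proof. by rewrite /cabs /= expr0n /= addr0 sqrtr_sqr. Qed.
Lemma cabs_sqr z : cabs z ^+ 2 = (complex.Re z) ^+ 2 + (complex.Im z) ^+ 2.
Proof. by case: z => a b; rewrite /cabs /= sqr_sqrtr // addr_ge0 // sqr_ge0. Qed.
Lemma Re_le_cabs z : `|complex.Re z| <= cabs z.
Proof.
case: z => a b; rewrite /cabs /= -[leLHS]sqrtr_sqr; apply: ler_wsqrtr.
by rewrite lerDl sqr_ge0.
Qed.
Lemma Im_le_cabs z : `|complex.Im z| <= cabs z.
Proof.
case: z => a b; rewrite /cabs /= -[leLHS]sqrtr_sqr; apply: ler_wsqrtr.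
by rewrite lerDr sqr_ge0.
Qed.
Lemma cabsi (r : R) : cabs (Complex 0 r) = `|r|.
Proof. by rewrite /cabs expr0n /= add0r sqrtr_sqr. Qed.
Lemma complex_split z :
  z = ((complex.Re z)%:C)%C + Complex 0 (complex.Im z).
Proof. by case: z => a b; congr Complex => /=; rewrite ?addr0 ?add0r. Qed.
Lemma cabs_le_ReIm z : cabs z <= `|complex.Re z| + `|complex.Im z|.
Proof.
rewrite [X in cabs X]complex_split.
by apply: le_trans (cabsD _ _) _; rewrite cabsR cabsi.
Qed.
Lemma cabs_distD (u z w : C) : cabs (z - w) <= cabs (z - u) + cabs (u - w).
Proof.
have -> : z - w = (z - u) + (u - w) by ring.
exact: cabsD.
Qed.
Lemma cabs_lerB z w : cabs z - cabs w <= cabs (z - w).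
Proof. by rewrite lerBlDr; apply: le_trans (cabsD _ _); rewrite subrK. Qed.
Lemma cabs0P z : cabs z <= 0 -> z = 0.
Proof. by move=> h; apply/eqP; rewrite -cabs_eq0 eq_le h cabs_ge0. Qed.

Lemma cabs_prod (I : Type) (s : seq I) (F : I -> C) :
  cabs (\prod_(i <- s) F i) = \prod_(i <- s) cabs (F i).
Proof.
elim: s => [|a s IH]; rewrite ?big_nil ?cabs1 // !big_cons cabsM IH //.
Qed.
End Cabs.

(** * Induction and connectedness on the unit interval *)

Section RealInduction.
Variable R : realType.

(** The supremum of the [s] with [P] on all of [0, [s]] satisfies [P] by the third hypothesis; if it
    were less than 1, the second would push it further. *)
Lemma real_induction (P : R -> Prop) :
  P 0 ->
  (forall s, 0 <= s < 1 -> P s ->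
     exists2 d, 0 < d & forall s', s < s' < s + d -> s' <= 1 -> P s') ->
  (forall s, 0 < s <= 1 -> (forall s', 0 <= s' < s -> P s') -> P s) ->
  forall s, 0 <= s <= 1 -> P s.
Proof.
move=> P0 Pstep Plim.
pose A := [set s : R | 0 <= s <= 1 /\ forall s', 0 <= s' <= s -> P s'].
have A0 : A 0.
  split; first by rewrite lexx ler01.
  by move=> s' h; have -> : s' = 0 by apply/eqP; rewrite eq_le andbC.
have Aub : ubound A 1 by move=> s [/andP[]].
have hs : has_sup A by split; [exists 0 | exists 1].
set m := sup A.
have m0 : 0 <= m by apply: ub_le_sup => //; exists 1.
have m1 : m <= 1 by apply: ge_sup => //; exists 0.
have below s' : 0 <= s' < m -> P s'.
  move=> /andP[s0 sm]; have e0 : 0 < m - s' by rewrite subr_gt0.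
  have [a [_ Aa] ha] := sup_adherent e0 hs.
  by apply: Aa; rewrite s0 /=; move: ha; rewrite -/m => ha; flra.
have Pm : P m.
  have [m00|m00] := eqVneq m 0; first by rewrite m00.
  by apply: Plim => //; rewrite lt0r m00 m0.
have [m1'|m1'] := eqVneq m 1.
  move=> s /andP[s0 s1]; have [->|ns] := eqVneq s 1; first by rewrite -m1'.
  by apply: below; rewrite s0 m1' lt_neqAle ns.
have mlt : m < 1 by rewrite lt_neqAle m1'.
have [d d0 hd] := Pstep m (introT andP (conj m0 mlt)) Pm.
pose b := m + Num.min (d / 2) (1 - m).
have mb : m < b.
  rewrite /b ltrDl lt_min divr_gt0 //= subr_gt0 //.
have b1 : b <= 1 by rewrite /b -lerBrDl ge_min lexx orbT.
have bd : b < m + d.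
  rewrite /b ltrD2l gt_min; apply/orP; left; flra.
have Ab : A b.
  split; first by rewrite b1 andbT; flra.
  move=> s' /andP[s0 sb]; have [sm|sm|->//] := ltgtP s' m.
    by apply: below; rewrite s0.
  by apply: hd; [rewrite sm /=; flra | flra].
by have := ub_le_sup (ex_intro _ 1 Aub) Ab; rewrite -/m => h; flra.
Qed.

(** The continuation arguments (identity theorem, coincidence of plaques, propagation of smallness)
    reduce to this one along segments. *)
Lemma interval_connected (P : R -> Prop) :
  (forall s, 0 <= s <= 1 -> exists2 d, 0 < d &
     forall s', 0 <= s' <= 1 -> `|s' - s| < d -> (P s <-> P s')) ->
  P 0 -> forall s, 0 <= s <= 1 -> P s.
Proof.
move=> h P0; apply: real_induction => // s.
  move=> /andP[s0 s1] Ps; have [|d d0 hd] := h s; first by rewrite s0 ltW.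
  exists d => // s' /andP[ss' s'd] s'1; apply/hd => //; first by rewrite s'1 andbT; flra.
  by rewrite gtr0_norm; flra.
move=> /andP[s0 s1] Ps; have [|d d0 hd] := h s; first by rewrite s1 ltW.
pose t := Num.max 0 (s - d / 2).
have t0 : 0 <= t by rewrite le_max lexx.
have ts : t < s by rewrite gt_max s0 /=; flra.
have td : s - d < t by rewrite lt_max; apply/orP; right; flra.
apply/(hd t); [by rewrite t0 /=; flra| by rewrite ltr0_norm; flra | ].
by apply: Ps; rewrite t0.
Qed.

Lemma seq_exp_lt (x e : R) : 0 <= x < 1 -> 0 < e -> exists n, x ^+ n < e.
Proof.
move=> /andP[x0 x1] e0.
have := @cvg_expr R x; rewrite ger0_norm // => /(_ x1) /cvgrPdist_lt /(_ _ e0).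
move=> [n _ /(_ n (leqnn n)) /=]; rewrite sub0r normrN => h; exists n.
exact: le_lt_trans (ler_norm _) h.
Qed.

(* Take n-th roots and let n tend to infinity. *)
Lemma le_of_pow_le (x y K : R) : 0 <= x -> 0 <= y ->
  (forall n, x ^+ n <= K * y ^+ n) -> x <= y.
Proof.
move=> x0 y0 h; rewrite leNgt; apply/negP => yx.
have x0' : 0 < x by flra.
have r1 : 0 <= y / x < 1 by rewrite divr_ge0 //= ltr_pdivrMr // mul1r.
have K0 : 0 < K by have := h 0%N; rewrite !expr0 mulr1; flra.
have [n hn] := seq_exp_lt r1 (ltac:(rewrite invr_gt0; exact: K0) : 0 < K^-1).
have := h n; rewrite leNgt => /negP; apply.
move: hn; rewrite expr_div_n ltr_pdivrMr ?exprn_gt0 // => hn.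
by rewrite mulrC -ltr_pdivlMr // mulrC.
Qed.
End RealInduction.

(** * Complex differentiability *)

Section Calculus.
Variable R : realType.
Local Notation C := R[i].
Implicit Types (f g : C -> C) (z w c : C).

Definition ccont f z := forall e : R, 0 < e -> exists2 d : R, 0 < d &
  forall w, cabs (w - z) < d -> cabs (f w - f z) < e.

(* Carathéodory's form of complex differentiability *)
Definition cder f z l := exists q : C -> C,
  [/\ forall w, f w = f z + (w - z) * q w, ccont q z & q z = l].

Definition holo c (r : R) f := forall z, cabs (z - c) < r -> exists l, cder f z l.

Lemma ccont_const k z : ccont (fun=> k) z.
Proof. by move=> e e0; exists 1 => // w _; rewrite subrr cabs0. Qed.
Lemma ccont_id z : ccont (fun w => w) z.
Proof. by move=> e e0; exists e. Qed.

Lemma ccontD f g z : ccont f z -> ccont g z -> ccont (fun w => f w + g w) z.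
Proof.
move=> cf cg e e0; have e2 : 0 < e / 2 by flra.
have [d1 d10 h1] := cf _ e2; have [d2 d20 h2] := cg _ e2.
exists (Num.min d1 d2); first by rewrite lt_min d10.
move=> w; rewrite lt_min => /andP[/h1 a /h2 b].
have -> : f w + g w - (f z + g z) = (f w - f z) + (g w - g z) by ring.
by apply: le_lt_trans (cabsD _ _) _; flra.
Qed.

Lemma ccontM f g z : ccont f z -> ccont g z -> ccont (fun w => f w * g w) z.
Proof.
move=> cf cg e e0.
pose K := cabs (f z) + cabs (g z) + 1.
have K0 : 0 < K by have := cabs_ge0 (f z); have := cabs_ge0 (g z); rewrite /K; flra.
have e2 : 0 < Num.min 1 (e / (2 * K)) by rewrite lt_min ltr01 divr_gt0 // mulr_gt0.
have [d1 d10 h1] := cf _ e2; have [d2 d20 h2] := cg _ e2.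
exists (Num.min d1 d2); first by rewrite lt_min d10.
move=> w; rewrite lt_min => /andP[/h1 a /h2 b].
have -> : f w * g w - f z * g z = (f w - f z) * g w + f z * (g w - g z) by ring.
apply: le_lt_trans (cabsD _ _) _; rewrite !cabsM.
move: a b; rewrite !lt_min => /andP[a1 a2] /andP[b1 b2].
have gw : cabs (g w) <= K.
  have -> : g w = g z + (g w - g z) by ring.
  apply: le_trans (cabsD _ _) _; have := cabs_ge0 (f z); rewrite /K; flra.
have fz : cabs (f z) <= K by have := cabs_ge0 (g z); rewrite /K; flra.
have E : e = e / (2 * K) * K + K * (e / (2 * K)) by field; apply: lt0r_neq0.
rewrite [X in _ < X]E; apply: ltr_leD.
  apply: (@le_lt_trans _ _ (cabs (f w - f z) * K)); first by rewrite ler_wpM2l // cabs_ge0.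
  by rewrite ltr_pM2r.
by apply: ler_pM => //; rewrite ?cabs_ge0 //; apply: ltW.
Qed.

Lemma ccont_comp f g z : ccont f z -> ccont g (f z) -> ccont (fun w => g (f w)) z.
Proof.
move=> cf cg e /cg[d d0 hd]; have [d' d'0 hd'] := cf _ d0.
by exists d' => // w /hd'/hd.
Qed.

Lemma ccont_inv z : z != 0 -> ccont (fun w => w^-1) z.
Proof.
move=> z0 e e0; have az : 0 < cabs z by rewrite cabs_gt0.
exists (Num.min (cabs z / 2) (e * cabs z ^+ 2 / 2)).
  by rewrite lt_min !divr_gt0 //= mulr_gt0 // exprn_gt0.
move=> w; rewrite lt_min => /andP[h1 h2].
have aw : cabs z / 2 < cabs w.
  by have := cabs_lerB z w; rewrite cabsB; flra.
have w0 : w != 0 by rewrite -cabs_gt0; flra.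
have -> : w^-1 - z^-1 = (z - w) / (z * w) by field; rewrite z0 w0.
rewrite cabs_div cabsM (cabsB z) ltr_pdivrMr ?mulr_gt0 //; last by flra.
apply: lt_trans h2 _.
have -> : e * cabs z ^+ 2 / 2 = (e * cabs z) * (cabs z / 2) by ring.
by rewrite [X in _ < X]mulrA ltr_pM2l // mulr_gt0.
Qed.

Lemma ccontV f z : ccont f z -> f z != 0 -> ccont (fun w => (f w)^-1) z.
Proof. by move=> cf f0; apply: (@ccont_comp f (fun w => w^-1)) => //; exact: ccont_inv. Qed.

Lemma ccont_near f g z (d : R) : 0 < d ->
  (forall w, cabs (w - z) < d -> f w = g w) -> ccont f z -> ccont g z.
Proof.
move=> d0 fg cf e /cf[d' d'0 h]; exists (Num.min d d'); first by rewrite lt_min d0.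
move=> w; rewrite lt_min => /andP[h1 /h]; rewrite !fg // subrr cabs0 //.
Qed.

Lemma cder_cont f z l : cder f z l -> ccont f z.
Proof.
move=> [q [E cq _]].
suff : ccont (fun w => f z + (w - z) * q w) z.
  by apply: (@ccont_near _ _ _ 1) => // w _; rewrite -E.
apply: ccontD; first exact: ccont_const.
by apply: ccontM => //; apply: ccontD; [exact: ccont_id | exact: ccont_const].
Qed.

Lemma ccont_eq f g z (d : R) : 0 < d -> ccont f z -> ccont g z ->
  (forall w, w != z -> cabs (w - z) < d -> f w = g w) -> f z = g z.
Proof.
move=> d0 cf cg fg; apply/eqP; rewrite -subr_eq0 -cabs_eq0 eq_le cabs_ge0 andbT leNgt.
apply/negP => h; have e2 : 0 < cabs (f z - g z) / 2 by flra.
have [d1 d10 h1] := cf _ e2; have [d2 d20 h2] := cg _ e2.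
pose r := Num.min d (Num.min d1 d2) / 2.
have r0 : 0 < r by rewrite divr_gt0 // !lt_min d0 d10.
have rd : r < Num.min d (Num.min d1 d2) by rewrite /r; move: r0; rewrite /r; flra.
have cw : cabs ((z + (r%:C)%C) - z) = r.
  by rewrite addrC addKr cabsR gtr0_norm.
have nz : z + (r%:C)%C != z.
  by rewrite -subr_eq0 -cabs_eq0 cw lt0r_neq0.
move: rd; rewrite !lt_min => /and3P[ra rb rc].
have := h1 (z + (r%:C)%C); have := h2 (z + (r%:C)%C); rewrite cw => /(_ rc) A /(_ rb) B.
have E := fg _ nz; rewrite cw in E; rewrite E // in B.
have := cabs_distD (g (z + (r%:C)%C)) (f z) (g z); rewrite (cabsB (f z) (g (z + _))); flra.
Qed.

Lemma cder_unique f z l l' : cder f z l -> cder f z l' -> l = l'.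
Proof.
move=> [q [E cq <-]] [q' [E' cq' <-]].
apply: (@ccont_eq q q' z 1) => // w wz _.
have : (w - z) * q w = (w - z) * q' w by apply: (@addrI _ (f z)); rewrite -E -E'.
by apply: mulfI; rewrite subr_eq0.
Qed.

Lemma cder_const k z : cder (fun=> k) z 0.
Proof. by exists (fun=> 0); split=> //; [move=> w; rewrite mulr0 addr0|exact: ccont_const]. Qed.
Lemma cder_id z : cder (fun w => w) z 1.
Proof. by exists (fun=> 1); split=> //; [move=> w; rewrite mulr1 subrKC|exact: ccont_const]. Qed.

Lemma cderD f g z l m : cder f z l -> cder g z m -> cder (fun w => f w + g w) z (l + m).
Proof.
move=> [q [E cq <-]] [q' [E' cq' <-]]; exists (fun w => q w + q' w); split=> //.
  by move=> w; rewrite [in LHS]E [in LHS]E'; ring.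
exact: ccontD.
Qed.

Lemma cderM f g z l m : cder f z l -> cder g z m ->
  cder (fun w => f w * g w) z (l * g z + f z * m).
Proof.
move=> fl gm; have cg := cder_cont gm.
move: fl gm => [q [E cq <-]] [q' [E' cq' <-]].
exists (fun w => q w * g w + f z * q' w); split=> //.
  by move=> w; rewrite (E' w) (E w); ring.
by apply: ccontD; apply: ccontM => //; exact: ccont_const.
Qed.

Lemma cder_comp f g z l m : cder f z l -> cder g (f z) m ->
  cder (fun w => g (f w)) z (m * l).
Proof.
move=> fl; have cf := cder_cont fl; move: fl => [q [E cq <-]] [q' [E' cq' <-]].
exists (fun w => q' (f w) * q w); split=> //.
  move=> w; rewrite (E' (f w)).
  have -> : f w - f z = (w - z) * q w by rewrite (E w); ring.
  by ring.
by apply: ccontM => //; exact: ccont_comp cf cq'.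
Qed.

Lemma cder_inv z : z != 0 -> cder (fun w => w^-1) z (- z^-2).
Proof.
move=> z0; exists (fun w => if w == 0 then z^-2 else - (z^-1 * w^-1)); split.
- move=> w; case: eqP => [->|/eqP w0]; last by field; rewrite z0 w0.
  by rewrite invr0; field.
- apply: (@ccont_near (fun w => (- z^-1) * w^-1) _ _ (cabs z)).
  + by rewrite cabs_gt0.
  + move=> w h; case: eqP => [w0|_]; last by rewrite mulNr.
    by move: h; rewrite w0 sub0r cabsN ltxx.
  + by apply: ccontM; [exact: ccont_const|exact: ccont_inv].
- by rewrite (negbTE z0); field.
Qed.

Lemma cder_near f g z l (d : R) : 0 < d ->
  (forall w, cabs (w - z) < d -> f w = g w) -> cder f z l -> cder g z l.
Proof.
move=> d0 fg [q [E cq ql]].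
(* Carathéodory's identity is required for every [w], while [f] and [g] agree only near [z]: away
   from [z] the slope has to be that of [g]. *)
exists (fun w => if w == z then q w else (g w - g z) / (w - z)); split.
- move=> w; case: eqP => [->|/eqP wz]; first by rewrite subrr mul0r addr0.
  by rewrite mulrC divfK ?subr_eq0 // subrKC.
- apply: (ccont_near d0 _ cq) => w h; case: eqP => // /eqP wz.
  rewrite -!fg ?subrr ?cabs0 // [in RHS]E; field; by rewrite subr_eq0.
- by rewrite eqxx.
Qed.

Lemma cderN f z l : cder f z l -> cder (fun w => - f w) z (- l).
Proof.
move=> fl; have := cderM (cder_const (-1) z) fl; rewrite mul0r add0r mulN1r.
by apply: (@cder_near _ _ _ _ 1) => // w _; rewrite mulN1r.
Qed.
Lemma cderB f g z l m : cder f z l -> cder g z m -> cder (fun w => f w - g w) z (l - m).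
Proof. by move=> fl gm; apply: cderD => //; exact: cderN. Qed.
Lemma cderV f z l : cder f z l -> f z != 0 ->
  cder (fun w => (f w)^-1) z (- (f z)^-2 * l).
Proof. by move=> fl f0; apply: (cder_comp fl); exact: cder_inv. Qed.
Lemma cderX f z l n : cder f z l -> exists m, cder (fun w => f w ^+ n) z m.
Proof.
move=> fl; elim: n => [|n [m IH]]; first by exists 0; exact: cder_const.
exists (l * f z ^+ n + f z * m); have := cderM fl IH.
by apply: (@cder_near _ _ _ _ 1) => // w _; rewrite exprS.
Qed.

Lemma cder_distlim f z l :
  (forall e : R, 0 < e -> exists d : R, 0 < d /\ forall h : C, 0 < cabs h -> cabs h < d ->
      cabs ((f (z + h) - f z) / h - l) < e) <-> cder f z l.
Proof.
split=> [h|[q [E cq <-]] e e0].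
  exists (fun w => if w == z then l else (f w - f z) / (w - z)); split.
  - move=> w; case: eqP => [->|/eqP wz]; first by rewrite subrr mul0r addr0.
    by rewrite mulrC divfK ?subr_eq0 // subrKC.
  - move=> e e0; have [d [d0 hd]] := h _ e0; exists d => // w wd; rewrite eqxx.
    case: eqP => [_|/eqP wz]; first by rewrite subrr cabs0.
    have := hd (w - z); rewrite subrKC; apply => //.
    by rewrite cabs_gt0 subr_eq0.
  - by rewrite eqxx.
have [d d0 hd] := cq _ e0; exists d; split=> // h h0 hd'.
have := hd (z + h); have -> : z + h - z = h by ring.
move=> /(_ hd'); rewrite (E (z + h)).
suff -> : f z + (z + h - z) * q (z + h) - f z = h * q (z + h) by rewrite mulrAC divff ?mul1r // -cabs_gt0.
by ring.
Qed.

Lemma holo_sub c r c' r' f : holo c r f -> cabs (c' - c) + r' <= r -> holo c' r' f.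
Proof.
move=> h hr z zc; apply: h; apply: le_lt_trans (cabs_distD c' _ _) _; flra.
Qed.

Lemma holo_cont c r f z : holo c r f -> cabs (z - c) < r -> ccont f z.
Proof. by move=> h /h[l]; exact: cder_cont. Qed.

Lemma holo_ext c r f g : (forall z, cabs (z - c) < r -> f z = g z) ->
  holo c r f -> holo c r g.
Proof.
move=> fg h z zr; have [l hl] := h _ zr; exists l.
apply: (@cder_near f g z l (r - cabs (z - c))) => //; first flra.
by move=> w hw; apply: fg; have := cabs_distD z w c; flra.
Qed.

Lemma holo_const c r k : holo c r (fun=> k).
Proof. by move=> z _; exists 0; exact: cder_const. Qed.
Lemma holo_id c r : holo c r (fun z => z).
Proof. by move=> z _; exists 1; exact: cder_id. Qed.
Lemma holoD c r f g : holo c r f -> holo c r g -> holo c r (fun z => f z + g z).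
Proof. by move=> hf hg z zr; have [l ?] := hf _ zr; have [m ?] := hg _ zr; exists (l + m); exact: cderD. Qed.
Lemma holoB c r f g : holo c r f -> holo c r g -> holo c r (fun z => f z - g z).
Proof. by move=> hf hg z zr; have [l ?] := hf _ zr; have [m ?] := hg _ zr; exists (l - m); exact: cderB. Qed.
Lemma holoM c r f g : holo c r f -> holo c r g -> holo c r (fun z => f z * g z).
Proof.
move=> hf hg z zr; have [l hl] := hf _ zr; have [m hm] := hg _ zr.
by exists (l * g z + f z * m); exact: cderM.
Qed.
Lemma holoV c r f : holo c r f -> (forall z, cabs (z - c) < r -> f z != 0) ->
  holo c r (fun z => (f z)^-1).
Proof. by move=> hf f0 z zr; have [l fl] := hf _ zr; exists (- (f z)^-2 * l); apply: cderV fl _; exact: f0. Qed.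
Lemma holo_comp c r c' r' f g : holo c r f -> holo c' r' g ->
  (forall z, cabs (z - c) < r -> cabs (f z - c') < r') -> holo c r (fun z => g (f z)).
Proof.
move=> hf hg fg z zr; have [l fl] := hf _ zr; have [m gm] := hg _ (fg _ zr).
by exists (m * l); exact: cder_comp.
Qed.
Lemma holo_shift c r f k : holo (c + k) r f -> holo c r (fun z => f (z + k)).
Proof.
move=> hf; apply: (@holo_comp c r (c + k) r (fun z => z + k)) => //.
  by apply: holoD; [exact: holo_id|exact: holo_const].
by move=> z; have -> : z + k - (c + k) = z - c by ring.
Qed.
End Calculus.

(** * Integration along segments *)

Section Antiderivative.
Variable R : realType.
Local Notation C := R[i].
Local Notation mu := (@lebesgue_measure R).

Lemma continuous_antiderivative (f : R -> R) : continuous f ->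
  exists F : R -> R, forall x, 0 <= x <= 1 -> forall e, 0 < e ->
    exists2 d, 0 < d & forall y, `|y - x| < d ->
      `|F y - F x - (y - x) * f x| <= e * `|y - x|.
Proof.
move=> cf.
(* Working on [-1, 2] makes 0 and 1 interior points, so the derivative is two-sided on all of
   [0, 1]. *)
pose F x := (\int[mu]_(t in [set` `[(-1 : R), x]]) (f t))%R.
exists F => x /andP[x0 x1] e e0.
have intf : mu.-integrable `[(-1 : R), 2] (EFin \o f).
  apply: continuous_compact_integrable; first exact: segment_compact.
  exact: continuous_subspaceT.
have [|||dF dFx] := @continuous_FTC1_closed R f (-1) x 2 _ intf; [flra|flra|exact: cf|].
have {}dF : derivable F x 1 := dF; have {}dFx : (F^`()%classic) x = f x := dFx.
clearbody F; have : is_derive x 1 F (f x).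
  by apply: DeriveDef => //; rewrite -derive1E.
move=> /@is_derive1_caratheodory [g [Eg cg gx]].
move: cg => /cvgrPdist_lt /(_ _ e0) [d /= d0 hd].
exists d => // y yx; rewrite Eg -gx.
have -> : g y * (y - x) - (y - x) * g x = (g y - g x) * (y - x) by ring.
rewrite normrM ler_wpM2r //.
by rewrite distrC ltW // hd //= distrC.
Qed.
End Antiderivative.

Section SegmentIntegral.
Variable R : realType.
Local Notation C := R[i].
Implicit Types (f g : C -> C) (a b z w : C).
Local Notation re := (@complex.Re R).
Local Notation im := (@complex.Im R).

(** Derivative relative to [0, 1], hence one-sided at its end points. *)
Definition cder_itv (F : R -> C) (s : R) (v : C) := forall e : R, 0 < e ->
  exists2 d : R, 0 < d & forall s', 0 <= s' <= 1 -> `|s' - s| < d ->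
    cabs (F s' - F s - ((s' - s)%:C)%C * v) <= e * `|s' - s|.

Lemma re_real_mul (r : R) z : re ((r%:C)%C * z) = r * re z.
Proof. by case: z => x y /=; rewrite mul0r subr0. Qed.

Lemma re_le_cabs z : re z <= cabs z.
Proof. exact: le_trans (ler_norm _) (Re_le_cabs z). Qed.

(** Mean value inequality by real induction on the bound with slope [M + e]: the slack [e] absorbs
    the error term of the derivative, forwards from [s] and backwards from a limit point. *)
Lemma cder_itv_re_le (F : R -> C) (phi : R -> C) (M : R) :
  (forall s, 0 <= s <= 1 -> cder_itv F s (phi s)) ->
  (forall s, 0 <= s <= 1 -> re (phi s) <= M) -> re (F 1 - F 0) <= M.
Proof.
move=> dF hM; apply/ler_addgt0Pr => e e0.
suff H : forall s, 0 <= s <= 1 -> re (F s - F 0) <= (M + e) * s.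
  by have := H 1; rewrite lexx ler01 mulr1; apply.
have reD z w : re (z + w) = re z + re w by case: z; case: w.
have key s s' : 0 <= s <= 1 -> 0 <= s' <= 1 ->
    cabs (F s' - F s - ((s' - s)%:C)%C * phi s) <= e * `|s' - s| ->
    `|re (F s' - F s) - (s' - s) * re (phi s)| <= e * `|s' - s|.
  move=> hs hs' h; apply: le_trans h; rewrite -re_real_mul.
  have -> : re (F s' - F s) - re (((s' - s)%:C)%C * phi s) =
            re (F s' - F s - ((s' - s)%:C)%C * phi s).
    by rewrite [RHS]reD; congr (_ + _); case: (_ * phi s).
  exact: Re_le_cabs.
have tel s s' : re (F s' - F 0) = re (F s' - F s) + re (F s - F 0).
  by rewrite -reD; congr re; ring.
apply: real_induction.
- by rewrite subrr mulr0.
- move=> s /andP[s0 s1] IH; have hs : 0 <= s <= 1 by rewrite s0 ltW.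
  have [d d0 hd] := dF s hs e e0; exists d => // s' /andP[ss' s'd] s'1.
  have hs' : 0 <= s' <= 1 by rewrite s'1 andbT; flra.
  have := key _ _ hs hs' (hd s' hs' _); rewrite gtr0_norm ?subr_gt0 // => /(_ ltac:(flra)).
  rewrite ler_norml => /andP[_ h]; rewrite (tel s).
  have := hM _ hs => h2; have : (s' - s) * re (phi s) <= (s' - s) * M by rewrite ler_wpM2l //; flra.
  nra.
- move=> s /andP[s0 s1] IH; have hs : 0 <= s <= 1 by rewrite s1 ltW.
  have [d d0 hd] := dF s hs e e0.
  pose t := Num.max 0 (s - d / 2).
  have t0 : 0 <= t by rewrite le_max lexx.
  have ts : t < s by rewrite gt_max s0 /=; flra.
  have td : s - d < t by rewrite lt_max; apply/orP; right; flra.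
  have ht : 0 <= t <= 1 by rewrite t0 /=; flra.
  have := key _ _ hs ht (hd t ht _); rewrite ltr0_norm ?subr_lt0 // => /(_ ltac:(flra)).
  rewrite ler_norml => /andP[h _]; rewrite (tel t).
  have := IH t; rewrite t0 ts => /(_ isT) h1.
  have -> : re (F s - F t) = - re (F t - F s) by case: (F t); case: (F s) => * /=; ring.
  have := hM _ hs => h2; have : (s - t) * re (phi s) <= (s - t) * M by rewrite ler_wpM2l //; flra.
  nra.
Qed.

Lemma cder_itv_scale (F : R -> C) s v k : cder_itv F s v ->
  cder_itv (fun t => k * F t) s (k * v).
Proof.
move=> h e e0; have K0 : 0 < cabs k + 1 by have := cabs_ge0 k; flra.
have [d d0 hd] := h _ (divr_gt0 e0 K0); exists d => // s' hs' hsd.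
have -> : k * F s' - k * F s - ((s' - s)%:C)%C * (k * v) =
          k * (F s' - F s - ((s' - s)%:C)%C * v) by ring.
rewrite cabsM; apply: (@le_trans _ _ (cabs k * (e / (cabs k + 1) * `|s' - s|))).
  by rewrite ler_wpM2l ?cabs_ge0 // hd.
rewrite mulrA ler_wpM2r // mulrCA ler_piMr ?(ltW e0) //.
by rewrite ler_pdivrMr // mul1r; flra.
Qed.

(** Multiplication by the conjugate of [F 1 - F 0] turns the modulus into a real part. *)
Lemma cder_itv_le (F : R -> C) (phi : R -> C) (M : R) :
  (forall s, 0 <= s <= 1 -> cder_itv F s (phi s)) ->
  (forall s, 0 <= s <= 1 -> cabs (phi s) <= M) -> cabs (F 1 - F 0) <= M.
Proof.
move=> dF hM; set D := F 1 - F 0.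
have [D0|D0] := eqVneq D 0.
  rewrite D0 cabs0; apply: le_trans (hM 0 _); [exact: cabs_ge0|by rewrite lexx ler01].
have aD : 0 < cabs D by rewrite cabs_gt0.
have := @cder_itv_re_le (fun t => conjc D * F t) (fun t => conjc D * phi t) (cabs D * M).
have -> : conjc D * F 1 - conjc D * F 0 = conjc D * D by rewrite /D; ring.
have -> : re (conjc D * D) = cabs D ^+ 2.
  by rewrite cabs_sqr; case: (D) => x y /=; ring.
rewrite expr2 ler_pM2l //; apply => s hs; first exact/cder_itv_scale/dF.
apply: le_trans (re_le_cabs _) _; rewrite cabsM.
have -> : cabs (conjc D) = cabs D by case: (D) => x y; rewrite /cabs /= sqrrN.
by rewrite ler_wpM2l ?cabs_ge0 // hM.
Qed.

Lemma cder_itvD (F G : R -> C) s v w : cder_itv F s v -> cder_itv G s w ->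
  cder_itv (fun t => F t + G t) s (v + w).
Proof.
move=> hF hG e e0; have e2 : 0 < e / 2 by flra.
have [d d0 hd] := hF _ e2; have [d' d'0 hd'] := hG _ e2.
exists (Num.min d d'); first by rewrite lt_min d0.
move=> s' hs'; rewrite lt_min => /andP[/(hd _ hs') A /(hd' _ hs') B].
have -> : F s' + G s' - (F s + G s) - ((s' - s)%:C)%C * (v + w) =
  (F s' - F s - ((s' - s)%:C)%C * v) + (G s' - G s - ((s' - s)%:C)%C * w) by ring.
apply: le_trans (cabsD _ _) _; have -> : e = e / 2 + e / 2 by flra.
rewrite mulrDl; exact: lerD.
Qed.

Definition spt a b (s : R) := a + ((s%:C)%C) * (b - a).

(** The integral of [f] from [a] to [b] as the increment of a primitive along the segment:
    linearity, estimates and subdivision then follow from the mean value inequality. *)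
Definition is_sint f a b (I : C) := exists F : R -> C,
  (forall s, 0 <= s <= 1 -> cder_itv F s (f (spt a b s) * (b - a))) /\ I = F 1 - F 0.

Lemma is_sint_unique f a b I J : is_sint f a b I -> is_sint f a b J -> I = J.
Proof.
move=> [F [hF ->]] [G [hG ->]].
apply/eqP; rewrite -subr_eq0 -cabs_eq0 eq_le cabs_ge0 andbT.
have := @cder_itv_le (fun t => F t + (-1) * G t) (fun=> 0) 0.
have -> : F 1 + -1 * G 1 - (F 0 + -1 * G 0) = F 1 - F 0 - (G 1 - G 0) by ring.
apply=> s hs; last by rewrite cabs0.
have -> : 0 = f (spt a b s) * (b - a) + (-1) * (f (spt a b s) * (b - a)) :> C by ring.
by apply: cder_itvD; [exact: hF|exact/cder_itv_scale/hG].
Qed.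

Lemma is_sint_le f a b I M : is_sint f a b I ->
  (forall s, 0 <= s <= 1 -> cabs (f (spt a b s)) <= M) -> cabs I <= M * cabs (b - a).
Proof.
move=> [F [hF ->]] hM; apply: (cder_itv_le hF) => s hs.
by rewrite cabsM ler_wpM2r ?cabs_ge0 // hM.
Qed.

Lemma is_sint_ext f g a b I : (forall s, 0 <= s <= 1 -> f (spt a b s) = g (spt a b s)) ->
  is_sint f a b I -> is_sint g a b I.
Proof.
move=> fg [F [hF ->]]; exists F; split=> // s hs; rewrite -fg //; exact: hF.
Qed.

Lemma is_sintD f g a b I J : is_sint f a b I -> is_sint g a b J ->
  is_sint (fun z => f z + g z) a b (I + J).
Proof.
move=> [F [hF ->]] [G [hG ->]]; exists (fun t => F t + G t); split; last by ring.
by move=> s hs; rewrite mulrDl; apply: cder_itvD; [exact: hF|exact: hG].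
Qed.

Lemma is_sintZ f a b I k : is_sint f a b I -> is_sint (fun z => k * f z) a b (k * I).
Proof.
move=> [F [hF ->]]; exists (fun t => k * F t); split; last by ring.
by move=> s hs; rewrite -mulrA; exact/cder_itv_scale/hF.
Qed.

Lemma cder_cder_itv (F : C -> C) a b s l : cder F (spt a b s) l ->
  cder_itv (fun t => F (spt a b t)) s (l * (b - a)).
Proof.
move=> [q [E cq <-]] e e0.
pose K := cabs (b - a) + 1.
have K0 : 0 < K by rewrite /K; have := cabs_ge0 (b - a); flra.
have [d d0 hd] := cq _ (divr_gt0 e0 K0).
exists (d / K); first exact: divr_gt0.
move=> s' _ h.
have D : spt a b s' - spt a b s = ((s' - s)%:C)%C * (b - a) by rewrite /spt rmorphB; ring.
rewrite (E (spt a b s')) D.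
set q' := q (spt a b s'); set q0 := q (spt a b s).
have -> : F (spt a b s) + ((s' - s)%:C)%C * (b - a) * q' - F (spt a b s) -
   ((s' - s)%:C)%C * (q0 * (b - a)) = ((s' - s)%:C)%C * ((b - a) * (q' - q0)) by ring.
rewrite !cabsM cabsR mulrC ler_wpM2r //.
have : cabs (q' - q0) < e / K.
  apply: hd; rewrite D cabsM cabsR.
  apply: (@le_lt_trans _ _ (`|s' - s| * K)); first by rewrite ler_wpM2l // /K; flra.
  by rewrite -ltr_pdivlMr.
move=> /ltW hq; apply: (@le_trans _ _ (K * (e / K))).
  by apply: ler_pM => //; rewrite ?cabs_ge0 // /K; flra.
by rewrite mulrC divfK // gt_eqF.
Qed.

Lemma is_sint_primitive (F f : C -> C) a b :
  (forall s, 0 <= s <= 1 -> cder F (spt a b s) (f (spt a b s))) ->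
  is_sint f a b (F b - F a).
Proof.
move=> h; exists (fun t => F (spt a b t)); split.
  by move=> s hs; apply: cder_cder_itv; exact: h.
by rewrite /spt mul1r subrKC mul0r addr0.
Qed.

Lemma cder_itv_sub (F : R -> C) (p q s : R) v : 0 <= p -> p <= q -> q <= 1 -> 0 <= s <= 1 ->
  cder_itv F (p + s * (q - p)) v ->
  cder_itv (fun t => F (p + t * (q - p))) s (((q - p)%:C)%C * v).
Proof.
move=> p0 pq q1 /andP[s0 s1] h e e0; have [d d0 hd] := h _ e0.
have qp1 : q - p <= 1 by flra.
exists d => // s' /andP[s'0 s'1] h'.
have D : p + s' * (q - p) - (p + s * (q - p)) = (s' - s) * (q - p) by ring.
have := hd (p + s' * (q - p)); rewrite D.
have N : `|(s' - s) * (q - p)| <= `|s' - s|.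
  by rewrite normrM ler_piMr // ger0_norm; flra.
have hr : 0 <= p + s' * (q - p) <= 1 by apply/andP; split; nra.
move=> /(_ hr) /(_ (le_lt_trans N h')); rewrite rmorphM -mulrA => H.
by apply: le_trans H _; rewrite ler_wpM2l // ltW.
Qed.

Lemma is_sint_sub f a b (F : R -> C) (p q : R) :
  (forall s, 0 <= s <= 1 -> cder_itv F s (f (spt a b s) * (b - a))) ->
  0 <= p -> p <= q -> q <= 1 ->
  is_sint f (spt a b p) (spt a b q) (F q - F p).
Proof.
move=> hF p0 pq q1; exists (fun t => F (p + t * (q - p))); split; last first.
  by rewrite mul1r mul0r addr0 subrKC.
move=> s /andP[s0 s1].
have -> : spt (spt a b p) (spt a b q) s = spt a b (p + s * (q - p)).
  by rewrite /spt !rmorphD /= !rmorphM /= rmorphB; ring.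
have -> : spt a b q - spt a b p = ((q - p)%:C)%C * (b - a).
  by rewrite /spt rmorphB; ring.
rewrite mulrCA; apply: cder_itv_sub => //; first by rewrite s0.
by apply: hF; apply/andP; split; nra.
Qed.

Lemma is_sint_exists f a b : (forall s, 0 <= s <= 1 -> ccont f (spt a b s)) ->
  exists I, is_sint f a b I.
Proof.
move=> cf.
(* The fundamental theorem is available for functions continuous on the whole line; clamping the
   parameter extends the integrand continuously beyond the segment. *)
pose cl (s : R) : R := Num.max 0 (Num.min 1 s).
have cl01 s : 0 <= cl s <= 1.
  by rewrite /cl le_max lexx /= ge_max ler01 /= ge_min lexx.
have cle s : 0 <= s <= 1 -> cl s = s.
  by move=> /andP[s0 s1]; rewrite /cl (min_idPr s1) (max_idPr s0).
have cl_lip s t : `|cl s - cl t| <= `|s - t|.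
  rewrite /cl; case: (leP 1 s) => h1; case: (leP 1 t) => h2; rewrite ?(max_idPr ler01);
  try (case: (leP 0 s) => h3); try (case: (leP 0 t) => h4); rewrite ?subrr ?normr0 ?normr_ge0 //;
  try (rewrite ger0_norm; last flra); try (rewrite ler0_norm; last flra);
  try (rewrite ger0_norm; last flra); try (rewrite ler0_norm; last flra); flra.
pose phi s := f (spt a b (cl s)) * (b - a).
have cphi x (e : R) : 0 < e -> exists2 d, 0 < d & forall y, `|y - x| < d -> cabs (phi y - phi x) < e.
  move=> e0.
  have : ccont (fun z => f z * (b - a)) (spt a b (cl x)).
    by apply: ccontM; [exact: cf|exact: ccont_const].
  move=> /(_ _ e0) [d d0 hd]; pose K := cabs (b - a) + 1.
  have K0 : 0 < K by rewrite /K; have := cabs_ge0 (b - a); flra.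
  exists (d / K); first exact: divr_gt0.
  move=> y hy; apply: hd.
  have -> : spt a b (cl y) - spt a b (cl x) = ((cl y - cl x)%:C)%C * (b - a).
    by rewrite /spt rmorphB; ring.
  rewrite cabsM cabsR.
  apply: (@le_lt_trans _ _ (`|y - x| * K)).
    by apply: ler_pM => //; rewrite ?cabs_ge0 // /K; flra.
  by rewrite -ltr_pdivlMr.
have cre : continuous (fun s => re (phi s)).
  move=> x; apply/cvgrPdist_lt => e e0; have [d d0 hd] := cphi x e e0.
  exists d => // y /= hy; apply: le_lt_trans (hd y _); last by rewrite distrC.
  rewrite distrC; apply: le_trans (Re_le_cabs _).
  by case: (phi y) => ? ?; case: (phi x) => ? ?.
have cim : continuous (fun s => im (phi s)).
  move=> x; apply/cvgrPdist_lt => e e0; have [d d0 hd] := cphi x e e0.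
  exists d => // y /= hy; apply: le_lt_trans (hd y _); last by rewrite distrC.
  rewrite distrC; apply: le_trans (Im_le_cabs _).
  by case: (phi y) => ? ?; case: (phi x) => ? ?.
have [F hF] := continuous_antiderivative cre.
have [G hG] := continuous_antiderivative cim.
exists (Complex (F 1) (G 1) - Complex (F 0) (G 0)).
exists (fun t => Complex (F t) (G t)); split=> // s hs e e0.
have -> : f (spt a b s) * (b - a) = phi s by rewrite /phi cle.
have e2 : 0 < e / 2 by flra.
have [d d0 hd] := hF s hs _ e2; have [d' d'0 hd'] := hG s hs _ e2.
exists (Num.min d d'); first by rewrite lt_min d0.
move=> s' hs'; rewrite lt_min => /andP[/hd A /hd' B].
apply: le_trans (cabs_le_ReIm _) _.
have -> : e = e / 2 + e / 2 by flra.
rewrite mulrDl; apply: lerD.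
  apply: le_trans A; rewrite le_eqVlt; apply/orP; left; apply/eqP; congr (`|_|).
  by case: (phi s) => x y /=; ring.
apply: le_trans B; rewrite le_eqVlt; apply/orP; left; apply/eqP; congr (`|_|).
by case: (phi s) => x y /=; ring.
Qed.

Definition sint f a b : C := xget 0 [set I | is_sint f a b I].

Lemma sint_eq f a b I : is_sint f a b I -> sint f a b = I.
Proof.
move=> h; rewrite /sint; case: xgetP => [J _ hJ|/(_ I)//].
exact: is_sint_unique hJ h.
Qed.

Lemma sintP f a b : (forall s, 0 <= s <= 1 -> ccont f (spt a b s)) ->
  is_sint f a b (sint f a b).
Proof. by move=> /is_sint_exists [I hI]; rewrite (sint_eq hI). Qed.

Lemma sint_split f a b (p : R) : 0 <= p <= 1 ->
  (forall s, 0 <= s <= 1 -> ccont f (spt a b s)) ->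
  sint f a b = sint f a (spt a b p) + sint f (spt a b p) b.
Proof.
move=> /andP[p0 p1] cf; have [I [F [hF E]]] := is_sint_exists cf.
have h1 := is_sint_sub hF (lexx 0) p0 p1.
have h2 := is_sint_sub hF p0 p1 (lexx 1).
have e0 : spt a b 0 = a by rewrite /spt mul0r addr0.
have e1 : spt a b 1 = b by rewrite /spt mul1r subrKC.
rewrite e0 in h1; rewrite e1 in h2.
rewrite (sint_eq h1) (sint_eq h2) (@sint_eq f a b (F 1 - F 0)); last by exists F.
by ring.
Qed.
End SegmentIntegral.

(** * Goursat's theorem and the maximum principle *)

Section Rectangles.
Variable R : realType.
Local Notation C := R[i].
Implicit Types (f g : C -> C) (z w : C) (a b c d x y : R).
Local Notation re := (@complex.Re R).
Local Notation im := (@complex.Im R).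

Lemma nested_point (xs : nat -> R) (w : R) :
  (forall n, xs n <= xs n.+1 /\ xs n.+1 + w / 2 ^+ n.+1 <= xs n + w / 2 ^+ n) -> 0 <= w ->
  exists X, forall n, xs n <= X <= xs n + w / 2 ^+ n.
Proof.
move=> h w0.
have inc n m : (n <= m)%N -> xs n <= xs m.
  by move=> /subnK <-; elim: (m - n)%N => // k IH; rewrite addSn; apply: le_trans IH (h _).1.
have dec n m : (n <= m)%N -> xs m + w / 2 ^+ m <= xs n + w / 2 ^+ n.
  by move=> /subnK <-; elim: (m - n)%N => // k IH; rewrite addSn; apply: le_trans (h _).2 IH.
have w2 n : 0 <= w / 2 ^+ n by rewrite divr_ge0 // exprn_ge0.
have ub n m : xs m <= xs n + w / 2 ^+ n.
  have [nm|/ltnW mn] := leqP n m.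
    by apply: le_trans (dec _ _ nm); rewrite lerDl.
  by apply: le_trans (inc _ _ mn) _; rewrite lerDl.
exists (sup (range xs)) => n; apply/andP; split.
  apply: ub_le_sup; last by exists n.
  by exists (xs 0%N + w / 2 ^+ 0) => _ [m _ <-]; exact: ub.
by apply: ge_sup; [exists (xs 0%N); exists 0%N|move=> _ [m _ <-]; exact: ub].
Qed.

(** Cousin's lemma: rectangles on which [P] fails, each a quarter of the one before, shrink to a
    point, and the local hypothesis at that point contradicts the failure. This is the form in which
    compactness of rectangles is used, for Goursat's theorem, for boundedness on discs and for the
    surface itself. *)
Lemma cousin_rectangle (P : R -> R -> R -> R -> Prop) a b c d :
  a <= b -> c <= d ->
  (forall a b c d, a <= b -> c <= d ->
    P a ((a + b) / 2) c ((c + d) / 2) -> P ((a + b) / 2) b c ((c + d) / 2) ->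
    P a ((a + b) / 2) ((c + d) / 2) d -> P ((a + b) / 2) b ((c + d) / 2) d -> P a b c d) ->
  (forall x y, a <= x <= b -> c <= y <= d -> exists2 e, 0 < e &
     forall a' b' c' d', a <= a' -> a' <= x -> x <= b' -> b' <= b ->
       c <= c' -> c' <= y -> y <= d' -> d' <= d ->
       b' - a' < e -> d' - c' < e -> P a' b' c' d') ->
  P a b c d.
Proof.
move=> ab cd quarter loc; apply: contrapT => nP.
pose w := b - a; pose h := d - c.
have w0 : 0 <= w by rewrite subr_ge0.
have h0 : 0 <= h by rewrite subr_ge0.
pose Q n (p : R * R) := P p.1 (p.1 + w / 2 ^+ n) p.2 (p.2 + h / 2 ^+ n).
pose S n (p p' : R * R) := [/\ ~ Q n.+1 p',
   p.1 <= p'.1, p'.1 + w / 2 ^+ n.+1 <= p.1 + w / 2 ^+ n,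
   p.2 <= p'.2 & p'.2 + h / 2 ^+ n.+1 <= p.2 + h / 2 ^+ n].
have half (r : R) n : r / 2 ^+ n = r / 2 ^+ n.+1 + r / 2 ^+ n.+1.
  by rewrite exprS; field; rewrite expf_neq0.
have pos (r : R) n : 0 <= r -> 0 <= r / 2 ^+ n by move=> r0; rewrite divr_ge0 // exprn_ge0.
have step n p : ~ Q n p -> exists p', S n p p'.
  move=> nQ; apply: contrapT => nS; apply: nQ.
  have sub (p' : R * R) : p.1 <= p'.1 -> p'.1 + w / 2 ^+ n.+1 <= p.1 + w / 2 ^+ n ->
      p.2 <= p'.2 -> p'.2 + h / 2 ^+ n.+1 <= p.2 + h / 2 ^+ n -> Q n.+1 p'.
    by move=> *; apply: contrapT => nQ; apply: nS; exists p'.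
  have mid (r u : R) : (u + (u + r / 2 ^+ n)) / 2 = u + r / 2 ^+ n.+1.
    by rewrite (half r n); field; rewrite expf_neq0.
  have fin (r u : R) : u + r / 2 ^+ n = u + r / 2 ^+ n.+1 + r / 2 ^+ n.+1.
    by rewrite (half r n) addrA.
  have wn := pos w n.+1 w0; have hn := pos h n.+1 h0.
  have hw := half w n; have hh := half h n.
  apply: quarter; rewrite ?lerDl ?pos // !mid.
  - by apply: (sub p) => //; flra.
  - by rewrite [p.1 + w / 2 ^+ n]fin; apply: (sub (p.1 + w / 2 ^+ n.+1, p.2)) => //=; flra.
  - by rewrite [p.2 + h / 2 ^+ n]fin; apply: (sub (p.1, p.2 + h / 2 ^+ n.+1)) => //=; flra.
  - rewrite [p.1 + w / 2 ^+ n]fin [p.2 + h / 2 ^+ n]fin.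
    by apply: (sub (p.1 + w / 2 ^+ n.+1, p.2 + h / 2 ^+ n.+1)) => //=; flra.
(* Lower left corners of the nested bad rectangles; the sides are [w] and [h] divided by 2 ^ n. *)
pose u := fix u n := if n is n'.+1 then xget (u n') [set p' | S n' (u n') p'] else (a, c).
have uQ n : ~ Q n (u n).
  elim: n => [|n IH]; first by rewrite /Q /= expr0 !divr1 /w /h !subrKC.
  have [p' hp'] := step _ _ IH.
  by rewrite /=; case: xgetP => [p -> [] //|/(_ p')].
have uS n : S n (u n) (u n.+1).
  have [p' hp'] := step _ _ (uQ n).
  by rewrite /=; case: xgetP => [p -> //|/(_ p')].
have [n|X hX] := @nested_point (fun n => (u n).1) w _ w0; first by case: (uS n).
have [n|Y hY] := @nested_point (fun n => (u n).2) h _ h0; first by case: (uS n).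
have aX n : a <= (u n).1 /\ c <= (u n).2.
  elim: n => //= n [IH1 IH2]; case: (uS n) => _ h1 _ h2 _.
  by split; [exact: le_trans h1|exact: le_trans h2].
have bX n : (u n).1 + w / 2 ^+ n <= b /\ (u n).2 + h / 2 ^+ n <= d.
  elim: n => [|n [IH1 IH2]]; first by rewrite /= expr0 !divr1 /w /h !subrKC.
  case: (uS n) => _ _ h1 _ h2.
  by split; [exact: le_trans h1 _|exact: le_trans h2 _].
have XY : a <= X <= b /\ c <= Y <= d.
  have := hX 0%N; have := hY 0%N; rewrite /= expr0 !divr1 /w /h !subrKC //.
have [e e0 he] := loc X Y XY.1 XY.2.
have [n hn] : exists n, (2^-1 : R) ^+ n < e / (w + h + 1).
  apply: seq_exp_lt; first by apply/andP; split; flra.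
  by rewrite divr_gt0 //; flra.
have small r : 0 <= r -> r <= w + h -> r / 2 ^+ n < e.
  move=> r0 rw; rewrite -exprVn; move: hn; rewrite ltr_pdivlMr; last by flra.
  have : 0 < (2^-1 : R) ^+ n by rewrite exprn_gt0 // invr_gt0.
  by move=> q0; nra.
apply: (uQ n); rewrite /Q.
have /andP[x1 x2] := hX n; have /andP[y1 y2] := hY n.
have [a1 c1] := aX n; have [b1 d1] := bX n.
by apply: he => //; rewrite addrC addKr; apply: small => //; flra.
Qed.

Lemma sint_pt f z : sint f z z = 0.
Proof.
apply: sint_eq; exists (fun=> 0); split; last by rewrite subrr.
move=> s hs e e0; exists 1 => // s' _ _.
by rewrite [z - z]subrr !mulr0 !subr0 cabs0 mulr_ge0 // ltW.
Qed.

(** Boundary integral, counterclockwise: the top and the left side are run through backwards, hence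
    the two minus signs. *)
Definition rint f a b c d : C :=
  sint f (Complex a c) (Complex b c) + sint f (Complex b c) (Complex b d)
  - sint f (Complex a d) (Complex b d) - sint f (Complex a c) (Complex a d).

Definition inrect a b c d z := a <= re z <= b /\ c <= im z <= d.

Lemma spt_h a b y s : spt (Complex a y) (Complex b y) s = Complex (a + s * (b - a)) y.
Proof. by rewrite /spt; congr Complex => /=; ring. Qed.
Lemma spt_v x c d s : spt (Complex x c) (Complex x d) s = Complex x (c + s * (d - c)).
Proof. by rewrite /spt; congr Complex => /=; ring. Qed.

Lemma in_h a b c d y s : a <= b -> c <= y <= d -> 0 <= s <= 1 ->
  inrect a b c d (spt (Complex a y) (Complex b y) s).
Proof. by move=> ab hy /andP[s0 s1]; rewrite spt_h; split=> //=; apply/andP; split; nra. Qed.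
Lemma in_v a b c d x s : c <= d -> a <= x <= b -> 0 <= s <= 1 ->
  inrect a b c d (spt (Complex x c) (Complex x d) s).
Proof. by move=> ab hy /andP[s0 s1]; rewrite spt_v; split=> //=; apply/andP; split; nra. Qed.

Lemma sint_hsplit f a m b y : a <= m <= b ->
  (forall z, inrect a b y y z -> ccont f z) ->
  sint f (Complex a y) (Complex b y) =
  sint f (Complex a y) (Complex m y) + sint f (Complex m y) (Complex b y).
Proof.
move=> /andP[am mb] cf; have [ab|ab] := eqVneq a b.
  have -> : m = a by flra. by rewrite ab sint_pt add0r.
have ab' : 0 < b - a by rewrite subr_gt0 lt_neqAle ab; flra.
have p01 : 0 <= (m - a) / (b - a) <= 1.
  by rewrite divr_ge0 ?subr_ge0 ?(ltW ab') //=; [rewrite ler_pdivrMr //; flra | flra].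
rewrite (sint_split p01); first by rewrite spt_h divfK ?gt_eqF // subrKC.
by move=> s hs; apply: cf; apply: in_h; [flra | rewrite lexx | ].
Qed.

Lemma sint_vsplit f c m d x : c <= m <= d ->
  (forall z, inrect x x c d z -> ccont f z) ->
  sint f (Complex x c) (Complex x d) =
  sint f (Complex x c) (Complex x m) + sint f (Complex x m) (Complex x d).
Proof.
move=> /andP[am mb] cf; have [ab|ab] := eqVneq c d.
  have -> : m = c by flra. by rewrite ab sint_pt add0r.
have ab' : 0 < d - c by rewrite subr_gt0 lt_neqAle ab; flra.
have p01 : 0 <= (m - c) / (d - c) <= 1.
  by rewrite divr_ge0 ?subr_ge0 ?(ltW ab') //=; [rewrite ler_pdivrMr //; flra | flra].
rewrite (sint_split p01); first by rewrite spt_v divfK ?gt_eqF // subrKC.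
by move=> s hs; apply: cf; apply: in_v; [flra | rewrite lexx | ].
Qed.

Lemma rint_splitx f a m b c d : a <= m <= b -> c <= d ->
  (forall z, inrect a b c d z -> ccont f z) ->
  rint f a b c d = rint f a m c d + rint f m b c d.
Proof.
move=> amb cd cf; rewrite /rint (@sint_hsplit f a m b c) //; last first.
  by move=> z [h1 h2]; apply: cf; split=> //; flra.
rewrite (@sint_hsplit f a m b d) //; last first.
  by move=> z [h1 h2]; apply: cf; split=> //; flra.
by ring.
Qed.
Lemma rint_splity f a b c m d : c <= m <= d -> a <= b ->
  (forall z, inrect a b c d z -> ccont f z) ->
  rint f a b c d = rint f a b c m + rint f a b m d.
Proof.
move=> amb cd cf; rewrite /rint (@sint_vsplit f c m d a) //; last first.
  by move=> z [h1 h2]; apply: cf; split=> //; flra.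
rewrite (@sint_vsplit f c m d b) //; last first.
  by move=> z [h1 h2]; apply: cf; split=> //; flra.
by ring.
Qed.

(* Only boundary points matter: the integrand may be unbounded inside. *)
Lemma rint_le f a b c d M : a <= b -> c <= d ->
  (forall z, inrect a b c d z -> re z = a \/ re z = b \/ im z = c \/ im z = d ->
     ccont f z /\ cabs (f z) <= M) ->
  cabs (rint f a b c d) <= M * (2 * ((b - a) + (d - c))).
Proof.
move=> ab cd hf.
have Hh y : y = c \/ y = d -> cabs (sint f (Complex a y) (Complex b y)) <= M * (b - a).
  move=> hy; have hy' : c <= y <= d by case: hy => ->; rewrite lexx ?andbT.
  have hh s : 0 <= s <= 1 -> ccont f (spt (Complex a y) (Complex b y) s) /\
       cabs (f (spt (Complex a y) (Complex b y) s)) <= M.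
    move=> hs; apply: hf; first exact: in_h.
    by rewrite spt_h /=; case: hy => ->; tauto.
  have := is_sint_le (sintP (fun s hs => (hh s hs).1)) (fun s hs => (hh s hs).2).
  have -> : cabs (Complex b y - Complex a y) = b - a.
    by rewrite /cabs /= subrr expr0n addr0 sqrtr_sqr ger0_norm // subr_ge0.
  by [].
have Hv x : x = a \/ x = b -> cabs (sint f (Complex x c) (Complex x d)) <= M * (d - c).
  move=> hy; have hy' : a <= x <= b by case: hy => ->; rewrite lexx ?andbT.
  have hh s : 0 <= s <= 1 -> ccont f (spt (Complex x c) (Complex x d) s) /\
       cabs (f (spt (Complex x c) (Complex x d) s)) <= M.
    move=> hs; apply: hf; first exact: in_v.
    by rewrite spt_v /=; case: hy => ->; tauto.
  have := is_sint_le (sintP (fun s hs => (hh s hs).1)) (fun s hs => (hh s hs).2).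
  have -> : cabs (Complex x d - Complex x c) = d - c.
    by rewrite /cabs /= subrr expr0n add0r sqrtr_sqr ger0_norm // subr_ge0.
  by [].
have := Hh c (or_introl erefl); have := Hh d (or_intror erefl).
have := Hv a (or_introl erefl); have := Hv b (or_intror erefl).
rewrite /rint.
set A := sint f _ _; set B := sint f _ _; set D := sint f _ _; set E := sint f _ _.
move=> hA hB hD hE.
apply: le_trans (cabsD _ _) _; rewrite cabsN.
have := cabsD (E + A) (- D); rewrite cabsN; have := cabsD E A; flra.
Qed.

Lemma rint_ext f g a b c d : a <= b -> c <= d ->
  (forall z, inrect a b c d z -> re z = a \/ re z = b \/ im z = c \/ im z = d ->
     ccont f z /\ f z = g z) -> rint f a b c d = rint g a b c d.
Proof.
move=> ab cd fg.
have Hh y : y = c \/ y = d -> sint f (Complex a y) (Complex b y) = sint g (Complex a y) (Complex b y).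
  move=> hy; have hy' : c <= y <= d by case: hy => ->; rewrite lexx ?andbT.
  have hh s : 0 <= s <= 1 -> ccont f (spt (Complex a y) (Complex b y) s) /\
       f (spt (Complex a y) (Complex b y) s) = g (spt (Complex a y) (Complex b y) s).
    move=> hs; apply: fg; first exact: in_h.
    by rewrite spt_h /=; case: hy => ->; tauto.
  apply/esym/sint_eq; apply: is_sint_ext (fun s hs => (hh s hs).2) _.
  exact: sintP (fun s hs => (hh s hs).1).
have Hv x : x = a \/ x = b -> sint f (Complex x c) (Complex x d) = sint g (Complex x c) (Complex x d).
  move=> hy; have hy' : a <= x <= b by case: hy => ->; rewrite lexx ?andbT.
  have hh s : 0 <= s <= 1 -> ccont f (spt (Complex x c) (Complex x d) s) /\
       f (spt (Complex x c) (Complex x d) s) = g (spt (Complex x c) (Complex x d) s).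
    move=> hs; apply: fg; first exact: in_v.
    by rewrite spt_v /=; case: hy => ->; tauto.
  apply/esym/sint_eq; apply: is_sint_ext (fun s hs => (hh s hs).2) _.
  exact: sintP (fun s hs => (hh s hs).1).
by rewrite /rint !Hh ?Hv; auto.
Qed.

Lemma rint_lin f g a b c d k : a <= b -> c <= d ->
  (forall z, inrect a b c d z -> re z = a \/ re z = b \/ im z = c \/ im z = d ->
     ccont f z /\ ccont g z) ->
  rint (fun z => f z + k * g z) a b c d = rint f a b c d + k * rint g a b c d.
Proof.
move=> ab cd fg.
have Hh y : y = c \/ y = d -> sint (fun z => f z + k * g z) (Complex a y) (Complex b y) =
     sint f (Complex a y) (Complex b y) + k * sint g (Complex a y) (Complex b y).
  move=> hy; have hy' : c <= y <= d by case: hy => ->; rewrite lexx ?andbT.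
  have hh s : 0 <= s <= 1 -> ccont f (spt (Complex a y) (Complex b y) s) /\
       ccont g (spt (Complex a y) (Complex b y) s).
    move=> hs; apply: fg; first exact: in_h.
    by rewrite spt_h /=; case: hy => ->; tauto.
  apply: sint_eq; apply: is_sintD; first exact: sintP (fun s hs => (hh s hs).1).
  by apply: is_sintZ; exact: sintP (fun s hs => (hh s hs).2).
have Hv x : x = a \/ x = b -> sint (fun z => f z + k * g z) (Complex x c) (Complex x d) =
     sint f (Complex x c) (Complex x d) + k * sint g (Complex x c) (Complex x d).
  move=> hy; have hy' : a <= x <= b by case: hy => ->; rewrite lexx ?andbT.
  have hh s : 0 <= s <= 1 -> ccont f (spt (Complex x c) (Complex x d) s) /\
       ccont g (spt (Complex x c) (Complex x d) s).
    move=> hs; apply: fg; first exact: in_v.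
    by rewrite spt_v /=; case: hy => ->; tauto.
  apply: sint_eq; apply: is_sintD; first exact: sintP (fun s hs => (hh s hs).1).
  by apply: is_sintZ; exact: sintP (fun s hs => (hh s hs).2).
by rewrite /rint !Hh ?Hv; auto; ring.
Qed.

Lemma rint_affine a b c d (k l p : C) : rint (fun z => k + l * (z - p)) a b c d = 0.
Proof.
pose F z := (k - l * p) * z + l / 2 * (z * z).
have dF z : cder F z (k + l * (z - p)).
  have -> : k + l * (z - p) = 0 * z + (k - l * p) * 1 + (0 * (z * z) + l / 2 * (1 * z + z * 1)).
    by field.
  by apply: cderD; apply: cderM; (exact: cder_const || (try exact: cder_id));
     apply: cderM; exact: cder_id.
have E z w : sint (fun z => k + l * (z - p)) z w = F w - F z.
  by apply: sint_eq; apply: is_sint_primitive => s _; exact: dF.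
by rewrite /rint !E; ring.
Qed.
End Rectangles.

Section Goursat.
Variable R : realType.
Local Notation C := R[i].
Implicit Types (f g : C -> C) (z w : C) (a b c d x y : R) (E : seq C).
Local Notation re := (@complex.Re R).
Local Notation im := (@complex.Im R).

Lemma reB z w : re (z - w) = re z - re w. Proof. by case: z; case: w. Qed.
Lemma imB z w : im (z - w) = im z - im w. Proof. by case: z; case: w. Qed.
Lemma reD z w : re (z + w) = re z + re w. Proof. by case: z; case: w. Qed.
Lemma imD z w : im (z + w) = im z + im w. Proof. by case: z; case: w. Qed.

Lemma cabs0_of_le z (K : R) : (forall e, 0 < e -> cabs z <= e * K) -> z = 0.
Proof.
move=> h; apply: cabs0P; have [K0|K0] := leP K 0.
  by apply: le_trans (h 1 ltr01) _; rewrite mul1r.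
apply/ler_addgt0Pr => e e0; have := h (e / K) (divr_gt0 e0 K0).
by rewrite divfK ?gt_eqF // add0r.
Qed.

(** Bisection in the form of Cousin's lemma. The bound by [e] times the squared semiperimeter adds
    up exactly over four quarters, and it holds near each point because the affine part of [f]
    integrates to 0. *)
Lemma goursat0 f a b c d : a <= b -> c <= d ->
  (forall z, inrect a b c d z -> exists l, cder f z l) -> rint f a b c d = 0.
Proof.
move=> ab cd df.
have cf z : inrect a b c d z -> ccont f z by move=> /df[l]; exact: cder_cont.
apply: (@cabs0_of_le _ (((b - a) + (d - c)) ^+ 2)) => e e0.
suff : forall (Q := fun a' b' c' d' => a <= a' -> b' <= b -> c <= c' -> d' <= d ->
   cabs (rint f a' b' c' d') <= e * ((b' - a') + (d' - c')) ^+ 2), Q a b c d by exact.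
move=> Q; apply: (@cousin_rectangle _ Q a b c d) => // {ab cd}.
  move=> a' b' c' d' ab cd Q1 Q2 Q3 Q4 ha hb hc hd.
  have sub z : inrect a' b' c' d' z -> ccont f z.
    by move=> [h1 h2]; apply: cf; split; flra.
  rewrite (@rint_splitx _ f a' ((a' + b') / 2)) //; last by apply/andP; split; flra.
  rewrite (@rint_splity _ f a' ((a' + b') / 2) c' ((c' + d') / 2)); first last.
  - by move=> z [h1 h2]; apply: sub; split; flra.
  - by flra.
  - by apply/andP; split; flra.
  rewrite (@rint_splity _ f ((a' + b') / 2) b' c' ((c' + d') / 2)); first last.
  - by move=> z [h1 h2]; apply: sub; split; flra.
  - by flra.
  - by apply/andP; split; flra.
  have h1 := Q1 ltac:(flra) ltac:(flra) ltac:(flra) ltac:(flra).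
  have h2 := Q2 ltac:(flra) ltac:(flra) ltac:(flra) ltac:(flra).
  have h3 := Q3 ltac:(flra) ltac:(flra) ltac:(flra) ltac:(flra).
  have h4 := Q4 ltac:(flra) ltac:(flra) ltac:(flra) ltac:(flra).
  apply: le_trans (cabsD _ _) _.
  have t1 := cabsD (rint f a' ((a' + b') / 2) c' ((c' + d') / 2)) (rint f a' ((a' + b') / 2) ((c' + d') / 2) d').
  have t2 := cabsD (rint f ((a' + b') / 2) b' c' ((c' + d') / 2)) (rint f ((a' + b') / 2) b' ((c' + d') / 2) d').
  have -> : e * (b' - a' + (d' - c')) ^+ 2 =
   (e * ((a' + b') / 2 - a' + ((c' + d') / 2 - c')) ^+ 2 +
    e * ((a' + b') / 2 - a' + (d' - (c' + d') / 2)) ^+ 2) +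
   (e * (b' - (a' + b') / 2 + ((c' + d') / 2 - c')) ^+ 2 +
    e * (b' - (a' + b') / 2 + (d' - (c' + d') / 2)) ^+ 2) by field.
  by flra.
move=> x y hx hy; have hz : inrect a b c d (Complex x y) by split.
have [l [q [Eq cq ql]]] := df _ hz; have e2 : 0 < e / 2 by flra.
have [dl dl0 hdl] := cq _ e2; exists (dl / 2); first by flra.
move=> a' b' c' d' aa' a'x xb' b'b cc' c'y yd' d'd wa wc _ _ _ _.
set z0 := Complex x y in Eq cq ql hdl hz.
have ab' : a' <= b' by exact: le_trans xb'.
have cd' : c' <= d' by exact: le_trans yd'.
pose r z := f z - (f z0 + l * (z - z0)).
have caff z : ccont (fun z => f z0 + l * (z - z0)) z.
  apply: ccontD; first exact: ccont_const.
  apply: ccontM; first exact: ccont_const.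
  by apply: ccontD; [exact: ccont_id|exact: ccont_const].
have sub z : inrect a' b' c' d' z -> ccont f z by move=> [h1 h2]; apply: cf; split; flra.
have cr z : inrect a' b' c' d' z -> ccont r z.
  move=> hz'; apply: (@ccont_near _ (fun z => f z + (-1) * (f z0 + l * (z - z0))) _ _ 1) => //.
    by move=> w _; rewrite /r; ring.
  apply: ccontD; first exact: sub.
  by apply: ccontM; [exact: ccont_const|exact: caff].
rewrite (@rint_ext _ f (fun z => (f z0 + l * (z - z0)) + 1 * r z)) //; last first.
  by move=> z hz' _; split; [exact: sub|rewrite /r; ring].
rewrite rint_lin //; last by move=> z hz' _; split; [exact: caff|exact: cr].
rewrite rint_affine add0r mul1r.
set W := b' - a' + (d' - c').
apply: le_trans (@rint_le _ r a' b' c' d' (W * (e / 2)) ab' cd' _) _.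
  move=> z hz' _; split; first exact: cr.
  have zW : cabs (z - z0) <= W.
    apply: le_trans (cabs_le_ReIm _) _; rewrite reB imB /=.
    case: hz' => /andP[h1 h2] /andP[h3 h4].
    by apply: lerD; rewrite ler_norml; apply/andP; split; flra.
  have -> : r z = (z - z0) * (q z - l) by rewrite /r (Eq z); ring.
  rewrite cabsM; apply: ler_pM; rewrite ?cabs_ge0 //.
  by rewrite -ql; apply/ltW/hdl; apply: le_lt_trans zW _; rewrite /W; flra.
by rewrite le_eqVlt; apply/orP; left; apply/eqP; rewrite /W; field.
Qed.

(* The exceptional points are isolated by cutting a small square around each of them. *)
Lemma goursat E f a b c d : a <= b -> c <= d ->
  (forall z, inrect a b c d z -> ccont f z) ->
  (forall z, inrect a b c d z -> z \notin E -> exists l, cder f z l) -> rint f a b c d = 0.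
Proof.
elim: E a b c d => [|p E IH] a b c d ab cd cf df.
  by apply: goursat0 => // z hz; exact: df.
have IH' a' b' c' d' : a <= a' -> a' <= b' -> b' <= b -> c <= c' -> c' <= d' -> d' <= d ->
   ~ inrect a' b' c' d' p -> rint f a' b' c' d' = 0.
  move=> h1 h2 h3 h4 h5 h6 hp; apply: IH => //.
    by move=> z [/andP[? ?] /andP[? ?]]; apply: cf; split; apply/andP; split; flra.
  move=> z hz zE; apply: df; first by case: hz => /andP[? ?] /andP[? ?]; split; apply/andP; split; flra.
  by rewrite inE negb_or zE andbT; apply/negP => /eqP zp; apply: hp; rewrite -zp.
have [hp|hp] := pselect (inrect a b c d p); last by apply: IH'.
have [/andP[p1 p2] /andP[p3 p4]] := hp.
have [d1 d10 hd1] := cf p hp 1 ltr01.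
apply: (@cabs0_of_le _ (8 * (cabs (f p) + 1) * d1)) => e e0.
(* The square of half side [dl] around [p] stays where the modulus of [f] is at most
   [cabs (f p) + 1], and its perimeter, at most [8 * dl], is proportional to [e]. *)
pose dl := Num.min 1 e * (d1 / 4).
have dl0 : 0 < dl by rewrite mulr_gt0 // ?lt_min ?ltr01 ?divr_gt0.
have dld : dl <= d1 / 4 by rewrite /dl ler_piMl ?ge_min ?lexx //; flra.
have dle : dl <= e * d1 / 4 by rewrite /dl -mulrA ler_wpM2r ?ge_min ?lexx ?orbT //; flra.
pose x1 := Num.max a (re p - dl); pose x2 := Num.min b (re p + dl).
pose y1 := Num.max c (im p - dl); pose y2 := Num.min d (im p + dl).
have hx1 : a <= x1 <= re p by rewrite /x1 le_max lexx /= ge_max p1 /=; flra.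
have hx2 : re p <= x2 <= b by rewrite /x2 ge_min lexx /= le_min p2 /= andbT; flra.
have hy1 : c <= y1 <= im p by rewrite /y1 le_max lexx /= ge_max p3 /=; flra.
have hy2 : im p <= y2 <= d by rewrite /y2 ge_min lexx /= le_min p4 /= andbT; flra.
have lx1 : re p - dl <= x1 by rewrite /x1 le_max lexx orbT.
have lx2 : x2 <= re p + dl by rewrite /x2 ge_min lexx orbT.
have ly1 : im p - dl <= y1 by rewrite /y1 le_max lexx orbT.
have ly2 : y2 <= im p + dl by rewrite /y2 ge_min lexx orbT.
have degx (u v w : R) : rint f u u v w = 0 by rewrite /rint !sint_pt; ring.
have degy (u v w : R) : rint f u v w w = 0 by rewrite /rint !sint_pt; ring.
have sub a' b' c' d' : a <= a' -> b' <= b -> c <= c' -> d' <= d ->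
   forall z, inrect a' b' c' d' z -> ccont f z.
  by move=> h1 h3 h4 h6 z [/andP[? ?] /andP[? ?]]; apply: cf; split; apply/andP; split; flra.
have left0 : rint f a x1 c d = 0.
  have [xa|xa] := leP (re p - dl) a.
    by have -> : x1 = a by rewrite /x1; apply/max_idPl.
  have E1 : x1 = re p - dl by rewrite /x1; apply/max_idPr/ltW.
  rewrite E1.
  by apply: IH'; [flra|flra|flra|flra|flra|flra|move=> [/andP[_ h] _]; flra].
have right0 : rint f x2 b c d = 0.
  have [xa|xa] := leP b (re p + dl).
    by have -> : x2 = b by rewrite /x2; apply/min_idPl.
  have E1 : x2 = re p + dl by rewrite /x2; apply/min_idPr/ltW.
  rewrite E1.
  by apply: IH'; [flra|flra|flra|flra|flra|flra|move=> [/andP[h _] _]; flra].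
have bot0 : rint f x1 x2 c y1 = 0.
  have [xa|xa] := leP (im p - dl) c.
    by have -> : y1 = c by rewrite /y1; apply/max_idPl.
  have E1 : y1 = im p - dl by rewrite /y1; apply/max_idPr/ltW.
  rewrite E1.
  by apply: IH'; [flra|flra|flra|flra|flra|flra|move=> [_ /andP[_ h]]; flra].
have top0 : rint f x1 x2 y2 d = 0.
  have [xa|xa] := leP d (im p + dl).
    by have -> : y2 = d by rewrite /y2; apply/min_idPl.
  have E1 : y2 = im p + dl by rewrite /y2; apply/min_idPr/ltW.
  rewrite E1.
  by apply: IH'; [flra|flra|flra|flra|flra|flra|move=> [_ /andP[h _]]; flra].
rewrite (@rint_splitx _ f a x1 b) //; last by flra.
rewrite left0 add0r (@rint_splitx _ f x1 x2 b) //; [|flra|by apply: sub; flra].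
rewrite right0 addr0 (@rint_splity _ f x1 x2 c y1 d) //; [|flra|flra|by apply: sub; flra].
rewrite bot0 add0r (@rint_splity _ f x1 x2 y1 y2 d) //; [|flra|flra|by apply: sub; flra].
rewrite top0 addr0.
apply: le_trans (@rint_le _ f x1 x2 y1 y2 (cabs (f p) + 1) _ _ _) _; [flra|flra| |].
  move=> z hz _; split; first by apply: sub hz; flra.
  have zW : cabs (z - p) < d1.
    apply: le_lt_trans (cabs_le_ReIm _) _; rewrite reB imB /=.
    case: hz => /andP[h1 h2] /andP[h3 h4].
    have h5 : `|re z - re p| <= dl by rewrite ler_norml; apply/andP; split; flra.
    have h6 : `|im z - im p| <= dl by rewrite ler_norml; apply/andP; split; flra.
    by flra.
  have -> : f z = f p + (f z - f p) by ring.
  by apply: le_trans (cabsD _ _) _; rewrite lerD2l; exact/ltW/hd1.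
have : 0 <= cabs (f p) by exact: cabs_ge0.
set K := cabs (f p) => K0.
have -> : e * (8 * (K + 1) * d1) = (K + 1) * (8 * (e * d1)) by ring.
rewrite ler_wpM2l //; flra.
Qed.
End Goursat.

Section MaxPrinciple.
Variable R : realType.
Local Notation C := R[i].
Implicit Types (f g : C -> C) (z w c : C) (E : seq C).
Local Notation re := (@complex.Re R).
Local Notation im := (@complex.Im R).

Lemma cder_itv_im_ge (F : R -> C) (phi : R -> C) (m : R) :
  (forall s, 0 <= s <= 1 -> cder_itv F s (phi s)) ->
  (forall s, 0 <= s <= 1 -> m <= im (phi s)) -> m <= im (F 1 - F 0).
Proof.
move=> dF hm.
have imE z : im z = - re (Complex 0 1 * z) by case: z => a b /=; ring.
have := @cder_itv_re_le R (fun t => Complex 0 1 * F t) (fun t => Complex 0 1 * phi t) (- m).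
rewrite -mulrBr imE => h; suff : re (Complex 0 1 * (F 1 - F 0)) <= - m by flra.
apply: h => s hs; first exact/cder_itv_scale/dF.
by rewrite -[re _]opprK -imE lerN2 hm.
Qed.

Lemma is_sint_im_ge f (a b I : C) m : is_sint f a b I ->
  (forall s, 0 <= s <= 1 -> m <= im (f (spt a b s) * (b - a))) -> m <= im I.
Proof. by move=> [F [hF ->]] hm; exact: cder_itv_im_ge hF hm. Qed.

Lemma inv_kernel_bound (u v L : R) : 0 < v -> v <= L -> -L <= u <= L ->
  v / (2 * L ^+ 2) <= v / (u ^+ 2 + v ^+ 2).
Proof.
move=> v0 vL /andP[u1 u2]; rewrite ler_pM2l // lef_pV2 ?posrE; nra.
Qed.

(* The winding integral of a square around an interior point: each side contributes a
   positive imaginary part. *)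
Lemma winding_neq0 (x1 x2 y1 y2 : R) z : x1 < re z < x2 -> y1 < im z < y2 ->
  rint (fun w => (w - z)^-1) x1 x2 y1 y2 != 0.
Proof.
case: z => p q /= /andP[hx1 hx2] /andP[hy1 hy2].
set z := Complex p q.
pose L := (x2 - x1) + (y2 - y1).
have L0 : 0 < L by rewrite /L; flra.
have c1 w : w != z -> ccont (fun w => (w - z)^-1) w.
  move=> wz; apply: ccontV; last by rewrite subr_eq0.
  by apply: ccontD; [exact: ccont_id|exact: ccont_const].
have hor (y : R) : y != q -> forall s, 0 <= s <= 1 ->
    ccont (fun w => (w - z)^-1) (spt (Complex x1 y) (Complex x2 y) s).
  by move=> yq s _; rewrite spt_h; apply: c1; apply: contra yq => /eqP[_ ->].
have ver (x : R) : x != p -> forall s, 0 <= s <= 1 ->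
    ccont (fun w => (w - z)^-1) (spt (Complex x y1) (Complex x y2) s).
  by move=> yq s _; rewrite spt_v; apply: c1; apply: contra yq => /eqP[-> _].
have A : 0 < im (sint (fun w => (w - z)^-1) (Complex x1 y1) (Complex x2 y1)).
  have yq : y1 != q by rewrite lt_eqF.
  apply: (@lt_le_trans _ _ ((x2 - x1) * ((q - y1) / (2 * L ^+ 2)))).
    by rewrite mulr_gt0 ?divr_gt0 ?subr_gt0 ?mulr_gt0 ?exprn_gt0 //; flra.
  apply: (is_sint_im_ge (sintP (hor _ yq))) => s /andP[s0 s1]; rewrite spt_h /z /=.
  set X := x1 + s * (x2 - x1).
  have hX : x1 <= X <= x2 by rewrite /X; apply/andP; split; nra.
  have -> : ((X - p) / ((X - p) ^+ 2 + (y1 - q) ^+ 2) * (y1 - y1) +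
     - ((y1 - q) / ((X - p) ^+ 2 + (y1 - q) ^+ 2)) * (x2 - x1)) =
     (x2 - x1) * ((q - y1) / ((X - p) ^+ 2 + (q - y1) ^+ 2)).
    by rewrite subrr mulr0 add0r -(sqrrN (y1 - q)) opprB -mulNr opprB mulrC.
  rewrite ler_wpM2l //; first by flra.
  by apply: inv_kernel_bound; rewrite ?/L; flra.
have B : 0 < im (sint (fun w => (w - z)^-1) (Complex x2 y1) (Complex x2 y2)).
  have yq : x2 != p by rewrite gt_eqF.
  apply: (@lt_le_trans _ _ ((y2 - y1) * ((x2 - p) / (2 * L ^+ 2)))).
    by rewrite mulr_gt0 ?divr_gt0 ?subr_gt0 ?mulr_gt0 ?exprn_gt0 //; flra.
  apply: (is_sint_im_ge (sintP (ver _ yq))) => s /andP[s0 s1]; rewrite spt_v /z /=.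
  set X := y1 + s * (y2 - y1).
  have hX : y1 <= X <= y2 by rewrite /X; apply/andP; split; nra.
  have -> : ((x2 - p) / ((x2 - p) ^+ 2 + (X - q) ^+ 2) * (y2 - y1) +
     - ((X - q) / ((x2 - p) ^+ 2 + (X - q) ^+ 2)) * (x2 - x2)) =
     (y2 - y1) * ((x2 - p) / ((X - q) ^+ 2 + (x2 - p) ^+ 2)).
    by rewrite subrr mulr0 addr0 mulrC [X in _ / X]addrC.
  rewrite ler_wpM2l //; first by flra.
  by apply: inv_kernel_bound; rewrite ?/L; flra.
have D : im (sint (fun w => (w - z)^-1) (Complex x1 y2) (Complex x2 y2)) <= 0.
  have yq : y2 != q by rewrite gt_eqF.
  suff : 0 <= im ((-1) * sint (fun w => (w - z)^-1) (Complex x1 y2) (Complex x2 y2)).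
    by case: (sint _ _ _) => u v /=; flra.
  apply: (is_sint_im_ge (is_sintZ (-1) (sintP (hor _ yq)))) => s /andP[s0 s1]; rewrite spt_h /z /=.
  set X := x1 + s * (x2 - x1).
  set N := (X - p) ^+ 2 + (y2 - q) ^+ 2.
  have N0 : 0 < N^-1.
    by rewrite invr_gt0 /N ltr_wpDl ?sqr_ge0 // exprn_gt0 // subr_gt0.
  have -> : (-1 * ((X - p) / N) - - 0 * - ((y2 - q) / N)) * (y2 - y2) +
     (-1 * - ((y2 - q) / N) + - 0 * ((X - p) / N)) * (x2 - x1) =
     (y2 - q) * (x2 - x1) * N^-1 by ring.
  by rewrite mulr_ge0 ?(ltW N0) // mulr_ge0; flra.
have E : im (sint (fun w => (w - z)^-1) (Complex x1 y1) (Complex x1 y2)) <= 0.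
  have yq : x1 != p by rewrite lt_eqF.
  suff : 0 <= im ((-1) * sint (fun w => (w - z)^-1) (Complex x1 y1) (Complex x1 y2)).
    by case: (sint _ _ _) => u v /=; flra.
  apply: (is_sint_im_ge (is_sintZ (-1) (sintP (ver _ yq)))) => s /andP[s0 s1]; rewrite spt_v /z /=.
  set X := y1 + s * (y2 - y1).
  set N := (x1 - p) ^+ 2 + (X - q) ^+ 2.
  have N0 : 0 < N^-1.
    rewrite invr_gt0 /N ltr_pwDl ?sqr_ge0 // -(sqrrN (x1 - p)) opprB exprn_gt0 // subr_gt0 //.
  have -> : (-1 * ((x1 - p) / N) - - 0 * - ((X - q) / N)) * (y2 - y1) +
     (-1 * - ((X - q) / N) + - 0 * ((x1 - p) / N)) * (x1 - x1) =
     (p - x1) * (y2 - y1) * N^-1 by ring.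
  by rewrite mulr_ge0 ?(ltW N0) // mulr_ge0; flra.
apply/negP => /eqP /(congr1 im) /=; rewrite /rint !imB imD /=.
by move=> h; flra.
Qed.

(* Maximum principle, by Landau's trick: apply Cauchy's estimate to [f ^+ n] and take n-th
   roots. The boundary is any square between the circles of radii [s] and [2 s]. *)
Lemma max_principle E f c (s M : R) : 0 < s ->
  (forall z, cabs (z - c) <= 2 * s -> ccont f z) ->
  (forall z, cabs (z - c) <= 2 * s -> z \notin E -> exists l, cder f z l) ->
  (forall z, s <= cabs (z - c) <= 2 * s -> cabs (f z) <= M) ->
  forall a, cabs (a - c) < s -> a \notin E -> cabs (f a) <= M.
Proof.
move=> s0 cf df fM a ha aE.
set x1 := re c - s; set x2 := re c + s; set y1 := im c - s; set y2 := im c + s.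
have rin z : inrect x1 x2 y1 y2 z -> cabs (z - c) <= 2 * s.
  case; rewrite /x1 /x2 /y1 /y2 => /andP[h1 h2] /andP[h3 h4].
  apply: le_trans (cabs_le_ReIm _) _; rewrite reB imB.
  have : `|re z - re c| <= s by rewrite ler_norml; flra.
  have : `|im z - im c| <= s by rewrite ler_norml; flra.
  by flra.
have rbd z : re z = x1 \/ re z = x2 \/ im z = y1 \/ im z = y2 -> s <= cabs (z - c).
  have := Re_le_cabs (z - c); have := Im_le_cabs (z - c); rewrite reB imB /x1 /x2 /y1 /y2.
  rewrite !ler_norml => /andP[h1 h2] /andP[h3 h4].
  by case=> [|[|[|]]] hz; flra.
pose dist := s - cabs (a - c); have dist0 : 0 < dist by rewrite /dist; flra.
have adist z : re z = x1 \/ re z = x2 \/ im z = y1 \/ im z = y2 -> dist <= cabs (z - a).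
  by move=> /rbd h; rewrite /dist; have := cabs_distD a z c; flra.
pose J := rint (fun w => (w - a)^-1) x1 x2 y1 y2.
have [ax ay] : x1 < re a < x2 /\ y1 < im a < y2.
  have := Re_le_cabs (a - c); have := Im_le_cabs (a - c); rewrite reB imB /x1 /x2 /y1 /y2.
  rewrite !ler_norml => /andP[h1 h2] /andP[h3 h4].
  by split; apply/andP; split; flra.
have J0 : J != 0 by exact: winding_neq0.
have x12 : x1 <= x2 by flra.
have y12 : y1 <= y2 by flra.
have M0 : 0 <= M.
  apply: le_trans (fM (c + (s%:C)%C) _); first exact: cabs_ge0.
  have -> : c + (s%:C)%C - c = (s%:C)%C by ring.
  by rewrite cabsR gtr0_norm //; flra.
have [la dfa] := df a (ltac:(flra)) aE.
(* Perimeter [8 * s], over the distance of [a] to the boundary and the modulus of the winding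
   integral. The constant disappears on taking n-th roots, since [J] is nonzero and independent of
   [n]. *)
apply: (@le_of_pow_le _ _ _ (8 * s / dist / cabs J)) => //; first exact: cabs_ge0.
move=> n.
have [l [q [Eq cq ql]]] := cderX n dfa.
have cz z : z != a -> ccont (fun w => (w - a)^-1) z.
  move=> wz; apply: ccontV; last by rewrite subr_eq0.
  by apply: ccontD; [exact: ccont_id|exact: ccont_const].
have bda z : re z = x1 \/ re z = x2 \/ im z = y1 \/ im z = y2 -> z != a.
  by move=> /adist h; rewrite -subr_eq0 -cabs_gt0; flra.
have qE z : z != a -> q z = (f z ^+ n - f a ^+ n) * (z - a)^-1.
  by move=> za; rewrite (Eq z); field; rewrite subr_eq0.
have cfn z : cabs (z - c) <= 2 * s -> ccont (fun w => f w ^+ n) z.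
  move=> hz; elim: n {l q Eq cq ql qE} => [|n IH].
    by apply: (@ccont_near _ (fun=> 1) _ _ 1) => //; exact: ccont_const.
  apply: (@ccont_near _ (fun w => f w * f w ^+ n) _ _ 1) => //.
    by move=> w _; rewrite exprS.
  by apply: ccontM => //; exact: cf.
have qcont z : inrect x1 x2 y1 y2 z -> ccont q z.
  move=> hz; have [->//|za] := eqVneq z a.
  apply: (@ccont_near _ (fun z => (f z ^+ n - f a ^+ n) * (z - a)^-1) _ _ (cabs (z - a))).
  - by rewrite cabs_gt0 subr_eq0.
  - move=> w hw; rewrite qE //; apply/eqP => wa.
    by move: hw; rewrite wa cabsB ltxx.
  - apply: ccontM; last exact: cz.
    by apply: ccontD; [exact/cfn/rin|exact: ccont_const].
(* The difference quotient of [f ^+ n] is continuous at [a], but nothing is known yet of its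
   derivative there, so [a] joins the exceptional points. *)
have Gq : rint q x1 x2 y1 y2 = 0.
  apply: (@goursat _ (a :: E)) => // z hz; rewrite inE negb_or => /andP[za zE].
  have [m dm] := df z (rin _ hz) zE; have [m' dm'] := cderX n dm.
  have d1 : cder (fun z => f z ^+ n - f a ^+ n) z (m' - 0).
    by apply: cderB => //; exact: cder_const.
  have d2 : cder (fun z => z - a) z (1 - 0).
    by apply: cderB; [exact: cder_id|exact: cder_const].
  have za0 : z - a != 0 by rewrite subr_eq0.
  exists ((m' - 0) * (z - a)^-1 + (f z ^+ n - f a ^+ n) * (- (z - a)^-2 * (1 - 0))).
  have d3 := cderM d1 (cderV d2 za0).
  apply: (cder_near _ _ d3); first by rewrite -cabs_gt0 in za0; exact: za0.
  move=> w hw; rewrite qE //; apply/eqP => wa.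
  by move: hw; rewrite wa cabsB ltxx.
have Jn : rint (fun z => f z ^+ n * (z - a)^-1) x1 x2 y1 y2 = f a ^+ n * J.
  rewrite -[RHS]add0r -Gq /J -rint_lin //; last first.
    by move=> z hz hb; split; [exact: qcont|exact/cz/bda].
  apply: rint_ext => // z hz hb; split.
    by apply: ccontM; [exact/cfn/rin|exact/cz/bda].
  by rewrite qE ?bda //; ring.
have : cabs (f a ^+ n * J) <= (M ^+ n / dist) * (2 * ((x2 - x1) + (y2 - y1))).
  rewrite -Jn; apply: rint_le => // z hz hb; split.
    by apply: ccontM; [exact/cfn/rin|exact/cz/bda].
  rewrite cabsM cabsX cabsV; apply: ler_pM.
  - by rewrite exprn_ge0 // cabs_ge0.
  - by rewrite invr_ge0 cabs_ge0.
  - by apply: lerXn2r; rewrite ?nnegrE ?cabs_ge0 // fM // rbd // rin.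
  - by rewrite lef_pV2 ?posrE ?adist // (lt_le_trans dist0) // adist.
have -> : 2 * (x2 - x1 + (y2 - y1)) = 8 * s by rewrite /x1 /x2 /y1 /y2; ring.
rewrite cabsM cabsX -ler_pdivlMr ?cabs_gt0 // => h; apply: le_trans h _.
by rewrite le_eqVlt; apply/orP; left; apply/eqP; field; rewrite cabs_eq0 J0 gt_eqF.
Qed.
End MaxPrinciple.

(** * Local theory of holomorphic functions *)

Section Removable.
Variable R : realType.
Local Notation C := R[i].
Implicit Types (f g q : C -> C) (z w c a b : C).
Local Notation re := (@complex.Re R).
Local Notation im := (@complex.Im R).

Lemma holo_max c (r s M : R) f : holo c r f -> 0 < s -> 2 * s < r ->
  (forall z, s <= cabs (z - c) <= 2 * s -> cabs (f z) <= M) ->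
  forall z, cabs (z - c) <= 2 * s -> cabs (f z) <= M.
Proof.
move=> hf s0 sr hM z hz; have [zs|zs] := leP s (cabs (z - c)); first by apply: hM; rewrite zs.
apply: (@max_principle _ [::] f c s) => //.
- by move=> w hw; apply: (holo_cont hf); flra.
- by move=> w hw _; apply: hf; flra.
Qed.

Lemma ccont_quot f q a z : (forall w, f w = f a + (w - a) * q w) -> z != a -> ccont f z -> ccont q z.
Proof.
move=> E za cf.
apply: (@ccont_near _ (fun w => (f w - f a) * (w - a)^-1) _ _ (cabs (z - a))).
- by rewrite cabs_gt0 subr_eq0.
- move=> w hw; rewrite (E w); have wa : w - a != 0.
    by rewrite subr_eq0; apply/eqP => wa; move: hw; rewrite wa cabsB ltxx.
  by field.
- apply: ccontM; first by apply: ccontD => //; exact: ccont_const.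
  apply: ccontV; last by rewrite subr_eq0.
  by apply: ccontD; [exact: ccont_id|exact: ccont_const].
Qed.

Lemma cder_quot f q a z l : (forall w, f w = f a + (w - a) * q w) -> z != a -> cder f z l ->
  exists m, cder q z m.
Proof.
move=> E za df; have za0 : z - a != 0 by rewrite subr_eq0.
have d1 := cderB df (cder_const (f a) z).
have d2 := cderB (cder_id z) (cder_const a z).
have d3 := cderM d1 (cderV d2 za0).
eexists; apply: (cder_near _ _ d3); first by rewrite -cabs_gt0 in za0; exact: za0.
move=> w hw; rewrite (E w); have wa : w - a != 0.
  by rewrite subr_eq0; apply/eqP => wa; move: hw; rewrite wa cabsB ltxx.
by field.
Qed.

Lemma cabs_quot_le f q a z (M d : R) : (forall w, f w = f a + (w - a) * q w) ->
  0 < d -> d <= cabs (z - a) -> cabs (f z - f a) <= M -> cabs (q z) <= M / d.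
Proof.
move=> E d0 dz; rewrite (E z) addrC addKr cabsM => h.
have z0 : 0 < cabs (z - a) by flra.
rewrite ler_pdivlMr //; apply: le_trans h; rewrite mulrC ler_wpM2r ?cabs_ge0 //.
Qed.

(** The difference quotient at [a] is at most [2 * M / s] between the circles of radii [s] and
    [2 * s], where [s] is a quarter of the distance to the boundary, hence also inside by the
    maximum principle. This replaces Cauchy's estimate from the integral formula. *)
Lemma cauchy_lipschitz c (r M : R) f a z : holo c r f ->
  (forall w, cabs (w - c) < r -> cabs (f w) <= M) ->
  cabs (a - c) < r -> cabs (z - c) < r ->
  cabs (f z - f a) <= 8 * M / (r - cabs (a - c)) * cabs (z - a).
Proof.
move=> hf hM ha hz.
have [->|za] := eqVneq z a; first by rewrite !subrr cabs0 mulr0.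
pose s := (r - cabs (a - c)) / 4; have s0 : 0 < s by rewrite /s; flra.
have -> : 8 * M / (r - cabs (a - c)) = 2 * M / s by rewrite /s; field; apply/eqP; flra.
have f2M w : cabs (w - c) < r -> cabs (f w - f a) <= 2 * M.
  move=> hw; apply: le_trans (cabsD _ _) _; rewrite cabsN.
  by have := hM _ hw; have := hM _ ha; flra.
have [l [q [E cq ql]]] := hf _ ha.
have ins w : cabs (w - a) <= 2 * s -> cabs (w - c) < r.
  by move=> hw; have := cabs_distD a w c; rewrite /s in hw *; flra.
rewrite {1}(E z) addrC addKr cabsM mulrC ler_wpM2r ?cabs_ge0 //.
have [zs|zs] := leP s (cabs (z - a)).
  by apply: (cabs_quot_le E) => //; exact: f2M.
apply: (@max_principle _ [:: a] q a s) => //.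
- move=> w hw; have [->//|wa] := eqVneq w a.
  by apply: (ccont_quot E) => //; apply: (holo_cont hf); exact: ins.
- move=> w hw; rewrite inE => wa; have [m dm] := hf w (ins _ hw); exact: (cder_quot E wa dm).
- move=> w /andP[h1 h2]; apply: (cabs_quot_le E) => //; exact/f2M/ins.
- by rewrite inE.
Qed.

Lemma cder_le f a l (L d : R) : 0 < d -> cder f a l ->
  (forall z, cabs (z - a) < d -> cabs (f z - f a) <= L * cabs (z - a)) -> cabs l <= L.
Proof.
move=> d0 [q [E cq <-]] h; apply/ler_addgt0Pr => e e0.
have [d' d'0 hd'] := cq _ e0.
pose t := Num.min d d' / 2; have t0 : 0 < t by rewrite divr_gt0 // lt_min d0.
have : t < Num.min d d' by rewrite /t; move: t0; rewrite /t; flra.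
rewrite lt_min => /andP[td td'].
pose z := a + (t%:C)%C.
have za : cabs (z - a) = t by rewrite /z addrC addKr cabsR gtr0_norm.
have := h z; rewrite za => /(_ td); rewrite (E z) addrC addKr cabsM za mulrC ler_pM2r // => h1.
have := hd' z; rewrite za => /(_ td') h2.
have -> : q a = q z - (q z - q a) by ring.
apply: le_trans (cabsD _ _) _; rewrite cabsN; flra.
Qed.

Lemma cauchy_deriv c (r M : R) f a l : holo c r f ->
  (forall w, cabs (w - c) < r -> cabs (f w) <= M) ->
  cabs (a - c) < r -> cder f a l -> cabs l <= 8 * M / (r - cabs (a - c)).
Proof.
move=> hf hM ha dl; apply: (@cder_le f a l _ (r - cabs (a - c))) => //; first by flra.
move=> z hz; apply: (cauchy_lipschitz hf hM) => //.
by have := cabs_distD a z c; flra.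
Qed.

Lemma ccont_bounded f a : ccont f a ->
  exists2 d : R, 0 < d & forall z, cabs (z - a) < d -> cabs (f z) <= cabs (f a) + 1.
Proof.
move=> /(_ _ ltr01) [d d0 hd]; exists d => // z /hd h.
have -> : f z = f a + (f z - f a) by ring.
by apply: le_trans (cabsD _ _) _; flra.
Qed.

(** A square-root Hölder estimate makes [g] Cauchy at [a]; the limit is read off along the points
    [a + 1 / (n + 1)], real and imaginary parts separately. *)
Lemma cauchy_limit g a (d K : R) : 0 < d ->
  (forall z w, 0 < cabs (w - a) -> cabs (w - a) <= cabs (z - a) -> cabs (z - a) < d ->
     cabs (g z - g w) ^+ 2 <= K * cabs (z - a)) ->
  exists l, ccont (fun z => if z == a then l else g z) a.
Proof.
move=> d0 h.
have K0 : 0 <= K.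
  have := h (a + ((d / 2)%:C)%C) (a + ((d / 2)%:C)%C).
  rewrite addrC addKr cabsR gtr0_norm ?divr_gt0 // => /(_ (ltac:(flra)) (lexx _) (ltac:(flra))).
  by rewrite subrr cabs0 expr0n /= => h1; nra.
have small e : 0 < e -> exists2 t, 0 < t & forall z w, 0 < cabs (w - a) -> 0 < cabs (z - a) ->
    cabs (w - a) < t -> cabs (z - a) < t -> cabs (g z - g w) < e.
  move=> e0; exists (Num.min d (e ^+ 2 / (K + 1))).
    by rewrite lt_min d0 divr_gt0 ?exprn_gt0 //; flra.
  have main z w : 0 < cabs (w - a) -> cabs (w - a) <= cabs (z - a) ->
      cabs (z - a) < Num.min d (e ^+ 2 / (K + 1)) -> cabs (g z - g w) < e.
    rewrite lt_min => w0 wz /andP[zd ze].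
    rewrite -(@ltr_pXn2r _ 2) ?nnegrE ?cabs_ge0 ?(ltW e0) //.
    apply: le_lt_trans (h z w w0 wz zd) _.
    move: ze; rewrite ltr_pdivlMr; last by flra.
    by have := cabs_ge0 (z - a); nra.
  move=> z w w0 z0 wt zt; have [wz|/ltW zw] := leP (cabs (w - a)) (cabs (z - a)).
    exact: main.
  by rewrite cabsB; exact: main.
pose p n : C := a + ((n.+1%:R^-1)%:C)%C.
have pa n : cabs (p n - a) = n.+1%:R^-1 by rewrite /p addrC addKr cabsR gtr0_norm // invr_gt0.
have pgt n : 0 < cabs (p n - a) by rewrite pa invr_gt0.
have psmall t : 0 < t -> exists N, forall n, (N <= n)%N -> cabs (p n - a) < t.
  move=> t0; have [N hN] : exists N : nat, t^-1 < N%:R by exists (Num.bound t^-1); apply: archi_boundP; rewrite invr_ge0 ltW.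
  exists N => n Nn; rewrite pa invf_plt ?posrE //.
  by apply: lt_trans hN _; rewrite ltr_nat ltnS.
have cau (k : C -> R) : (forall z w, `|k z - k w| <= cabs (z - w)) ->
    exists l : R, forall e, 0 < e -> exists N, forall n, (N <= n)%N -> `|l - k (g (p n))| <= e.
  move=> hk.
  have : cvgn (fun n => k (g (p n))).
    apply: cauchy_cvg; apply/cauchy_exP => /= e e0.
    have [t t0 ht] := small e e0; have [N hN] := psmall t t0.
    exists (k (g (p N))); exists N => // n /= Nn.
    by rewrite /ball /=; apply: le_lt_trans (hk _ _) _; apply: ht; rewrite ?pgt ?hN.
  move=> /cvg_ex[l hl]; exists l => e e0.
  move: hl => /cvgrPdist_le /(_ e e0) [N _ hN]; exists N => n Nn; exact: hN.
have [l1 hl1] := cau re (fun z w => ltac:(rewrite -reB; exact: Re_le_cabs)).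
have [l2 hl2] := cau im (fun z w => ltac:(rewrite -imB; exact: Im_le_cabs)).
exists (Complex l1 l2) => e e0; have e4 : 0 < e / 4 by flra.
have [t t0 ht] := small _ e4; exists t => // z zt; rewrite eqxx.
case: eqP => [_|/eqP za]; first by rewrite subrr cabs0.
have z0 : 0 < cabs (z - a) by rewrite cabs_gt0 subr_eq0.
have [N1 h1] := hl1 _ e4; have [N2 h2] := hl2 _ e4; have [N3 h3] := psmall t t0.
pose n := maxn N1 (maxn N2 N3).
have n1 : (N1 <= n)%N by exact: leq_maxl.
have n2 : (N2 <= n)%N by rewrite /n; apply: leq_trans (leq_maxr _ _); exact: leq_maxl.
have n3 : (N3 <= n)%N by rewrite /n; apply: leq_trans (leq_maxr _ _); exact: leq_maxr.
apply: le_lt_trans (cabs_distD (g (p n)) _ _) _.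
have A := ht z (p n) (pgt n) z0 (h3 _ n3) zt.
have B : cabs (g (p n) - Complex l1 l2) <= e / 4 + e / 4.
  apply: le_trans (cabs_le_ReIm _) _; rewrite reB imB; apply: lerD.
    by rewrite distrC; exact: h1.
  by rewrite distrC; exact: h2.
by flra.
Qed.

(** Let [p] be the difference quotient of [g] at a point [b] near [a]. The factor of
    [G w = (w - a) * p w ^+ 2] makes [G] continuous at [a], so the maximum principle with
    exceptional points [a] and [b] bounds it. The square matters: it gives |p z| = O(|z -
    a|^(-1/2)), hence |g z - g b| = O(|z - a|^(1/2)), where the first power would only give
    boundedness. *)
Lemma removable_singularity g a (d K : R) : 0 < d ->
  (forall z, 0 < cabs (z - a) -> cabs (z - a) < d -> exists l, cder g z l) ->
  (forall z, 0 < cabs (z - a) -> cabs (z - a) < d -> cabs (g z) <= K) ->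
  exists l, ccont (fun z => if z == a then l else g z) a.
Proof.
move=> d0 dg gK.
have K0 : 0 <= K.
  apply: le_trans (gK (a + ((d / 2)%:C)%C) _ _); first exact: cabs_ge0.
  - by rewrite addrC addKr cabsR gtr0_norm; flra.
  - by rewrite addrC addKr cabsR gtr0_norm; flra.
pose s := d / 4; have s0 : 0 < s by rewrite /s; flra.
have sd : 2 * s < d by rewrite /s; flra.
pose B := 2 * K / (s / 2).
have B0 : 0 <= B by rewrite divr_ge0 ?mulr_ge0 //; flra.
have KK : 0 <= 4 * (2 * s * B ^+ 2) by rewrite mulr_ge0 // mulr_ge0 ?sqr_ge0 // mulr_ge0 // ltW.
apply: (@cauchy_limit g a (s / 2) (4 * (2 * s * B ^+ 2))); first by flra.
move=> z b b0 bz zs2; have [->|zb] := eqVneq z b.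
  by rewrite subrr cabs0 expr0n /= mulr_ge0 ?cabs_ge0.
have bs2 : cabs (b - a) < s / 2 by flra.
have [m [p [E cp pm]]] := dg b b0 (ltac:(flra)).
have ab : a != b by rewrite -subr_eq0 -cabs_gt0 cabsB.
pose G w := (w - a) * p w ^+ 2.
have Gb w : 0 < cabs (w - a) -> cabs (w - a) < d -> forall e, 0 < e -> e <= cabs (w - b) ->
    cabs (p w) <= 2 * K / e.
  move=> w0 wd e e0 ew; apply: (cabs_quot_le E) => //.
  apply: le_trans (cabsD _ _) _; rewrite cabsN.
  by have := gK _ w0 wd; have := gK b b0 (ltac:(flra)); flra.
have cl w : ccont (fun w => w - a) w by apply: ccontD; [exact: ccont_id|exact: ccont_const].
have cp2 w : ccont p w -> ccont G w.
  move=> cpw; apply: ccontM; first exact: cl.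
  apply: (@ccont_near _ (fun w => p w * p w) _ _ 1) => //.
  exact: ccontM.
have cG w : cabs (w - a) <= 2 * s -> ccont G w.
  move=> ws; have [->|wb] := eqVneq w b; first exact: cp2.
  have [wa|wa] := eqVneq w a; last first.
    have wa0 : 0 < cabs (w - a) by rewrite cabs_gt0 subr_eq0.
    apply: cp2; apply: (ccont_quot E) => //.
    have wd : cabs (w - a) < d by flra.
    have [l dl] := dg w wa0 wd.
    exact: cder_cont dl.
  rewrite wa {wa wb ws w} => e e0.
  pose e1 := cabs (b - a) / 2.
  have e10 : 0 < e1 by rewrite /e1; flra.
  pose Q := (2 * K / e1) ^+ 2 + 1.
  have Q0 : 0 < Q by rewrite /Q ltr_wpDl ?sqr_ge0.
  exists (Num.min e1 (e / Q)); first by rewrite lt_min e10 divr_gt0.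
  move=> w; rewrite lt_min => /andP[w1 w2]; rewrite /G subrr mul0r subr0.
  have [->|wa] := eqVneq w a; first by rewrite subrr mul0r cabs0.
  have wa0 : 0 < cabs (w - a) by rewrite cabs_gt0 subr_eq0.
  rewrite cabsM cabsX; move: w2; rewrite ltr_pdivlMr // => w2; apply: le_lt_trans w2.
  rewrite ler_wpM2l ?cabs_ge0 //.
  have h : cabs (p w) <= 2 * K / e1.
    apply: Gb => //; first by rewrite /e1 in w1; flra.
    by have := cabs_distD w b a; rewrite (cabsB b w) /e1 in w1 *; flra.
  have : cabs (p w) ^+ 2 <= (2 * K / e1) ^+ 2.
    by apply: lerXn2r; rewrite ?nnegrE ?cabs_ge0 // divr_ge0 ?mulr_ge0 // ltW.
  by rewrite /Q; flra.
have za0 : 0 < cabs (z - a) by flra.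
have Gz : cabs (G z) <= 2 * s * B ^+ 2.
  apply: (@max_principle _ [:: a; b] G a s) => //.
  - move=> w ws; rewrite !inE negb_or => /andP[wa wb].
    have wa0 : 0 < cabs (w - a) by rewrite cabs_gt0 subr_eq0.
    have [l dl] := dg w wa0 (ltac:(flra)); have [m' dm'] := cder_quot E wb dl.
    have [m2 dm2] := cderX 2 dm'.
    by eexists; apply: cderM dm2; apply: cderB; [exact: cder_id|exact: cder_const].
  - move=> w /andP[w1 w2]; rewrite /G cabsM cabsX; apply: ler_pM; rewrite ?cabs_ge0 ?exprn_ge0 ?cabs_ge0 //.
    apply: lerXn2r; rewrite ?nnegrE ?cabs_ge0 //; apply: Gb; [flra|flra|flra|].
    by have := cabs_distD b w a; flra.
  - by flra.
  - by rewrite !inE negb_or zb andbT -subr_eq0 -cabs_gt0.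
rewrite {1}(E z) addrC addKr cabsM exprMn.
have zb2 : cabs (z - b) <= 2 * cabs (z - a).
  by have := cabs_distD a z b; rewrite (cabsB a b); flra.
have zb4 : cabs (z - b) ^+ 2 <= 4 * cabs (z - a) ^+ 2.
  have -> : 4 * cabs (z - a) ^+ 2 = (2 * cabs (z - a)) ^+ 2 by ring.
  by apply: lerXn2r; rewrite ?nnegrE ?mulr_ge0 ?cabs_ge0.
move: Gz; rewrite /G cabsM cabsX => Gz.
apply: (@le_trans _ _ (4 * cabs (z - a) ^+ 2 * cabs (p z) ^+ 2)).
  by rewrite ler_wpM2r // exprn_ge0 ?cabs_ge0.
have -> : 4 * cabs (z - a) ^+ 2 * cabs (p z) ^+ 2 =
   4 * (cabs (z - a) * cabs (p z) ^+ 2) * cabs (z - a) by ring.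
by rewrite ler_wpM2r ?cabs_ge0 // ler_wpM2l.
Qed.

(** Division by [z - a] within holomorphic functions, on which power series, zeros and Jensen's
    bound are built. Away from [a] the quotient [q] is differentiable. Near [a] it is Lipschitz by
    the maximum principle, so its own difference quotient at [a] is bounded and has a removable
    singularity, whose value is the derivative of [q] at [a]. *)
Lemma holo_quot c (r : R) f a : holo c r f -> cabs (a - c) < r ->
  exists q, [/\ holo c r q, forall w, f w = f a + (w - a) * q w & cder f a (q a)].
Proof.
move=> hf ha; have [l dfa] := hf _ ha.
have [q [E cq ql]] := dfa; exists q; split=> //; last by rewrite ql.
have dq z : cabs (z - c) < r -> z != a -> exists m, cder q z m.
  by move=> hz za; have [m dm] := hf _ hz; exact: cder_quot E za dm.
move=> z hz; have [->|za] := eqVneq z a; last exact: dq.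
have [d1 d10 hd1] := ccont_bounded cq.
set L := cabs (q a) + 1 in hd1.
pose d := Num.min d1 (r - cabs (a - c)) / 2.
have mpos : 0 < Num.min d1 (r - cabs (a - c)) by rewrite lt_min d10 subr_gt0.
have d0 : 0 < d by rewrite divr_gt0.
have : d < Num.min d1 (r - cabs (a - c)) by rewrite /d; flra.
rewrite lt_min => /andP[dd1 dr].
have ins w : cabs (w - a) < d -> cabs (w - c) < r.
  by move=> hw; have := cabs_distD a w c; flra.
pose s := d / 4; have s0 : 0 < s by rewrite /s; flra.
have sd : 2 * s < d by rewrite /s; flra.
have L0 : 0 <= L by rewrite /L; have := cabs_ge0 (q a); flra.
have qc w : cabs (w - a) <= 2 * s -> ccont q w.
  move=> hw; have [->//|wa] := eqVneq w a.
  by have [|m dm] := dq w _ wa; [apply: ins; flra|exact: cder_cont dm].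
(* The slope [p] of [q] at [b] has two exceptional points: [b], where it is only continuous, and
   [a], where [q] is only continuous. *)
have lipb b w : b != a -> cabs (b - a) < s / 2 -> w != a -> cabs (w - a) < s ->
    cabs (q w - q b) <= 2 * L / (s / 2) * cabs (w - b).
  move=> ba bs wa ws; have [->|wb] := eqVneq w b; first by rewrite !subrr cabs0 mulr0.
  have [|m [p [Ep cp pm]]] := dq b _ ba; first by apply: ins; flra.
  rewrite {1}(Ep w) addrC addKr cabsM mulrC ler_wpM2r ?cabs_ge0 //.
  apply: (@max_principle _ [:: a; b] p a s) => //; last by rewrite !inE negb_or wa.
  - move=> v hv; have [->//|vb] := eqVneq v b.
    by apply: (ccont_quot Ep) => //; exact: qc.
  - move=> v hv; rewrite !inE negb_or => /andP[va vb].
    by have [|m' dm'] := dq v _ va; [apply: ins; flra|exact: cder_quot Ep vb dm'].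
  - move=> v /andP[v1 v2]; apply: (cabs_quot_le Ep); first flra.
      by have := cabs_distD b v a; flra.
    apply: le_trans (cabsD _ _) _; rewrite cabsN.
    have := hd1 v (ltac:(flra)); have := hd1 b (ltac:(flra)); flra.
pose K := 2 * L / (s / 2).
have K0 : 0 <= K by rewrite divr_ge0 ?mulr_ge0 //; flra.
have lipa b : b != a -> cabs (b - a) < s / 2 -> cabs (q b - q a) <= K * cabs (b - a).
  move=> ba bs; apply/ler_addgt0Pr => e e0; have e2 : 0 < e / (2 * (K + 1)).
    by rewrite divr_gt0 // mulr_gt0 //; flra.
  have e3 : 0 < e / 2 by flra.
  have [t t0 ht] := cq _ e3.
  pose u := Num.min (Num.min t s) (e / (2 * (K + 1))) / 2.
  have u0' : 0 < Num.min (Num.min t s) (e / (2 * (K + 1))) by rewrite !lt_min t0 s0.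
  have u0 : 0 < u by rewrite divr_gt0.
  have : u < Num.min (Num.min t s) (e / (2 * (K + 1))) by rewrite /u; flra.
  rewrite !lt_min => /andP[/andP[ut us] ue].
  pose w := a + (u%:C)%C.
  have wu : cabs (w - a) = u by rewrite /w addrC addKr cabsR gtr0_norm.
  have wa : w != a by rewrite -subr_eq0 -cabs_gt0 wu.
  have h1 := lipb b w ba bs wa (ltac:(rewrite wu; flra)).
  have h2 := ht w (ltac:(rewrite wu; flra)).
  have h3 : cabs (w - b) <= u + cabs (b - a) by rewrite -wu (cabsB b); exact: cabs_distD.
  have h4 := cabs_distD (q w) (q b) (q a); rewrite (cabsB (q b) (q w)) in h4.
  have h5 : K * cabs (w - b) <= K * u + K * cabs (b - a) by rewrite -mulrDr ler_wpM2l.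
  move: ue; rewrite ltr_pdivlMr; last by rewrite mulr_gt0 //; flra.
  rewrite -/K in h1; move=> ue; nra.
pose r' z := (q z - q a) / (z - a).
have [m hm] : exists m, ccont (fun z => if z == a then m else r' z) a.
  apply: (@removable_singularity r' a (s / 2) K); first by flra.
  - move=> w w0 ws; have wa : w != a by rewrite -subr_eq0 -cabs_gt0.
    have [|m dm] := dq w _ wa; first by apply: ins; flra.
    eexists; apply: cderM; first by apply: cderB; [exact: dm|exact: cder_const].
    apply: cderV; first by apply: cderB; [exact: cder_id|exact: cder_const].
    by rewrite subr_eq0.
  - move=> w w0 ws; have wa : w != a by rewrite -subr_eq0 -cabs_gt0.
    by rewrite /r' cabs_div ler_pdivrMr // lipa.
exists m; exists (fun z => if z == a then m else r' z); split=> //; last by rewrite eqxx.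
move=> w; case: eqP => [->|/eqP wa]; first by rewrite subrr mul0r addr0.
by rewrite /r'; field; rewrite subr_eq0.
Qed.
End Removable.

Section LocalTheory.
Variable R : realType.
Local Notation C := R[i].
Implicit Types (f g q : C -> C) (z w c a b : C).

Definition deriv f z : C := xget 0 [set l | cder f z l].

Lemma derivE f z l : cder f z l -> deriv f z = l.
Proof.
move=> h; rewrite /deriv; case: xgetP => [m _ hm|/(_ l)//].
exact: cder_unique hm h.
Qed.

Lemma derivP f z l : cder f z l -> cder f z (deriv f z).
Proof. by move=> h; rewrite (derivE h). Qed.

Lemma holo_derivP c (r : R) f z : holo c r f -> cabs (z - c) < r -> cder f z (deriv f z).
Proof. by move=> hf hz; have [l hl] := hf _ hz; exact: derivP hl. Qed.

Lemma holo_bounded c (r : R) f : holo c r f -> 0 < r ->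
  exists d M : R, [/\ 0 < d, d <= r & forall z, cabs (z - c) < d -> cabs (f z) <= M].
Proof.
move=> hf r0; have [|d d0 hd] := @ccont_bounded _ f c.
  by apply: (holo_cont hf); rewrite subrr cabs0.
exists (Num.min d r), (cabs (f c) + 1); split; first by rewrite lt_min d0.
- by rewrite ge_min lexx orbT.
- by move=> z; rewrite lt_min => /andP[/hd].
Qed.

(** Dividing twice at [a], f = f a + (w - a) q and q = q a + (w - a) q2, so the slope of f' at [a]
    is 2 q2 + (w - a) q2'. It is continuous at [a] because Cauchy's estimate bounds q2'. *)
Lemma holo_deriv c (r : R) f : holo c r f -> holo c r (deriv f).
Proof.
move=> hf a ha.
have [q [hq E dfa]] := holo_quot hf ha.
have [q2 [hq2 E2 dqa]] := holo_quot hq ha.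
have hq2a : holo a (r - cabs (a - c)) q2 by apply: (holo_sub hq2); flra.
have [d [M [d0 dr hM]]] := holo_bounded hq2a (ltac:(flra) : 0 < r - cabs (a - c)).
have cq2 : ccont q2 a by exact: holo_cont hq2 ha.
pose p w := if w == a then q2 a + deriv q a else (deriv f w - deriv f a) / (w - a).
have pE w : w != a -> cabs (w - a) < d -> p w = q2 w + (q2 w + (w - a) * deriv q2 w).
  move=> wa wd; have wc : cabs (w - c) < r by have := cabs_distD a w c; flra.
  have dq2 := holo_derivP hq2 wc.
  have dq : cder q w (q2 w + (w - a) * deriv q2 w).
    have := cderD (cder_const (q a) w) (cderM (cderB (cder_id w) (cder_const a w)) dq2).
    rewrite add0r subr0 mul1r; by apply: (@cder_near _ _ _ _ _ 1).
  have df : cder f w (q w + (w - a) * deriv q w).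
    have := cderD (cder_const (f a) w) (cderM (cderB (cder_id w) (cder_const a w)) (derivP dq)).
    rewrite add0r subr0 mul1r; by apply: (@cder_near _ _ _ _ _ 1).
  rewrite /p (negbTE wa) (derivE df) (derivE dfa) (derivE dq) (E2 w).
  have wa0 : w - a != 0 by rewrite subr_eq0.
  by field.
exists (q2 a + deriv q a); exists p; split.
- move=> w; rewrite /p; case: eqP => [->|/eqP wa]; first by rewrite subrr mul0r addr0.
  by field; rewrite subr_eq0.
- rewrite (derivE dqa) in p pE *.
  move=> e e0; have e4 : 0 < e / 4 by flra.
  have [t t0 ht] := cq2 _ e4.
  pose K := 8 * (`|M| + 1) / (d / 2) ; have K0 : 0 < K by rewrite divr_gt0 ?mulr_gt0 //; have := normr_ge0 M; flra.
  exists (Num.min (d / 2) (Num.min t (e / 4 / K))).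
    by rewrite !lt_min t0 !divr_gt0.
  move=> w; rewrite !lt_min => /and3P[wd wt we].
  have pa : p a = q2 a + q2 a by rewrite /p eqxx.
  rewrite pa; have [->|wa] := eqVneq w a; first by rewrite pa subrr cabs0.
  rewrite pE //; last by flra.
  have -> : q2 w + (q2 w + (w - a) * deriv q2 w) - (q2 a + q2 a) =
     (q2 w - q2 a) + ((q2 w - q2 a) + (w - a) * deriv q2 w) by ring.
  have wc : cabs (w - c) < r by have := cabs_distD a w c; flra.
  have D : cabs (deriv q2 w) <= K.
    have hq2d : holo a d q2 by apply: (holo_sub hq2a); rewrite subrr cabs0 add0r.
    apply: le_trans (cauchy_deriv hq2d hM (ltac:(flra) : cabs (w - a) < d) (holo_derivP hq2 wc)) _.
    apply: ler_pM.
    - have : 0 <= M by apply: le_trans (hM w _); [exact: cabs_ge0|flra].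
      by flra.
    - by rewrite invr_ge0; flra.
    - have := ler_norm M; flra.
    - by rewrite lef_pV2 ?posrE; flra.
  have wK : cabs (w - a) * K < e / 4 by rewrite -ltr_pdivlMr.
  have h1 := ht w wt.
  apply: le_lt_trans (cabsD _ _) _.
  have h2 := cabsD (q2 w - q2 a) ((w - a) * deriv q2 w).
  have h3 : cabs ((w - a) * deriv q2 w) <= cabs (w - a) * K.
    by rewrite cabsM ler_wpM2l ?cabs_ge0.
  by flra.
- by rewrite /p eqxx.
Qed.

(** If division by [z - a] never stops, the maximum principle for the n-th quotient gives |f z| <= M
    (|z - a| / s)^n for all n, hence f = 0 near [a]. *)
Lemma zero_dichotomy a (r : R) f : 0 < r -> holo a r f ->
  (exists2 d, 0 < d & forall z, cabs (z - a) < d -> f z = 0) \/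
  (exists k g, [/\ holo a r g, g a != 0 & forall z, f z = (z - a) ^+ k * g z]).
Proof.
move=> r0 hf.
have [[k [g [hg ga E]]]|none] := pselect (exists k g, [/\ holo a r g, g a != 0 & forall z, f z = (z - a) ^+ k * g z]).
  by right; exists k, g.
left.
have aa : cabs (a - a) < r by rewrite subrr cabs0.
have all k : exists g, holo a r g /\ forall z, f z = (z - a) ^+ k * g z.
  elim: k => [|k [g [hg E]]].
    by exists f; split=> // z; rewrite expr0 mul1r.
  have g0 : g a = 0 by apply: contrapT => ga; apply: none; exists k, g; split=> //; apply/eqP.
  have [q [hq Eq _]] := holo_quot hg aa.
  exists q; split=> // z; rewrite (E z) (Eq z) g0 exprS; ring.
have [d [M [d0 dr hM]]] := holo_bounded hf r0.
pose s := d / 4; have s0 : 0 < s by rewrite /s; flra.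
exists s => // z zs.
have [->|za] := eqVneq z a.
  by have [g [_ ->]] := all 1%N; rewrite subrr expr1 mul0r.
have M0 : 0 <= M by apply: le_trans (hM z _); [exact: cabs_ge0|rewrite /s in zs; flra].
have bound n : cabs (f z) <= M * (cabs (z - a) / s) ^+ n.
  have [g [hg E]] := all n.
  rewrite (E z) cabsM cabsX expr_div_n mulrCA ler_wpM2l ?exprn_ge0 ?cabs_ge0 //.
  apply: (@holo_max _ a r s) => //; [by rewrite /s; flra| |flra].
  move=> w /andP[w1 w2]; rewrite ler_pdivlMr ?exprn_gt0 //.
  have := hM w (ltac:(rewrite /s in w2; flra)); rewrite (E w) cabsM cabsX mulrC.
  apply: le_trans; rewrite ler_wpM2l ?cabs_ge0 //.
  by apply: lerXn2r; rewrite ?nnegrE ?cabs_ge0 ?(ltW s0).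
apply: cabs0P; rewrite leNgt; apply/negP => fz.
have M1 : 0 < M by apply: lt_le_trans fz _; have := bound 0%N; rewrite expr0 mulr1.
have [n hn] : exists n, (cabs (z - a) / s) ^+ n < cabs (f z) / M.
  apply: seq_exp_lt; last exact: divr_gt0.
  by rewrite divr_ge0 ?cabs_ge0 ?(ltW s0) //= ltr_pdivrMr // mul1r.
by have := bound n; move: hn; rewrite ltr_pdivlMr // mulrC; flra.
Qed.

(** The form in which isolated zeros are used: a lower bound on every small annulus, ready for
    [min_modulus]. *)
Lemma zero_annulus a (r : R) f : 0 < r -> holo a r f ->
  (exists2 d, 0 < d & forall z, cabs (z - a) < d -> f z = 0) \/
  (exists2 d, 0 < d & forall s, 0 < s -> 2 * s < d ->
     exists2 m, 0 < m & forall z, s <= cabs (z - a) <= 2 * s -> m <= cabs (f z)).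
Proof.
move=> r0 /(zero_dichotomy r0)[?|[k [g [hg ga E]]]]; [by left|right].
have g0 : 0 < cabs (g a) / 2 by rewrite divr_gt0 // cabs_gt0.
have cg : ccont g a by apply: (holo_cont hg); rewrite subrr cabs0.
have [d d0 hd] := cg _ g0; exists d => // s s0 sd.
exists (s ^+ k * (cabs (g a) / 2)); first by rewrite mulr_gt0 // exprn_gt0.
move=> z /andP[z1 z2]; rewrite (E z) cabsM cabsX; apply: ler_pM.
- by rewrite exprn_ge0 // ltW.
- exact: ltW.
- by apply: lerXn2r; rewrite ?nnegrE ?cabs_ge0 ?(ltW s0).
- have := hd z (ltac:(flra)); have := cabs_lerB (g a) (g z); rewrite (cabsB (g a)); flra.
Qed.

Lemma cpath_dist a b (s t : R) :
  cabs (a + (s%:C)%C * (b - a) - (a + (t%:C)%C * (b - a))) = `|s - t| * cabs (b - a).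
Proof.
have -> : a + (s%:C)%C * (b - a) - (a + (t%:C)%C * (b - a)) = ((s - t)%:C)%C * (b - a).
  by rewrite rmorphB; ring.
by rewrite cabsM cabsR.
Qed.

Lemma disc_convex c (r s : R) a b : cabs (a - c) < r -> cabs (b - c) < r -> 0 <= s <= 1 ->
  cabs (a + (s%:C)%C * (b - a) - c) < r.
Proof.
move=> ha hb /andP[s0 s1].
have -> : a + (s%:C)%C * (b - a) - c = ((1 - s)%:C)%C * (a - c) + (s%:C)%C * (b - c).
  by rewrite rmorphB rmorph1; ring.
apply: le_lt_trans (cabsD _ _) _; rewrite !cabsM !cabsR !ger0_norm ?subr_ge0 //.
have [s00|s00] := eqVneq s 0; first by rewrite s00 subr0 mul1r mul0r addr0.
have s0' : 0 < s by rewrite lt0r s00.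
have : s * cabs (b - c) < s * r by rewrite ltr_pM2l.
have : (1 - s) * cabs (a - c) <= (1 - s) * r by rewrite ler_wpM2l ?subr_ge0 // ltW.
by flra.
Qed.

Lemma disc_connected c (r : R) (P : C -> Prop) :
  (forall z, cabs (z - c) < r -> exists2 d, 0 < d &
     forall w, cabs (w - c) < r -> cabs (w - z) < d -> (P z <-> P w)) ->
  forall z w, cabs (z - c) < r -> cabs (w - c) < r -> P z -> P w.
Proof.
move=> h z w hz hw Pz.
have := @interval_connected R (fun s => P (z + (s%:C)%C * (w - z))) _ _ 1.
rewrite mul1r subrKC; apply.
- move=> s hs; have [d d0 hd] := h _ (disc_convex hz hw hs).
  have K0 : 0 < cabs (w - z) + 1 by have := cabs_ge0 (w - z); flra.
  exists (d / (cabs (w - z) + 1)); first exact: divr_gt0.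
  move=> s' hs' ss'; apply: hd; first exact: disc_convex.
  rewrite cpath_dist; apply: (@le_lt_trans _ _ (`|s' - s| * (cabs (w - z) + 1))).
    by rewrite ler_wpM2l //; flra.
  by rewrite -ltr_pdivlMr.
- by rewrite mul0r addr0.
- by rewrite ler01 lexx.
Qed.

(** Vanishing near a point is a locally constant property: where it fails, [zero_annulus] keeps [f]
    away from 0 in a punctured neighbourhood. *)
Lemma identity_theorem c (r : R) f a (d : R) : holo c r f -> cabs (a - c) < r -> 0 < d ->
  (forall z, cabs (z - c) < r -> cabs (z - a) < d -> f z = 0) ->
  forall z, cabs (z - c) < r -> f z = 0.
Proof.
move=> hf ha d0 fa z hz.
pose P z := exists2 d, 0 < d & forall w, cabs (w - c) < r -> cabs (w - z) < d -> f w = 0.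
suff [e e0 he] : P z by apply: he => //; rewrite subrr cabs0.
apply: (@disc_connected c r P _ a z ha hz); last by exists d.
move=> {hz}{}z hz.
have rz : 0 < r - cabs (z - c) by flra.
have hfz : holo z (r - cabs (z - c)) f by apply: (holo_sub hf); flra.
have [[e e0 he]|[e e0 he]] := zero_annulus rz hfz.
  exists e => // w hw we; split=> _.
    exists (e - cabs (w - z)); first by flra.
    by move=> v _ hv; apply: he; have := cabs_distD w v z; flra.
  by exists e => // v _; exact: he.
exists (Num.min e (r - cabs (z - c)) / 4); first by rewrite divr_gt0 // lt_min e0.
move=> w hw we; have we' : cabs (w - z) < e / 4 by rewrite (lt_le_trans we) // ler_wpM2r // ge_min lexx.
split=> [[t t0 ht]|[t t0 ht]].
  exists (t - cabs (w - z)) => //.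
    rewrite subr_gt0 ltNge; apply/negP => tw.
    have [m m0 hm] := he (t / 2) (ltac:(flra)) (ltac:(flra)).
    pose v := z + ((t * 3 / 4)%:C)%C.
    have vz : cabs (v - z) = t * 3 / 4 by rewrite /v addrC addKr cabsR gtr0_norm; flra.
    have vc : cabs (v - c) < r.
      have := cabs_distD z v c; rewrite vz.
      have : Num.min e (r - cabs (z - c)) <= r - cabs (z - c) by rewrite ge_min lexx orbT.
      by flra.
    have := hm v (ltac:(rewrite vz; flra)).
    by rewrite ht ?cabs0 // ?vz; flra.
  by move=> v vc hv; apply: ht => //; have := cabs_distD w v z; flra.
exfalso.
pose u := Num.min t (Num.min e (r - cabs (w - c))) / 4.
have m0' : 0 < Num.min t (Num.min e (r - cabs (w - c))) by rewrite !lt_min t0 e0 subr_gt0.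
have u0 : 0 < u by rewrite /u; flra.
have : u < Num.min t (Num.min e (r - cabs (w - c))) by rewrite /u; flra.
rewrite !lt_min => /and3P[ut ue ur].
have [v vu vz] : exists2 v, cabs (v - w) <= u & 0 < cabs (v - z).
  have [wz|wz] := eqVneq w z.
    by exists (w + (u%:C)%C); rewrite ?wz addrC addKr cabsR gtr0_norm.
  by exists w; rewrite ?subrr ?cabs0 ?(ltW u0) // cabs_gt0 subr_eq0.
have vz' : cabs (v - z) < e / 2.
  have := cabs_distD w v z.
  have : u <= e / 4 by rewrite /u ler_wpM2r // !ge_min lexx orbT.
  by flra.
have [m mm0 hm] := he (cabs (v - z)) vz (ltac:(flra)).
have := hm v (ltac:(rewrite lexx; flra)).
rewrite ht ?cabs0; [flra| |flra].
by have := cabs_distD w v c; flra.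
Qed.

Lemma min_modulus c (r s m : R) f : holo c r f -> 0 < s -> 2 * s < r -> 0 < m ->
  (forall z, cabs (z - c) < r -> f z != 0) ->
  (forall z, s <= cabs (z - c) <= 2 * s -> m <= cabs (f z)) ->
  forall z, cabs (z - c) <= 2 * s -> m <= cabs (f z).
Proof.
move=> hf s0 sr m0 nz hm z hz.
have fz : 0 < cabs (f z) by rewrite cabs_gt0 nz //; flra.
rewrite -lef_pV2 ?posrE // -cabsV.
apply: (holo_max (holoV hf nz) s0 sr) => // w hw.
rewrite cabsV lef_pV2 ?posrE ?hm // cabs_gt0 nz //; flra.
Qed.

(** On a small annulus f - f a is at least [m] in modulus. If a value [y] closer than [m / 2] to f a
    were omitted, f - y would be zero-free and at least [m / 2] on the annulus, hence at [a]. *)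
Lemma open_mapping a (r e : R) f : holo a r f -> 0 < e -> e <= r ->
  (forall d, 0 < d -> exists2 z, cabs (z - a) < d & f z != f a) ->
  exists2 d, 0 < d & forall y, cabs (y - f a) < d -> exists2 z, cabs (z - a) < e & f z = y.
Proof.
move=> hf e0 er nc; have r0 : 0 < r by flra.
have hf' : holo a r (fun z => f z - f a) by apply: holoB => //; exact: holo_const.
have [[d d0 hd]|[d d0 hd]] := zero_annulus r0 hf'.
  have [z zd /eqP []] := nc d d0.
  by apply/eqP; rewrite -subr_eq0; apply/eqP; exact: hd.
pose s := Num.min d e / 4.
have md : 0 < Num.min d e by rewrite lt_min d0.
have s0 : 0 < s by rewrite /s; flra.
have : 2 * s < Num.min d e by rewrite /s; flra.
rewrite lt_min => /andP[sd se].
have [m m0 hm] := hd s s0 sd.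
exists (m / 2); first by flra.
move=> y hy; apply: contrapT => none.
have nz z : cabs (z - a) < e -> f z - y != 0.
  by move=> ze; apply/negP; rewrite subr_eq0 => /eqP fz; apply: none; exists z.
have hfy : holo a e (fun z => f z - y).
  by apply: holoB; [apply: (holo_sub hf); rewrite subrr cabs0 add0r|exact: holo_const].
have := @min_modulus a e s (m / 2) _ hfy s0 se (ltac:(flra)) nz _ a.
rewrite subrr cabs0 (cabsB (f a)) => /(_ _ (ltac:(flra))) h.
suff : m / 2 <= cabs (y - f a) by flra.
apply: h => z hz; have := hm z hz.
have := cabs_distD y (f z) (f a); flra.
Qed.

(** Otherwise f = f c + (z - c)^k g with g c nonzero, and |f| exceeds |f c| in the direction of a
    k-th root [v] of f c / g c. *)
Lemma max_modulus_const c (r : R) f : 0 < r -> holo c r f ->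
  (forall z, cabs (z - c) < r -> cabs (f z) <= cabs (f c)) ->
  exists2 d, 0 < d & forall z, cabs (z - c) < d -> f z = f c.
Proof.
move=> r0 hf hM.
have [fc0|fc0] := eqVneq (f c) 0.
  by exists r => // z /hM; rewrite fc0 cabs0 => /cabs0P.
have hf' : holo c r (fun z => f z - f c) by apply: holoB => //; exact: holo_const.
have [[d d0 hd]|[k [g [hg gc E]]]] := zero_dichotomy r0 hf'.
  by exists d => // z /hd /eqP; rewrite subr_eq0 => /eqP.
exfalso.
have k0 : (0 < k)%N.
  rewrite lt0n; apply/negP => /eqP k0; move: (E c); rewrite k0 subrr expr0 mul1r => /esym gc0.
  by rewrite gc0 eqxx in gc.
pose v := (k.-root (f c / g c))%R.
have vk : v ^+ k = f c / g c by rewrite /v rootCK.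
have cg : ccont g c by apply: (holo_cont hg); rewrite subrr cabs0.
pose V := cabs v ^+ k + 1.
have V0 : 0 < V by rewrite /V ltr_wpDl // exprn_ge0 // cabs_ge0.
have fc : 0 < cabs (f c) by rewrite cabs_gt0.
have [d d0 hd] := cg _ (divr_gt0 fc V0).
pose t := Num.min d r / (2 * (cabs v + 1)).
have v1 : 0 < cabs v + 1 by have := cabs_ge0 v; flra.
have mdr : 0 < Num.min d r by rewrite lt_min d0.
have t0 : 0 < t by rewrite divr_gt0 // mulr_gt0.
pose z := c + (t%:C)%C * v.
have zc : cabs (z - c) < Num.min d r.
  rewrite /z addrC addKr cabsM cabsR gtr0_norm //.
  apply: (@le_lt_trans _ _ (t * (cabs v + 1))); first by rewrite ler_wpM2l ?(ltW t0) //; flra.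
  rewrite /t invfM mulrA -mulrA mulVf ?gt_eqF // mulr1; flra.
move: zc; rewrite lt_min => /andP[zd zr].
have h1 := hd z zd; have h2 := hM z zr.
have fz : f z = f c * (1 + (t%:C)%C ^+ k) + (t%:C)%C ^+ k * v ^+ k * (g z - g c).
  have -> : f z = f c + (z - c) ^+ k * g z by rewrite -(E z); ring.
  rewrite /z [c + _]addrC addrK exprMn vk -/z; field; exact: gc.
have tk : 0 < t ^+ k by rewrite exprn_gt0.
have h3 : cabs (f c * (1 + (t%:C)%C ^+ k)) = cabs (f c) * (1 + t ^+ k).
  rewrite cabsM; congr (_ * _).
  have -> : 1 + (t%:C)%C ^+ k = ((1 + t ^+ k)%:C)%C :> C by rewrite rmorphD rmorph1 rmorphXn.
  by rewrite cabsR gtr0_norm //; flra.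
have h4 : cabs ((t%:C)%C ^+ k * v ^+ k * (g z - g c)) < t ^+ k * cabs (f c).
  rewrite !cabsM !cabsX cabsR gtr0_norm // -mulrA ltr_pM2l //.
  apply: (@le_lt_trans _ _ (V * cabs (g z - g c))).
    by rewrite ler_wpM2r ?cabs_ge0 // /V; flra.
  by rewrite mulrC -ltr_pdivlMr.
have h5 := cabsD (f z) (- ((t%:C)%C ^+ k * v ^+ k * (g z - g c))).
rewrite cabsN {1}fz addrK h3 in h5; flra.
Qed.
End LocalTheory.

(** * Second-order estimates and primitives *)

Section SecondOrder.
Variable R : realType.
Local Notation C := R[i].
Implicit Types (f g q u : C -> C) (z w c a b : C).
Local Notation re := (@complex.Re R).

Lemma cder_quadratic f z l (d K : R) : 0 < d ->
  (forall w, cabs (w - z) < d -> cabs (f w - f z - (w - z) * l) <= K * cabs (w - z) ^+ 2) ->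
  cder f z l.
Proof.
move=> d0 h; apply/cder_distlim => e e0.
pose K' := `|K| + 1; have K'0 : 0 < K' by have := normr_ge0 K; rewrite /K'; flra.
exists (Num.min d (e / K')); split; first by rewrite lt_min d0 divr_gt0.
move=> k k0; rewrite lt_min => /andP[kd ke].
have kn : k != 0 by rewrite -cabs_gt0.
have -> : (f (z + k) - f z) / k - l = (f (z + k) - f z - k * l) / k by field.
have E : z + k - z = k by ring.
have := h (z + k); rewrite E => /(_ kd) H.
rewrite cabs_div ltr_pdivrMr //; apply: le_lt_trans H _.
rewrite expr2 mulrA ltr_pM2r //.
move: ke; rewrite ltr_pdivlMr // => ke; have := ler_norm K; rewrite /K' in ke; nra.
Qed.

Lemma disc_bounded c (r rho : R) f : (forall z, cabs (z - c) < r -> ccont f z) -> rho < r ->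
  exists M, forall z, cabs (z - c) <= rho -> cabs (f z) <= M.
Proof.
move=> cf rr.
pose P (a b a' b' : R) := exists M, forall z, inrect a b a' b' z -> cabs (z - c) <= rho -> cabs (f z) <= M.
have [rho0|rho0] := ltP rho 0.
  by exists 0 => z h; have := cabs_ge0 (z - c); flra.
have [M hM] : P (re c - rho) (re c + rho) (complex.Im c - rho) (complex.Im c + rho).
  apply: cousin_rectangle; [flra|flra| |].
    move=> a b a' b' ab ab' [M1 h1] [M2 h2] [M3 h3] [M4 h4].
    exists (Num.max (Num.max M1 M2) (Num.max M3 M4)) => z [/andP[z1 z2] /andP[z3 z4]] zc.
    rewrite !le_max.
    have [xl|/ltW xl] := leP (re z) ((a + b) / 2); have [yl|/ltW yl] := leP (complex.Im z) ((a' + b') / 2).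
    - by rewrite h1 //; split; apply/andP.
    - by rewrite h3 ?orbT //; split; apply/andP.
    - by rewrite h2 ?orbT //; split; apply/andP.
    - by rewrite h4 ?orbT //; split; apply/andP.
  move=> x y _ _; set p := Complex x y.
  have [pr|pr] := ltP (cabs (p - c)) r.
    have [d d0 hd] := ccont_bounded (cf _ pr); exists (d / 2); first flra.
    move=> a b a' b' _ ax xb _ _ ay yb _ wd hd'; exists (cabs (f p) + 1) => z [/andP[z1 z2] /andP[z3 z4]] _.
    apply: hd; apply: le_lt_trans (cabs_le_ReIm _) _; rewrite reB imB /=.
    have : `|re z - x| <= b - a by rewrite ler_norml; flra.
    have : `|complex.Im z - y| <= b' - a' by rewrite ler_norml; flra.
    by flra.
  (* A rectangle this small around a point at distance at least [r] from [c] misses the disc of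
     radius [rho], so any bound holds there. *)
  exists ((r - rho) / 2); first flra.
  move=> a b a' b' _ ax xb _ _ ay yb _ wd hd'; exists 0 => z [/andP[z1 z2] /andP[z3 z4]] zc.
  have : cabs (p - z) < r - rho.
    apply: le_lt_trans (cabs_le_ReIm _) _; rewrite reB imB /=.
    have : `|x - re z| <= b - a by rewrite ler_norml; flra.
    have : `|y - complex.Im z| <= b' - a' by rewrite ler_norml; flra.
    by flra.
  by have := cabs_distD z p c; flra.
exists M => z zc; apply: hM => //.
have := Re_le_cabs (z - c); have := Im_le_cabs (z - c); rewrite reB imB !ler_norml.
by move=> /andP[h1 h2] /andP[h3 h4]; split; apply/andP; split; flra.
Qed.

(** Cauchy's estimate for [f], then for its difference quotient at [a]. The constant is uniform in
    [a], as is needed to differentiate the radial primitive and to expand a plaque near a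
    tangency. *)
Lemma holo_second_order c (r rho : R) f : holo c r f -> 0 < rho -> rho < r ->
  exists2 K, 0 <= K & forall a w, cabs (a - c) < rho -> cabs (w - c) < rho ->
    cabs (f w - f a) <= K * cabs (w - a) /\
    cabs (f w - f a - (w - a) * deriv f a) <= K * cabs (w - a) ^+ 2.
Proof.
move=> hf rho0 rr.
pose r1 := (rho * 2 + r) / 3; pose r2 := (rho + r * 2) / 3.
have [M hM] := disc_bounded (fun z => @holo_cont _ _ _ f z hf) (ltac:(rewrite /r2; flra) : r2 < r).
have M0 : 0 <= M.
  by apply: le_trans (hM c _); [exact: cabs_ge0|rewrite subrr cabs0 /r2; flra].
have hf2 : holo c r2 f by apply: (holo_sub hf); rewrite subrr cabs0 /r2; flra.
pose t := (r - rho) / 3; have t0 : 0 < t by rewrite /t; flra.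
pose L := 8 * M / t; have L0 : 0 <= L by apply: divr_ge0 (ltW t0); exact: mulr_ge0.
pose K := L + 8 * L / t; have K0 : 0 <= 8 * L / t by apply: divr_ge0 (ltW t0); exact: mulr_ge0.
have lip a w : cabs (a - c) < r1 -> cabs (w - c) < r1 -> cabs (f w - f a) <= L * cabs (w - a).
  move=> ha hw; apply: le_trans (cauchy_lipschitz hf2 (fun z hz => hM z (ltW hz)) _ _) _.
  - by rewrite /r1 /r2 in ha *; flra.
  - by rewrite /r1 /r2 in hw *; flra.
  - rewrite ler_wpM2r ?cabs_ge0 // /L ler_wpM2l ?mulr_ge0 //.
    by rewrite lef_pV2 ?posrE // /t; move: ha; rewrite /r1 /r2; flra.
exists K; first by rewrite /K; flra.
move=> a w ha hw; have ha1 : cabs (a - c) < r1 by rewrite /r1; flra.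
have hw1 : cabs (w - c) < r1 by rewrite /r1; flra.
split.
  apply: le_trans (lip _ _ ha1 hw1) _; rewrite ler_wpM2r ?cabs_ge0 // /K; flra.
have [|q [hq E dq]] := @holo_quot _ c r f a hf; first flra.
have qL v : cabs (v - c) < r1 -> cabs (q v) <= L.
  move=> hv; have [->|va] := eqVneq v a.
    apply: (@cder_le _ f a _ _ (r1 - cabs (a - c))) => //; first flra.
    by move=> x hx; apply: lip => //; have := cabs_distD a x c; flra.
  have va0 : 0 < cabs (v - a) by rewrite cabs_gt0 subr_eq0.
  have := lip a v ha1 hv; rewrite {1}(E v) addrC addKr cabsM mulrC ler_pM2r //.
rewrite (derivE dq) {1}(E w).
have -> : f a + (w - a) * q w - f a - (w - a) * q a = (w - a) * (q w - q a) by ring.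
have hq1 : holo c r1 q by apply: (holo_sub hq); rewrite subrr cabs0 /r1; flra.
rewrite cabsM expr2 mulrCA ler_wpM2l ?cabs_ge0 //.
apply: le_trans (cauchy_lipschitz hq1 qL ha1 hw1) _.
rewrite ler_wpM2r ?cabs_ge0 //; apply: (@le_trans _ _ (8 * L / t)); last by rewrite /K; flra.
apply: ler_wpM2l; first exact: mulr_ge0.
by rewrite lef_pV2 ?posrE // /t /r1; flra.
Qed.

(* Radial primitive [z |-> int_0^1 (z - c) f (c + s (z - c)) ds] *)
Lemma holo_primitive c (r : R) f : holo c r f ->
  exists F, forall z, cabs (z - c) < r -> cder F z (f z).
Proof.
move=> hf; exists (fun z => sint f c z) => z hz.
pose rho := (r + cabs (z - c)) / 2.
have rho0 : 0 < rho by rewrite /rho; have := cabs_ge0 (z - c); flra.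
have rr : rho < r by rewrite /rho; flra.
have cc : cabs (c - c) < rho by rewrite subrr cabs0.
have [K K0 hK] := holo_second_order hf rho0 rr.
apply: (@cder_quadratic _ _ _ (rho - cabs (z - c)) (K * cabs (z - c) + K)); first by rewrite /rho; flra.
move=> w hw; have wc : cabs (w - c) < rho by have := cabs_distD z w c; flra.
have zc : cabs (z - c) < rho by rewrite /rho; flra.
have onseg v s : cabs (v - c) < rho -> 0 <= s <= 1 -> cabs (spt c v s - c) < rho.
  by move=> hv hs; exact: disc_convex.
have seg v : cabs (v - c) < rho -> forall s, 0 <= s <= 1 -> ccont f (spt c v s).
  by move=> hv s hs; apply: (holo_cont hf); have := onseg v s hv hs; flra.
have [Fw [dFw Ew]] := sintP (seg w wc); have [Fz [dFz Ez]] := sintP (seg z zc).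
(* The increment of [g] over the unit interval is [f z]. Subtracting [(w - z) * g] puts the whole
   remainder of the primitive into one path [D], whose velocity is quadratically small in
   [w - z]. *)
pose g (x : C) := x * f (c + x * (z - c)).
pose D s := (Fw s + (-1) * Fz s) + (- (w - z)) * g (spt 0 1 s).
have -> : sint f c w - sint f c z - (w - z) * f z = D 1 - D 0.
  have s1 : spt 0 1 1 = 1 :> C by rewrite /spt subr0 mulr1 add0r rmorph1.
  have s0 : spt 0 1 0 = 0 :> C by rewrite /spt subr0 mulr1 add0r rmorph0.
  have E1 : c + 1 * (z - c) = z by ring.
  by rewrite Ew Ez /D /g s1 s0 E1; ring.
apply: (@cder_itv_le _ D (fun s => (f (spt c w s) * (w - c) + (-1) * (f (spt c z s) * (z - c))) +
   (- (w - z)) * ((f (spt c z s) + (s%:C)%C * (deriv f (spt c z s) * (z - c))) * (1 - 0)))).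
  move=> s hs; apply: cder_itvD; first by apply: cder_itvD; [exact: dFw|exact/cder_itv_scale/dFz].
  apply: cder_itv_scale; apply: cder_cder_itv.
  have -> : spt 0 1 s = (s%:C)%C :> C by rewrite /spt subr0 mulr1 add0r.
  have dz : cder f (spt c z s) (deriv f (spt c z s)).
    by apply: (holo_derivP hf); have := onseg z s zc hs; flra.
  have d1 : cder (fun x => c + x * (z - c)) (s%:C)%C (z - c).
    have := cderD (cder_const c (s%:C)%C) (cderM (cder_id (s%:C)%C) (cder_const (z - c) (s%:C)%C)).
    by rewrite mulr0 addr0 add0r mul1r.
  by have := cderM (cder_id (s%:C)%C) (cder_comp d1 dz); rewrite mul1r.
move=> s hs; have [k1 k2] := hK _ _ (onseg z s zc hs) (onseg w s wc hs).
have E : spt c w s - spt c z s = (s%:C)%C * (w - z) by rewrite /spt; ring.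
rewrite E in k1 k2.
set X := f (spt c w s) in k1 k2 *; set Y := f (spt c z s) in k1 k2 *; set V := deriv f _ in k2 *.
have -> : X * (w - c) + -1 * (Y * (z - c)) + - (w - z) * ((Y + (s%:C)%C * (V * (z - c))) * (1 - 0)) =
  (z - c) * (X - Y - (s%:C)%C * (w - z) * V) + (w - z) * (X - Y) by ring.
case/andP: hs => s0 s1.
have sw : cabs ((s%:C)%C * (w - z)) <= cabs (w - z).
  by rewrite cabsM cabsR ger0_norm // ler_piMl ?cabs_ge0.
apply: le_trans (cabsD _ _) _; rewrite [leRHS]mulrDl; apply: lerD; rewrite cabsM.
  have -> : K * cabs (z - c) * cabs (w - z) ^+ 2 = cabs (z - c) * (K * cabs (w - z) ^+ 2) by ring.
  rewrite ler_wpM2l ?cabs_ge0 //; apply: le_trans k2 _.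
  by rewrite ler_wpM2l // lerXn2r ?nnegrE ?cabs_ge0.
rewrite expr2 mulrCA ler_wpM2l ?cabs_ge0 //; apply: le_trans k1 _.
by rewrite ler_wpM2l.
Qed.

(** ln |1 + z| = ln (1 + x) / 2 with x = 2 re z + |z|^2. From x - 4 x^2 <= ln (1 + x) <= x and |x|
    <= (5/2) |z| the error is at most (25/2 + 1/2) |z|^2. *)
Lemma ln_cabs1D (z : C) : cabs z <= 1 / 2 ->
  `|ln (cabs (1 + z)) - re z| <= 13 * cabs z ^+ 2.
Proof.
move=> hz; pose x := 2 * re z + cabs z ^+ 2.
have zr := Re_le_cabs z; rewrite ler_norml in zr; case/andP: zr => zr1 zr2.
have z0 := cabs_ge0 z.
have Ex : cabs (1 + z) ^+ 2 = 1 + x.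
  by rewrite cabs_sqr /x cabs_sqr; case: (z) => a b /=; ring.
have x1 : 0 < 1 + x.
  rewrite -Ex exprn_gt0 // cabs_gt0; apply/eqP => z1.
  have zE : z = -1 by apply/eqP; rewrite -addr_eq0 addrC z1.
  by move: hz; rewrite zE cabsN cabs1; flra.
have n1z : 0 < cabs (1 + z).
  by rewrite lt0r cabs_ge0 andbT; apply/eqP => h; move: x1; rewrite -Ex h expr0n /=; flra.
have L : ln (cabs (1 + z)) = ln (1 + x) / 2.
  by rewrite -Ex lnXn // mulr2n; flra.
have x34 : 1 / 4 <= 1 + x.
  rewrite -Ex; have : 1 / 2 <= cabs (1 + z).
    by have := cabs_lerB 1 (- z); rewrite opprK cabsN cabs1; flra.
  by move=> h; have := @lerXn2r _ 2 (1/2) (cabs (1 + z)) (ltac:(rewrite nnegrE; flra)) (ltac:(rewrite nnegrE; flra)) h; flra.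
have up : ln (1 + x) <= x by apply: le_ln1Dx; flra.
have lo : x - 4 * x ^+ 2 <= ln (1 + x).
  have h : ln (1 + (- x / (1 + x))) <= - x / (1 + x).
    apply: le_ln1Dx; rewrite ltr_pdivlMr //; flra.
  have E : 1 + (- x / (1 + x)) = (1 + x)^-1 by field; rewrite gt_eqF.
  rewrite E lnV ?posrE // in h.
  have : x - 4 * x ^+ 2 <= x / (1 + x).
    by rewrite ler_pdivlMr //; nra.
  by rewrite mulNr in h; flra.
have x2 : x ^+ 2 <= 25 / 4 * cabs z ^+ 2.
  have h1 : `|x| <= 5 / 2 * cabs z by rewrite ler_norml /x; apply/andP; split; nra.
  rewrite -(@real_normK _ x) ?num_real //.
  have -> : 25 / 4 * cabs z ^+ 2 = (5 / 2 * cabs z) ^+ 2 by field.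
  by rewrite lerXn2r ?nnegrE // mulr_ge0 //; flra.
have xx : re z = x / 2 - cabs z ^+ 2 / 2 by rewrite /x; field.
have zz : 0 <= cabs z ^+ 2 by rewrite exprn_ge0.
by rewrite L xx ler_norml; apply/andP; split; flra.
Qed.
End SecondOrder.

(** * Harnack's inequality, Jensen's bound and three circles *)

Section Harnack.
Variable R : realType.
Local Notation C := R[i].
Implicit Types (f g q u L : C -> C) (z w c a b : C).
Local Notation re := (@complex.Re R).

Lemma real_complexB (x y : R) : ((x%:C)%C - (y%:C)%C) = ((x - y)%:C)%C :> C.
Proof. by rewrite rmorphB. Qed.

Lemma cder_itv_ln (U : R -> C) s v : U s != 0 -> cder_itv U s v ->
  cder_itv (fun t => ((ln (cabs (U t)))%:C)%C) s ((re (v / U s))%:C)%C.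
Proof.
move=> U0 dU e e0; have aU : 0 < cabs (U s) by rewrite cabs_gt0.
pose K := (cabs v + 1) / cabs (U s).
have K0 : 0 < K by rewrite divr_gt0 //; have := cabs_ge0 v; flra.
pose e1 := Num.min 1 (e * cabs (U s) / 2).
have e10 : 0 < e1 by rewrite lt_min ltr01 divr_gt0 // mulr_gt0.
have [d d0 hd] := dU _ e10.
exists (Num.min d (Num.min (1 / (2 * K)) (e / (26 * K ^+ 2)))).
  have K2 : 0 < K ^+ 2 by rewrite exprn_gt0.
  by rewrite !lt_min d0 /=; apply/andP; split; apply: divr_gt0 => //; exact: mulr_gt0.
move=> s' hs'; rewrite !lt_min => /and3P[h1 h2 h3].
have H := hd _ hs' h1.
set eta := (U s' - U s) / U s.
have E : U s' = U s * (1 + eta) by rewrite /eta; field.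
have heta : cabs eta <= K * `|s' - s|.
  rewrite /eta cabs_div ler_pdivrMr //.
  have -> : K * `|s' - s| * cabs (U s) = (cabs v + 1) * `|s' - s| by rewrite /K; field; rewrite gt_eqF.
  have -> : U s' - U s = (U s' - U s - ((s' - s)%:C)%C * v) + ((s' - s)%:C)%C * v by ring.
  apply: le_trans (cabsD _ _) _; rewrite [X in _ + X]cabsM cabsR mulrDl addrC mul1r.
  have : e1 <= 1 by rewrite ge_min lexx.
  rewrite [cabs v * _]mulrC lerD2l => h; apply: le_trans H _.
  by rewrite ler_piMl.
clearbody K.
have eta2 : cabs eta <= 1 / 2.
  apply: le_trans heta _; move: h2; rewrite ltr_pdivlMr ?mulr_gt0 // => h2.
  by have := normr_ge0 (s' - s); flra.
have L := ln_cabs1D eta2.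
have n1 : 0 < cabs (1 + eta).
  by have := cabs_lerB 1 (- eta); rewrite opprK cabsN cabs1; flra.
rewrite E cabsM lnM ?posrE // real_complexB [ln _ + _]addrC addrK -rmorphM real_complexB cabsR.
have -> : ln (cabs (1 + eta)) - (s' - s) * re (v / U s) =
   (ln (cabs (1 + eta)) - re eta) + (re eta - (s' - s) * re (v / U s)) by ring.
apply: le_trans (ler_normD _ _) _.
have -> : re eta - (s' - s) * re (v / U s) = re ((U s' - U s - ((s' - s)%:C)%C * v) / U s).
  by rewrite -re_real_mul -reB; congr re; rewrite /eta; field.
have A : `|re ((U s' - U s - ((s' - s)%:C)%C * v) / U s)| <= e / 2 * `|s' - s|.
  apply: le_trans (Re_le_cabs _) _; rewrite cabs_div ler_pdivrMr //.
  apply: le_trans H _; rewrite mulrAC ler_wpM2r //.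
  by have : e1 <= e * cabs (U s) / 2; [rewrite ge_min lexx orbT|flra].
have B : 13 * cabs eta ^+ 2 <= e / 2 * `|s' - s|.
  apply: (@le_trans _ _ (13 * (K * `|s' - s|) ^+ 2)).
    by rewrite ler_wpM2l // lerXn2r ?nnegrE ?cabs_ge0 // mulr_ge0 // ltW.
  move: h3; rewrite ltr_pdivlMr ?mulr_gt0 ?exprn_gt0 // => h3.
  have := normr_ge0 (s' - s); set t := `|s' - s| in h3 *; move=> t0.
  have -> : 13 * (K * t) ^+ 2 = t * (26 * K ^+ 2) / 2 * t by field.
  by rewrite ler_wpM2r //; flra.
by flra.
Qed.

(** [L] is a primitive of u' / u; comparing only its real part with ln |u| avoids any choice of
    argument. *)
Lemma holo_log c (r : R) u : holo c r u -> (forall z, cabs (z - c) < r -> u z != 0) ->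
  exists2 L, holo c r L & forall z, cabs (z - c) < r -> re (L z) - re (L c) = ln (cabs (u z)) - ln (cabs (u c)).
Proof.
move=> hu nz.
have [L hL] := holo_primitive (holoM (holo_deriv hu) (holoV hu nz)).
exists L; first by move=> z hz; eexists; exact: hL.
move=> z hz; have cc : cabs (c - c) < r by have := cabs_ge0 (z - c); rewrite subrr cabs0; flra.
have ons s : 0 <= s <= 1 -> cabs (spt c z s - c) < r by move=> hs; exact: disc_convex.
pose D s := ((ln (cabs (u (spt c z s))))%:C)%C + (-1) * ((re (L (spt c z s)))%:C)%C.
have dreal (F : R -> C) s v : cder_itv F s v -> cder_itv (fun t => ((re (F t))%:C)%C) s ((re v)%:C)%C.
  move=> h e e0; have [d d0 hd] := h e e0; exists d => // s' hs' ss'.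
  rewrite real_complexB -rmorphM real_complexB cabsR; apply: le_trans (hd _ hs' ss').
  by rewrite -re_real_mul -reB -reB; exact: Re_le_cabs.
have := @cder_itv_le _ D (fun=> 0) 0.
have -> : D 1 - D 0 = (((ln (cabs (u z)) - ln (cabs (u c))) - (re (L z) - re (L c)))%:C)%C.
  rewrite /D /spt rmorph1 rmorph0 mul1r mul0r addr0 subrKC !rmorphB /=; ring.
rewrite cabsR => h; suff : `|ln (cabs (u z)) - ln (cabs (u c)) - (re (L z) - re (L c))| <= 0.
  by rewrite normr_le0 => /eqP; flra.
apply: h => s hs; last by rewrite cabs0.
have hp := ons s hs.
have du := cder_cder_itv (holo_derivP hu hp).
have dL := cder_cder_itv (hL _ hp).
have d1 := cder_itv_ln (nz _ hp) du; have d2 := dreal _ _ _ dL.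
have := cder_itvD d1 (cder_itv_scale (-1) d2).
have -> : ((re (deriv u (spt c z s) * (z - c) / u (spt c z s)))%:C)%C +
  (-1) * ((re (deriv u (spt c z s) * (u (spt c z s))^-1 * (z - c)))%:C)%C = 0 :> C.
  have -> : deriv u (spt c z s) * (u (spt c z s))^-1 * (z - c) =
    deriv u (spt c z s) * (z - c) / u (spt c z s) by ring.
  by rewrite mulN1r subrr.
by [].
Qed.

(* Harnack's inequality for [- ln |u|], from Schwarz's lemma applied to the Cayley transform
   of [- log u]. *)
Lemma harnack_local c (r : R) u z : holo c r u -> 0 < r ->
  (forall z, cabs (z - c) < r -> u z != 0 /\ cabs (u z) < 1) ->
  cabs (z - c) <= r / 8 -> cabs (u c) ^+ 3 <= cabs (u z).
Proof.
move=> hu r0 hb hz.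
have cc : cabs (c - c) < r by rewrite subrr cabs0.
have zr : cabs (z - c) < r by flra.
have [L hL EL] := holo_log hu (fun z hz => (hb z hz).1).
pose k := - ln (cabs (u c)).
have gt0 w : cabs (w - c) < r -> 0 < cabs (u w) by move=> hw; rewrite cabs_gt0; exact: (hb w hw).1.
have k0 : 0 < k.
  by have := @ln_lt0 R (cabs (u c)); rewrite gt0 // (hb c cc).2 => /(_ isT); rewrite /k; flra.
pose phi w := (k%:C)%C - (L w - L c).
have rphi w : cabs (w - c) < r -> re (phi w) = - ln (cabs (u w)).
  move=> hw; have := EL w hw; rewrite /phi !reB /= /k; flra.
have phi0 w : cabs (w - c) < r -> 0 < re (phi w).
  move=> hw; rewrite rphi //; have := @ln_lt0 R (cabs (u w)).
  by rewrite gt0 // (hb w hw).2 => /(_ isT); flra.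
have hphi : holo c r phi.
  by apply: holoB; [exact: holo_const|apply: holoB => //; exact: holo_const].
have den w : cabs (w - c) < r -> phi w + (k%:C)%C != 0.
  move=> hw; apply/eqP => /(congr1 re); rewrite reD /= => h.
  by have := phi0 w hw; flra.
pose psi w := (phi w - (k%:C)%C) * (phi w + (k%:C)%C)^-1.
have hpsi : holo c r psi.
  apply: holoM; first by apply: holoB => //; exact: holo_const.
  by apply: holoV; [apply: holoD => //; exact: holo_const|exact: den].
have psi1 w : cabs (w - c) < r -> cabs (psi w) <= 1.
  move=> hw; rewrite cabs_div ler_pdivrMr ?cabs_gt0 ?den // mul1r.
  rewrite -(@ler_pXn2r _ 2) ?nnegrE ?cabs_ge0 // !cabs_sqr.
  by have := phi0 w hw; case: (phi w) => x y /= h; nra.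
have psic : psi c = 0 by rewrite /psi /phi subrr subr0 subrr mul0r.
have [q [hq Eq _]] := holo_quot hpsi cc.
have r4 : 0 < r / 5 * 2 by flra.
have qb w : cabs (w - c) <= 2 * (r / 5 * 2) -> cabs (q w) <= 1 / (r / 5 * 2).
  apply: (holo_max hq r4); first flra.
  move=> v /andP[v1 v2]; apply: (cabs_quot_le Eq) => //.
  by rewrite psic subr0 psi1 //; flra.
have hpsi2 : cabs (psi z) <= 1 / 2.
  rewrite (Eq z) psic add0r cabsM.
  have := qb z (ltac:(flra)); rewrite ler_pdivlMr // => h.
  have := cabs_ge0 (z - c); have := cabs_ge0 (q z) => h1 h2; nra.
have h3 : cabs (phi z) <= 3 * k.
  move: hpsi2; rewrite cabs_div ler_pdivrMr ?cabs_gt0 ?den // => h.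
  have := cabs_lerB (phi z) (k%:C)%C; have := cabsD (phi z) (k%:C)%C.
  by rewrite cabsR gtr0_norm //; flra.
have := Re_le_cabs (phi z); rewrite ler_norml rphi // => /andP[_ h4].
rewrite -ler_ln ?posrE ?exprn_gt0 ?gt0 // lnXn ?gt0 //.
by rewrite -mulr_natr; rewrite /k in h3; flra.
Qed.

(** A chain of k steps of length at most [(r - rho) / 8] along the segment from [z] to [w], each
    costing an exponent 3. Hence [n = 3 ^ k] depends on [r] and [rho] alone. *)
Lemma harnack_chain (r rho : R) : 0 < rho -> rho < r -> exists n, forall c u z w,
  holo c r u -> (forall z, cabs (z - c) < r -> u z != 0 /\ cabs (u z) < 1) ->
  cabs (z - c) < rho -> cabs (w - c) < rho -> cabs (u z) ^+ n <= cabs (u w).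
Proof.
move=> rho0 rr; pose d := (r - rho) / 8; have d0 : 0 < d by rewrite /d; flra.
have [k hk] : exists k : nat, 2 * rho / d < k%:R.
  exists (Num.bound (2 * rho / d)); apply: archi_boundP.
  by apply: divr_ge0 (ltW d0); flra.
exists (3 ^ k)%N => c u z w hu hb hz hw.
have : cabs (z - w) <= k%:R * d.
  have := cabs_distD c z w; rewrite (cabsB c w); move: hk; rewrite ltr_pdivrMr //; flra.
elim: k z w hz hw {hk} => [|k IH] z w hz hw.
  rewrite mul0r => /cabs0P /eqP; rewrite subr_eq0 => /eqP ->.
  by rewrite expn0 expr1.
move=> hzw.
have k1 : 0 < k.+1%:R :> R by [].
pose s : R := k.+1%:R^-1.
have s01 : 0 <= s <= 1 by rewrite invr_ge0 ltW //= invf_le1 // ler1n.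
pose m := z + (s%:C)%C * (w - z).
have hm : cabs (m - c) < rho by exact: disc_convex.
have zm : cabs (m - z) <= d.
  rewrite /m addrC addKr cabsM cabsR ger0_norm; last by case/andP: s01.
  by rewrite (cabsB w) /s mulrC ler_pdivrMr // mulrC.
have mw : cabs (m - w) <= k%:R * d.
  have -> : m - w = ((1 - s)%:C)%C * (z - w) by rewrite /m rmorphB rmorph1; ring.
  rewrite cabsM cabsR ger0_norm; last by case/andP: s01; flra.
  have -> : 1 - s = k%:R / k.+1%:R by rewrite /s -natr1; field; rewrite natr1 gt_eqF.
  by rewrite mulrAC ler_pdivrMr // -mulrA [d * _]mulrC ler_wpM2l.
have rz : 0 < r - cabs (z - c) by flra.
have h3 : cabs (u z) ^+ 3 <= cabs (u m).
  apply: (@harnack_local z (r - cabs (z - c))) => //.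
  - by apply: (holo_sub hu); flra.
  - by move=> v hv; apply: hb; have := cabs_distD z v c; flra.
  - by apply: le_trans zm _; rewrite /d; flra.
apply: le_trans (IH m w hm hw mw).
by rewrite expnS exprM lerXn2r ?nnegrE ?exprn_ge0 ?cabs_ge0.
Qed.

(** The qualitative form used for plaques, whose differences are bounded and zero-free: smallness at
    one point spreads to the smaller disc, uniformly in the function. *)
Lemma harnack (r rho M : R) : 0 < rho -> rho < r ->
  forall e, 0 < e -> exists2 d, 0 < d & forall c u z w,
  holo c r u -> (forall z, cabs (z - c) < r -> u z != 0 /\ cabs (u z) <= M) ->
  cabs (z - c) < rho -> cabs (w - c) < rho -> cabs (u z) < d -> cabs (u w) < e.
Proof.
move=> rho0 rr e e0; have [n hn] := harnack_chain rho0 rr.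
pose M' := `|M| + 1; have M'0 : 0 < M' by have := normr_ge0 M; rewrite /M'; flra.
have eM : 0 < Num.min 1 (e / M') by rewrite lt_min ltr01 divr_gt0.
exists (M' * Num.min 1 (e / M') ^+ n); first by rewrite mulr_gt0 // exprn_gt0.
move=> c u z w hu hb hz hw uz; rewrite ltNge; apply/negP => uw.
pose v x := (M'^-1%:C)%C * u x.
have cv x : cabs (v x) = cabs (u x) / M'.
  by rewrite /v cabsM cabsR gtr0_norm ?invr_gt0 // mulrC.
have hv : holo c r v by apply: holoM => //; exact: holo_const.
have M'c : (M'^-1%:C)%C != 0 :> C by rewrite -cabs_gt0 cabsR normr_gt0 invr_eq0 gt_eqF.
have := hn c v w z hv _ hw hz; rewrite !cv => h.
have : (cabs (u w) / M') ^+ n <= cabs (u z) / M'.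
  apply: h => x hx; have [u0 uM] := hb x hx; split; first by rewrite mulf_neq0.
  rewrite cv ltr_pdivrMr // mul1r; have := ler_norm M; rewrite /M'; flra.
rewrite leNgt => /negP; apply.
rewrite ltr_pdivrMr // mulrC; apply: lt_le_trans uz _.
rewrite ler_wpM2l ?(ltW M'0) //; apply: lerXn2r; rewrite ?nnegrE ?divr_ge0 ?cabs_ge0 ?(ltW M'0) ?(ltW eM) //.
by rewrite ge_min; apply/orP; right; rewrite ler_pM2r ?invr_gt0.
Qed.

(** Jensen's bound by dividing out the zeros. A factor z - a has modulus at least 6 s where |z - c|
    >= 7 s and at most 3 s where |z - c| <= 2 s, so each zero gains a factor 2. *)
Lemma zeros_bound c (r s M : R) h (zs : seq C) : holo c r h -> 0 < s -> 16 * s <= r ->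
  (forall z, cabs (z - c) < r -> cabs (h z) <= M) -> uniq zs ->
  (forall z, z \in zs -> cabs (z - c) < s /\ h z = 0) ->
  forall z, cabs (z - c) <= 2 * s -> cabs (h z) <= M / 2 ^+ size zs.
Proof.
move=> hh s0 sr hM uzs hz z zs2.
have [g [hg E]] : exists g, holo c r g /\ forall z, h z = (\prod_(a <- zs) (z - a)) * g z.
  elim: zs uzs hz => [|a zs IH] /=.
    by exists h; split=> // w; rewrite big_nil mul1r.
  move=> /andP[azs uzs] hz; have [|g [hg E]] := IH uzs.
    by move=> w hw; apply: hz; rewrite inE hw orbT.
  have [ac ha] := hz a (mem_head _ _).
  have ga : g a = 0.
    move: ha; rewrite (E a) => /eqP; rewrite mulf_eq0 => /orP[|/eqP//].
    rewrite prodf_seq_eq0 => /hasP[b bz /=]; rewrite subr_eq0 => /eqP ab.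
    by rewrite ab bz in azs.
  have [q [hq Eq _]] := holo_quot hg (ltac:(flra) : cabs (a - c) < r).
  exists q; split=> // w; rewrite big_cons (E w) (Eq w) ga; ring.
have M0 : 0 <= M by apply: le_trans (hM c _); [exact: cabs_ge0|rewrite subrr cabs0; flra].
have gb : cabs (g z) <= M / (6 * s) ^+ size zs.
  apply: (@holo_max _ c r (7 * s)) => //; [flra|flra| |flra].
  move=> w /andP[w1 w2]; rewrite ler_pdivlMr ?exprn_gt0 ?mulr_gt0 //.
  apply: le_trans (hM w (ltac:(flra))); rewrite (E w) cabsM mulrC ler_wpM2r ?cabs_ge0 //.
  rewrite cabs_prod; elim: zs {uzs E} hz => [|a zs IH] hz; first by rewrite big_nil expr0.
  rewrite big_cons /= exprS; apply: ler_pM.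
  - by rewrite mulr_ge0 // ltW.
  - by rewrite exprn_ge0 // mulr_ge0 // ltW.
  - by have := (hz a (mem_head _ _)).1; have := cabs_distD a w c; flra.
  - by apply: IH => b hb; apply: hz; rewrite inE hb orbT.
rewrite (E z) cabsM cabs_prod.
have pb : \prod_(a <- zs) cabs (z - a) <= (3 * s) ^+ size zs.
  elim: zs {uzs E gb} hz => [|a zs IH] hz; first by rewrite big_nil expr0.
  rewrite big_cons /= exprS; apply: ler_pM.
  - exact: cabs_ge0.
  - by apply: prodr_ge0 => *; exact: cabs_ge0.
  - by have := (hz a (mem_head _ _)).1; have := cabs_distD c z a; rewrite (cabsB c a); flra.
  - by apply: IH => b hb; apply: hz; rewrite inE hb orbT.
apply: le_trans (ler_pM _ (cabs_ge0 _) pb gb) _.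
  by apply: prodr_ge0 => *; exact: cabs_ge0.
have -> : 6 * s = 2 * (3 * s) by ring.
rewrite [X in _ / X]exprMn invfM mulrCA !mulrA mulrAC mulfK ?lexx //.
by rewrite expf_neq0 // mulf_neq0 // gt_eqF.
Qed.

(* Three circles: iterated divided differences at the centre are controlled on both discs. *)
Lemma three_circles c (r s M : R) h N : holo c r h -> 0 < s -> 256 * s < r ->
  (forall z, cabs (z - c) < r -> cabs (h z) <= M) ->
  (forall z, cabs (z - c) <= 2 * s -> cabs (h z) <= M / 2 ^+ N) ->
  forall z, cabs (z - c) <= 4 * s -> cabs (h z) <= 2 * M / 2 ^+ (N %/ 6).
Proof.
move=> hh s0 sr hM hN z zs.
have cc : cabs (c - c) < r by rewrite subrr cabs0; flra.
have M0 : 0 <= M by apply: le_trans (hM c cc); exact: cabs_ge0.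
pose eta := M / 2 ^+ N; have eta0 : 0 <= eta by rewrite divr_ge0 // exprn_ge0.
have key k : exists g, [/\ holo c r g,
   forall w, cabs (w - c) <= 2 * s -> cabs (g w) <= eta * (2 / s) ^+ k,
   forall w, cabs (w - c) <= 2 * (64 * s) -> cabs (g w) <= M * (2 / (64 * s)) ^+ k &
   cabs (h z) <= eta * 8 ^+ k + cabs (z - c) ^+ k * cabs (g z)].
  elim: k => [|k [g [hg h1 h2 h3]]].
    exists h; split=> //.
    - by move=> w hw; rewrite expr0 mulr1 hN.
    - by move=> w hw; rewrite expr0 mulr1 hM //; flra.
    - by rewrite !expr0 mulr1 mul1r lerDr.
  have [q [hq Eq _]] := holo_quot hg cc.
  exists q; split=> //.
  - apply: (holo_max hq s0); first flra.
    move=> w /andP[w1 w2]; have -> : eta * (2 / s) ^+ k.+1 = (2 * (eta * (2 / s) ^+ k)) / s.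
      by rewrite exprS; ring.
    apply: (cabs_quot_le Eq) => //; apply: le_trans (cabsD _ _) _; rewrite cabsN.
    by have := h1 w w2; have := h1 c; rewrite subrr cabs0 => /(_ (ltac:(flra))); flra.
  - apply: (holo_max hq (ltac:(flra) : 0 < 64 * s)); first flra.
    move=> w /andP[w1 w2]; have -> : M * (2 / (64 * s)) ^+ k.+1 = (2 * (M * (2 / (64 * s)) ^+ k)) / (64 * s).
      by rewrite exprS; ring.
    apply: (cabs_quot_le Eq) => //; first flra.
    apply: le_trans (cabsD _ _) _; rewrite cabsN.
    by have := h2 w w2; have := h2 c; rewrite subrr cabs0 => /(_ (ltac:(flra))); flra.
  - apply: le_trans h3 _; rewrite (Eq z).
    have t1 := cabsD (g c) ((z - c) * q z); rewrite [cabs (_ * q z)]cabsM in t1.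
    have t2 := h1 c; rewrite subrr cabs0 in t2; have {}t2 := t2 (ltac:(flra)).
    have t3 : cabs (z - c) ^+ k * cabs (g c) <= eta * 8 ^+ k.
      apply: (@le_trans _ _ ((4 * s) ^+ k * (eta * (2 / s) ^+ k))).
        apply: ler_pM; rewrite ?exprn_ge0 ?cabs_ge0 //.
        by apply: lerXn2r; rewrite ?nnegrE ?cabs_ge0 // mulr_ge0 // ltW.
      rewrite mulrCA -exprMn; have -> : 4 * s * (2 / s) = 8 by field; rewrite gt_eqF.
      exact: lexx.
    have t4 : cabs (z - c) ^+ k * cabs (g c + (z - c) * q z) <=
       cabs (z - c) ^+ k * (cabs (g c) + cabs (z - c) * cabs (q z)).
      by rewrite ler_wpM2l ?exprn_ge0 ?cabs_ge0.
    have t5 : 0 <= eta * 8 ^+ k by rewrite mulr_ge0 // exprn_ge0.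
    rewrite !exprS; rewrite mulrDr in t4; nra.
(* This [k] balances the two terms: the first is M 8^k / 2^N, the second M / 8^k, because 4 s times
   2 / (64 s) is 1/8. *)
pose k := (N %/ 6)%N.
have [g [hg h1 h2 h3]] := key k; clear key.
apply: le_trans h3 _; rewrite -/k.
have k6 : (6 * k <= N)%N by rewrite mulnC leq_divM.
have p2 n : 0 < 2 ^+ n :> R by rewrite exprn_gt0.
have A : eta * 8 ^+ k <= M / 2 ^+ (3 * k).
  rewrite /eta -mulrA ler_wpM2l // mulrC ler_pdivrMr // ler_pdivlMl //.
  have -> : 8 = 2 ^+ 3 :> R by ring.
  by rewrite -exprM -exprD ler_weXn2l ?ler1n //; lia.
have B : cabs (z - c) ^+ k * cabs (g z) <= M / 2 ^+ (3 * k).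
  apply: (@le_trans _ _ ((4 * s) ^+ k * (M * (2 / (64 * s)) ^+ k))).
    apply: ler_pM; rewrite ?exprn_ge0 ?cabs_ge0 //; last by apply: h2; flra.
    by apply: lerXn2r; rewrite ?nnegrE ?cabs_ge0 // mulr_ge0 // ltW.
  rewrite mulrCA -exprMn; have -> : 4 * s * (2 / (64 * s)) = (2 ^+ 3)^-1 by field; rewrite gt_eqF.
  by rewrite exprVn -exprM.
have D : M / 2 ^+ (3 * k) <= M / 2 ^+ k.
  rewrite ler_wpM2l // lef_pV2 ?posrE // ler_weXn2l ?ler1n //; lia.
by flra.
Qed.
End Harnack.

Section ThreeCircles.
Variable R : realType.
Local Notation C := R[i].
Implicit Types (f g h : C -> C) (z w c t : C).

Lemma holo_discP f (r : R) : holo_disc f r <-> holo 0 r f.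
Proof.
split=> hf z hz.
  have [|l hl] := hf z; first by rewrite subr0 in hz.
  by exists l; apply/cder_distlim.
have [|l hl] := hf z; first by rewrite subr0.
by exists l; apply/cder_distlim.
Qed.

(** Each doubling of the radius divides the exponent by 6 and doubles the constant; [m] doublings
    lead from [rho] past [r / 256], so [j = 6 ^ m] depends on [r] and [rho] only. Two points of the
    disc of radius [r / 600] are at most [r / 300] apart, within that reach. *)
Lemma three_circles_iter (r rho : R) : 0 < r -> 0 < rho -> exists (j : nat) (K : R),
  [/\ (0 < j)%N, 1 <= K & forall c t h (M : R) N, holo c r h ->
   (forall z, cabs (z - c) < r -> cabs (h z) <= M) -> cabs (t - c) <= r / 600 ->
   (forall z, cabs (z - t) <= rho -> cabs (h z) <= M / 2 ^+ N) ->
   forall z, cabs (z - c) <= r / 600 -> cabs (h z) <= K * M / 2 ^+ (N %/ j)].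
Proof.
move=> r0 rho0.
have exm : exists m, r / 256 <= rho * 2 ^+ m.
  have q1 : 0 <= (2^-1 : R) < 1 by apply/andP; split; flra.
  have q2 : 0 < rho / r * 256 by apply: mulr_gt0; [exact: divr_gt0|rewrite ltr0n].
  have [m hm] := seq_exp_lt q1 q2.
  exists m; move: hm; rewrite exprVn.
  have p : 0 < 2 ^+ m :> R by rewrite exprn_gt0.
  rewrite -[X in X < _]mul1r ltr_pdivrMr // => h.
  have -> : rho * 2 ^+ m = r / 256 * (rho / r * 256 * 2 ^+ m) by field; rewrite gt_eqF.
  by apply: ler_peMr (ltW h); apply: divr_ge0; [exact: ltW|exact: ler0n].
case: (ex_minnP exm) => m hm mmin.
exists (6 ^ m)%N, (2 ^+ m); split=> [||c t h M N hh hM tc hN z hz].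
- by rewrite expn_gt0.
- by rewrite exprn_ege1 // ler1n.
have M0 : 0 <= M by apply: le_trans (hM c _); [exact: cabs_ge0|rewrite subrr cabs0].
have key i : (i <= m)%N -> forall z, cabs (z - t) <= rho * 2 ^+ i ->
    cabs (h z) <= 2 ^+ i * M / 2 ^+ (N %/ 6 ^ i).
  elim: i => [|i IH] im.
    by move=> w; rewrite !expr0 mulr1 mul1r expn0 divn1; exact: hN.
  have IH' := IH (ltnW im).
  have small : rho * 2 ^+ i < r / 256.
    by rewrite ltNge; apply/negP => /mmin; rewrite leqNgt im.
  have p2 : 0 < 2 ^+ i :> R by rewrite exprn_gt0.
  have p21 : 1 <= 2 ^+ i :> R by rewrite exprn_ege1 // ler1n.
  move=> w; rewrite exprS => hw.
  have -> : (N %/ 6 ^ i.+1 = N %/ 6 ^ i %/ 6)%N by rewrite expnSr divnMA.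
  rewrite -(mulrA 2 (2 ^+ i) M).
  apply: (@three_circles _ t (r - cabs (t - c)) (rho * 2 ^+ i / 2)).
  - by apply: (holo_sub hh); flra.
  - by rewrite divr_gt0 // mulr_gt0.
  - by flra.
  - move=> v hv; apply: (@le_trans _ _ M); last by rewrite ler_peMl.
    by apply: hM; have := cabs_distD t v c; flra.
  - by move=> v hv; apply: IH'; flra.
  - by flra.
apply: (key m (leqnn m)); have := cabs_distD c z t; rewrite (cabsB c t); flra.
Qed.
End ThreeCircles.

(** * The surface and its compact subsets *)

Section Ambient.
Variable R : realType.
Local Notation C := R[i].
Local Notation re := (@complex.Re R).
Local Notation im := (@complex.Im R).
Implicit Types (z w l : C) (u v : P1 R).

(** The inversion exchanging the two charts. It is a rotation of the sphere ([chordal_inv]), so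
    statements about one chart carry over to the other. *)
Definition p1inv u : P1 R := if u is Some w then (if w == 0 then None else Some w^-1) else Some 0.

Lemma p1invK u : p1inv (p1inv u) = u.
Proof.
case: u => [w|] /=; last by rewrite eqxx.
by have [->|w0] := eqVneq w 0; rewrite /= ?(invr_eq0, negbTE w0) ?invrK.
Qed.

Lemma p1chart_true w : p1chart true w = p1inv (Some w). Proof. by []. Qed.

Lemma p1chart_inj k : injective (@p1chart R k).
Proof.
case: k => w w' /=; last by case.
by move=> h; have := congr1 p1inv h; rewrite -/(p1inv (Some w)) -/(p1inv (Some w')) !p1invK => -[].
Qed.

Lemma sqrt1D_gt0 w : 0 < Num.sqrt (1 + cabs w ^+ 2).
Proof. by rewrite sqrtr_gt0 ltr_wpDr // exprn_ge0 // cabs_ge0. Qed.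

Lemma sqrt1D_inv w : w != 0 -> Num.sqrt (1 + cabs w^-1 ^+ 2) = Num.sqrt (1 + cabs w ^+ 2) / cabs w.
Proof.
move=> w0; have aw : 0 < cabs w by rewrite cabs_gt0.
have -> : 1 + cabs w^-1 ^+ 2 = (1 + cabs w ^+ 2) / cabs w ^+ 2.
  by rewrite cabsV; field; rewrite gt_eqF.
rewrite sqrtrM ?addr_ge0 ?exprn_ge0 ?cabs_ge0 //; congr (_ * _).
by rewrite sqrtrV ?exprn_ge0 ?cabs_ge0 // sqrtr_sqr ger0_norm ?cabs_ge0.
Qed.

Lemma chordal_sym u v : chordal u v = chordal v u.
Proof.
case: u => [a|]; case: v => [b|] //=.
by rewrite (cabsB a b) (mulrC (Num.sqrt (1 + cabs a ^+ 2))).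
Qed.

Lemma chordal_inv u v : chordal (p1inv u) (p1inv v) = chordal u v.
Proof.
have h0 : Num.sqrt (1 + cabs (0 : C) ^+ 2) = 1 by rewrite cabs0 expr0n addr0 sqrtr1.
have hN (w : C) : chordal (p1inv (Some w)) (p1inv None) = chordal (Some w) None.
  rewrite /=; have [->|w0] := eqVneq w 0; first by rewrite ?eqxx.
  rewrite /= subr0 h0 mulr1 sqrt1D_inv // cabsV; field.
  by rewrite (gt_eqF (sqrt1D_gt0 w)) cabs_eq0 w0.
case: u => [a|]; case: v => [b|]; [|exact: hN|by rewrite chordal_sym hN chordal_sym|by rewrite /p1inv /chordal subrr cabs0 mul0r].
rewrite /p1inv; have [->|a0] := eqVneq a 0; have [->|b0] := eqVneq b 0; rewrite /chordal.
- by rewrite subrr cabs0 mul0r.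
- rewrite sqrt1D_inv // sub0r cabsN h0; field.
  by rewrite (gt_eqF (sqrt1D_gt0 b)) cabs_eq0 b0.
- rewrite sqrt1D_inv // subr0 h0; field.
  by rewrite (gt_eqF (sqrt1D_gt0 a)) cabs_eq0 a0.
- have -> : a^-1 - b^-1 = (b - a) / (a * b) by field; rewrite a0 b0.
  rewrite !sqrt1D_inv // cabs_div cabsM (cabsB b a); field.
  by rewrite (gt_eqF (sqrt1D_gt0 a)) (gt_eqF (sqrt1D_gt0 b)) !cabs_eq0 a0 b0.
Qed.

Lemma chordal_chart k w w' : chordal (p1chart k w) (p1chart k w') = chordal (Some w) (Some w').
Proof. by case: k => //; rewrite !p1chart_true chordal_inv. Qed.

Lemma chordal_le w w' : chordal (Some w) (Some w') <= cabs (w - w').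
Proof.
rewrite /= ler_pdivrMr ?mulr_gt0 ?sqrt1D_gt0 //.
have h (x : C) : 1 <= Num.sqrt (1 + cabs x ^+ 2).
  by rewrite -[leLHS]sqrtr1 ler_wsqrtr // lerDl exprn_ge0 // cabs_ge0.
rewrite ler_peMr ?cabs_ge0 //; have := h w; have := h w'; nra.
Qed.

Lemma chordal_near k w (e : R) : 0 < e -> exists2 d, 0 < d & forall u,
  chordal u (p1chart k w) < d -> exists2 w', u = p1chart k w' & cabs (w' - w) < e.
Proof.
move=> e0; pose S := Num.sqrt (1 + cabs w ^+ 2).
have S0 : 0 < S by exact: sqrt1D_gt0.
have W0 : 0 < 1 + cabs w by have := cabs_ge0 w; flra.
(* The first term excludes the point outside the chart, at chordal distance [1 / S], and bounds the
   coordinate of [u]; with that bound the second turns chordal into Euclidean distance. *)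
exists (Num.min (1 / (2 * S)) (e / (2 * S * (1 + cabs w)))).
  by rewrite lt_min !divr_gt0 ?mulr_gt0.
suff main u : chordal u (Some w) < Num.min (1 / (2 * S)) (e / (2 * S * (1 + cabs w))) ->
    exists2 w', u = Some w' & cabs (w' - w) < e.
  move=> u; case: k => /=; last exact: main.
  rewrite -/(p1inv (Some w)) -chordal_inv p1invK => /main[w' E h].
  by exists w' => //; rewrite -[LHS]p1invK E.
rewrite lt_min !ltr_pdivlMr ?mulr_gt0 // => /andP[h1 h2].
case: u h1 h2 => [w'|] h1 h2; last first.
  exfalso; move: h1; rewrite /= -/S; have -> : 1 / S * (2 * S) = 2 by field; rewrite gt_eqF.
  by flra.
exists w' => //; move: h1 h2; rewrite /= -/S.
set S' := Num.sqrt _; have S'0 : 0 < S' by exact: sqrt1D_gt0.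
set x := cabs (w' - w); move=> h1 h2.
have S'1 : S' <= 1 + cabs w + x.
  have w'w : cabs w' <= cabs w + x.
    by have := cabsD w (w' - w); rewrite subrKC.
  apply: (@le_trans _ _ (1 + cabs w')); last by flra.
  have n := cabs_ge0 w'.
  rewrite -[leRHS]ger0_norm; last by flra.
  rewrite -sqrtr_sqr ler_wsqrtr //; nra.
have x0 : 0 <= x by exact: cabs_ge0.
have E1 : x / (S' * S) * (2 * S) = 2 * x / S' by field; rewrite !gt_eqF.
have E2 : x / (S' * S) * (2 * S * (1 + cabs w)) = 2 * x * (1 + cabs w) / S' by field; rewrite !gt_eqF.
rewrite E1 ltr_pdivrMr // mul1r in h1; rewrite E2 ltr_pdivrMr // in h2.
have : 2 * x * (1 + cabs w) < e * (1 + cabs w + x) by nra.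
have xw : x < 1 + cabs w by flra.
by move=> h; nra.
Qed.
End Ambient.

Section Torus.
Variable R : realType.
Local Notation C := R[i].
Local Notation re := (@complex.Re R).
Local Notation im := (@complex.Im R).
Variables om1 om2 : C.
Implicit Types (z w l : C) (k : bool) (p q x : Mpt R).
Local Notation inLat := (inLat om1 om2).
Local Notation Meq := (Meq om1 om2).
Local Notation Mclose := (Mclose om1 om2).

Definition pt k z w : Mpt R := (z, p1chart k w).

Lemma inLat0 : inLat 0.
Proof. by exists 0, 0; rewrite !mul0r addr0. Qed.
Lemma inLatD l l' : inLat l -> inLat l' -> inLat (l + l').
Proof. by move=> [m [n ->]] [m' [n' ->]]; exists (m + m'), (n + n'); rewrite !intrD; ring. Qed.
Lemma inLatN l : inLat l -> inLat (- l).
Proof. by move=> [m [n ->]]; exists (- m), (- n); rewrite !intrN; ring. Qed.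
Lemma inLatB l l' : inLat l -> inLat l' -> inLat (l - l').
Proof. by move=> hl hl'; apply: inLatD => //; exact: inLatN. Qed.

Lemma Meq_refl p : Meq p p.
Proof. by split; rewrite ?subrr //; exact: inLat0. Qed.
Lemma Meq_sym p q : Meq p q -> Meq q p.
Proof. by move=> [h E]; split=> //; rewrite -opprB; exact: inLatN. Qed.
Lemma Meq_trans p q x : Meq p q -> Meq q x -> Meq p x.
Proof.
move=> [h E] [h' E']; split; last by rewrite E.
have -> : p.1 - x.1 = (p.1 - q.1) + (q.1 - x.1) by ring.
exact: inLatD.
Qed.

Lemma Mclose_l p p' q (d : R) : Meq p p' -> Mclose p q d -> Mclose p' q d.
Proof.
move=> [h E] [l [hl [h1 h2]]]; exists (l + (p.1 - p'.1)); split; first exact: inLatD.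
split; last by rewrite -E.
by have -> : p'.1 + (l + (p.1 - p'.1)) - q.1 = p.1 + l - q.1 by ring.
Qed.
Lemma Mclose_r p q q' (d : R) : Meq q q' -> Mclose p q d -> Mclose p q' d.
Proof.
move=> [h E] [l [hl [h1 h2]]]; exists (l - (q.1 - q'.1)); split; first exact: inLatB.
split; last by rewrite -E.
by have -> : p.1 + (l - (q.1 - q'.1)) - q'.1 = p.1 + l - q.1 by ring.
Qed.

Lemma Mclose_le p q (d d' : R) : d <= d' -> Mclose p q d -> Mclose p q d'.
Proof. by move=> dd [l [hl [h1 h2]]]; exists l; split=> //; split; apply: lt_le_trans dd. Qed.

Lemma Mclose_coord k z w (e : R) : 0 < e -> exists2 d, 0 < d & forall x, Mclose x (pt k z w) d ->
  exists z' w', [/\ Meq x (pt k z' w'), cabs (z' - z) < e & cabs (w' - w) < e].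
Proof.
move=> e0; have [d d0 hd] := chordal_near k w e0.
exists (Num.min d e); first by rewrite lt_min d0.
move=> [x u] [l [hl [/= h1 h2]]]; move: h1 h2; rewrite !lt_min => /andP[_ h1] /andP[/hd[w' -> hw] _].
exists (x + l), w'; split=> //; split=> //=.
by rewrite opprD addrA subrr add0r; exact: inLatN.
Qed.

Lemma coord_Mclose k z w z' w' x (d : R) : Meq x (pt k z' w') ->
  cabs (z' - z) < d -> cabs (w' - w) < d -> Mclose x (pt k z w) d.
Proof.
move=> hx hz hw; apply: (@Mclose_l (pt k z' w')); first exact: Meq_sym.
exists 0; split; first exact: inLat0.
rewrite /= addr0; split=> //; rewrite chordal_chart.
exact: le_lt_trans (chordal_le _ _) hw.
Qed.

(** Two closed hemispheres, one in each chart: compactness of the sphere becomes that of a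
    square. *)
Lemma pt_surj x : exists k w, [/\ x = pt k x.1 w & cabs w <= 1].
Proof.
case: x => z [w|]; last by exists true, 0; rewrite cabs0 /pt /= eqxx.
have [w1|w1] := leP (cabs w) 1; first by exists false, w.
have w0 : w != 0 by rewrite -cabs_gt0; flra.
exists true, w^-1; rewrite /pt /= invr_eq0 (negbTE w0) invrK; split=> //.
by rewrite cabsV invf_le1 ?ltW //; flra.
Qed.

Hypothesis hom1 : om1 != 0.
Hypothesis hom : cim (om2 / om1) != 0.

Lemma fundamental_domain z : exists s t : R, [/\ 0 <= s <= 1, 0 <= t <= 1 &
  inLat (z - ((s%:C)%C * om1 + (t%:C)%C * om2))].
Proof.
set tau := om2 / om1.
have imt : im tau != 0 by move: hom; rewrite -/tau; case: tau.
pose t := im (z / om1) / im tau; pose s := re (z / om1) - t * re tau.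
have E : z / om1 = (s%:C)%C + (t%:C)%C * tau.
  have gen (Z T : C) : im T != 0 ->
      Z = ((re Z - im Z / im T * re T)%:C)%C + ((im Z / im T)%:C)%C * T.
    by case: Z => a b; case: T => c d /= d0; congr Complex; field.
  exact: gen.
have Ez : z = (s%:C)%C * om1 + (t%:C)%C * om2.
  by rewrite -[z](divfK hom1) E mulrDl; congr (_ + _); rewrite /tau; field.
have fl (x : R) : 0 <= x - (Num.floor x)%:~R <= 1.
  by have := floor_itv x; rewrite intrD => /andP[h1 h2]; apply/andP; split; flra.
exists (s - (Num.floor s)%:~R), (t - (Num.floor t)%:~R); split=> //.
exists (Num.floor s), (Num.floor t).
have -> : ((Num.floor s)%:~R : C) = (((Num.floor s)%:~R : R)%:C)%C by rewrite rmorph_int.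
have -> : ((Num.floor t)%:~R : C) = (((Num.floor t)%:~R : R)%:C)%C by rewrite rmorph_int.
rewrite {1}Ez !rmorphB /=; ring.
Qed.

Variable X : Mset R.
Hypothesis Xcl : Mclosed om1 om2 X.

Lemma Mclosed_open q : ~ X q -> exists2 d, 0 < d & forall x, Mclose x q d -> ~ X x.
Proof.
move=> nq; apply: contrapT => h; apply: nq.
have u n : exists x, Mclose x q (n.+1%:R^-1) /\ X x.
  apply: contrapT => h'; apply: h; exists n.+1%:R^-1; first by rewrite invr_gt0.
  by move=> x hx Xx; apply: h'; exists x.
have [f hf] := choice u; apply: (Xcl (fun n => (hf n).2)) => e e0.
exists (Num.bound e^-1) => n hn; apply: Mclose_le (hf n).1.
rewrite -[e]invrK lef_pV2 ?posrE ?invr_gt0 //.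
have := archi_boundP (ltW (ltac:(rewrite invr_gt0; exact: e0) : 0 < e^-1)).
by move=> /ltW h1; apply: le_trans h1 _; rewrite ler_nat; exact: leq_trans hn _.
Qed.

(* Compactness of [X] as an induction principle on subsets of [X]. *)
Lemma Mcompact_ind (P : Mset R -> Prop) :
  (forall S S', (forall x, S x -> S' x) -> P S' -> P S) ->
  (forall S S', P S -> P S' -> P (fun x => S x \/ S' x)) ->
  P (fun=> False) ->
  (forall q, X q -> exists2 d, 0 < d & P (fun x => X x /\ Mclose x q d)) -> P X.
Proof.
move=> mono union empty loc.
have loc' q : exists2 d, 0 < d & P (fun x => X x /\ Mclose x q d).
  have [Xq|nq] := pselect (X q); first exact: loc.
  have [d d0 hd] := Mclosed_open nq; exists d => //.
  by apply: mono empty => x [Xx /hd].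
pose zz (s t : R) := (s%:C)%C * om1 + (t%:C)%C * om2.
pose om := cabs om1 + cabs om2 + 1.
have om0 : 0 < om by rewrite /om; have := cabs_ge0 om1; have := cabs_ge0 om2; flra.
have zzd s t s' t' (d : R) : `|s' - s| < d -> `|t' - t| < d -> cabs (zz s' t' - zz s t) < d * om.
  move=> h1 h2; have -> : zz s' t' - zz s t = ((s' - s)%:C)%C * om1 + ((t' - t)%:C)%C * om2.
    by rewrite /zz !rmorphB /=; ring.
  apply: le_lt_trans (cabsD _ _) _; rewrite !cabsM !cabsR /om.
  have := cabs_ge0 om1; have := cabs_ge0 om2; have := normr_ge0 (s' - s).
  by nra.
(* Tube lemma: Cousin's lemma over the square of the chart at fixed torus parameters, and afterwards
   over the square of these parameters. *)
have tube k s t : exists2 d, 0 < d & P (fun x => X x /\ exists s' t' w,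
    [/\ `|s' - s| < d, `|t' - t| < d, inrect (-1) 1 (-1) 1 w & Meq x (pt k (zz s' t') w)]).
  apply: (@cousin_rectangle _ (fun a b c d => exists2 e, 0 < e & P (fun x => X x /\ exists s' t' w,
    [/\ `|s' - s| < e, `|t' - t| < e, inrect a b c d w & Meq x (pt k (zz s' t') w)]))); [flra|flra| |].
    move=> a b c d ab cd [e1 e10 P1] [e2 e20 P2] [e3 e30 P3] [e4 e40 P4].
    exists (Num.min (Num.min e1 e2) (Num.min e3 e4)); first by rewrite !lt_min e10 e20 e30.
    have := union _ _ (union _ _ P1 P2) (union _ _ P3 P4).
    apply: mono => x [Xx [s' [t' [w [h1 h2 [/andP[w1 w2] /andP[w3 w4]] h4]]]]].
    move: h1 h2; rewrite !lt_min => /andP[/andP[s1 s2] /andP[s3 s4]] /andP[/andP[t1 t2] /andP[t3 t4]].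
    have [xl|/ltW xl] := leP (re w) ((a + b) / 2); have [yl|/ltW yl] := leP (im w) ((c + d) / 2).
    - by left; left; split=> //; exists s', t', w; split=> //; split; apply/andP.
    - by right; left; split=> //; exists s', t', w; split=> //; split; apply/andP.
    - by left; right; split=> //; exists s', t', w; split=> //; split; apply/andP.
    - by right; right; split=> //; exists s', t', w; split=> //; split; apply/andP.
  move=> wx wy _ _; have [d d0 hd] := loc' (pt k (zz s t) (Complex wx wy)).
  exists (d / 2); first flra.
  move=> a b c d' _ ax xb _ _ cy yd _ wd hd'; exists (d / om); first exact: divr_gt0.
  apply: mono hd => x [Xx [s' [t' [w [h1 h2 [/andP[w1 w2] /andP[w3 w4]] h4]]]]].
  split=> //; apply: (coord_Mclose h4).
    by have := zzd _ _ _ _ _ h1 h2; rewrite divfK ?gt_eqF.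
  apply: le_lt_trans (cabs_le_ReIm _) _; rewrite reB imB /=.
  have : `|re w - wx| <= b - a by rewrite ler_norml; flra.
  have : `|im w - wy| <= d' - c by rewrite ler_norml; flra.
  by flra.
have half k : P (fun x => X x /\ exists s' t' w,
    [/\ 0 <= s' <= 1, 0 <= t' <= 1, inrect (-1) 1 (-1) 1 w & Meq x (pt k (zz s' t') w)]).
  apply: (@cousin_rectangle _ (fun a b c d => P (fun x => X x /\ exists s' t' w,
    [/\ a <= s' <= b, c <= t' <= d, inrect (-1) 1 (-1) 1 w & Meq x (pt k (zz s' t') w)]))); [flra|flra| |].
    move=> a b c d ab cd P1 P2 P3 P4.
    have := union _ _ (union _ _ P1 P2) (union _ _ P3 P4).
    apply: mono => x [Xx [s' [t' [w [/andP[w1 w2] /andP[w3 w4] h3 h4]]]]].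
    have [xl|/ltW xl] := leP s' ((a + b) / 2); have [yl|/ltW yl] := leP t' ((c + d) / 2).
    - by left; left; split=> //; exists s', t', w; split=> //; apply/andP.
    - by right; left; split=> //; exists s', t', w; split=> //; apply/andP.
    - by left; right; split=> //; exists s', t', w; split=> //; apply/andP.
    - by right; right; split=> //; exists s', t', w; split=> //; apply/andP.
  move=> s t _ _; have [d d0 hd] := tube k s t; exists d => //.
  move=> a b c d' _ ax xb _ _ cy yd _ wd hd'.
  apply: mono hd => x [Xx [s' [t' [w [/andP[w1 w2] /andP[w3 w4] h3 h4]]]]].
  by split=> //; exists s', t', w; split=> //; rewrite ltr_norml; apply/andP; split; flra.
apply: mono (union _ _ (half false) (half true)) => x Xx.
have [k [w [Ex w1]]] := pt_surj x; have [s [t [s01 t01 hl]]] := fundamental_domain x.1.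
have : exists s' t' w, [/\ 0 <= s' <= 1, 0 <= t' <= 1, inrect (-1) 1 (-1) 1 w & Meq x (pt k (zz s' t') w)].
  exists s, t, w; split=> //.
    have := Re_le_cabs w; have := Im_le_cabs w; rewrite !ler_norml => /andP[h1 h2] /andP[h3 h4].
    by split; apply/andP; split; flra.
  by split=> //; exact: (congr1 snd Ex).
by case: k {Ex} => h; [right|left].
Qed.
End Torus.

(** * Flow boxes in coordinates *)

Section Boxes.
Variable R : realType.
Local Notation C := R[i].
Variables om1 om2 : C.
Implicit Types (z w l t y a b : C) (p q x : Mpt R) (B : FlowBox R).
Local Notation inLat := (inLat om1 om2).
Local Notation Meq := (Meq om1 om2).
Local Notation Mclose := (Mclose om1 om2).
Local Notation inPlaque := (inPlaque om1 om2).

Lemma chart_transfer k1 k2 w1 w2 : p1chart k1 w1 = p1chart k2 w2 ->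
  exists (om : C -> C) (rho K : R), [/\ 0 < rho, 0 < K, om w1 = w2,
    forall w, cabs (w - w1) < rho -> p1chart k1 w = p1chart k2 (om w) &
    holo w1 rho om /\
    forall w w', cabs (w - w1) < rho -> cabs (w' - w1) < rho ->
      cabs (om w - om w') <= K * cabs (w - w')].
Proof.
have [<-|k12] := eqVneq k1 k2.
  move=> /p1chart_inj <-; exists id, 1, 1; split=> //; split; first exact: holo_id.
  by move=> w w' _ _; rewrite mul1r.
move=> E.
have [w0 w2E] : w1 != 0 /\ w2 = w1^-1.
  case: k1 k2 k12 E => [] [] //= _.
    by case: eqP => // /eqP w0 [<-].
  by case: eqP => // /eqP w0 [->]; rewrite invrK invr_eq0.
have aw : 0 < cabs w1 by rewrite cabs_gt0.
have near w : cabs (w - w1) < cabs w1 / 2 -> cabs w1 / 2 < cabs w.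
  by move=> h; have := cabs_lerB w1 w; rewrite (cabsB w1); flra.
have nz w : cabs (w - w1) < cabs w1 / 2 -> w != 0.
  by move=> /near h; rewrite -cabs_gt0; flra.
exists (fun w => w^-1), (cabs w1 / 2), (4 / cabs w1 ^+ 2); split=> //.
- by flra.
- by rewrite divr_gt0 // exprn_gt0.
- move=> w /nz wn; case: k1 k2 k12 {E} => [] [] //= _.
    by rewrite (negbTE wn).
  by rewrite invr_eq0 (negbTE wn) invrK.
split; first by apply: holoV; [exact: holo_id|exact: nz].
move=> w w' hw hw'; have wn := nz _ hw; have wn' := nz _ hw'.
have -> : w^-1 - w'^-1 = (w' - w) / (w * w') by field; rewrite wn wn'.
rewrite cabs_div cabsM (cabsB w') mulrC ler_wpM2r ?cabs_ge0 //.
have h1 := near _ hw; have h2 := near _ hw'.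
rewrite -[leRHS]invf_div lef_pV2 ?posrE ?mulr_gt0 ?divr_gt0 ?exprn_gt0 //; [|flra|flra].
have -> : cabs w1 ^+ 2 / 4 = (cabs w1 / 2) * (cabs w1 / 2) by field.
by apply: ler_pM; flra.
Qed.

(* In the coordinates [(t, y)] of a box, [t] runs along the plaques and [y] is transverse to them;
   [bsh B e] is the translation [Phi e] in these coordinates. *)
Definition bg B a t := a + fb_f B a t.
Definition bpt B t y := fb_phi B (if fb_vert B then (y, t) else (t, y)).
Definition bz B t y := if fb_vert B then y else t.
Definition bw B t y := if fb_vert B then t else y.
Definition bsh B (e : C) (ty : C * C) : C * C :=
  if fb_vert B then (ty.1, ty.2 + e) else (ty.1 + e, ty.2).

Lemma bptE B t y : bpt B t y = pt (fb_chart B) (fb_z0 B + bz B t y) (fb_w0 B + bw B t y).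
Proof. by rewrite /bpt /bz /bw /fb_phi; case: (fb_vert B). Qed.

Lemma inPlaqueE B a p : inPlaque B a p <-> exists t, cabs t < fb_r1 B /\ Meq p (bpt B t (bg B a t)).
Proof. by rewrite /Defs.inPlaque /bpt /bg /fb_coord; case: (fb_vert B). Qed.

Lemma Phi_bpt B e t y : Phi e (bpt B t y) = bpt B (bsh B e (t, y)).1 (bsh B e (t, y)).2.
Proof. by rewrite /Phi /bpt /bsh; case: (fb_vert B); rewrite /fb_phi /= addrA. Qed.

Lemma Phi_Meq e p q : Meq p q -> Meq (Phi e p) (Phi e q).
Proof. by move=> [h E]; split=> //=; have -> : p.1 + e - (q.1 + e) = p.1 - q.1 by ring. Qed.

Definition btrans B1 B2 (l : C) (om : C -> C) t y : C * C :=
  let z' := fb_z0 B1 + bz B1 t y + l - fb_z0 B2 in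
  let w' := om (fb_w0 B1 + bw B1 t y) - fb_w0 B2 in
  if fb_vert B2 then (w', z') else (z', w').

Lemma bsh_bz B e t y : bz B (bsh B e (t, y)).1 (bsh B e (t, y)).2 = bz B t y + e.
Proof. by rewrite /bz /bsh; case: (fb_vert B). Qed.
Lemma bsh_bw B e t y : bw B (bsh B e (t, y)).1 (bsh B e (t, y)).2 = bw B t y.
Proof. by rewrite /bw /bsh; case: (fb_vert B). Qed.

Lemma btrans_bz B1 B2 l om t y : let ty := btrans B1 B2 l om t y in
  bz B2 ty.1 ty.2 = fb_z0 B1 + bz B1 t y + l - fb_z0 B2.
Proof. by rewrite /= /btrans /bz; case: (fb_vert B2). Qed.
Lemma btrans_bw B1 B2 l om t y : let ty := btrans B1 B2 l om t y in
  bw B2 ty.1 ty.2 = om (fb_w0 B1 + bw B1 t y) - fb_w0 B2.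
Proof. by rewrite /= /btrans /bw; case: (fb_vert B2). Qed.

Lemma bz_bw_inj B t y t' y' : bz B t y = bz B t' y' -> bw B t y = bw B t' y' -> t = t' /\ y = y'.
Proof. by rewrite /bz /bw; case: (fb_vert B). Qed.

(* [B2] sees the point of coordinates [(t, y)] in [B1] at [T t y]; [T] is a translation in one variable
   and a change of chart in the other, hence commutes with [Phi e]. *)
Lemma transition B1 B2 t1 y1 t2 y2 : Meq (bpt B1 t1 y1) (bpt B2 t2 y2) ->
  exists (T : C -> C -> C * C) (rho K : R), [/\ 0 < rho, 1 <= K, T t1 y1 = (t2, y2),
   forall t y, cabs (t - t1) < rho -> cabs (y - y1) < rho ->
     Meq (bpt B1 t y) (bpt B2 (T t y).1 (T t y).2) &
   [/\ forall t y t' y', cabs (t - t1) < rho -> cabs (y - y1) < rho ->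
     cabs (t' - t1) < rho -> cabs (y' - y1) < rho ->
     cabs ((T t y).1 - (T t' y').1) <= K * (cabs (t - t') + cabs (y - y')) /\
     cabs ((T t y).2 - (T t' y').2) <= K * (cabs (t - t') + cabs (y - y')),
   forall t y e, T (bsh B1 e (t, y)).1 (bsh B1 e (t, y)).2 = bsh B2 e (T t y) &
   forall h c r, holo c r h -> (forall s, cabs (s - c) < r -> cabs (s - t1) < rho /\ cabs (h s - y1) < rho) ->
     holo c r (fun s => (T s (h s)).1) /\ holo c r (fun s => (T s (h s)).2)]].
Proof.
rewrite !bptE => -[hl /= /chart_transfer[om [rho [K [rho0 K0 Eom hom [holo_om lip_om]]]]]].
set w1 := fb_w0 B1 + bw B1 t1 y1 in Eom hom holo_om lip_om.
pose l := fb_z0 B2 + bz B2 t2 y2 - (fb_z0 B1 + bz B1 t1 y1).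
have nw t y : cabs (t - t1) < rho -> cabs (y - y1) < rho -> cabs (fb_w0 B1 + bw B1 t y - w1) < rho.
  move=> ht hy; have -> : fb_w0 B1 + bw B1 t y - w1 = bw B1 t y - bw B1 t1 y1 by rewrite /w1; ring.
  by rewrite /bw; case: (fb_vert B1).
exists (btrans B1 B2 l om), rho, (K + 1); split=> //.
- by flra.
- have f1 : bz B2 (btrans B1 B2 l om t1 y1).1 (btrans B1 B2 l om t1 y1).2 = bz B2 t2 y2.
    by rewrite btrans_bz /l; ring.
  have f2 : bw B2 (btrans B1 B2 l om t1 y1).1 (btrans B1 B2 l om t1 y1).2 = bw B2 t2 y2.
    by rewrite btrans_bw Eom; ring.
  have [<- <-] := bz_bw_inj f1 f2.
  by case: (btrans _ _ _ _ _ _).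
- move=> t y ht hy; rewrite !bptE btrans_bz btrans_bw; split => /=.
    have -> : fb_z0 B1 + bz B1 t y - (fb_z0 B2 + (fb_z0 B1 + bz B1 t y + l - fb_z0 B2)) = - l by ring.
    by rewrite /l opprB.
  rewrite (hom _ (nw _ _ ht hy)); congr p1chart; ring.
- split.
  + move=> t y t' y' ht hy ht' hy'.
    have A1 : cabs (bz B1 t y - bz B1 t' y') <= (K + 1) * (cabs (t - t') + cabs (y - y')).
      have := cabs_ge0 (t - t'); have := cabs_ge0 (y - y').
      by rewrite /bz; case: (fb_vert B1); nra.
    have A2 : cabs (om (fb_w0 B1 + bw B1 t y) - om (fb_w0 B1 + bw B1 t' y')) <= (K + 1) * (cabs (t - t') + cabs (y - y')).
      apply: le_trans (lip_om _ _ (nw _ _ ht hy) (nw _ _ ht' hy')) _.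
      have -> : fb_w0 B1 + bw B1 t y - (fb_w0 B1 + bw B1 t' y') = bw B1 t y - bw B1 t' y' by ring.
      have := cabs_ge0 (t - t'); have := cabs_ge0 (y - y').
      by rewrite /bw; case: (fb_vert B1); nra.
    have E1 : fb_z0 B1 + bz B1 t y + l - fb_z0 B2 - (fb_z0 B1 + bz B1 t' y' + l - fb_z0 B2) =
       bz B1 t y - bz B1 t' y' by ring.
    have E2 : om (fb_w0 B1 + bw B1 t y) - fb_w0 B2 - (om (fb_w0 B1 + bw B1 t' y') - fb_w0 B2) =
       om (fb_w0 B1 + bw B1 t y) - om (fb_w0 B1 + bw B1 t' y') by ring.
    by rewrite /btrans; case: (fb_vert B2); rewrite /= E1 E2.
  + move=> t y e; rewrite /btrans bsh_bz bsh_bw /bsh; case: (fb_vert B2) => /=; congr pair; ring.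
  + move=> h c r hh hs.
    have hz : holo c r (fun s => fb_z0 B1 + bz B1 s (h s) + l - fb_z0 B2).
      apply: holoB; last exact: holo_const.
      apply: holoD; last exact: holo_const.
      apply: holoD; first exact: holo_const.
      by rewrite /bz; case: (fb_vert B1) => //; exact: holo_id.
    have hw : holo c r (fun s => om (fb_w0 B1 + bw B1 s (h s)) - fb_w0 B2).
      apply: holoB; last exact: holo_const.
      apply: (holo_comp _ holo_om); last by move=> s /hs[? ?]; exact: nw.
      apply: holoD; first exact: holo_const.
      by rewrite /bw; case: (fb_vert B1) => //; exact: holo_id.
    by rewrite /btrans; case: (fb_vert B2).
Qed.

Variable X : Mset R.
Hypothesis Xinv : Minvariant om1 om2 X.

Lemma bpt_inj B t y t' y' : good_box om1 om2 X B ->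
  cabs (bz B t y) < fb_rz B -> cabs (bz B t' y') < fb_rz B ->
  Meq (bpt B t y) (bpt B t' y') -> t = t' /\ y = y'.
Proof.
move=> [_ [_ [_ [inj _]]]] h h'; rewrite !bptE => -[hl /= hw].
have cz (u : C) : fb_z0 B + u - fb_z0 B = u by ring.
apply: (@bz_bw_inj B).
  apply: (@addrI _ (fb_z0 B)); apply: inj => //; rewrite ?cz //.
apply: (@addrI _ (fb_w0 B)); exact: p1chart_inj hw.
Qed.

Lemma gb_dom B a t : good_box om1 om2 X B -> fb_A B a -> cabs t < fb_r1 B ->
  cabs (bz B t (bg B a t)) < fb_rz B.
Proof.
move=> [_ [_ [_ [_ [_ [h _]]]]]] Aa ht; have [h1 _] := h a t Aa ht.
by move: h1; rewrite /fb_coord /bz /bg; case: (fb_vert B).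
Qed.

Lemma gb_bound B : good_box om1 om2 X B -> exists2 M, 0 < M &
  forall a t, fb_A B a -> cabs t < fb_r1 B -> cabs (bg B a t) <= M.
Proof.
move=> [_ [rz [rw [_ [_ [h _]]]]]]; exists (fb_rz B + fb_rw B); first by flra.
move=> a t Aa ht; have [h1 h2] := h a t Aa ht.
by move: h1 h2; rewrite /fb_coord /bg; case: (fb_vert B) => /=; flra.
Qed.

Lemma gb_holo B a : good_box om1 om2 X B -> fb_A B a -> holo 0 (fb_r1 B) (bg B a).
Proof.
move=> [_ [_ [_ [_ [_ [_ [h _]]]]]]] /h[_ /holo_discP hf].
by apply: holoD => //; exact: holo_const.
Qed.

Lemma gb_center B a : good_box om1 om2 X B -> fb_A B a -> bg B a 0 = a.
Proof. by move=> [_ [_ [_ [_ [_ [_ [h _]]]]]]] /h[h0 _]; rewrite /bg h0 addr0. Qed.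

Lemma gb_X B a t : good_box om1 om2 X B -> fb_A B a -> cabs t < fb_r1 B -> X (bpt B t (bg B a t)).
Proof.
move=> [_ [_ [_ [_ [_ [_ [_ [_ [h _]]]]]]]]] Aa ht; apply: (h a) => //.
by apply/inPlaqueE; exists t; split=> //; exact: Meq_refl.
Qed.

Lemma gb_disj B a b p : good_box om1 om2 X B -> fb_A B a -> fb_A B b ->
  inPlaque B a p -> inPlaque B b p -> a = b.
Proof.
move=> [_ [_ [_ [_ [_ [_ [_ [_ [_ h]]]]]]]]] Aa Ab pa pb.
by apply: contrapT => ab; exact: h ab pa pb.
Qed.

Lemma gb_neq B a b t : good_box om1 om2 X B -> fb_A B a -> fb_A B b -> cabs t < fb_r1 B ->
  bg B a t = bg B b t -> a = b.
Proof.
move=> gB Aa Ab ht E; apply: (gb_disj gB Aa Ab (p := bpt B t (bg B a t))); apply/inPlaqueE.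
  by exists t; split=> //; exact: Meq_refl.
by exists t; split=> //; rewrite E; exact: Meq_refl.
Qed.

Lemma inPlaque_coord B a t y : good_box om1 om2 X B -> fb_A B a -> cabs (bz B t y) < fb_rz B ->
  inPlaque B a (bpt B t y) <-> (cabs t < fb_r1 B /\ y = bg B a t).
Proof.
move=> gB Aa hd; split=> [/inPlaqueE[t' [ht' E]]|[ht ->]].
  by have [-> ->] := bpt_inj gB hd (gb_dom gB Aa ht') E.
by apply/inPlaqueE; exists t; split=> //; exact: Meq_refl.
Qed.

Lemma inPlaque_Meq B a p q : Meq p q -> inPlaque B a p -> inPlaque B a q.
Proof. by move=> pq [t [ht E]]; exists t; split=> //; apply: Meq_trans E; exact: Meq_sym. Qed.

(** Distinct plaques are disjoint graphs, so their difference has no zero. The resulting continuity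
    is uniform in both labels and may start from any point [s], where [good_box] fixes one label and
    compares at the centre. *)
Lemma gb_harnack B (rho : R) : good_box om1 om2 X B -> 0 < rho -> rho < fb_r1 B ->
  forall e, 0 < e -> exists2 d, 0 < d & forall a b s t, fb_A B a -> fb_A B b ->
   cabs s < rho -> cabs t < rho -> cabs (bg B a s - bg B b s) < d -> cabs (bg B a t - bg B b t) < e.
Proof.
move=> gB rho0 rr e e0; have [M M0 hM] := gb_bound gB.
have [d d0 hd] := harnack (2 * M) rho0 rr e0.
exists d => // a b s t Aa Ab hs ht h.
have [->|ab] := eqVneq a b; first by rewrite subrr cabs0.
apply: (hd 0 (fun t => bg B a t - bg B b t) s t) => //; rewrite ?subr0 //.
  by apply: holoB; exact: gb_holo.
move=> z; rewrite subr0 => hz; split.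
  by rewrite subr_eq0; apply: contra_neq ab; exact: gb_neq.
apply: le_trans (cabsD _ _) _; rewrite cabsN; have := hM a z Aa hz; have := hM b z Ab hz; flra.
Qed.

Lemma gb_lipschitz B (rho : R) : good_box om1 om2 X B -> rho < fb_r1 B -> exists2 L, 0 < L &
  forall a s t, fb_A B a -> cabs s <= rho -> cabs t < fb_r1 B -> cabs (bg B a t - bg B a s) <= L * cabs (t - s).
Proof.
move=> gB rr; have [M M0 hM] := gb_bound gB.
exists (8 * M / (fb_r1 B - rho)); first by rewrite divr_gt0 ?mulr_gt0 // subr_gt0.
move=> a s t Aa hs ht.
have hb w : cabs (w - 0) < fb_r1 B -> cabs (bg B a w) <= M by rewrite subr0; exact: hM.
apply: le_trans (cauchy_lipschitz (gb_holo gB Aa) hb _ _) _; rewrite ?subr0 //; first flra.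
rewrite ler_wpM2r ?cabs_ge0 // ler_wpM2l ?mulr_ge0 ?(ltW M0) //.
by rewrite lef_pV2 ?posrE; flra.
Qed.

Lemma box_nbhd_coord B t0 y0 : good_box om1 om2 X B -> cabs t0 < fb_r1 B -> cabs (bz B t0 y0) < fb_rz B ->
  box_nbhd om1 om2 X B (bpt B t0 y0) <->
  exists2 d, 0 < d & forall t y, cabs (t - t0) < d -> cabs (y - y0) < d -> X (bpt B t y) ->
    exists2 a, fb_A B a & y = bg B a t.
Proof.
move=> gB ht0 hz0.
have bzd (t y : C) d : cabs (t - t0) < d -> cabs (y - y0) < d -> cabs (bz B t y) < d + cabs (bz B t0 y0).
  move=> h1 h2; have h : cabs (bz B t y - bz B t0 y0) < d by rewrite /bz; case: (fb_vert B).
  by have := cabs_lerB (bz B t y) (bz B t0 y0); flra.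
split=> [[d [d0 hd]]|[d d0 hd]].
  exists (Num.min d (fb_rz B - cabs (bz B t0 y0))); first by rewrite lt_min d0 subr_gt0.
  move=> t y; rewrite !lt_min => /andP[t1 t2] /andP[y1 y2] Xp.
  have [|a [Aa pa]] := hd _ Xp.
    rewrite !bptE; apply: (coord_Mclose (Meq_refl _ _ _)).
      have -> : fb_z0 B + bz B t y - (fb_z0 B + bz B t0 y0) = bz B t y - bz B t0 y0 by ring.
      by rewrite /bz; case: (fb_vert B).
    have -> : fb_w0 B + bw B t y - (fb_w0 B + bw B t0 y0) = bw B t y - bw B t0 y0 by ring.
    by rewrite /bw; case: (fb_vert B).
  have hz : cabs (bz B t y) < fb_rz B by have := bzd _ _ _ t2 y2; flra.
  by have [_ E] := (inPlaque_coord gB Aa hz).1 pa; exists a.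
pose d' := Num.min d (Num.min (fb_r1 B - cabs t0) (fb_rz B - cabs (bz B t0 y0))).
have d'0 : 0 < d' by rewrite !lt_min d0 !subr_gt0 ht0.
have [e e0 he] := @Mclose_coord R om1 om2 (fb_chart B) (fb_z0 B + bz B t0 y0) (fb_w0 B + bw B t0 y0) d' d'0.
exists e; split=> // p Xp; rewrite bptE => /he[z' [w' [hp hz hw]]].
pose t := if fb_vert B then w' - fb_w0 B else z' - fb_z0 B.
pose y := if fb_vert B then z' - fb_z0 B else w' - fb_w0 B.
have Eb : bpt B t y = pt (fb_chart B) z' w'.
  by rewrite bptE /bz /bw /t /y; case: (fb_vert B); rewrite !subrKC.
have [td yd] : cabs (t - t0) < d' /\ cabs (y - y0) < d'.
  have Ez : z' - (fb_z0 B + bz B t0 y0) = z' - fb_z0 B - bz B t0 y0 by ring.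
  have Ew : w' - (fb_w0 B + bw B t0 y0) = w' - fb_w0 B - bw B t0 y0 by ring.
  by move: hz hw; rewrite Ez Ew /t /y /bz /bw; case: (fb_vert B).
move: (td) (yd); rewrite /d' !lt_min => /and3P[t1 t2 t3] /and3P[y1 y2 y3].
have [|a Aa ya] := hd t y t1 y1; first by rewrite Eb; exact: Xinv hp.
exists a; split=> //; apply: (inPlaque_Meq (Meq_sym hp)); rewrite -Eb.
apply/inPlaque_coord => //.
  by have := bzd t y _ t3 y3; flra.
split=> //; have := cabs_lerB t t0; flra.
Qed.
End Boxes.

(** * Compatibility of plaques *)

Section LeafCountable.
Variable R : realType.
Local Notation C := R[i].
Variables om1 om2 : C.
Hypothesis hom1 : om1 != 0.
Hypothesis hom : cim (om2 / om1) != 0.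
Variable L : Lamination R.
Hypothesis hL : is_lamination om1 om2 L.
Implicit Types (z w l t y a b c : C) (p q x : Mpt R) (B : FlowBox R).
Local Notation inLat := (inLat om1 om2).
Local Notation Meq := (Meq om1 om2).
Local Notation Mclose := (Mclose om1 om2).
Local Notation inPlaque := (inPlaque om1 om2).
Local Notation X := (lam_X L).
Local Notation leaf := (leaf om1 om2 L).
Local Notation gam B a t := (bpt B t (bg B a t)).
Local Notation Flow := (flow_box_of om1 om2 L).
Local Notation box_nbhd := (box_nbhd om1 om2 X).

Lemma lam_inv : Minvariant om1 om2 X. Proof. by case: hL. Qed.
Lemma lam_closed : Mclosed om1 om2 X. Proof. by case: hL. Qed.

Lemma atlas_flow B : lam_atlas L B -> Flow B.
Proof.
move=> AB; split; first by case: hL => _ _ h _ _; exact: h.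
by move=> a p q Aa pa qa; apply: rt_step; exists B, a.
Qed.

Lemma atlas_box q : X q -> exists2 B, lam_atlas L B & box_nbhd B q.
Proof. by move=> Xq; case: hL => _ _ _ h _; have [B []] := h q Xq; exists B. Qed.

Lemma Mclose_refl q (d : R) : 0 < d -> Mclose q q d.
Proof.
move=> d0; have [k [w [E _]]] := pt_surj q.
rewrite {2}E; apply: (@coord_Mclose _ _ _ k q.1 w q.1 w); rewrite ?subrr ?cabs0 //.
by rewrite -E; exact: Meq_refl.
Qed.

Lemma box_nbhd_plaque B q : box_nbhd B q -> X q -> exists2 a, fb_A B a & inPlaque B a q.
Proof. by move=> [d [d0 hd]] Xq; have [a [Aa pa]] := hd q Xq (Mclose_refl _ d0); exists a. Qed.

Lemma Mclose_open q (d0 : R) : 0 < d0 -> exists2 d, 0 < d & forall q', Mclose q' q d ->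
  exists2 d', 0 < d' & forall p, Mclose p q' d' -> Mclose p q d0.
Proof.
move=> d00; have [k [w [E _]]] := pt_surj q.
have d2 : 0 < d0 / 2 by flra.
have [d dd0 hd] := @Mclose_coord R om1 om2 k q.1 w _ d2.
exists d => // q'; rewrite E => /hd[z' [w' [hq' hz hw]]].
have [d' d'0 hd'] := @Mclose_coord R om1 om2 k z' w' _ d2.
exists d' => // p /(Mclose_r hq')/hd'[z'' [w'' [hp hz' hw']]].
apply: (coord_Mclose hp).
  by have := cabs_distD z' z'' q.1; flra.
by have := cabs_distD w' w'' w; flra.
Qed.

Lemma box_nbhd_open B q : box_nbhd B q ->
  exists2 d, 0 < d & forall q', Mclose q' q d -> box_nbhd B q'.
Proof.
move=> [d [d0 hd]]; have [e e0 he] := Mclose_open q d0.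
exists e => // q' /he[d' d'0 hd']; exists d'; split=> // p Xp /hd'; exact: hd.
Qed.

Lemma box_nbhd_Meq B q q' : Meq q q' -> box_nbhd B q -> box_nbhd B q'.
Proof.
move=> E [d [d0 hd]]; exists d; split=> // p Xp h; apply: hd => //.
exact: Mclose_r (Meq_sym E) h.
Qed.

Lemma flow_good B : Flow B -> good_box om1 om2 X B. Proof. by case. Qed.

Lemma gam_continuous B a t (d : R) : good_box om1 om2 X B -> fb_A B a -> cabs t < fb_r1 B -> 0 < d ->
  exists2 e, 0 < e & forall s, cabs (s - t) < e -> cabs s < fb_r1 B /\ Mclose (gam B a s) (gam B a t) d.
Proof.
move=> gB Aa ht d0.
have cg : ccont (bg B a) t by apply: (holo_cont (gb_holo gB Aa)); rewrite subr0.
have [e e0 he] := cg _ d0.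
exists (Num.min (fb_r1 B - cabs t) (Num.min d e)); first by rewrite !lt_min subr_gt0 ht d0.
move=> s; rewrite !lt_min => /and3P[h1 h2 /he h3]; split.
  by have := cabs_lerB s t; flra.
rewrite !bptE; apply: (coord_Mclose (Meq_refl _ _ _)).
  have -> : fb_z0 B + bz B s (bg B a s) - (fb_z0 B + bz B t (bg B a t)) =
    bz B s (bg B a s) - bz B t (bg B a t) by ring.
  by rewrite /bz; case: (fb_vert B).
have -> : fb_w0 B + bw B s (bg B a s) - (fb_w0 B + bw B t (bg B a t)) =
  bw B s (bg B a s) - bw B t (bg B a t) by ring.
by rewrite /bw; case: (fb_vert B).
Qed.

Lemma inPlaque_gam B a t : cabs t < fb_r1 B -> inPlaque B a (gam B a t).
Proof. by move=> ht; apply/inPlaqueE; exists t; split=> //; exact: Meq_refl. Qed.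

Lemma atlas_compat B B' a a' t : lam_atlas L B -> lam_atlas L B' -> fb_A B a -> fb_A B' a' ->
  cabs t < fb_r1 B -> inPlaque B' a' (gam B a t) ->
  exists2 d, 0 < d & forall s, cabs (s - t) < d -> cabs s < fb_r1 B /\ inPlaque B' a' (gam B a s).
Proof.
move=> AB AB' Aa Aa' ht pa'; have gB := flow_good (atlas_flow AB).
case: hL => _ _ _ _ compat.
have [d [d0 hd]] := compat _ _ _ _ _ AB AB' Aa Aa' (inPlaque_gam a ht) pa'.
have [e e0 he] := gam_continuous gB Aa ht d0.
exists e => // s /he[h1 /hd h2]; split=> //; apply/h2; exact: inPlaque_gam.
Qed.

Lemma rat_dense t (d : R) : 0 < d -> exists u : rat * rat, cabs (Complex (ratr u.1) (ratr u.2) - t) < d.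
Proof.
case: t => x y d0; have d2 : 0 < d / 2 by flra.
have [u hu] := @rat_in_itvoo R (x - d / 2) (x + d / 2) (ltac:(flra)).
have [v hv] := @rat_in_itvoo R (y - d / 2) (y + d / 2) (ltac:(flra)).
rewrite in_itv /= in hu; rewrite in_itv /= in hv.
move: hu hv => /andP[u1 u2] /andP[v1 v2]; exists (u, v).
apply: le_lt_trans (cabs_le_ReIm _) _; rewrite reB imB /=.
have : `|ratr u - x| < d / 2 by rewrite ltr_norml; apply/andP; split; flra.
have : `|ratr v - y| < d / 2 by rewrite ltr_norml; apply/andP; split; flra.
by flra.
Qed.

(* Distinct plaques of [B'] cut a plaque of [B] in disjoint open sets. *)
Lemma crossing_countable B a B' : lam_atlas L B -> fb_A B a -> lam_atlas L B' ->
  countable [set c | fb_A B' c /\ exists p, inPlaque B a p /\ inPlaque B' c p].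
Proof.
move=> AB Aa AB'; have gB' := flow_good (atlas_flow AB').
have H c : exists u : rat * rat, fb_A B' c -> (exists p, inPlaque B a p /\ inPlaque B' c p) ->
    inPlaque B' c (gam B a (Complex (ratr u.1) (ratr u.2))).
  have [[Ac [p [pa pc]]]|h] := pselect (fb_A B' c /\ exists p, inPlaque B a p /\ inPlaque B' c p); last first.
    by exists (0, 0) => Ac hp; case: h.
  have [t [ht E]] := (inPlaqueE _ _ _ _ _).1 pa.
  have [d d0 hd] := atlas_compat AB AB' Aa Ac ht (inPlaque_Meq E pc).
  have [u hu] := rat_dense t d0.
  by exists u => _ _; exact: (hd _ hu).2.
have [f hf] := choice H.
apply/countable_injP; exists (fun c => choice.pickle (f c)).
move=> c c'; rewrite !inE => -[Ac hc] [Ac' hc'] /(pcan_inj choice.pickleK) E.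
apply: (gb_disj gB' Ac Ac' (hf c Ac hc)).
by rewrite E; exact: hf.
Qed.

Lemma finite_atlas : exists (n : nat) (b : nat -> FlowBox R),
  (forall i, (i < n)%N -> lam_atlas L (b i)) /\
  forall q, X q -> exists2 i, (i < n)%N & box_nbhd (b i) q.
Proof.
pose P (U : Mset R) := exists (n : nat) (b : nat -> FlowBox R),
  (forall i, (i < n)%N -> lam_atlas L (b i)) /\
  forall q, U q -> exists2 i, (i < n)%N & box_nbhd (b i) q.
apply: (@Mcompact_ind _ om1 om2 hom1 hom X lam_closed P).
- by move=> S S' SS' [n [b [h1 h2]]]; exists n, b; split=> // q /SS'/h2.
- move=> S S' [n [b [h1 h2]]] [n' [b' [h1' h2']]].
  exists (n + n')%N, (fun i => if (i < n)%N then b i else b' (i - n)%N); split.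
    move=> i hi; case: ifPn => [/h1//|ni]; apply: h1'; lia.
  move=> q [/h2[i hi hq]|/h2'[i hi hq]].
    by exists i; rewrite ?hi //; lia.
  exists (n + i)%N; first by rewrite ltn_add2l.
  by rewrite ltnNge leq_addr /= addKn.
- by exists 0%N, (fun _ => Build_FlowBox false false 0 0 1 1 1 (fun=> False) (fun _ _ => 0)).
- move=> q Xq; have [B AB hB] := atlas_box Xq; have [d d0 hd] := box_nbhd_open hB.
  exists d => //; exists 1%N, (fun=> B); split=> // x [_ hx].
  by exists 0%N => //; exact: hd.
Qed.

Lemma leaf_X p q : X p -> leaf p q -> X q.
Proof.
move=> Xp h; elim: h Xp => {p q}// [p q [B [a [AB [Aa [_ qa]]]]] _|p q x _ h1 _ h2 Xp].
  have gB := flow_good (atlas_flow AB).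
  have [t [ht E]] := (inPlaqueE _ _ _ _ _).1 qa.
  exact: lam_inv (gb_X gB Aa ht) (Meq_sym E).
by apply: h2; exact: h1.
Qed.

(** Each plaque meets countably many plaques of the finite atlas, so the set [RU] of plaques reached
    by finite chains is countable. It covers the leaf, and each of its members meets countably many
    plaques of [B]. *)
Lemma leaf_labels_countable B p : lam_atlas L B -> X p ->
  countable [set c | fb_A B c /\ exists q, leaf p q /\ inPlaque B c q].
Proof.
move=> AB Xp; have [n [b [hb cov]]] := finite_atlas.
pose valid (ia : nat * C) := (ia.1 < n)%N /\ fb_A (b ia.1) ia.2.
pose nb (ia : nat * C) := [set jc | valid jc /\ exists q, inPlaque (b ia.1) ia.2 q /\ inPlaque (b jc.1) jc.2 q].
have nbc ia : valid ia -> countable (nb ia).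
  move=> [hi Aa].
  have : countable (\bigcup_(j in [set j | (j < n)%N])
     ((fun c => (j, c)) @` [set c | fb_A (b j) c /\ exists q, inPlaque (b ia.1) ia.2 q /\ inPlaque (b j) c q])).
    apply: bigcup_countable; first exact: countableP.
    move=> j jn; apply: card_le_trans (card_image_le _ _) _.
    exact: (crossing_countable (hb _ hi) Aa (hb _ jn)).
  apply: sub_countable; apply: subset_card_le => -[j c] [[/= jn Ac] hq].
  by exists j => //; exists c.
have [i0 i0n hi0] := cov p Xp; have [a0 Aa0 pa0] := box_nbhd_plaque hi0 Xp.
pose Reach := fix Reach k := if k is k'.+1 then \bigcup_(ia in Reach k') nb ia else [set (i0, a0)].
have Rv k ia : Reach k ia -> valid ia.
  by case: k => [->|k [x _ []]].
have Rc k : countable (Reach k).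
  elim: k => [|k IH]; first exact: countable1.
  by apply: bigcup_countable => // ia /Rv; exact: nbc.
pose RU := \bigcup_k Reach k.
have RUc : countable RU by apply: bigcup_countable => // k _; exact: Rc.
have RUnb ia jc q : RU ia -> valid jc -> inPlaque (b ia.1) ia.2 q -> inPlaque (b jc.1) jc.2 q -> RU jc.
  by move=> [k _ hk] vj h1 h2; exists k.+1 => //; exists ia => //; split=> //; exists q.
pose Inv q := exists ia, RU ia /\ inPlaque (b ia.1) ia.2 q.
have InvL q : leaf p q -> Inv q.
  have I0 : Inv p by exists (i0, a0); split=> //; exists 0%N.
  move=> h; elim: h I0 => {Xp hi0 pa0}{}p.
  - move=> {}q [B1 [a [AB1 [Aa [p1 q1]]]]] Ip.
    have gB1 := flow_good (atlas_flow AB1).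
    have [t [ht Et]] := (inPlaqueE _ _ _ _ _).1 p1; have [s [hs Es]] := (inPlaqueE _ _ _ _ _).1 q1.
    have InvM x x' : Meq x x' -> Inv x -> Inv x'.
      by move=> E [ia [h1 h2]]; exists ia; split=> //; exact: inPlaque_Meq h2.
    apply: (InvM _ _ (Meq_sym Es)).
    (* A step of the leaf may use an atlas box outside the finite family; its plaque is followed
       through the boxes of that family. *)
    apply: (@disc_connected R 0 (fb_r1 B1) (fun t => Inv (gam B1 a t)) _ t s); rewrite ?subr0 //; last exact: InvM Ip.
    move=> z; rewrite subr0 => hz; have Xz := gb_X gB1 Aa hz.
    have [i hi hbi] := cov _ Xz; have [c Ac pc] := box_nbhd_plaque hbi Xz.
    have [d d0 hd] := atlas_compat AB1 (hb _ hi) Aa Ac hz pc.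
    exists d => // w _ wz; have [hw pw] := hd w wz.
    split=> -[ia [h1 h2]]; exists (i, c); split=> //.
      by apply: (RUnb ia _ (gam B1 a z)).
    by apply: (RUnb ia _ (gam B1 a w)).
  - by [].
  - by move=> q1 q2 _ h1 _ h2 /h1/h2.
have : countable (\bigcup_(ia in RU) [set c | valid ia /\ fb_A B c /\ exists q, inPlaque (b ia.1) ia.2 q /\ inPlaque B c q]).
  apply: bigcup_countable => // ia [k _ /Rv [hi Aa]].
  apply: sub_countable (crossing_countable (hb _ hi) Aa AB).
  by apply: subset_card_le => c [].
apply: sub_countable; apply: subset_card_le => c [Ac [q [/InvL[ia [h1 h2]] h3]]].
exists ia => //; split; first by case: h1 => k _ /Rv.
by split=> //; exists q.
Qed.
End LeafCountable.

Section Compat.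
Variable R : realType.
Local Notation C := R[i].
Variables om1 om2 : C.
Hypothesis hom1 : om1 != 0.
Hypothesis hom : cim (om2 / om1) != 0.
Variable L : Lamination R.
Hypothesis hL : is_lamination om1 om2 L.
Implicit Types (z w l t y a b c : C) (p q x : Mpt R) (B : FlowBox R).
Local Notation inLat := (inLat om1 om2).
Local Notation Meq := (Meq om1 om2).
Local Notation Mclose := (Mclose om1 om2).
Local Notation inPlaque := (inPlaque om1 om2).
Local Notation X := (lam_X L).
Local Notation leaf := (leaf om1 om2 L).
Local Notation gam B a t := (bpt B t (bg B a t)).
Local Notation Flow := (flow_box_of om1 om2 L).
Local Notation box_nbhd := (box_nbhd om1 om2 X).

(** A continuous path takes all values between its end values, and a nondegenerate interval has
    positive measure. *)
Lemma countable_path_const (f : R -> R) (A : set R) : countable A ->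
  (forall s, 0 <= s <= 1 -> A (f s)) ->
  (forall s e, 0 <= s <= 1 -> 0 < e -> exists2 d, 0 < d &
     forall s', 0 <= s' <= 1 -> `|s' - s| < d -> `|f s' - f s| < e) -> f 0 = f 1.
Proof.
move=> cA fA cf.
have main (v : R) : f 0 < v < f 1 \/ f 1 < v < f 0 -> A v.
  move=> hv; apply: contrapT => nA.
  have nv s : 0 <= s <= 1 -> f s != v by move=> hs; apply/eqP => E; apply: nA; rewrite -E; exact: fA.
  have conn (b : bool) : (f 0 < v) = b -> (f 1 < v) = b.
    move=> E0; apply: (@interval_connected R (fun s => (f s < v) = b)) => //; last by rewrite ler01 lexx.
    move=> s hs; have e0 : 0 < `|f s - v| by rewrite normr_gt0 subr_eq0 nv.
    have [d d0 hd] := cf s _ hs e0; exists d => // s' hs' ss'; have := hd s' hs' ss'.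
    have := nv s hs; rewrite neq_lt => /orP[sv|sv].
      rewrite [X in _ < X]ltr0_norm ?subr_lt0 // ltr_norml => /andP[h1 h2].
      by rewrite sv; have -> : f s' < v by flra.
    rewrite [X in _ < X]gtr0_norm ?subr_gt0 // ltr_norml => /andP[h1 h2].
    have -> : (f s < v) = false by apply/negbTE; rewrite -leNgt ltW.
    by have -> : (f s' < v) = false by apply/negbTE; rewrite -leNgt; flra.
  by case: hv => /andP[v1 v2]; [have := conn _ v1|have := conn _ (le_gtF (ltW v2))]; flra.
apply: contrapT => /eqP; rewrite neq_lt => /orP[h|h].
  have sub : `]f 0, f 1[ `<=` A by move=> v /=; rewrite in_itv /= => hv; apply: main; left.
  have c := sub_countable (subset_card_le sub) cA.
  have := countable_lebesgue_measure0 c; rewrite lebesgue_measure_itv /= lte_fin h -EFinB => -[] E.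
  by flra.
have sub : `]f 1, f 0[ `<=` A by move=> v /=; rewrite in_itv /= => hv; apply: main; right.
have c := sub_countable (subset_card_le sub) cA.
have := countable_lebesgue_measure0 c; rewrite lebesgue_measure_itv /= lte_fin h -EFinB => -[] E.
by flra.
Qed.

Lemma ccountable_path_const (f : R -> C) (A : set C) : countable A ->
  (forall s, 0 <= s <= 1 -> A (f s)) ->
  (forall s e, 0 <= s <= 1 -> 0 < e -> exists2 d, 0 < d &
     forall s', 0 <= s' <= 1 -> `|s' - s| < d -> cabs (f s' - f s) < e) -> f 0 = f 1.
Proof.
move=> cA fA cf.
have Re_eq : complex.Re (f 0) = complex.Re (f 1).
  apply: (@countable_path_const (fun s => complex.Re (f s)) ((@complex.Re R) @` A)).
  - exact: sub_countable (card_image_le _ _) cA.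
  - by move=> s hs; exists (f s) => //; exact: fA.
  - move=> s e hs e0; have [d d0 hd] := cf s e hs e0; exists d => // s' hs' ss'.
    by apply: le_lt_trans (hd s' hs' ss'); rewrite -reB; exact: Re_le_cabs.
have Im_eq : complex.Im (f 0) = complex.Im (f 1).
  apply: (@countable_path_const (fun s => complex.Im (f s)) ((@complex.Im R) @` A)).
  - exact: sub_countable (card_image_le _ _) cA.
  - by move=> s hs; exists (f s) => //; exact: fA.
  - move=> s e hs e0; have [d d0 hd] := cf s e hs e0; exists d => // s' hs' ss'.
    by apply: le_lt_trans (hd s' hs' ss'); rewrite -imB; exact: Im_le_cabs.
by move: Re_eq Im_eq; case: (f 0) => ? ?; case: (f 1) => ? ? /= -> ->.
Qed.

(* Labels of the plaques of an atlas box met along a plaque of [B] form a continuous path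
   (Harnack) with countably many values. *)
Lemma flow_atlas_compat B B0 a c t : Flow B -> lam_atlas L B0 -> fb_A B a -> fb_A B0 c ->
  cabs t < fb_r1 B -> box_nbhd B0 (gam B a t) -> inPlaque B0 c (gam B a t) ->
  exists2 d, 0 < d & forall s, cabs (s - t) < d -> cabs s < fb_r1 B /\ inPlaque B0 c (gam B a s).
Proof.
move=> FB AB0 Aa Ac ht hB0 pc.
have gB := flow_good FB; have gB0 := flow_good (atlas_flow hL AB0).
have inv := lam_inv hL.
have [tau0 [htau0 E0]] := (inPlaqueE _ _ _ _ _).1 pc.
set y0 := bg B0 c tau0 in E0.
have hz0 : cabs (bz B0 tau0 y0) < fb_rz B0 by exact: gb_dom gB0 Ac htau0.
have [T [rho [K [rho0 K1 ET TM [Tlip _ Thol]]]]] := transition E0.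
have [dl dl0 hdl] := (box_nbhd_coord inv gB0 htau0 hz0).1 (box_nbhd_Meq E0 hB0).
have cg : ccont (bg B a) t by apply: (holo_cont (gb_holo gB Aa)); rewrite subr0.
pose e1 := Num.min (dl / (4 * K)) (Num.min rho ((fb_r1 B0 - cabs tau0) / (4 * K))).
have K4 : 0 < 4 * K by flra.
have e10 : 0 < e1 by rewrite !lt_min rho0 !divr_gt0 ?subr_gt0.
have [e2 e20 he2] := cg _ e10.
pose d := Num.min e1 (Num.min e2 (fb_r1 B - cabs t)).
have d0 : 0 < d by rewrite lt_min e10 lt_min e20 subr_gt0.
exists d => // s hs.
have near u : cabs (u - t) < d -> [/\ cabs u < fb_r1 B, cabs (u - t) < rho, cabs (bg B a u - bg B a t) < rho,
   cabs ((T u (bg B a u)).1 - tau0) < Num.min dl ((fb_r1 B0 - cabs tau0) / 2) &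
   cabs ((T u (bg B a u)).2 - y0) < dl].
  rewrite lt_min => /andP[u1]; rewrite lt_min => /andP[/he2 u2 u3].
  have ur : cabs u < fb_r1 B by have := cabs_lerB u t; flra.
  move: (u1) (u2); rewrite /e1 !lt_min => /and3P[a1 a2 a3] /and3P[b1 b2 b3].
  have tt0 : cabs (t - t) < rho by rewrite subrr cabs0.
  have yy0 : cabs (bg B a t - bg B a t) < rho by rewrite subrr cabs0.
  have [] := Tlip _ _ _ _ a2 b2 tt0 yy0; rewrite ET /= => l1 l2.
  move: a1 a3 b1 b3; rewrite !ltr_pdivlMr // => a1 a3 b1 b3.
  split=> //; last by flra.
  by apply/andP; split; flra.
have lab u : exists c', cabs (u - t) < d -> fb_A B0 c' /\ (T u (bg B a u)).2 = bg B0 c' (T u (bg B a u)).1.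
  have [hu|hu] := pselect (cabs (u - t) < d); last by exists c.
  have [ur u1 u2 u3 u4] := near u hu; move: u3; rewrite lt_min => /andP[u3 _].
  have [|c' Ac' E] := hdl _ _ u3 u4; first exact: inv (gb_X gB Aa ur) (TM _ _ u1 u2).
  by exists c'.
have [lb hlb] := choice lab.
have labP u : cabs (u - t) < d -> inPlaque B0 (lb u) (gam B a u).
  move=> hu; have [ur u1 u2 u3 u4] := near u hu; have [Al El] := hlb u hu.
  apply/inPlaqueE; exists (T u (bg B a u)).1; rewrite -El; split; last exact: TM.
  by move: u3; rewrite lt_min => /andP[_ u3]; have := cabs_lerB (T u (bg B a u)).1 tau0; flra.
have tt : cabs (t - t) < d by rewrite subrr cabs0.
have lbt : lb t = c.
  by apply: (gb_disj gB0 _ Ac (labP t tt) pc); exact: (hlb t tt).1.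
have [ur _ _ _ _] := near s hs; split=> //.
suff <- : lb s = c by exact: labP.
have Xt := gb_X gB Aa ht.
pose path (r : R) := t + (r%:C)%C * (s - t).
have hpath r : 0 <= r <= 1 -> cabs (path r - t) < d by move=> hr; exact: disc_convex.
have := @ccountable_path_const (fun r => lb (path r)) _ (leaf_labels_countable hom1 hom hL AB0 Xt).
rewrite /path mul0r addr0 mul1r subrKC lbt => <- //.
  move=> r hr; have hp := hpath r hr; split; first exact: (hlb _ hp).1.
  exists (gam B a (path r)); split; last exact: labP.
  case: FB => _ h; apply: (h a) => //; apply: inPlaque_gam => //.
  by have [] := near _ hp.
move=> r e hr e0; have hp := hpath r hr; rewrite -/(path r).
pose rr := (fb_r1 B0 + cabs tau0) / 2.
have rr0 : 0 < rr by rewrite /rr; have := cabs_ge0 tau0; flra.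
have rr1 : rr < fb_r1 B0 by rewrite /rr; flra.
have [eta eta0 heta] := gb_harnack gB0 rr0 rr1 e0.
have [Lp Lp0 hLp] := gb_lipschitz gB0 rr1.
have [Ap Ep] := hlb _ hp.
have cp : ccont (bg B a) (path r).
  by apply: (holo_cont (gb_holo gB Aa)); rewrite subr0; have [] := near _ hp.
have Lp1 : 0 < 1 + Lp by flra.
have Kp : 0 < K by flra.
have q0 : 0 < eta / (4 * K * (1 + Lp)) by rewrite divr_gt0 // !mulr_gt0.
have [f1 f10 hf1] := cp _ q0.
pose f2 := Num.min f1 (eta / (4 * K * (1 + Lp))).
have f20 : 0 < f2 by rewrite lt_min f10.
have S0 : 0 < cabs (s - t) + 1 by have := cabs_ge0 (s - t); flra.
exists (f2 / (cabs (s - t) + 1)); first exact: divr_gt0.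
move=> r' hr'; rewrite ltr_pdivlMr // => rr'; have hp' := hpath r' hr'; rewrite -/(path r').
have pd : cabs (path r' - path r) < f2.
  by rewrite cpath_dist; apply: le_lt_trans rr'; rewrite ler_wpM2l //; flra.
move: pd; rewrite lt_min => /andP[/hf1 p1 p2].
have [Ap' Ep'] := hlb _ hp'.
have [u0 u1 u2 u3 u4] := near _ hp; have [v0 v1 v2 v3 v4] := near _ hp'.
have [l1 l2] := Tlip _ _ _ _ v1 v2 u1 u2.
set tr := (T (path r) (bg B a (path r))).1 in Ep u3 l1 *; set tr' := (T (path r') (bg B a (path r'))).1 in Ep' v3 l1 *.
have trr : cabs tr < rr by move: u3; rewrite lt_min => /andP[_ u3]; have := cabs_lerB tr tau0; rewrite /rr; flra.
have trr' : cabs tr' < rr by move: v3; rewrite lt_min => /andP[_ v3]; have := cabs_lerB tr' tau0; rewrite /rr; flra.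
have c0 : cabs (0 : C) < rr by rewrite cabs0.
rewrite -(gb_center gB0 Ap') -(gb_center gB0 Ap).
apply: (heta _ _ tr' 0 Ap' Ap trr' c0).
have D : cabs (path r' - path r) + cabs (bg B a (path r') - bg B a (path r)) <= 2 * (eta / (4 * K * (1 + Lp))) by flra.
have KD : K * (cabs (path r' - path r) + cabs (bg B a (path r') - bg B a (path r))) <= eta / (2 * (1 + Lp)).
  have -> : eta / (2 * (1 + Lp)) = K * (2 * (eta / (4 * K * (1 + Lp)))) by field; rewrite !gt_eqF.
  by apply: ler_wpM2l D; exact: ltW.
apply: le_lt_trans (cabs_distD (bg B0 (lb (path r)) tr) _ _) _.
have := hLp (lb (path r)) tr' tr Ap (ltW trr') (ltac:(flra)).
rewrite -Ep' -Ep.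
have h5 : Lp * cabs (tr - tr') <= Lp * (eta / (2 * (1 + Lp))).
  by rewrite ler_wpM2l ?(ltW Lp0) // (cabsB tr); exact: le_trans l1 KD.
have h6 := le_trans l2 KD.
move=> h4.
have h7 : eta / (2 * (1 + Lp)) + Lp * (eta / (2 * (1 + Lp))) < eta.
  have -> : eta / (2 * (1 + Lp)) + Lp * (eta / (2 * (1 + Lp))) = eta / 2 by field; rewrite gt_eqF.
  by flra.
by flra.
Qed.
End Compat.

(** * Arbitrary flow boxes, and leaves on which a coordinate is constant *)

Section FlowCompat.
Variable R : realType.
Local Notation C := R[i].
Variables om1 om2 : C.
Hypothesis hom1 : om1 != 0.
Hypothesis hom : cim (om2 / om1) != 0.
Variable L : Lamination R.
Hypothesis hL : is_lamination om1 om2 L.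
Implicit Types (z w l t y a b c : C) (p q x : Mpt R) (B : FlowBox R).
Local Notation inLat := (inLat om1 om2).
Local Notation Meq := (Meq om1 om2).
Local Notation Mclose := (Mclose om1 om2).
Local Notation inPlaque := (inPlaque om1 om2).
Local Notation X := (lam_X L).
Local Notation leaf := (leaf om1 om2 L).
Local Notation gam B a t := (bpt B t (bg B a t)).
Local Notation Flow := (flow_box_of om1 om2 L).
Local Notation box_nbhd := (box_nbhd om1 om2 X).

(** The change of parameter is the first component of the transition along the plaque [a]; the
    inclusion hypothesis puts the second component on the plaque [c]. *)
Lemma plaque_param B B0 a c t tau0 : good_box om1 om2 X B -> good_box om1 om2 X B0 -> fb_A B a -> fb_A B0 c ->
  cabs t < fb_r1 B -> cabs tau0 < fb_r1 B0 -> Meq (gam B a t) (gam B0 c tau0) ->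
  (exists2 d, 0 < d & forall s, cabs (s - t) < d -> cabs s < fb_r1 B /\ inPlaque B0 c (gam B a s)) ->
  exists (phi : C -> C) (e : R), [/\ 0 < e, holo t e phi, phi t = tau0 &
    forall s, cabs (s - t) < e ->
      [/\ cabs s < fb_r1 B, cabs (phi s) < fb_r1 B0 & Meq (gam B a s) (gam B0 c (phi s))]].
Proof.
move=> gB gB0 Aa Ac ht htau E [d d0 hd].
have [T [rho [K [rho0 K1 ET TM [Tlip _ Thol]]]]] := transition E.
have dom0 := gb_dom gB0 Ac htau.
set y0 := bg B0 c tau0 in E ET dom0.
have cg : ccont (bg B a) t by apply: (holo_cont (gb_holo gB Aa)); rewrite subr0.
have gap : 0 < fb_rz B0 - cabs (bz B0 tau0 y0) by rewrite subr_gt0.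
set G := fb_rz B0 - cabs (bz B0 tau0 y0) in gap.
have K4 : 0 < 4 * K by flra.
pose e1 := Num.min rho (G / (4 * K)).
have e10 : 0 < e1 by rewrite lt_min rho0 divr_gt0.
have [e2 e20 he2] := cg _ e10.
pose e := Num.min d (Num.min e1 e2).
have e0 : 0 < e by rewrite lt_min d0 lt_min e10.
exists (fun s => (T s (bg B a s)).1), e.
have near s : cabs (s - t) < e -> [/\ cabs (s - t) < d, cabs (s - t) < rho, cabs (bg B a s - bg B a t) < rho &
    cabs (bz B0 (T s (bg B a s)).1 (T s (bg B a s)).2) < fb_rz B0].
  rewrite lt_min => /andP[h1]; rewrite lt_min => /andP[h2 /he2 h3].
  move: h2 h3; rewrite /e1 !lt_min !ltr_pdivlMr // => /andP[h2 h4] /andP[h3 h5].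
  split=> //.
  have tt0 : cabs (t - t) < rho by rewrite subrr cabs0.
  have yy0 : cabs (bg B a t - bg B a t) < rho by rewrite subrr cabs0.
  have [l1 l2] := Tlip _ _ _ _ h2 h3 tt0 yy0; rewrite ET /= in l1 l2.
  have h6 : cabs (bz B0 (T s (bg B a s)).1 (T s (bg B a s)).2 - bz B0 tau0 y0) < G.
    by rewrite /bz; case: (fb_vert B0); flra.
  have := cabs_lerB (bz B0 (T s (bg B a s)).1 (T s (bg B a s)).2) (bz B0 tau0 y0).
  by rewrite /G in h6; flra.
split=> //.
- have [] := Thol (bg B a) t e _ _ => //.
    move=> s hs; have [h1 _ _ _] := near s hs; have [hs' _] := hd s h1.
    by apply: (gb_holo gB Aa); rewrite subr0.
  by move=> s hs; have [_ h2 h3 _] := near s hs.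
- by rewrite ET.
move=> s hs; have [h1 h2 h3 h4] := near s hs; have [hs' ps] := hd s h1.
have M1 := TM _ _ h2 h3.
have [h5 h6] := (inPlaque_coord gB0 Ac h4).1 (inPlaque_Meq M1 ps).
by split=> //; rewrite -h6.
Qed.

Lemma gam_inj B a b s t : good_box om1 om2 X B -> fb_A B a -> fb_A B b -> cabs s < fb_r1 B -> cabs t < fb_r1 B ->
  Meq (gam B a s) (gam B b t) -> s = t.
Proof.
move=> gB Aa Ab hs ht E.
by have [] := bpt_inj gB (gb_dom gB Aa hs) (gb_dom gB Ab ht) E.
Qed.

Lemma param_nonconst B B0 a c t (phi : C -> C) (e : R) : good_box om1 om2 X B -> fb_A B a ->
  0 < e -> cabs t < fb_r1 B ->
  (forall s, cabs (s - t) < e -> cabs s < fb_r1 B /\ Meq (gam B a s) (gam B0 c (phi s))) ->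
  forall d, 0 < d -> exists2 z, cabs (z - t) < d & phi z != phi t.
Proof.
move=> gB Aa e0 ht h d d0.
pose u := Num.min d e / 2.
have m0 : 0 < Num.min d e by rewrite lt_min d0.
have u0 : 0 < u by rewrite /u; flra.
have : u < Num.min d e by rewrite /u; flra.
rewrite lt_min => /andP[ud ue].
have E : cabs (t + (u%:C)%C - t) = u by rewrite addrC addKr cabsR gtr0_norm.
exists (t + (u%:C)%C); first by rewrite E.
apply/eqP => Ephi.
have [h1 h2] := h (t + (u%:C)%C) (ltac:(rewrite E; exact: ue)).
have [_ h3] := h t (ltac:(rewrite subrr cabs0; exact: e0)).
rewrite Ephi in h2; have := gam_inj gB Aa Aa h1 ht (Meq_trans h2 (Meq_sym h3)).
by move=> E2; move: E; rewrite E2 subrr cabs0; flra.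
Qed.

(** Two flow boxes are compared through an atlas box [B0]. Both plaques map into the same plaque of
    [B0], by [phi] and [psi]; as [psi] is nonconstant, hence open, it takes all values of [phi] near
    the point. *)
Lemma flow_compat B B' a a' t : Flow B -> Flow B' -> fb_A B a -> fb_A B' a' ->
  cabs t < fb_r1 B -> inPlaque B' a' (gam B a t) ->
  exists2 d, 0 < d & forall s, cabs (s - t) < d -> cabs s < fb_r1 B /\ inPlaque B' a' (gam B a s).
Proof.
move=> FB FB' Aa Aa' ht pa'; have gB := flow_good FB; have gB' := flow_good FB'.
have Xq := gb_X gB Aa ht.
have [B0 AB0 hB0] := atlas_box hL Xq; have [c Ac pc] := box_nbhd_plaque hB0 Xq.
have gB0 := flow_good (atlas_flow hL AB0).
have [t' [ht' E']] := (inPlaqueE _ _ _ _ _).1 pa'.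
have [tau0 [htau E0]] := (inPlaqueE _ _ _ _ _).1 pc.
have c1 := flow_atlas_compat hom1 hom hL FB AB0 Aa Ac ht hB0 pc.
have c2 := flow_atlas_compat hom1 hom hL FB' AB0 Aa' Ac ht' (box_nbhd_Meq E' hB0) (inPlaque_Meq E' pc).
have [phi [e [e0 hphi phit hp]]] := plaque_param gB gB0 Aa Ac ht htau E0 c1.
have [psi [e' [e'0 hpsi psit hp']]] := plaque_param gB' gB0 Aa' Ac ht' htau (Meq_trans (Meq_sym E') E0) c2.
have nc : forall d, 0 < d -> exists2 z, cabs (z - t') < d & psi z != psi t'.
  apply: (@param_nonconst B' B0 a' c t' psi e') => // s hs.
  by have [? ? ?] := hp' s hs.
have [dl dl0 hdl] := open_mapping hpsi e'0 (lexx _) nc.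
have cphi : ccont phi t by apply: (holo_cont hphi); rewrite subrr cabs0.
have [f f0 hf] := cphi _ dl0.
exists (Num.min e f); first by rewrite lt_min e0.
move=> s; rewrite lt_min => /andP[/hp[h1 h2 h3] /hf h4]; split=> //.
have [|z hz Ez] := hdl (phi s); first by rewrite psit -phit.
have [h5 h6 h7] := hp' z hz; apply/inPlaqueE; exists z; split=> //.
by apply: Meq_trans h3 _; rewrite -Ez; exact: Meq_sym.
Qed.

Lemma flow_param B B0 a c t tau0 : Flow B -> Flow B0 -> fb_A B a -> fb_A B0 c ->
  cabs t < fb_r1 B -> cabs tau0 < fb_r1 B0 -> Meq (gam B a t) (gam B0 c tau0) ->
  exists (phi : C -> C) (e : R), [/\ 0 < e, holo t e phi, phi t = tau0 &
    forall s, cabs (s - t) < e ->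
      [/\ cabs s < fb_r1 B, cabs (phi s) < fb_r1 B0 & Meq (gam B a s) (gam B0 c (phi s))]].
Proof.
move=> FB FB0 Aa Ac ht htau E.
apply: plaque_param => //; try exact: flow_good.
by apply: flow_compat => //; apply/inPlaqueE; exists tau0.
Qed.

(** Equality of the coordinate that is transverse to the boxes of type [v]. *)
Definition same_level (v : bool) p q := if v then inLat (p.1 - q.1) else p.2 = q.2.

Lemma same_level_sym v p q : same_level v p q -> same_level v q p.
Proof. by case: v => //= h; rewrite -opprB; exact: inLatN. Qed.
Lemma same_level_trans v p q x : same_level v p q -> same_level v q x -> same_level v p x.
Proof.
case: v => /= [h h'|-> //]; have -> : p.1 - x.1 = (p.1 - q.1) + (q.1 - x.1) by ring.
exact: inLatD.
Qed.
Lemma same_level_Meq v p q : Meq p q -> same_level v p q.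
Proof. by case: v => -[]. Qed.

Lemma same_level_bpt B t y t' y' : good_box om1 om2 X B ->
  cabs (bz B t y) < fb_rz B -> cabs (bz B t' y') < fb_rz B ->
  same_level (fb_vert B) (bpt B t y) (bpt B t' y') <-> y = y'.
Proof.
move=> [_ [_ [_ [inj _]]]]; rewrite !bptE /bz /bw; case: (fb_vert B) => h h' /=; split.
- move=> hl; apply: (@addrI _ (fb_z0 B)); apply: inj => //; rewrite addrC addKr //.
- by move=> ->; rewrite subrr; exact: inLat0.
- by move=> /p1chart_inj /addrI.
- by move=> ->.
Qed.

Lemma same_level_neg B t y t' y' : good_box om1 om2 X B ->
  cabs (bz B t y) < fb_rz B -> cabs (bz B t' y') < fb_rz B ->
  same_level (~~ fb_vert B) (bpt B t y) (bpt B t' y') -> t = t'.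
Proof.
move=> [_ [_ [_ [inj _]]]]; rewrite !bptE /bz /bw; case: (fb_vert B) => h h' /=.
- by move=> /p1chart_inj /addrI.
- move=> hl; apply: (@addrI _ (fb_z0 B)); apply: inj => //; rewrite addrC addKr //.
Qed.

Definition const_plaque B a := forall s t, cabs s < fb_r1 B -> cabs t < fb_r1 B -> bg B a s = bg B a t.

Lemma const_plaque_local B a t (d : R) : good_box om1 om2 X B -> fb_A B a -> cabs t < fb_r1 B -> 0 < d ->
  (forall s, cabs (s - t) < d -> bg B a s = bg B a t) -> const_plaque B a.
Proof.
move=> gB Aa ht d0 hd.
have H : forall s, cabs (s - 0) < fb_r1 B -> bg B a s - bg B a t = 0.
  apply: (@identity_theorem R 0 (fb_r1 B) (fun s => bg B a s - bg B a t) t d) => //.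
  - by apply: holoB; [exact: gb_holo gB Aa|exact: holo_const].
  - by rewrite subr0.
  - by move=> z _ hz; rewrite hd // subrr.
move=> s s' hs hs'; apply: (@subIr _ (bg B a t)).
by rewrite !H ?subr0.
Qed.

(** Were the types different, the constant coordinate would be the parameter of [B1], and the change
    of parameter would be constant. With equal types it is the transverse coordinate, constant near
    [tau] by the open mapping theorem and then everywhere. *)
Lemma const_plaque_transfer B B1 a b s tau : Flow B -> Flow B1 -> fb_A B a -> fb_A B1 b ->
  cabs s < fb_r1 B -> cabs tau < fb_r1 B1 -> Meq (gam B a s) (gam B1 b tau) -> const_plaque B a ->
  fb_vert B1 = fb_vert B /\ const_plaque B1 b.
Proof.
move=> FB FB1 Aa Ab hs htau E cst; have gB := flow_good FB; have gB1 := flow_good FB1.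
have [phi [e [e0 hphi phis hp]]] := flow_param FB FB1 Aa Ab hs htau E.
have lev u : cabs (u - s) < e -> same_level (fb_vert B) (gam B1 b (phi u)) (gam B1 b tau).
  move=> hu; have [u1 u2 u3] := hp u hu.
  apply: same_level_trans (same_level_Meq _ (Meq_sym u3)) _.
  apply: same_level_trans (same_level_Meq _ E).
  by apply/(same_level_bpt gB (gb_dom gB Aa u1) (gb_dom gB Aa hs)); exact: cst.
have nc : forall d, 0 < d -> exists2 z, cabs (z - s) < d & phi z != phi s.
  by apply: (@param_nonconst B B1 a b s phi e) => // u hu; have [] := hp u hu.
have V : fb_vert B1 = fb_vert B.
  apply: contrapT => /eqP V; have [z hz] := nc e e0; case/eqP.
  have [z1 z2 z3] := hp z hz; rewrite phis.
  apply: (same_level_neg gB1 (gb_dom gB1 Ab z2) (gb_dom gB1 Ab htau)).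
  have -> : ~~ fb_vert B1 = fb_vert B by move: V; case: (fb_vert B1); case: (fb_vert B).
  exact: lev.
split=> //.
have [dl dl0 hdl] := open_mapping hphi e0 (lexx _) nc.
apply: (const_plaque_local gB1 Ab htau dl0) => x hx.
have [|z hz <-] := hdl x; first by rewrite phis.
have [z1 z2 z3] := hp z hz.
by apply/(same_level_bpt gB1 (gb_dom gB1 Ab z2) (gb_dom gB1 Ab htau)); rewrite V; exact: lev.
Qed.

Lemma closed_Mcompact (S : Mset R) : Mclosed om1 om2 S -> (forall x, S x -> X x) -> Mcompact om1 om2 S.
Proof.
move=> cS SX u Su.
pose P (U : Mset R) := exists N, forall n, (N <= n)%N -> ~ U (u n).
have [q [Xq hq]] : exists q, X q /\ forall d, 0 < d -> forall N, exists2 n, (N <= n)%N & Mclose (u n) q d.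
  apply: contrapT => none.
  have [N hN] : P X.
    apply: (@Mcompact_ind R om1 om2 hom1 hom X (lam_closed hL) P).
    - by move=> U U' UU' [N hN]; exists N => n /hN h /UU'.
    - move=> U U' [N hN] [N' hN']; exists (maxn N N') => n; rewrite geq_max => /andP[/hN h /hN' h'].
      by case.
    - by exists 0%N => n _ [].
    - move=> q Xq; apply: contrapT => h; apply: none; exists q; split=> // d d0 N.
      apply: contrapT => h2; apply: h; exists d => //; exists N => n Nn [_ hn].
      by apply: h2; exists n.
  exact: (hN N (leqnn N) (SX _ (Su N))).
have nx m k : exists n, (m < n)%N /\ Mclose (u n) q (k.+1%:R^-1).
  by have [|n h1 h2] := hq (k.+1%:R^-1) _ m.+1; [rewrite invr_gt0|exists n].
have [f hf] := choice (fun mk : nat * nat => nx mk.1 mk.2).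
pose phi := fix phi k := if k is k'.+1 then f (phi k', k') else 0%N.
have conv : Mconv om1 om2 (u \o phi) q.
  move=> e e0; exists (Num.bound e^-1).+1 => -[//|n] hn.
  have [_ h2] := hf (phi n, n); apply: Mclose_le h2.
  rewrite -[e]invrK lef_pV2 ?posrE ?invr_gt0 //=.
  have := archi_boundP (ltW (ltac:(rewrite invr_gt0; exact: e0) : 0 < e^-1)).
  by move=> /ltW h1; apply: le_trans h1 _; rewrite ler_nat; exact: leq_trans (ltnW hn) _.
exists phi, q; split; first by move=> n; have [] := hf (phi n, n).
by split=> //; apply: cS conv => n; exact: Su.
Qed.

Hypothesis hnc : no_compact_leaf om1 om2 L.

(** The whole leaf would lie in one level and consist of constant plaques. In a box around a limit
    point of the leaf, its plaques arbitrarily near all have the same transverse coordinate, which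
    therefore is that of the limit: the leaf is closed, hence compact. *)
Lemma no_const_plaque B a : Flow B -> fb_A B a -> ~ const_plaque B a.
Proof.
move=> FB Aa cst; have gB := flow_good FB.
have r0 : cabs (0 : C) < fb_r1 B by rewrite cabs0; case: gB.
set v := fb_vert B; pose p := gam B a 0.
have Xp : X p by exact: gb_X gB Aa r0.
pose Q x := same_level v x p /\ forall B1 b, Flow B1 -> fb_A B1 b -> inPlaque B1 b x ->
   fb_vert B1 = v /\ const_plaque B1 b.
have Qp : Q p.
  split; first exact/same_level_Meq/Meq_refl.
  move=> B1 b FB1 Ab /inPlaqueE[tau [htau E]].
  exact: (const_plaque_transfer FB FB1 Aa Ab r0 htau E cst).
have QL' x x' : leaf x x' -> Q x -> Q x'.
  move=> h; elim: h => {x x'} //.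
    move=> x' x [B1 [b [AB1 [Ab [p1 x1]]]]] [lp hp].
    have FB1 := atlas_flow hL AB1; have gB1 := flow_good FB1.
    have [V1 c1] := hp B1 b FB1 Ab p1.
    have [t [ht Et]] := (inPlaqueE _ _ _ _ _).1 p1; have [s [hs Es]] := (inPlaqueE _ _ _ _ _).1 x1.
    split.
      apply: same_level_trans (same_level_Meq _ Es) _.
      apply: same_level_trans lp; apply: same_level_trans (same_level_Meq _ (Meq_sym Et)).
      by rewrite -V1; apply/(same_level_bpt gB1 (gb_dom gB1 Ab hs) (gb_dom gB1 Ab ht)); exact: c1.
    move=> B2 b2 FB2 Ab2 /inPlaqueE[tau [htau E]].
    have [V2 c2] := const_plaque_transfer FB1 FB2 Ab Ab2 hs htau (Meq_trans (Meq_sym Es) E) c1.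
    by split=> //; rewrite V2.
  by move=> q1 q2 q3 _ h1 _ h2 /h1/h2.
have QL x : leaf p x -> Q x by move=> h; exact: QL' h Qp.
apply: (hnc Xp); apply: closed_Mcompact; last by move=> x /(leaf_X hL Xp).
move=> u x hu cu.
have Xu n : X (u n) := leaf_X hL Xp (hu n).
have Xx : X x by exact: lam_closed hL u x Xu cu.
have [B1 AB1 hB1] := atlas_box hL Xx; have FB1 := atlas_flow hL AB1; have gB1 := flow_good FB1.
have [b1 Ab1 pb1] := box_nbhd_plaque hB1 Xx; have [t1 [ht1 E1]] := (inPlaqueE _ _ _ _ _).1 pb1.
have inv := lam_inv hL.
set y1 := bg B1 b1 t1 in E1.
have dom1 : cabs (bz B1 t1 y1) < fb_rz B1 by exact: gb_dom gB1 Ab1 ht1.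
have [dl dl0 hdl] := (box_nbhd_coord inv gB1 ht1 dom1).1 (box_nbhd_Meq E1 hB1).
have near (e : R) : 0 < e -> exists b t, [/\ fb_A B1 b, cabs t < fb_r1 B1, leaf p (gam B1 b t) & cabs (bg B1 b t - y1) < e].
  move=> e0.
  pose d' := Num.min (Num.min dl e) (Num.min (fb_r1 B1 - cabs t1) (fb_rz B1 - cabs (bz B1 t1 y1))).
  have d'0 : 0 < d' by rewrite !lt_min dl0 e0 !subr_gt0 ht1.
  have [f f0 hf] := @Mclose_coord R om1 om2 (fb_chart B1) (fb_z0 B1 + bz B1 t1 y1) (fb_w0 B1 + bw B1 t1 y1) d' d'0.
  have [N hN] := cu f f0.
  have := Mclose_r E1 (hN N (leqnn N)); rewrite bptE => /hf[z' [w' [hp hz hw]]].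
  pose t := if fb_vert B1 then w' - fb_w0 B1 else z' - fb_z0 B1.
  pose y := if fb_vert B1 then z' - fb_z0 B1 else w' - fb_w0 B1.
  have Eb : bpt B1 t y = pt (fb_chart B1) z' w'.
    by rewrite bptE /bz /bw /t /y; case: (fb_vert B1); rewrite !subrKC.
  have [td yd] : cabs (t - t1) < d' /\ cabs (y - y1) < d'.
    have Ez : z' - (fb_z0 B1 + bz B1 t1 y1) = z' - fb_z0 B1 - bz B1 t1 y1 by ring.
    have Ew : w' - (fb_w0 B1 + bw B1 t1 y1) = w' - fb_w0 B1 - bw B1 t1 y1 by ring.
    by move: hz hw; rewrite Ez Ew /t /y /bz /bw; case: (fb_vert B1).
  move: td yd; rewrite /d' !lt_min => /andP[/andP[a1 a2] /andP[a3 a4]] /andP[/andP[c1 c2] /andP[c3 c4]].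
  rewrite -Eb in hp.
  have [|b Ab Ey] := hdl t y a1 c1; first exact: inv (leaf_X hL Xp (hu N)) hp.
  have tr : cabs t < fb_r1 B1 by have := cabs_lerB t t1; flra.
  exists b, t; split=> //; last by rewrite -Ey.
  apply: (rt_trans _ _ _ _ _ (hu N)); case: FB1 => _ h; apply: (h b) => //.
    by rewrite Ey in hp; apply/inPlaqueE; exists t.
  exact: inPlaque_gam.
have [b [t [Ab ht lt hy]]] := near 1 ltr01.
have [lv hv] := QL _ lt; have [V1 c1] := hv B1 b FB1 Ab (inPlaque_gam _ _ _ ht).
suff Ey : bg B1 b t = y1.
  apply: (rt_trans _ _ _ _ _ lt); case: FB1 => _ h; apply: (h b) => //; first exact: inPlaque_gam.
  by apply/inPlaqueE; exists t1; split=> //; rewrite (c1 t1 t ht1 ht) Ey.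
apply: contrapT => /eqP ny; have e0 : 0 < cabs (bg B1 b t - y1) by rewrite cabs_gt0 subr_eq0.
have [b' [t' [Ab' ht' lt' hy']]] := near _ e0.
have [lv' _] := QL _ lt'.
have := same_level_trans lv (same_level_sym lv'); rewrite -V1.
move=> /(same_level_bpt gB1 (gb_dom gB1 Ab ht) (gb_dom gB1 Ab' ht')) E.
by move: hy'; rewrite E ltxx.
Qed.
End FlowCompat.

(** * Tangencies with the first factor *)

Section MetricLemma.
Variable R : realType.
Local Notation C := R[i].
Implicit Types (f g phi : C -> C) (z c : C).

(** Changes of chart are isometries of the spherical metric |dw| / (1 + |w|^2). *)
Lemma chart_deriv k1 k2 (w1 w2 : C) (om : C -> C) m (rho : R) : 0 < rho -> om w1 = w2 ->
  (forall w, cabs (w - w1) < rho -> p1chart k1 w = p1chart k2 (om w)) -> cder om w1 m ->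
  cabs m * (1 + cabs w1 ^+ 2) = 1 + cabs w2 ^+ 2.
Proof.
move=> rho0 E1 hom dm.
have w11 : cabs (w1 - w1) < rho by rewrite subrr cabs0.
have [k12|k12] := eqVneq k1 k2.
  have omid w : cabs (w - w1) < rho -> w = om w by rewrite -k12 in hom => /hom /p1chart_inj.
  have d1 : cder om w1 1 := cder_near rho0 omid (cder_id w1).
  by rewrite (cder_unique dm d1) cabs1 mul1r -E1 -omid.
have key w : cabs (w - w1) < rho -> w != 0 /\ om w = w^-1.
  move=> /hom; case: k1 k2 k12 {hom} => [] [] //= _.
    by case: eqP => // /eqP w0 [<-].
  case: eqP => // /eqP w0 [E].
  have E' : om w = w^-1 by rewrite [X in _ = X^-1]E invrK.
  by split=> //; rewrite [X in X != 0]E invr_eq0.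
have [w10 _] := key _ w11.
have ominv w : cabs (w - w1) < rho -> w^-1 = om w by move=> /key[].
have d1 := cder_near rho0 ominv (cder_inv w10).
rewrite (cder_unique dm d1) -E1 -ominv // cabsN !cabsV cabsX.
have : cabs w1 != 0 by rewrite cabs_eq0.
by move=> h; field.
Qed.

Lemma deriv0_const f c (r : R) : 0 < r -> (forall z, cabs (z - c) < r -> cder f z 0) ->
  forall z, cabs (z - c) < r -> f z = f c.
Proof.
move=> r0 df z hz; have cc : cabs (c - c) < r by rewrite subrr cabs0.
have := @cder_itv_le R (fun s => f (spt c z s)) (fun=> 0 * (z - c)) 0.
have -> : spt c z 1 = z by rewrite /spt rmorph1 mul1r subrKC.
have -> : spt c z 0 = c by rewrite /spt rmorph0 mul0r addr0.
move=> h; apply/eqP; rewrite -subr_eq0; apply/eqP; apply: cabs0P; apply: h.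
  by move=> s hs; apply: cder_cder_itv; apply: df; exact: disc_convex.
by move=> s _; rewrite mul0r cabs0.
Qed.

(* The logarithm of the length of a holomorphic form in the spherical metric is strictly
   subharmonic: compare with [phi (1 + conj (w c) w) ^+ 2] by Cauchy-Schwarz. *)
Lemma spherical_max phi (w : C -> C) c (r S : R) : 0 < r -> 0 < S -> holo c r phi -> holo c r w ->
  (forall z, cabs (z - c) < r -> cabs (phi z) * (1 + cabs (w z) ^+ 2) <= S) ->
  S <= cabs (phi c) * (1 + cabs (w c) ^+ 2) ->
  exists2 d, 0 < d & forall z, cabs (z - c) < d -> w z = w c.
Proof.
move=> r0 S0 hphi hw hS Sc.
pose a := conjc (w c).
pose F z := phi z * ((1 + a * w z) * (1 + a * w z)).
(* Lagrange's identity for the vectors (1, x) and (1, y). The defect |x - y|^2 of the Cauchy-Schwarz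
   inequality must vanish once [F] is constant, which forces [w z = w c]. *)
have CS (x y : C) : cabs (1 + conjc x * y) ^+ 2 + cabs (x - y) ^+ 2 = (1 + cabs x ^+ 2) * (1 + cabs y ^+ 2).
  by rewrite !cabs_sqr; case: x => x1 x2; case: y => y1 y2 /=; ring.
have hF : holo c r F.
  have h1 : holo c r (fun z => 1 + a * w z).
    by apply: holoD; [exact: holo_const|apply: holoM => //; exact: holo_const].
  by apply: holoM => //; exact: holoM.
have EF z : cabs (F z) = cabs (phi z) * cabs (1 + a * w z) ^+ 2.
  by rewrite /F !cabsM expr2.
pose W := 1 + cabs (w c) ^+ 2.
have W0 : 0 < W by rewrite /W ltr_wpDr // exprn_ge0 // cabs_ge0.
have EFc : cabs (F c) = cabs (phi c) * (W * W).
  by rewrite EF; have := CS (w c) (w c); rewrite subrr cabs0 expr0n addr0 => ->.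
have up z : cabs (z - c) < r -> cabs (F z) + cabs (phi z) * cabs (w c - w z) ^+ 2 <= S * W.
  move=> hz; rewrite EF -mulrDr CS; have := hS z hz; rewrite -/W => h.
  by rewrite [W * _]mulrC mulrA ler_wpM2r // ltW.
have cc : cabs (c - c) < r by rewrite subrr cabs0.
have FcS : cabs (F c) = S * W.
  apply/eqP; rewrite eq_le; apply/andP; split.
    have := up c cc; rewrite subrr cabs0 expr0n mulr0 addr0 //.
  by rewrite EFc mulrA ler_wpM2r // ltW.
have [|d d0 hd] := max_modulus_const r0 hF.
  move=> z hz; rewrite FcS; apply: le_trans (up z hz).
  by rewrite lerDl mulr_ge0 ?exprn_ge0 ?cabs_ge0.
exists (Num.min d r); first by rewrite lt_min d0.
move=> z; rewrite lt_min => /andP[zd zr].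
have := up z zr; rewrite hd // FcS => h.
have phz : 0 < cabs (phi z).
  rewrite lt0r cabs_ge0 andbT; apply/eqP => p0.
  have : cabs (F z) = 0 by rewrite EF p0 mul0r.
  by rewrite hd // FcS; have := mulr_gt0 S0 W0; flra.
have h2 : cabs (phi z) * cabs (w c - w z) ^+ 2 <= 0 by flra.
have : cabs (w c - w z) ^+ 2 <= 0 by rewrite -(pmulr_rle0 _ phz).
move=> h3; have : cabs (w c - w z) ^+ 2 == 0 by rewrite eq_le h3 exprn_ge0 // cabs_ge0.
by rewrite expf_eq0 /= cabs_eq0 subr_eq0 => /eqP ->.
Qed.
End MetricLemma.

Section Approx.
Variable R : realType.
Local Notation C := R[i].
Variables om1 om2 : C.
Hypothesis hom1 : om1 != 0.
Hypothesis hom : cim (om2 / om1) != 0.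
Variable L : Lamination R.
Hypothesis hL : is_lamination om1 om2 L.
Implicit Types (z w l t y a b c : C) (p q x : Mpt R) (B : FlowBox R).
Local Notation inLat := (inLat om1 om2).
Local Notation Meq := (Meq om1 om2).
Local Notation Mclose := (Mclose om1 om2).
Local Notation inPlaque := (inPlaque om1 om2).
Local Notation X := (lam_X L).
Local Notation leaf := (leaf om1 om2 L).
Local Notation gam B a t := (bpt B t (bg B a t)).
Local Notation Flow := (flow_box_of om1 om2 L).
Local Notation box_nbhd := (box_nbhd om1 om2 X).

Lemma box_point B t1 y1 (d : R) : good_box om1 om2 X B -> 0 < d ->
  exists2 e, 0 < e & forall x, Mclose x (bpt B t1 y1) e ->
    exists t y, [/\ Meq x (bpt B t y), cabs (t - t1) < d & cabs (y - y1) < d].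
Proof.
move=> gB d0.
have [f f0 hf] := @Mclose_coord R om1 om2 (fb_chart B) (fb_z0 B + bz B t1 y1) (fb_w0 B + bw B t1 y1) d d0.
exists f => // x; rewrite bptE => /hf[z' [w' [hp hz hw]]].
pose t := if fb_vert B then w' - fb_w0 B else z' - fb_z0 B.
pose y := if fb_vert B then z' - fb_z0 B else w' - fb_w0 B.
have Eb : bpt B t y = pt (fb_chart B) z' w'.
  by rewrite bptE /bz /bw /t /y; case: (fb_vert B); rewrite !subrKC.
exists t, y; split; rewrite ?Eb //.
  have Ez : z' - (fb_z0 B + bz B t1 y1) = z' - fb_z0 B - bz B t1 y1 by ring.
  have Ew : w' - (fb_w0 B + bw B t1 y1) = w' - fb_w0 B - bw B t1 y1 by ring.
  by move: hz hw; rewrite Ez Ew /t /y /bz /bw; case: (fb_vert B).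
have Ez : z' - (fb_z0 B + bz B t1 y1) = z' - fb_z0 B - bz B t1 y1 by ring.
have Ew : w' - (fb_w0 B + bw B t1 y1) = w' - fb_w0 B - bw B t1 y1 by ring.
by move: hz hw; rewrite Ez Ew /t /y /bz /bw; case: (fb_vert B).
Qed.

Lemma bpt_close B t y t1 y1 (d : R) : cabs (t - t1) < d -> cabs (y - y1) < d ->
  Mclose (bpt B t y) (bpt B t1 y1) d.
Proof.
move=> ht hy; rewrite !bptE; apply: (coord_Mclose (Meq_refl _ _ _)).
  have -> : fb_z0 B + bz B t y - (fb_z0 B + bz B t1 y1) = bz B t y - bz B t1 y1 by ring.
  by rewrite /bz; case: (fb_vert B).
have -> : fb_w0 B + bw B t y - (fb_w0 B + bw B t1 y1) = bw B t y - bw B t1 y1 by ring.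
by rewrite /bw; case: (fb_vert B).
Qed.

(** Harnack for the values, Cauchy's estimate for the derivatives. The radius [r0] is fixed before
    the precision [e], so limits of plaques can be taken on a fixed disc. *)
Lemma plaque_close B a1 t1 : good_box om1 om2 X B -> fb_A B a1 -> cabs t1 < fb_r1 B ->
  box_nbhd B (gam B a1 t1) ->
  exists2 r0, 0 < r0 & [/\ cabs t1 + r0 < fb_r1 B,
   forall t, cabs (t - t1) < r0 -> box_nbhd B (gam B a1 t) &
   forall e, 0 < e -> exists2 d, 0 < d & forall b tau, fb_A B b ->
    cabs (tau - t1) < r0 -> cabs (bg B b tau - bg B a1 tau) < d ->
    forall t, cabs (t - t1) < r0 -> [/\ cabs (bg B b t - bg B a1 t) < e,
      cabs (deriv (bg B b) t - deriv (bg B a1) t) < e & box_nbhd B (gam B b t)]].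
Proof.
move=> gB Aa1 ht1 hB.
have [d1 d10 hd1] := box_nbhd_open hB.
have cg : ccont (bg B a1) t1 by apply: (holo_cont (gb_holo gB Aa1)); rewrite subr0.
have [d2 d20 hd2] := cg (d1 / 2) (ltac:(flra)).
pose G := fb_r1 B - cabs t1; have G0 : 0 < G by rewrite /G subr_gt0.
pose r0 := Num.min (Num.min d1 d2) G / 4.
have m0 : 0 < Num.min (Num.min d1 d2) G by rewrite !lt_min d10 d20.
have r00 : 0 < r0 by rewrite /r0; flra.
have rm : r0 <= Num.min (Num.min d1 d2) G / 4 by [].
have [r1 r2 r3] : [/\ r0 <= d1 / 4, r0 <= d2 / 4 & r0 <= G / 4].
  by split; apply: le_trans rm _; rewrite ler_wpM2r // !ge_min lexx ?orbT.
clearbody r0.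
exists r0 => //; split; first by rewrite /G in r3; flra.
  move=> t ht; apply: hd1; apply: Mclose_le (bpt_close _ _ _); last by have := hd2 t (ltac:(flra)); exact.
    by flra.
  by flra.
move=> e e0.
pose rho := fb_r1 B - G / 4.
have rho0 : 0 < rho by rewrite /rho /G in G0 *; have := cabs_ge0 t1; flra.
have rho1 : rho < fb_r1 B by rewrite /rho; flra.
pose e' := Num.min (Num.min e (d1 / 2)) (e * G / 64).
have e'0 : 0 < e' by rewrite !lt_min e0 !divr_gt0 // mulr_gt0.
have [d d0 hd] := gb_harnack gB rho0 rho1 e'0.
exists d => // b tau Ab htau hdif t ht.
have ins u : cabs (u - t1) < G / 2 -> cabs u < rho.
  by move=> hu; have := cabs_lerB u t1; rewrite /rho /G in hu *; flra.
have close u : cabs (u - t1) < G / 2 -> cabs (bg B b u - bg B a1 u) < e'.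
  by move=> hu; apply: (hd b a1 tau u) => //; apply: ins => //; flra.
have ct := close t (ltac:(flra)).
have /andP[/andP[f1 f2] f3] : (e' <= e) && (e' <= d1 / 2) && (e' <= e * G / 64).
  by rewrite /e' !ge_min !lexx ?orbT.
have hdiff : holo t1 (G / 2) (fun u => bg B b u - bg B a1 u).
  by apply: holoB; [apply: (holo_sub (gb_holo gB Ab))|apply: (holo_sub (gb_holo gB Aa1))]; rewrite subr0 /G; flra.
have tG : cabs (t - t1) < G / 2 by flra.
split.
- by flra.
- have tr : cabs (t - 0) < fb_r1 B by rewrite subr0; have := ins t tG; flra.
  have dd := cderB (holo_derivP (gb_holo gB Ab) tr) (holo_derivP (gb_holo gB Aa1) tr).
  apply: le_lt_trans (cauchy_deriv hdiff (fun u hu => ltW (close u hu)) tG dd) _.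
  rewrite ltr_pdivrMr; last by flra.
  apply: (@le_lt_trans _ _ (8 * (e * G / 64))); first by flra.
  have : e * (G / 4) <= e * (G / 2 - cabs (t - t1)) by rewrite ler_wpM2l ?(ltW e0) //; flra.
  by have := mulr_gt0 e0 G0; flra.
- apply: hd1; apply: bpt_close; first by flra.
  have -> : bg B b t - bg B a1 t1 = (bg B b t - bg B a1 t) + (bg B a1 t - bg B a1 t1) by ring.
  apply: le_lt_trans (cabsD _ _) _; have := hd2 t (ltac:(flra)); flra.
Qed.

Lemma plaque_approx B a1 t1 q : good_box om1 om2 X B -> fb_A B a1 -> cabs t1 < fb_r1 B ->
  Meq q (gam B a1 t1) -> box_nbhd B q ->
  exists2 r0, 0 < r0 & [/\ cabs t1 + r0 < fb_r1 B,
   forall t, cabs (t - t1) < r0 -> box_nbhd B (gam B a1 t) &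
   forall e, 0 < e -> exists2 d, 0 < d & forall x, X x -> Mclose x q d ->
    exists b tau, [/\ fb_A B b, cabs (tau - t1) < e, cabs (tau - t1) < r0, Meq x (gam B b tau) &
    forall t, cabs (t - t1) < r0 -> [/\ cabs (bg B b t - bg B a1 t) < e,
      cabs (deriv (bg B b) t - deriv (bg B a1) t) < e & box_nbhd B (gam B b t)]]].
Proof.
move=> gB Aa1 ht1 Eq hB; have hB' := box_nbhd_Meq Eq hB.
have [r0 r00 [h1 h2 h3]] := plaque_close gB Aa1 ht1 hB'.
exists r0 => //; split=> // e e0.
have [d d0 hd] := h3 e e0.
have [dl dl0 hdl] := (box_nbhd_coord (lam_inv hL) gB ht1 (gb_dom gB Aa1 ht1)).1 hB'.
have cg : ccont (bg B a1) t1 by apply: (holo_cont (gb_holo gB Aa1)); rewrite subr0.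
have [d2 d20 hd2] := cg (d / 2) (ltac:(flra)).
pose f := Num.min (Num.min (Num.min e r0) dl) (Num.min d2 (d / 2)).
have f0 : 0 < f by rewrite !lt_min e0 r00 dl0 d20 divr_gt0.
have [g g0 hg] := box_point t1 (bg B a1 t1) gB f0.
exists g => // x Xx /(Mclose_r Eq)/hg[t [y [Ex]]].
rewrite !lt_min => /andP[/andP[/andP[t2 t3] t4] /andP[t5 t6]] /andP[/andP[/andP[y2 y3] y4] /andP[y5 y6]].
have [|b Ab Ey] := hdl t y t4 y4; first exact: lam_inv hL _ _ Xx Ex.
exists b, t; split=> //; first by rewrite -Ey.
apply: (hd b t Ab t3); rewrite -Ey.
have -> : y - bg B a1 t = (y - bg B a1 t1) - (bg B a1 t - bg B a1 t1) by ring.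
apply: le_lt_trans (cabsD _ _) _; rewrite cabsN; have := hd2 t t5; flra.
Qed.
End Approx.

Section Tangency.
Variable R : realType.
Local Notation C := R[i].
Variables om1 om2 : C.
Hypothesis hom1 : om1 != 0.
Hypothesis hom : cim (om2 / om1) != 0.
Variable L : Lamination R.
Hypothesis hL : is_lamination om1 om2 L.
Implicit Types (z w l t y a b c : C) (p q x : Mpt R) (B : FlowBox R).
Local Notation inLat := (inLat om1 om2).
Local Notation Meq := (Meq om1 om2).
Local Notation Mclose := (Mclose om1 om2).
Local Notation inPlaque := (inPlaque om1 om2).
Local Notation X := (lam_X L).
Local Notation leaf := (leaf om1 om2 L).
Local Notation gam B a t := (bpt B t (bg B a t)).
Local Notation Flow := (flow_box_of om1 om2 L).
Local Notation box_nbhd := (box_nbhd om1 om2 X).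

(** [bDz] and [bDw] are the derivatives along a plaque of the coordinates [bpz] and [bpw] of its
    points; they treat both types of boxes at once. *)
Definition bDz B a t : C := if fb_vert B then deriv (bg B a) t else 1.
Definition bDw B a t : C := if fb_vert B then 1 else deriv (bg B a) t.
Definition bpz B a t : C := fb_z0 B + bz B t (bg B a t).
Definition bpw B a t : C := fb_w0 B + bw B t (bg B a t).

(* Length of [dz] along the plaque in the spherical metric of the second factor, up to the constant
   of that metric; it is [0] at points where [dw] vanishes, since division by [0] gives [0]. *)
Definition dzlen B a t : R := cabs (bDz B a t) * (1 + cabs (bpw B a t) ^+ 2) / cabs (bDw B a t).

Lemma cder_bpz B a t : good_box om1 om2 X B -> fb_A B a -> cabs t < fb_r1 B ->
  cder (bpz B a) t (bDz B a t).
Proof.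
move=> gB Aa ht; have dg : cder (bg B a) t (deriv (bg B a) t).
  by apply: (holo_derivP (gb_holo gB Aa)); rewrite subr0.
rewrite /bpz /bDz /bz; case: (fb_vert B).
  by have := cderD (cder_const (fb_z0 B) t) dg; rewrite add0r.
by have := cderD (cder_const (fb_z0 B) t) (cder_id t); rewrite add0r.
Qed.

Lemma cder_bpw B a t : good_box om1 om2 X B -> fb_A B a -> cabs t < fb_r1 B ->
  cder (bpw B a) t (bDw B a t).
Proof.
move=> gB Aa ht; have dg : cder (bg B a) t (deriv (bg B a) t).
  by apply: (holo_derivP (gb_holo gB Aa)); rewrite subr0.
rewrite /bpw /bDw /bw; case: (fb_vert B).
  by have := cderD (cder_const (fb_w0 B) t) (cder_id t); rewrite add0r.
by have := cderD (cder_const (fb_w0 B) t) dg; rewrite add0r.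
Qed.

Lemma gam_pt B a t : gam B a t = pt (fb_chart B) (bpz B a t) (bpw B a t).
Proof. exact: bptE. Qed.

(** A change of parameter multiplies dz and dw by the same factor; between boxes, z changes by a
    translation and w by a spherical isometry. *)
Lemma dzlen_transfer B B' a a' t t' : Flow B -> Flow B' -> fb_A B a -> fb_A B' a' ->
  cabs t < fb_r1 B -> cabs t' < fb_r1 B' -> Meq (gam B a t) (gam B' a' t') ->
  bDw B a t != 0 -> bDw B' a' t' != 0 -> dzlen B a t = dzlen B' a' t'.
Proof.
move=> FB FB' Aa Aa' ht ht' E Dw0 Dw'0; have gB := flow_good FB; have gB' := flow_good FB'.
have [phi [e [e0 hphi phit hp]]] := flow_param hom1 hom hL FB FB' Aa Aa' ht ht' E.
have [f df] : exists f, cder phi t f by apply: hphi; rewrite subrr cabs0.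
have dz := cder_bpz gB Aa ht; have dw := cder_bpw gB Aa ht.
have dz' : cder (fun s => bpz B' a' (phi s)) t (bDz B' a' t' * f).
  by apply: (cder_comp df); rewrite phit; exact: cder_bpz.
have dw' : cder (fun s => bpw B' a' (phi s)) t (bDw B' a' t' * f).
  by apply: (cder_comp df); rewrite phit; exact: cder_bpw.
have E' := E; rewrite !gam_pt in E'; case: E' => /= El Ew.
have [om [rho [K [rho0 K0 omw omE [omh _]]]]] := chart_transfer Ew.
have [m dm] : exists m, cder om (bpw B a t) m by apply: omh; rewrite subrr cabs0.
have mE := chart_deriv rho0 omw omE dm.
(* the lattice shift is locally constant *)
have [_ [_ [_ [inj _]]]] := gB'.
have dom' : cabs (bpz B' a' t' - fb_z0 B') < fb_rz B'.
  by rewrite /bpz addrC addKr; exact: gb_dom gB' Aa' ht'.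
have gap : 0 < fb_rz B' - cabs (bpz B' a' t' - fb_z0 B') by rewrite subr_gt0.
have [e1 e10 he1] := cder_cont dz gap.
have [e2 e20 he2] := cder_cont dw rho0.
have R1 : bDz B' a' t' * f = bDz B a t.
  apply: cder_unique dz' _.
  have h := cderD dz (cder_const (bpz B' a' t' - bpz B a t) t); rewrite addr0 in h.
  apply: (cder_near _ _ h (d := Num.min e e1)); first by rewrite lt_min e0.
  move=> s; rewrite lt_min => /andP[/hp[s1 s2 s3] /he1 s4].
  move: s3; rewrite !gam_pt => -[/= Ls _].
  apply: inj.
  - have -> : bpz B a s + (bpz B' a' t' - bpz B a t) - fb_z0 B' =
      (bpz B a s - bpz B a t) + (bpz B' a' t' - fb_z0 B') by ring.
    by apply: le_lt_trans (cabsD _ _) _; flra.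
  - by rewrite /bpz addrC addKr; exact: gb_dom gB' Aa' s2.
  - have -> : bpz B a s + (bpz B' a' t' - bpz B a t) - bpz B' a' (phi s) =
      (bpz B a s - bpz B' a' (phi s)) - (bpz B a t - bpz B' a' t') by ring.
    exact: inLatB.
have R2 : bDw B' a' t' * f = m * bDw B a t.
  apply: cder_unique dw' _.
  apply: (cder_near _ _ (cder_comp dw dm) (d := Num.min e e2)); first by rewrite lt_min e0.
  move=> s; rewrite lt_min => /andP[/hp[s1 s2 s3] /he2 s4].
  move: s3; rewrite !gam_pt => -[/= _]; rewrite omE //.
  exact: p1chart_inj.
have n1 : 0 < 1 + cabs (bpw B' a' t') ^+ 2 by rewrite ltr_wpDr // exprn_ge0 // cabs_ge0.
have m0 : m != 0.
  by apply/eqP => mz; move: mE; rewrite mz cabs0 mul0r; flra.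
have f0 : f != 0.
  by apply/eqP => fz; move: R2; rewrite fz mulr0 => /esym /eqP; rewrite mulf_eq0 (negbTE m0) (negbTE Dw0).
rewrite /dzlen -R1 -mE cabsM.
have := congr1 (@cabs R) R2; rewrite !cabsM => R3.
have a0 : cabs f != 0 by rewrite cabs_eq0.
have b0 : cabs (bDw B a t) != 0 by rewrite cabs_eq0.
have c0 : cabs (bDw B' a' t') != 0 by rewrite cabs_eq0.
apply: (mulIf b0); apply: (mulIf c0); rewrite divfK //.
have -> : cabs (bDz B' a' t') * (cabs m * (1 + cabs (bpw B a t) ^+ 2)) / cabs (bDw B' a' t') *
   cabs (bDw B a t) * cabs (bDw B' a' t') =
   cabs (bDz B' a' t') * (1 + cabs (bpw B a t) ^+ 2) * (cabs m * cabs (bDw B a t)) by field.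
by rewrite -R3; ring.
Qed.

Hypothesis hnc : no_compact_leaf om1 om2 L.

(** A derivative vanishing on a disc would make the plaque constant, which the absence of compact
    leaves excludes. *)
Lemma deriv_nonzero_annulus B a t1 : Flow B -> fb_A B a -> cabs t1 < fb_r1 B ->
  exists2 d, 0 < d & forall s, 0 < s -> 2 * s < d ->
     exists2 m, 0 < m & forall z, s <= cabs (z - t1) <= 2 * s -> m <= cabs (deriv (bg B a) z).
Proof.
move=> FB Aa ht; have gB := flow_good FB.
have r0 : 0 < fb_r1 B - cabs t1 by flra.
have hd : holo t1 (fb_r1 B - cabs t1) (deriv (bg B a)).
  by apply: (holo_sub (holo_deriv (gb_holo gB Aa))); rewrite subr0; flra.
have [[d d0 h]|//] := zero_annulus r0 hd; exfalso.
apply: (no_const_plaque hom1 hom hL hnc FB Aa).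
pose d' := Num.min d (fb_r1 B - cabs t1).
have d'0 : 0 < d' by rewrite lt_min d0.
apply: (const_plaque_local gB Aa ht d'0).
apply: (@deriv0_const R) d'0 _ => z; rewrite lt_min => /andP[z1 z2].
rewrite -(h z z1); apply: (holo_derivP (gb_holo gB Aa)).
by rewrite subr0; have := cabs_lerB z t1; flra.
Qed.

Section NoTangency.
Variable p : Mpt R.
Hypothesis Xp : X p.

Definition sample B a t := [/\ Flow B, fb_A B a, cabs t < fb_r1 B, box_nbhd B (gam B a t) & leaf p (gam B a t)].

Hypothesis NT : forall B a t, sample B a t -> fb_vert B = false -> deriv (bg B a) t != 0.

Lemma sample_Dw B a t : sample B a t -> bDw B a t != 0.
Proof.
by move=> h; rewrite /bDw; case E: (fb_vert B); [exact: oner_neq0|exact: NT].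
Qed.

(** Reads all samples near [q] in one box and on one disc, where values and derivatives of their
    plaques approach those of the plaque through [q]. The point [q] itself may lie on another
    leaf. *)
Lemma sample_local q : X q -> exists B1 a1 t1 r0, [/\ Flow B1, fb_A B1 a1, cabs t1 + r0 < fb_r1 B1, 0 < r0 &
  forall e, 0 < e -> exists2 d, 0 < d & forall B a t, sample B a t -> Mclose (gam B a t) q d ->
    exists b tau, [/\ cabs (tau - t1) < e, cabs (tau - t1) < r0, dzlen B a t = dzlen B1 b tau & fb_A B1 b /\
    forall t', cabs (t' - t1) < r0 -> [/\ sample B1 b t', cabs (bg B1 b t' - bg B1 a1 t') < e &
      cabs (deriv (bg B1 b) t' - deriv (bg B1 a1) t') < e]]].
Proof.
move=> Xq; have [B1 AB1 hB1] := atlas_box hL Xq; have FB1 := atlas_flow hL AB1; have gB1 := flow_good FB1.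
have [a1 Aa1 pa1] := box_nbhd_plaque hB1 Xq; have [t1 [ht1 E1]] := (inPlaqueE _ _ _ _ _).1 pa1.
have [r0 r00 [hr _ H]] := plaque_approx hL gB1 Aa1 ht1 E1 hB1.
exists B1, a1, t1, r0; split=> // e e0; have [d d0 hd] := H e e0.
exists d => // B a t sB Bq; have [FB Aa ht hB lB] := sB.
have [b [tau [Ab ta tr Ex hb]]] := hd _ (gb_X (flow_good FB) Aa ht) Bq.
have ins u : cabs (u - t1) < r0 -> cabs u < fb_r1 B1 by move=> hu; have := cabs_lerB u t1; flra.
have hs u : cabs (u - t1) < r0 -> sample B1 b u.
  move=> hu; have [_ _ h3] := hb u hu; split=> //; first exact: ins.
  apply: (rt_trans _ _ _ _ _ lB); case: FB1 => _ h; apply: (h b) => //.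
    by apply/inPlaqueE; exists tau; split=> //; exact: ins.
  by apply: inPlaque_gam; exact: ins.
exists b, tau; split=> //.
  apply: dzlen_transfer => //; first exact: ins.
    exact: sample_Dw.
  by apply: sample_Dw; exact: hs.
by split=> // u hu; have [h1 h2 _] := hb u hu; split=> //; exact: hs.
Qed.

(** The danger is a horizontal box whose plaque through [q] is tangent at [q]. The derivative of
    that plaque is bounded below on an annulus, hence so are those of nearby plaques of the leaf;
    the latter have no zero by [NT], and the minimum principle carries the bound inside. *)
Lemma dzlen_bounded : exists K, forall B a t, sample B a t -> dzlen B a t <= K.
Proof.
pose P (U : Mset R) := exists K, forall B a t, sample B a t -> U (gam B a t) -> dzlen B a t <= K.
suff [K hK] : P X.
  by exists K => B a t sB; apply: hK => //; have [FB Aa ht _ _] := sB; exact: gb_X (flow_good FB) Aa ht.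
apply: (@Mcompact_ind _ om1 om2 hom1 hom X (lam_closed hL) P).
- by move=> S S' SS' [K hK]; exists K => B a t sB /SS'; exact: hK.
- move=> S S' [K hK] [K' hK']; exists (Num.max K K') => B a t sB; rewrite le_max => -[h|h].
    by rewrite hK.
  by rewrite hK' ?orbT.
- by exists 0 => B a t _ [].
move=> q Xq; have [B1 [a1 [t1 [r0 [FB1 Aa1 hr r00 H]]]]] := sample_local Xq.
have gB1 := flow_good FB1.
have ht1 : cabs t1 < fb_r1 B1 by flra.
have [M M0 hM] := gb_bound gB1.
case EV : (fb_vert B1).
  have cd : ccont (deriv (bg B1 a1)) t1.
    by apply: (holo_cont (holo_deriv (gb_holo gB1 Aa1))); rewrite subr0.
  have [f f0 hf] := cd 1 ltr01.
  pose e := Num.min 1 f; have e0 : 0 < e by rewrite lt_min ltr01.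
  have [d d0 hd] := H e e0; exists d => //.
  pose W := cabs (fb_w0 B1) + fb_r1 B1.
  exists ((cabs (deriv (bg B1 a1) t1) + 2) * (1 + W ^+ 2)) => B a t sB [_ Bq].
  have [b [tau [ta tr -> [Ab hb]]]] := hd B a t sB Bq.
  have [_ _ h3] := hb tau tr.
  move: ta h3; rewrite /e !lt_min => /andP[_ ta] /andP[h3 _].
  rewrite /dzlen /bDz /bDw /bpw /bw EV cabs1 divr1; apply: ler_pM.
  - exact: cabs_ge0.
  - by rewrite addr_ge0 // exprn_ge0 // cabs_ge0.
  - have -> : deriv (bg B1 b) tau = (deriv (bg B1 b) tau - deriv (bg B1 a1) tau) +
      ((deriv (bg B1 a1) tau - deriv (bg B1 a1) t1) + deriv (bg B1 a1) t1) by ring.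
    apply: le_trans (cabsD _ _) _.
    have := cabsD (deriv (bg B1 a1) tau - deriv (bg B1 a1) t1) (deriv (bg B1 a1) t1).
    by have := hf tau ta; flra.
  - rewrite lerD2l; apply: lerXn2r; rewrite ?nnegrE ?cabs_ge0 //.
      by rewrite /W; have := cabs_ge0 (fb_w0 B1); have := cabs_ge0 t1; flra.
    by apply: le_trans (cabsD _ _) _; rewrite /W; have := cabs_lerB tau t1; flra.
have [dd dd0 hdd] := deriv_nonzero_annulus FB1 Aa1 ht1.
pose s := Num.min dd r0 / 4.
have m0 : 0 < Num.min dd r0 by rewrite lt_min dd0.
have s0 : 0 < s by rewrite /s; flra.
have : 2 * s < Num.min dd r0 by rewrite /s; flra.
rewrite lt_min => /andP[sd sr].
have [m mm0 hm] := hdd s s0 sd.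
pose e := Num.min (m / 2) s; have e0 : 0 < e by rewrite lt_min s0 divr_gt0.
have [d d0 hd] := H e e0; exists d => //.
pose W := cabs (fb_w0 B1) + M.
exists ((1 + W ^+ 2) / (m / 2)) => B a t sB [_ Bq].
have [b [tau [ta tr -> [Ab hb]]]] := hd B a t sB Bq.
have hdb : holo t1 r0 (deriv (bg B1 b)).
  by apply: (holo_sub (holo_deriv (gb_holo gB1 Ab))); rewrite subr0; flra.
have low : m / 2 <= cabs (deriv (bg B1 b) tau).
  apply: (@min_modulus R t1 r0 s (m / 2)) => //.
  - by flra.
  - by move=> z hz; have [h1 _ _] := hb z hz; exact: NT h1 EV.
  - move=> z hz; have zr : cabs (z - t1) < r0 by flra.
    have [_ _] := hb z zr; rewrite lt_min => /andP[h3 _].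
    by have := hm z hz; have := cabs_lerB (deriv (bg B1 a1) z) (deriv (bg B1 b) z); rewrite (cabsB (deriv _ _)); flra.
  - by move: ta; rewrite lt_min => /andP[_ ta]; flra.
have taur : cabs tau < fb_r1 B1 by have := cabs_lerB tau t1; flra.
rewrite /dzlen /bDz /bDw /bpw /bw EV cabs1 mul1r; apply: ler_pM.
- by rewrite addr_ge0 // exprn_ge0 // cabs_ge0.
- by rewrite invr_ge0 cabs_ge0.
- rewrite lerD2l; apply: lerXn2r; rewrite ?nnegrE ?cabs_ge0 //.
    by rewrite /W; have := cabs_ge0 (fb_w0 B1); flra.
  by apply: le_trans (cabsD _ _) _; rewrite /W; have := hM b tau Ab taur; flra.
- by rewrite lef_pV2 ?posrE //; flra.
Qed.
End NoTangency.
End Tangency.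

Section TangencyExists.
Variable R : realType.
Local Notation C := R[i].
Variables om1 om2 : C.
Hypothesis hom1 : om1 != 0.
Hypothesis hom : cim (om2 / om1) != 0.
Variable L : Lamination R.
Hypothesis hL : is_lamination om1 om2 L.
Implicit Types (z w l t y a b c : C) (p q x : Mpt R) (B : FlowBox R).
Local Notation inLat := (inLat om1 om2).
Local Notation Meq := (Meq om1 om2).
Local Notation Mclose := (Mclose om1 om2).
Local Notation inPlaque := (inPlaque om1 om2).
Local Notation X := (lam_X L).
Local Notation leaf := (leaf om1 om2 L).
Local Notation gam B a t := (bpt B t (bg B a t)).
Local Notation Flow := (flow_box_of om1 om2 L).
Local Notation box_nbhd := (box_nbhd om1 om2 X).
Hypothesis hnc : no_compact_leaf om1 om2 L.

Lemma perturb (A W A' W' e : R) : 0 <= A -> 0 <= W -> 0 <= W' -> `|A - A'| <= e -> `|W - W'| <= e ->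
  e <= 1 -> `|A * (1 + W ^+ 2) - A' * (1 + W' ^+ 2)| <= e * ((1 + (W + 1) ^+ 2) + A * (2 * W + 1)).
Proof.
move=> A0 W0 W'0 hA hW e1.
have -> : A * (1 + W ^+ 2) - A' * (1 + W' ^+ 2) = (A - A') * (1 + W' ^+ 2) + A * ((W - W') * (W + W')) by ring.
have e0 : 0 <= e by exact: le_trans (normr_ge0 _) hA.
have W'W : W' <= W + 1 by move: hW; rewrite ler_norml; flra.
apply: le_trans (ler_normD _ _) _; rewrite [leRHS]mulrDr; apply: lerD; rewrite !normrM.
  apply: ler_pM => //; rewrite ger0_norm; last by rewrite addr_ge0 // exprn_ge0.
  by rewrite lerD2l lerXn2r ?nnegrE //; flra.
rewrite (ger0_norm A0) [leRHS]mulrCA ler_wpM2l //; apply: ler_pM => //.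
by rewrite ger0_norm ?addr_ge0 //; flra.
Qed.

Lemma le_of_eps (x y Q : R) : (forall e, 0 < e -> e <= 1 -> x <= y + e * Q) -> x <= y.
Proof.
move=> h; apply/ler_addgt0Pr => e e0.
have Q0 : 0 < `|Q| + 1 by have := normr_ge0 Q; flra.
pose f := Num.min 1 (e / (`|Q| + 1)).
have f0 : 0 < f by rewrite lt_min ltr01 divr_gt0.
apply: le_trans (h f f0 _) _; first by rewrite ge_min lexx.
rewrite lerD2l; apply: (@le_trans _ _ (f * (`|Q| + 1))).
  by rewrite ler_wpM2l ?(ltW f0) //; have := ler_norm Q; flra.
by rewrite -ler_pdivlMr // ge_min lexx orbT.
Qed.

Lemma cabs_dist_le z w (e : R) : cabs (z - w) <= e -> `|cabs w - cabs z| <= e.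
Proof.
move=> h; rewrite ler_norml; have := cabs_lerB z w; have := cabs_lerB w z; rewrite (cabsB w z).
by move=> h1 h2; apply/andP; split; flra.
Qed.

Lemma tangency_exists p : X p -> exists B a t,
  [/\ Flow B, fb_A B a, cabs t < fb_r1 B, box_nbhd B (gam B a t) & leaf p (gam B a t)] /\
  fb_vert B = false /\ deriv (bg B a) t = 0.
Proof.
move=> Xp; apply: contrapT => none.
have NT B a t : sample om1 om2 L p B a t -> fb_vert B = false -> deriv (bg B a) t != 0.
  by move=> sB vB; apply/eqP => d0; apply: none; exists B, a, t.
have [K hK] := dzlen_bounded hom1 hom hL hnc NT.
pose Sg := [set s | exists B a t, sample om1 om2 L p B a t /\ s = dzlen B a t].
have sigle B a t : sample om1 om2 L p B a t -> Sg (dzlen B a t) by move=> h; exists B, a, t.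
have ubS : ubound Sg K by move=> s [B [a [t [h ->]]]]; exact: hK.
pose S := sup Sg.
have hS B a t : sample om1 om2 L p B a t -> dzlen B a t <= S.
  by move=> h; apply: ub_le_sup (sigle _ _ _ h); exists K.
(* In a vertical box the length vanishes where the derivative does, so it is evaluated on a small
   circle around the point, free of zeros. *)
have S0 : 0 < S.
  have [B AB hB] := atlas_box hL Xp; have FB := atlas_flow hL AB; have gB := flow_good FB.
  have [a Aa pa] := box_nbhd_plaque hB Xp; have [t [ht E]] := (inPlaqueE _ _ _ _ _).1 pa.
  have [r0 r00 [hr hb _]] := plaque_approx hL gB Aa ht E hB.
  have smp u : cabs (u - t) < r0 -> sample om1 om2 L p B a u.
    move=> hu; have ur : cabs u < fb_r1 B by have := cabs_lerB u t; flra.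
    split=> //; first exact: hb.
    by case: FB => _ h; apply: (h a) => //; exact: inPlaque_gam.
  have [d d0 hd] := deriv_nonzero_annulus hom1 hom hL hnc FB Aa ht.
  pose s := Num.min d r0 / 4.
  have m0 : 0 < Num.min d r0 by rewrite lt_min d0.
  have s0 : 0 < s by rewrite /s; flra.
  have : 2 * s < Num.min d r0 by rewrite /s; flra.
  rewrite lt_min => /andP[sd sr]; have [m mm0 hm] := hd s s0 sd.
  pose z := t + (s%:C)%C; have zt : cabs (z - t) = s by rewrite /z addrC addKr cabsR gtr0_norm.
  have sz : sample om1 om2 L p B a z by apply: smp; rewrite zt; flra.
  have Dw := sample_Dw NT sz.
  apply: lt_le_trans (hS _ _ _ sz); rewrite /dzlen divr_gt0 ?cabs_gt0 // mulr_gt0 //; last first.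
    by rewrite ltr_wpDr // exprn_ge0 // cabs_ge0.
  rewrite /bDz; case: (fb_vert B); last by rewrite cabs1.
  by apply: lt_le_trans mm0 (hm z _); rewrite zt; flra.
(* The supremum is localised by compactness: bounds smaller than [S] near every point of [X] would
   combine into one bound smaller than [S]. *)
have [q [Xq hq]] : exists q, X q /\ forall d K, 0 < d -> K < S ->
    exists B a t, [/\ sample om1 om2 L p B a t, Mclose (gam B a t) q d & K < dzlen B a t].
  apply: contrapT => noq.
  pose P (U : Mset R) := exists2 K, K < S & forall B a t, sample om1 om2 L p B a t -> U (gam B a t) -> dzlen B a t <= K.
  have [K' K'S hK'] : P X.
    apply: (@Mcompact_ind _ om1 om2 hom1 hom X (lam_closed hL) P).
    - by move=> U U' UU' [K1 h1 h2]; exists K1 => // B a t sB /UU'; exact: h2.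
    - move=> U U' [K1 h1 h2] [K2 h3 h4]; exists (Num.max K1 K2); first by rewrite gt_max h1.
      by move=> B a t sB [/(h2 _ _ _ sB) h|/(h4 _ _ _ sB) h]; rewrite le_max h ?orbT.
    - by exists 0 => // B a t _ [].
    move=> q Xq; apply: contrapT => h; apply: noq; exists q; split=> // d K1 d0 K1S.
    apply: contrapT => h2; apply: h; exists d => //; exists K1 => // B a t sB [_ hc].
    by rewrite leNgt; apply/negP => h3; apply: h2; exists B, a, t.
  have Sne : Sg !=set0.
    have [[B [a [t h]]]|h] := pselect (exists B a t, sample om1 om2 L p B a t).
      by exists (dzlen B a t); exact: sigle.
    have : Sg = set0 by apply/seteqP; split=> // s [B [a [t [h' _]]]]; case: h; exists B, a, t.
    by move=> S00; move: S0; rewrite /S S00 sup0 ltxx.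
  suff : S <= K' by flra.
  apply: ge_sup => // s [B [a [t [h ->]]]]; apply: hK' => //.
  by have [FB Aa ht _ _] := h; exact: gb_X (flow_good FB) Aa ht.
have [B1 [a1 [t1 [r0 [FB1 Aa1 hr r00 H]]]]] := sample_local hom1 hom hL NT Xq.
have gB1 := flow_good FB1.
have ht1 : cabs t1 < fb_r1 B1 by flra.
have insr u : cabs (u - t1) < r0 -> cabs u < fb_r1 B1 by move=> hu; have := cabs_lerB u t1; flra.
(* the limit plaque through [q] inherits the bound, with equality at [q] *)
have close b u (e : R) : cabs (bg B1 b u - bg B1 a1 u) < e ->
   cabs (deriv (bg B1 b) u - deriv (bg B1 a1) u) < e ->
   [/\ cabs (bDz B1 b u - bDz B1 a1 u) <= e, cabs (bDw B1 b u - bDw B1 a1 u) <= e &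
       cabs (bpw B1 b u - bpw B1 a1 u) <= e].
  move=> h1 h2; have e0 : 0 <= e by apply/ltW/(le_lt_trans _ h1)/cabs_ge0.
  rewrite /bDz /bDw /bpw /bw opprD addrACA subrr add0r.
  by case: (fb_vert B1); rewrite ?subrr ?cabs0; split=> //; exact: ltW.
have lim1 u : cabs (u - t1) < r0 ->
   cabs (bDz B1 a1 u) * (1 + cabs (bpw B1 a1 u) ^+ 2) <= S * cabs (bDw B1 a1 u).
  move=> hu; set A := cabs (bDz B1 a1 u); set W := cabs (bpw B1 a1 u).
  apply: (@le_of_eps _ _ (S + ((1 + (W + 1) ^+ 2) + A * (2 * W + 1)))) => e e0 e1.
  have [d d0 hd] := H e e0; have [B [a [t [sB cB _]]]] := hq d 0 d0 S0.
  have [b [tau [_ _ _ [Ab hb]]]] := hd B a t sB cB.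
  have [sb h1 h2] := hb u hu; have [c1 c2 c3] := close b u e h1 h2.
  have := hS _ _ _ sb; rewrite /dzlen ler_pdivrMr ?cabs_gt0 ?(sample_Dw NT sb) // => h3.
  have := @perturb A W _ _ e (cabs_ge0 _) (cabs_ge0 _) (cabs_ge0 _) (cabs_dist_le c1) (cabs_dist_le c3) e1.
  rewrite ler_norml => /andP[_ h4].
  have := cabs_dist_le c2; rewrite ler_norml => /andP[h5 _].
  have h6 : S * cabs (bDw B1 b u) <= S * (cabs (bDw B1 a1 u) + e) by rewrite ler_wpM2l ?(ltW S0) //; flra.
  by rewrite [e * (S + _)]mulrDr (mulrC e S); flra.
have lim2 : S * cabs (bDw B1 a1 t1) <= cabs (bDz B1 a1 t1) * (1 + cabs (bpw B1 a1 t1) ^+ 2).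
  set A := cabs (bDz B1 a1 t1); set W := cabs (bpw B1 a1 t1); set D := cabs (bDw B1 a1 t1).
  apply: (@le_of_eps _ _ (S + (D + 1) + ((1 + (W + 1) ^+ 2) + A * (2 * W + 1)))) => e e0 e1.
  have e2 : 0 < e / 2 by flra.
  have hg : holo 0 (fb_r1 B1) (bg B1 a1) by exact: gb_holo gB1 Aa1.
  have cg : ccont (bg B1 a1) t1 by apply: (holo_cont hg); rewrite subr0.
  have cg' : ccont (deriv (bg B1 a1)) t1 by apply: (holo_cont (holo_deriv hg)); rewrite subr0.
  have [f1 f10 hf1] := cg _ e2; have [f2 f20 hf2] := cg' _ e2.
  pose f := Num.min (e / 2) (Num.min f1 f2); have f0 : 0 < f by rewrite !lt_min e2 f10.
  have [d d0 hd] := H f f0; have [|B [a [t [sB cB Sg1]]]] := hq d (S - e) d0; first flra.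
  have [b [tau [ta tr Es [Ab hb]]]] := hd B a t sB cB.
  have [sb h1 h2] := hb tau tr.
  move: ta h1 h2; rewrite /f !lt_min => /and3P[ta1 ta2 ta3] /andP[h1 _] /andP[h2 _].
  have [c1 c2 c3] : [/\ cabs (bDz B1 b tau - bDz B1 a1 t1) <= e, cabs (bDw B1 b tau - bDw B1 a1 t1) <= e &
       cabs (bpw B1 b tau - bpw B1 a1 t1) <= e].
    have k1 : cabs (bg B1 b tau - bg B1 a1 t1) <= e.
      by have := cabs_distD (bg B1 a1 tau) (bg B1 b tau) (bg B1 a1 t1); have := hf1 tau ta2; flra.
    have k2 : cabs (deriv (bg B1 b) tau - deriv (bg B1 a1) t1) <= e.
      by have := cabs_distD (deriv (bg B1 a1) tau) (deriv (bg B1 b) tau) (deriv (bg B1 a1) t1); have := hf2 tau ta3; flra.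
    rewrite /bDz /bDw /bpw /bw opprD addrACA subrr add0r.
    by case: (fb_vert B1); rewrite ?subrr ?cabs0; split=> //; flra.
  have := Sg1; rewrite Es /dzlen ltr_pdivlMr ?cabs_gt0 ?(sample_Dw NT sb) // => h3.
  have := @perturb A W _ _ e (cabs_ge0 _) (cabs_ge0 _) (cabs_ge0 _) (cabs_dist_le c1) (cabs_dist_le c3) e1.
  rewrite ler_norml => /andP[h4 _].
  have := cabs_dist_le c2; rewrite -/D ler_norml => /andP[h5 h6].
  set D' := cabs (bDw B1 b tau) in h3 h5 h6.
  have h7 : S * D <= S * (D' + e) by rewrite ler_wpM2l ?(ltW S0) //; flra.
  have h8 : e * D' <= e * (D + 1) by rewrite ler_wpM2l ?(ltW e0) //; flra.
  rewrite mulrBl in h3; rewrite mulrDr in h7; rewrite !(mulrDr e) (mulrC e S); rewrite !(mulrDr e) in h8 h4; flra.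
have hg0 := gb_holo gB1 Aa1.
have hg : holo t1 r0 (bg B1 a1) by apply: (holo_sub hg0); rewrite subr0; flra.
have hg' : holo t1 r0 (deriv (bg B1 a1)) by apply: (holo_sub (holo_deriv hg0)); rewrite subr0; flra.
have tt : cabs (t1 - t1) < r0 by rewrite subrr cabs0.
(* In a vertical box the second coordinate is the parameter itself up to a translation, so it cannot
   be locally constant. *)
case EV : (fb_vert B1).
  have [|z||d d0 hd] := @spherical_max R (deriv (bg B1 a1)) (fun u => fb_w0 B1 + u) t1 r0 S r00 S0 hg'.
  - by apply: holoD; [exact: holo_const|exact: holo_id].
  - by move=> hz; have := lim1 z hz; rewrite /bDz /bDw /bpw /bw EV cabs1 mulr1.
  - by have := lim2; rewrite /bDz /bDw /bpw /bw EV cabs1 mulr1.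
  have := hd (t1 + ((d / 2)%:C)%C).
  rewrite [t1 + _ - _]addrC addKr cabsR gtr0_norm ?divr_gt0 // => /(_ ltac:(flra)) /addrI E.
  have : cabs (t1 + ((d / 2)%:C)%C - t1) = 0 by rewrite E subrr cabs0.
  by rewrite addrC addKr cabsR gtr0_norm; flra.
(* The limit plaque has no tangency either: the left side of [lim1] is at least 1 in a horizontal
   box. *)
have nz z : cabs (z - t1) < r0 -> deriv (bg B1 a1) z != 0.
  move=> hz; have := lim1 z hz; rewrite /bDz /bDw EV cabs1 mul1r => h.
  apply/eqP => E; move: h; rewrite E cabs0 mulr0.
  by have : 0 <= cabs (bpw B1 a1 z) ^+ 2 by [rewrite exprn_ge0 // cabs_ge0]; flra.
have [|z||d d0 hd] := @spherical_max R (fun u => (deriv (bg B1 a1) u)^-1) (fun u => fb_w0 B1 + bg B1 a1 u) t1 r0 S r00 S0 (holoV hg' nz).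
- by apply: holoD => //; exact: holo_const.
- move=> hz; have := lim1 z hz; rewrite /bDz /bDw /bpw /bw EV cabs1 mul1r => h.
  by rewrite cabsV mulrC ler_pdivrMr ?cabs_gt0 ?nz.
- have := lim2; rewrite /bDz /bDw /bpw /bw EV cabs1 mul1r => h.
  by rewrite cabsV mulrC ler_pdivlMr ?cabs_gt0 ?nz.
apply: (no_const_plaque hom1 hom hL hnc FB1 Aa1).
by apply: (const_plaque_local gB1 Aa1 ht1 d0) => s /hd /addrI.
Qed.
End TangencyExists.

(** * Propagation of smallness along leaves *)

Section Uniform.
Variable R : realType.
Local Notation C := R[i].
Variables om1 om2 : C.
Hypothesis hom1 : om1 != 0.
Hypothesis hom : cim (om2 / om1) != 0.
Variable L : Lamination R.
Hypothesis hL : is_lamination om1 om2 L.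
Implicit Types (z w l t y a b c : C) (p q x : Mpt R) (B : FlowBox R).
Local Notation inLat := (inLat om1 om2).
Local Notation Meq := (Meq om1 om2).
Local Notation Mclose := (Mclose om1 om2).
Local Notation inPlaque := (inPlaque om1 om2).
Local Notation X := (lam_X L).
Local Notation leaf := (leaf om1 om2 L).
Local Notation gam B a t := (bpt B t (bg B a t)).
Local Notation Flow := (flow_box_of om1 om2 L).
Local Notation box_nbhd := (box_nbhd om1 om2 X).

Lemma bz_near B t y t2 y2 (d : R) : cabs (t - t2) < d -> cabs (y - y2) < d ->
  cabs (bz B t2 y2) + d <= fb_rz B -> cabs (bz B t y) < fb_rz B.
Proof. by rewrite /bz; case: (fb_vert B) => h1 h2 h3; [have := cabs_lerB y y2|have := cabs_lerB t t2]; flra. Qed.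

Lemma exists_min3 (x y z : R) : 0 < x -> 0 < y -> 0 < z -> exists2 e, 0 < e & [/\ e <= x, e <= y & e <= z].
Proof.
move=> x0 y0 z0; exists (Num.min (Num.min x y) z); first by rewrite !lt_min x0 y0.
by rewrite !ge_min !lexx ?orbT.
Qed.

(** [flow_compat] with a disc whose size does not depend on the plaque: uniform Lipschitz bounds
    keep the image under [T] in the domain of [B2], and connectedness of the disc keeps it on a
    single plaque. *)
Lemma uniform_compat B1 B2 t1 y1 t2 y2 (T : C -> C -> C * C) (rho K : R) : Flow B1 -> Flow B2 ->
  cabs t1 < fb_r1 B1 -> cabs t2 < fb_r1 B2 -> cabs (bz B2 t2 y2) < fb_rz B2 ->
  0 < rho -> 1 <= K -> T t1 y1 = (t2, y2) ->
  (forall t y, cabs (t - t1) < rho -> cabs (y - y1) < rho ->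
     Meq (bpt B1 t y) (bpt B2 (T t y).1 (T t y).2)) ->
  (forall t y t' y', cabs (t - t1) < rho -> cabs (y - y1) < rho ->
     cabs (t' - t1) < rho -> cabs (y' - y1) < rho ->
     cabs ((T t y).1 - (T t' y').1) <= K * (cabs (t - t') + cabs (y - y')) /\
     cabs ((T t y).2 - (T t' y').2) <= K * (cabs (t - t') + cabs (y - y'))) ->
  box_nbhd B2 (bpt B2 t2 y2) -> forall e, 0 < e -> exists2 d, 0 < d & forall a s, fb_A B1 a ->
  cabs (s - t1) < d -> cabs (bg B1 a s - y1) < d -> exists2 b, fb_A B2 b & forall u, cabs (u - t1) < d ->
    [/\ cabs u < fb_r1 B1, cabs (u - t1) < e, cabs (bg B1 a u - y1) < e,
       (T u (bg B1 a u)).2 = bg B2 b (T u (bg B1 a u)).1 &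
       [/\ cabs (T u (bg B1 a u)).1 < fb_r1 B2, cabs ((T u (bg B1 a u)).1 - t2) < e & cabs ((T u (bg B1 a u)).2 - y2) < e]].
Proof.
move=> F1 F2 h1 h2 hz rho0 K1 T1 TM TL hb e e0.
have g1 := flow_good F1; have g2 := flow_good F2.
have [d0 d00 hd0] := (box_nbhd_coord (lam_inv hL) g2 h2 hz).1 hb.
have [e1 e10 [e1e e1rho e1d0]] := exists_min3 e0 rho0 d00.
have [||e2 e20 [e21 e2z e2r]] := @exists_min3 e1 (fb_rz B2 - cabs (bz B2 t2 y2)) (fb_r1 B2 - cabs t2) e10.
  - by rewrite subr_gt0.
  - by rewrite subr_gt0.
have [|Lg Lg0 hLg] := @gb_lipschitz _ om1 om2 X B1 ((cabs t1 + fb_r1 B1) / 2) g1; first by flra.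
have Q0 : 0 < K * (2 + 2 * Lg) by apply: mulr_gt0; flra.
have [||d d00' [dr de _]] := @exists_min3 ((fb_r1 B1 - cabs t1) / 2) (e2 / (K * (2 + 2 * Lg))) 1 _ _ ltr01.
- by flra.
- exact: divr_gt0.
have {}de : K * ((2 + 2 * Lg) * d) <= e2 by move: de; rewrite ler_pdivlMr // mulrC mulrA.
have KQ : (2 + 2 * Lg) * d <= K * ((2 + 2 * Lg) * d).
  by rewrite ler_peMl // mulr_ge0 // ?(ltW d00') //; flra.
exists d => // a s Aa hs hys.
have in1 u : cabs (u - t1) < d -> cabs u < (cabs t1 + fb_r1 B1) / 2.
  by move=> hu; have := cabs_lerB u t1; flra.
have sum u : cabs (u - t1) < d -> cabs (u - t1) + cabs (bg B1 a u - y1) < (2 + 2 * Lg) * d.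
  move=> hu; have u1 : cabs u < fb_r1 B1 by have := in1 u hu; flra.
  have k1 := hLg a s u Aa (ltW (in1 s hs)) u1.
  have k2 : cabs (u - s) <= 2 * d by have := cabs_distD t1 u s; rewrite (cabsB t1 s); flra.
  have k3 : Lg * cabs (u - s) <= Lg * (2 * d) by rewrite ler_wpM2l // ltW.
  by have := cabs_distD (bg B1 a s) (bg B1 a u) y1; flra.
have Tn u : cabs (u - t1) < d -> [/\ cabs (u - t1) < e2, cabs (bg B1 a u - y1) < e2,
    cabs ((T u (bg B1 a u)).1 - t2) < e2 & cabs ((T u (bg B1 a u)).2 - y2) < e2].
  move=> hu; have hsum := sum u hu.
  have p1 := cabs_ge0 (u - t1); have p2 := cabs_ge0 (bg B1 a u - y1).
  have q1 : cabs (u - t1) < e2 by flra.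
  have q2 : cabs (bg B1 a u - y1) < e2 by flra.
  have [||||l1 l2] := TL u (bg B1 a u) t1 y1; rewrite ?subrr ?cabs0 //; [by flra|by flra|].
  rewrite T1 /= in l1 l2.
  have l3 : K * (cabs (u - t1) + cabs (bg B1 a u - y1)) < K * ((2 + 2 * Lg) * d) by rewrite ltr_pM2l //; flra.
  by split=> //; [apply: le_lt_trans l1 _|apply: le_lt_trans l2 _]; flra.
have dom u : cabs (u - t1) < d -> cabs (bz B2 (T u (bg B1 a u)).1 (T u (bg B1 a u)).2) < fb_rz B2.
  by move=> hu; have [_ _ k1 k2] := Tn u hu; apply: (bz_near k1 k2); flra.
have Xu u : cabs (u - t1) < d -> exists2 b, fb_A B2 b & (T u (bg B1 a u)).2 = bg B2 b (T u (bg B1 a u)).1.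
  move=> hu; have [k1 k2 k3 k4] := Tn u hu; apply: hd0; [flra|flra|].
  apply: (lam_inv hL) (TM u _ _ _); [|flra|flra].
  by apply: (gb_X g1 Aa); have := in1 u hu; flra.
have in2 u : cabs (u - t1) < d -> cabs (T u (bg B1 a u)).1 < fb_r1 B2.
  by move=> hu; have [_ _ k1 _] := Tn u hu; have := cabs_lerB (T u (bg B1 a u)).1 t2; flra.
have TMu u : cabs (u - t1) < d -> Meq (gam B1 a u) (bpt B2 (T u (bg B1 a u)).1 (T u (bg B1 a u)).2).
  by move=> hu; have [k1 k2 _ _] := Tn u hu; apply: TM; flra.
have pl b u : fb_A B2 b -> cabs (u - t1) < d ->
    inPlaque B2 b (gam B1 a u) <-> (T u (bg B1 a u)).2 = bg B2 b (T u (bg B1 a u)).1.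
  move=> Ab hu; split=> [h|h].
    by have [] := (inPlaque_coord g2 Ab (dom u hu)).1 (inPlaque_Meq (TMu u hu) h).
  apply: (inPlaque_Meq (Meq_sym (TMu u hu))).
  by apply/(inPlaque_coord g2 Ab (dom u hu)); split=> //; exact: in2.
have [b Ab hbs] := Xu s hs; exists b => // u hu.
suff hP : inPlaque B2 b (gam B1 a u).
  have [k1 k2 k3 k4] := Tn u hu; split; [|flra|flra|exact/pl|split; [exact: in2|flra|flra]].
  by have := in1 u hu; flra.
apply: (@disc_connected _ t1 d (fun u => inPlaque B2 b (gam B1 a u)) _ s u hs hu); last exact/pl.
move=> z hz'; have [b' Ab' hb'] := Xu z hz'.
have z1 : cabs z < fb_r1 B1 by have := in1 z hz'; flra.
have zb' : inPlaque B2 b' (gam B1 a z) by apply/pl.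
have [d3 d30 hd3] := flow_compat hom1 hom hL F1 F2 Aa Ab' z1 zb'.
exists d3 => // w hw hwz; have [_ wb'] := hd3 w hwz.
split=> hh; have E : b = b' by [exact: gb_disj g2 Ab Ab' hh _|exact: (gb_disj g2 Ab Ab' hh)]; by rewrite E.
Qed.

End Uniform.

Section BoxChange.
Variable R : realType.
Local Notation C := R[i].
Variables om1 om2 : C.
Hypothesis hom1 : om1 != 0.
Hypothesis hom : cim (om2 / om1) != 0.
Variable L : Lamination R.
Hypothesis hL : is_lamination om1 om2 L.
Implicit Types (z w l t y a b c : C) (p q x : Mpt R) (B : FlowBox R).
Local Notation inLat := (inLat om1 om2).
Local Notation Meq := (Meq om1 om2).
Local Notation Mclose := (Mclose om1 om2).
Local Notation inPlaque := (inPlaque om1 om2).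
Local Notation X := (lam_X L).
Local Notation leaf := (leaf om1 om2 L).
Local Notation gam B a t := (bpt B t (bg B a t)).
Local Notation Flow := (flow_box_of om1 om2 L).
Local Notation box_nbhd := (box_nbhd om1 om2 X).

(* Its zeros are the intersections of the plaque [a] with the translate by [e] of the plaque [b]. *)
Definition bh B a b (e t : C) : C := bg B a (bsh B e (t, bg B b t)).1 - (bsh B e (t, bg B b t)).2.

Lemma bsh_near B (e t y t1 y1 : C) (d c : R) : cabs (t - t1) < d -> cabs (y - y1) < d -> cabs e < c ->
  cabs ((bsh B e (t, y)).1 - t1) < d + c /\ cabs ((bsh B e (t, y)).2 - y1) < d + c.
Proof.
move=> h1 h2 h3; have e0 := cabs_ge0 e; rewrite /bsh; case: (fb_vert B) => /=; split; try flra.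
  by rewrite addrAC; apply: le_lt_trans (cabsD _ _) _; flra.
by rewrite addrAC; apply: le_lt_trans (cabsD _ _) _; flra.
Qed.

(** Both sides are coordinates in [B2] of the same point, and [r] keeps every intermediate point
    where the transitions are valid and the coordinates injective. *)
Lemma transition_inverse B1 B2 t1 y1 t2 y2 (T T' : C -> C -> C * C) (rho rho' K K' : R) : Flow B2 ->
  cabs (bz B2 t2 y2) < fb_rz B2 ->
  0 < rho -> 0 < rho' -> 1 <= K -> 1 <= K' -> T t1 y1 = (t2, y2) -> T' t2 y2 = (t1, y1) ->
  (forall t y, cabs (t - t1) < rho -> cabs (y - y1) < rho ->
     Meq (bpt B1 t y) (bpt B2 (T t y).1 (T t y).2)) ->
  (forall t y, cabs (t - t2) < rho' -> cabs (y - y2) < rho' ->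
     Meq (bpt B2 t y) (bpt B1 (T' t y).1 (T' t y).2)) ->
  (forall t y t' y', cabs (t - t1) < rho -> cabs (y - y1) < rho ->
     cabs (t' - t1) < rho -> cabs (y' - y1) < rho ->
     cabs ((T t y).1 - (T t' y').1) <= K * (cabs (t - t') + cabs (y - y')) /\
     cabs ((T t y).2 - (T t' y').2) <= K * (cabs (t - t') + cabs (y - y'))) ->
  (forall t y t' y', cabs (t - t2) < rho' -> cabs (y - y2) < rho' ->
     cabs (t' - t2) < rho' -> cabs (y' - y2) < rho' ->
     cabs ((T' t y).1 - (T' t' y').1) <= K' * (cabs (t - t') + cabs (y - y')) /\
     cabs ((T' t y).2 - (T' t' y').2) <= K' * (cabs (t - t') + cabs (y - y'))) ->
  exists2 r, 0 < r & forall t y, cabs (t - t2) < r -> cabs (y - y2) < r -> T (T' t y).1 (T' t y).2 = (t, y).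
Proof.
move=> F2 hz rho0 rho'0 K1 K'1 T1 T'1 TM TM' TL TL'.
have g2 := flow_good F2.
have K0 : 0 < K by flra.
have K'0 : 0 < K' by flra.
have G0 : 0 < fb_rz B2 - cabs (bz B2 t2 y2) by rewrite subr_gt0.
have [||r r0 [r1 r2 r3]] := @exists_min3 R rho' (rho / (K' * 2)) ((fb_rz B2 - cabs (bz B2 t2 y2)) / (K * (K' * 4))) rho'0.
- by apply: divr_gt0 => //; apply: mulr_gt0.
- by apply: divr_gt0 => //; apply: mulr_gt0 => //; apply: mulr_gt0.
have {}r2 : K' * (2 * r) <= rho.
  by move: r2; rewrite ler_pdivlMr ?mulr_gt0 // mulrC mulrA.
have {}r3 : K * (K' * (4 * r)) <= fb_rz B2 - cabs (bz B2 t2 y2).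
  by move: r3; rewrite ler_pdivlMr ?mulr_gt0 // mulrC !mulrA.
have r4 : r <= K' * r by rewrite ler_peMl // ltW.
have r5 : K' * r <= K * (K' * r) by rewrite ler_peMl // mulr_ge0 ?ltW.
exists r => // t y ht hy.
have [||||l1 l2] := TL' t y t2 y2; rewrite ?subrr ?cabs0 //; [flra|flra|].
rewrite T'1 /= in l1 l2.
have l3 : K' * (cabs (t - t2) + cabs (y - y2)) < K' * (2 * r) by rewrite ltr_pM2l //; flra.
set u := (T' t y).1 in l1 *; set v := (T' t y).2 in l2 *.
have u1 : cabs (u - t1) < K' * (2 * r) by apply: le_lt_trans l1 l3.
have v1 : cabs (v - y1) < K' * (2 * r) by apply: le_lt_trans l2 l3.
have [||||m1 m2] := TL u v t1 y1; rewrite ?subrr ?cabs0 //; [flra|flra|].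
rewrite T1 /= in m1 m2.
have m3 : K * (cabs (u - t1) + cabs (v - y1)) < K * (K' * (4 * r)) by rewrite ltr_pM2l //; flra.
have E : Meq (bpt B2 (T u v).1 (T u v).2) (bpt B2 t y).
  apply: Meq_sym; apply: Meq_trans (TM u v _ _); [apply: TM'|flra|flra]; flra.
have [e1 e2] := bpt_inj g2 (bz_near (le_lt_trans m1 m3) (le_lt_trans m2 m3) ltac:(lra)) (bz_near ht hy ltac:(lra)) E.
by rewrite (surjective_pairing (T u v)) e1 e2.
Qed.

(** [bh] is the transverse gap between a translated point of one plaque and the other plaque. The
    transition commutes with the translation and maps plaques to plaques, so the gap changes at most
    by a constant factor. *)
Lemma bh_transition B1 B2 a1 a2 t1 t2 q : Flow B1 -> Flow B2 -> fb_A B1 a1 -> fb_A B2 a2 ->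
  cabs t1 < fb_r1 B1 -> cabs t2 < fb_r1 B2 -> Meq q (gam B1 a1 t1) -> Meq q (gam B2 a2 t2) ->
  box_nbhd B1 q -> box_nbhd B2 q -> forall rho, 0 < rho ->
  exists d K, [/\ 0 < d, 1 <= K & forall a b, fb_A B1 a -> fb_A B1 b ->
    cabs (bg B1 a t1 - bg B1 a1 t1) < d -> cabs (bg B1 b t1 - bg B1 a1 t1) < d ->
    exists a' b', [/\ fb_A B2 a', fb_A B2 b',
      cabs (bg B2 a' t2 - bg B2 a2 t2) <= K * cabs (bg B1 a t1 - bg B1 a1 t1),
      cabs (bg B2 b' t2 - bg B2 a2 t2) <= K * cabs (bg B1 b t1 - bg B1 a1 t1) &
      forall (e : C) (eta : R), cabs e < d -> eta < d ->
        (forall t, cabs (t - t1) < rho -> cabs (bh B1 a b e t) <= eta) ->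
        forall t, cabs (t - t2) < d -> cabs (bh B2 a' b' e t) <= K * eta]].
Proof.
move=> F1 F2 Aa1 Aa2 h1 h2 E1 E2 hb1 hb2 rho rho0.
have g1 := flow_good F1; have g2 := flow_good F2.
set y1 := bg B1 a1 t1; set y2 := bg B2 a2 t2.
have E12 : Meq (bpt B1 t1 y1) (bpt B2 t2 y2) := Meq_trans (Meq_sym E1) E2.
have [T [r1 [K [r10 K1 T1 TM [TL Tsh _]]]]] := transition E12.
have [T' [r2 [K' [r20 K'1 T'1 T'M [T'L T'sh _]]]]] := transition (Meq_sym E12).
have hz1 := gb_dom g1 Aa1 h1; have hz2 := gb_dom g2 Aa2 h2.
have [r3 r30 TT'] := transition_inverse F2 hz2 r10 r20 K1 K'1 T1 T'1 TM T'M TL T'L.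
have [|Lg Lg0 hLg] := @gb_lipschitz _ om1 om2 X B2 ((cabs t2 + fb_r1 B2) / 2) g2; first by flra.
have [dl1 dl10 uc1] := uniform_compat hom1 hom hL F1 F2 h1 h2 hz2 r10 K1 T1 TM TL (box_nbhd_Meq E2 hb2) r10.
have [c0 c00 [c0a c0b c0c]] := exists_min3 r10 dl10 rho0.
have [c2 c20 [c2a c2b _]] := exists_min3 r30 r20 ltr01.
have [|c1 c10 [c1a c1b c1c]] := @exists_min3 R c2 ((fb_r1 B2 - cabs t2) / 2) c0 c20 _ c00; first by flra.
have c4 : 0 < c1 / 4 by flra.
have [dl2 dl20 uc2] := uniform_compat hom1 hom hL F2 F1 h2 h1 hz1 r20 K'1 T'1 T'M T'L (box_nbhd_Meq E1 hb1) c4.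
(* [K] for the Lipschitz constant of the transition, [Lg + 1] because the image of a transverse gap
   is no longer transverse and has to be brought back to one parameter along a plaque. *)
pose Q := (Lg + 1) * K.
have Q1 : 1 <= Q by have : 0 < Lg * K by [apply: mulr_gt0; flra]; rewrite /Q; flra.
have KQ : K <= Q by have : 0 < Lg * K by [apply: mulr_gt0; flra]; rewrite /Q; flra.
have Q0 : 0 < Q by flra.
have [|d d0 [da db dc]] := exists_min3 c4 dl20 (_ : 0 < dl2 / Q); first exact: divr_gt0.
have {}dc : Q * d <= dl2 by move: dc; rewrite ler_pdivlMr // mulrC.
have lab a : fb_A B1 a -> cabs (bg B1 a t1 - y1) < d -> exists2 a', fb_A B2 a' &
   [/\ cabs (bg B2 a' t2 - y2) <= Q * cabs (bg B1 a t1 - y1),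
    exists2 tau, cabs (tau - t2) < dl2 & Meq (gam B1 a t1) (gam B2 a' tau) &
    forall u, cabs (u - t1) < dl1 ->
    [/\ cabs (u - t1) < r1, cabs (bg B1 a u - y1) < r1,
       (T u (bg B1 a u)).2 = bg B2 a' (T u (bg B1 a u)).1 &
        cabs (T u (bg B1 a u)).1 < fb_r1 B2]].
  move=> Aa ha; have tt : cabs (t1 - t1) < dl1 by rewrite subrr cabs0.
  have ha1 : cabs (bg B1 a t1 - y1) < dl1 by flra.
  have [a' Aa' ha'] := uc1 a t1 Aa tt ha1; exists a' => //.
  have [k1 k2 k3 k4 [k5 k6 k7]] := ha' t1 tt.
  have rr : cabs (t1 - t1) < r1 by rewrite subrr cabs0.
  have yy : cabs (y1 - y1) < r1 by rewrite subrr cabs0.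
  have [l1 l2] := TL t1 (bg B1 a t1) t1 y1 rr k3 rr yy.
  rewrite T1 subrr cabs0 add0r /= in l1 l2.
  have t2m : cabs t2 <= (cabs t2 + fb_r1 B2) / 2 by flra.
  split.
  - have l3 := hLg a' t2 _ Aa' t2m k5.
    have l4 : Lg * cabs ((T t1 (bg B1 a t1)).1 - t2) <= Lg * (K * cabs (bg B1 a t1 - y1)).
      by rewrite ler_wpM2l // ltW.
    have QE (r : R) : Q * r = Lg * (K * r) + K * r by rewrite /Q; ring.
    rewrite -k4 in l3; have := cabs_distD (T t1 (bg B1 a t1)).2 (bg B2 a' t2) y2.
    by rewrite (cabsB (bg B2 a' t2) (T _ _).2) QE; flra.
  - exists (T t1 (bg B1 a t1)).1; last by rewrite -k4; exact: TM.
    have l3 : K * cabs (bg B1 a t1 - y1) < K * d by rewrite ltr_pM2l //; flra.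
    have l4 : K * d <= Q * d by rewrite ler_wpM2r // ltW.
    by flra.
  - by move=> u hu; have [] := ha' u hu => ? ? ? ? []; split.
exists d, Q; split=> // a b Aa Ab ha hb.
have [a' Aa' [la1 la2 la3]] := lab a Aa ha; have [b' Ab' [lb1 [tau tau1 tau2] lb3]] := lab b Ab hb.
exists a', b'; split=> // e eta he heta hbh t ht.
have tt : cabs (t2 - t2) < dl2 by rewrite subrr cabs0.
have [|b1 Ab1 hb1'] := uc2 b' t2 Ab' tt.
  apply: le_lt_trans lb1 _; apply: lt_le_trans dc; rewrite ltr_pM2l //.
have h1b : cabs t1 < fb_r1 B1 by [].
have Eb : b1 = b.
  have [k1 k2 k3 k4 [k5 k6 k7]] := hb1' tau tau1.
  have h : inPlaque B1 b1 (bpt B1 (T' tau (bg B2 b' tau)).1 (T' tau (bg B2 b' tau)).2).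
    by rewrite k4; exact: inPlaque_gam.
  apply: (gb_disj g1 Ab1 Ab (inPlaque_Meq _ h) (inPlaque_gam _ _ _ h1b)).
  by apply: Meq_sym; apply: Meq_trans tau2 _; apply: T'M; flra.
subst b1; have [k1 k2 k3 k4 [k5 k6 k7]] := hb1' t (lt_le_trans ht db).
have K0 : 0 <= K by exact: le_trans ler01 K1.
clear K'1 dl10 r10 r20 r30 c00 c10 c20 dl20 hz1 hz2 tt la1 lb1 tau1 k1 ha hb Q1 KQ Q0 db dc d0 c2b rho0 h1.
set ty := T' t (bg B2 b' t) in k4 k5 k6 k7.
have hty : cabs (ty.1 - t1) < rho by flra.
have heta1 := hbh _ hty.
set p1 := bsh B1 e ty; set p2 := bsh B2 e (t, bg B2 b' t).
have p1E : T' p2.1 p2.2 = p1 by exact: T'sh.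
have he4 : cabs e < c1 / 4 by flra.
have [n1 n2] := bsh_near B2 k2 k3 he4.
have [n3 n4] := bsh_near B1 k6 k7 he4.
rewrite -surjective_pairing -/p1 in n3 n4; rewrite -/p2 in n1 n2.
have Tp1 : T p1.1 p1.2 = p2 by rewrite -p1E TT' -?surjective_pairing //; flra.
rewrite /bh -k4 -surjective_pairing -/p1 in heta1.
rewrite /bh -/p2.
have w1 : cabs (bg B1 a p1.1 - y1) < r1 by have := cabs_distD p1.2 (bg B1 a p1.1) y1; flra.
have [m1 _ m3 m4] := la3 p1.1 (ltac:(flra)).
have [||||l1 l2] := TL p1.1 (bg B1 a p1.1) p1.1 p1.2; [flra|by []|flra|flra|].
rewrite Tp1 subrr cabs0 add0r in l1 l2.
have p2m : cabs p2.1 <= (cabs t2 + fb_r1 B2) / 2 by have := cabs_lerB p2.1 t2; flra.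
have l3 := hLg a' p2.1 _ Aa' p2m m4; rewrite -m3 in l3.
have l4 : K * cabs (bg B1 a p1.1 - p1.2) <= K * eta by rewrite ler_wpM2l.
have l5 : Lg * cabs ((T p1.1 (bg B1 a p1.1)).1 - p2.1) <= Lg * (K * eta) by rewrite ler_wpM2l ?(ltW Lg0) //; exact: le_trans l1 l4.
have := cabs_distD (T p1.1 (bg B1 a p1.1)).2 (bg B2 a' p2.1) p2.2.
have QE : Q * eta = Lg * (K * eta) + K * eta by rewrite /Q; ring.
rewrite (cabsB (bg B2 a' p2.1) (T _ _).2) QE; move: l2 l3 l4 l5; clear; flra.
Qed.

End BoxChange.

Section Propagation.
Variable R : realType.
Local Notation C := R[i].
Variables om1 om2 : C.
Hypothesis hom1 : om1 != 0.
Hypothesis hom : cim (om2 / om1) != 0.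
Variable L : Lamination R.
Hypothesis hL : is_lamination om1 om2 L.
Implicit Types (z w l t y a b c : C) (p q x : Mpt R) (B : FlowBox R).
Local Notation inLat := (inLat om1 om2).
Local Notation Meq := (Meq om1 om2).
Local Notation Mclose := (Mclose om1 om2).
Local Notation inPlaque := (inPlaque om1 om2).
Local Notation X := (lam_X L).
Local Notation leaf := (leaf om1 om2 L).
Local Notation gam B a t := (bpt B t (bg B a t)).
Local Notation Flow := (flow_box_of om1 om2 L).
Local Notation box_nbhd := (box_nbhd om1 om2 X).
Variables (eps : nat -> C) (N : nat -> nat) (sc : C -> R).

Definition evn (P : nat -> Prop) := exists n0, forall n, (n0 <= n)%N -> P n.

Lemma evn_imp (P Q : nat -> Prop) : (forall n, P n -> Q n) -> evn P -> evn Q.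
Proof. by move=> PQ [n0 h]; exists n0 => n /h /PQ. Qed.

Lemma evn_and (P Q : nat -> Prop) : evn P -> evn Q -> evn (fun n => P n /\ Q n).
Proof.
move=> [n1 h1] [n2 h2]; exists (maxn n1 n2) => n; rewrite geq_max => /andP[/h1 ? /h2 ?]; by split.
Qed.

Hypothesis sc_ge0 : forall e, 0 <= sc e.
Hypothesis eps_lim : forall d : R, 0 < d -> evn (fun n => cabs (eps n) < d).
Hypothesis rate : forall j (d : R), (0 < j)%N -> 0 < d ->
  evn (fun n => sc (eps n) / 2 ^+ (N n %/ j) <= d * cabs (eps n)).

(* [K * (sc (eps n) / 2 ^+ (N n %/ j))] is [o(eps n)], by [rate]; three circles only cost a change of
   [j] and [K]. *)
Definition small_in B a t (rho K : R) (j : nat) := forall d : R, 0 < d -> evn (fun n =>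
  exists al be, [/\ fb_A B al, fb_A B be, cabs (bg B al t - bg B a t) < d, cabs (bg B be t - bg B a t) < d &
   forall u, cabs (u - t) < rho -> cabs (bh B al be (eps n) u) <= K * (sc (eps n) / 2 ^+ (N n %/ j))]).

Definition small q := exists B a t rho K j,
  [/\ Flow B, fb_A B a, cabs t < fb_r1 B, Meq q (gam B a t) & box_nbhd B q] /\
  [/\ 0 < rho, 0 <= K, (0 < j)%N & small_in B a t rho K j].

Lemma small_Meq q q' : Meq q q' -> small q -> small q'.
Proof.
move=> E [B [a [t [rho [K [j [[F Aa ht E' hb] h]]]]]]].
exists B, a, t, rho, K, j; split=> //; split=> //; first exact: Meq_trans (Meq_sym E) E'.
exact: box_nbhd_Meq E hb.
Qed.

Lemma rate0 (K d : R) j : 0 <= K -> (0 < j)%N -> 0 < d ->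
  evn (fun n => K * (sc (eps n) / 2 ^+ (N n %/ j)) < d).
Proof.
move=> K0 j0 d0; have K1 : 0 < K + 1 by flra.
apply: evn_imp (evn_and (rate j0 ltr01) (eps_lim (divr_gt0 d0 K1))) => n [h1 h2].
set r := sc (eps n) / _ in h1 *; rewrite mul1r in h1.
have r0 : 0 <= r by rewrite divr_ge0 // exprn_ge0.
have h3 : r < d / (K + 1) by flra.
by move: h3; rewrite ltr_pdivlMr // mulrDr mulr1 (mulrC r); flra.
Qed.

(** By [bh_transition], smallness may be tested in any box around the point: only the constant and
    the radius change, the exponent does not. *)
Lemma small_box q B a t : small q -> Flow B -> fb_A B a -> cabs t < fb_r1 B -> Meq q (gam B a t) ->
  box_nbhd B q -> exists rho K j, [/\ 0 < rho, 0 <= K, (0 < j)%N & small_in B a t rho K j].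
Proof.
move=> [B1 [a1 [t1 [rho [K [j [[F1 Aa1 ht1 E1 hb1] [rho0 K0 j0 h]]]]]]]] F Aa ht E hb.
have [d [Q [d0 Q1 hd]]] := bh_transition hom1 hom hL F1 F Aa1 Aa ht1 ht E1 E hb1 hb rho0.
exists d, (Q * K), j; split=> //; first by apply: mulr_ge0 => //; flra.
move=> e e0; have Q0 : 0 < Q by flra.
have [|m m0 [md me _]] := exists_min3 d0 (_ : 0 < e / Q) ltr01; first exact: divr_gt0.
apply: evn_imp (evn_and (h m m0) (evn_and (eps_lim d0) (rate0 K0 j0 d0))) => n [[al [be [Aal Abe hal hbe hh]]] [he hK]].
have [||al' [be' [Aal' Abe' k1 k2 k3]]] := hd al be Aal Abe; [by flra|by flra|].
have lte (x : R) : x < m -> Q * x < e by move=> xm; rewrite mulrC -ltr_pdivlMr //; flra.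
exists al', be'; split=> //; [exact: le_lt_trans k1 (lte _ hal)|exact: le_lt_trans k2 (lte _ hbe)|].
by move=> u hu; rewrite -mulrA; exact: (k3 _ _ he hK hh).
Qed.

Lemma bh_holo B al be (e : C) t (r : R) : good_box om1 om2 X B -> fb_A B al -> fb_A B be ->
  cabs t + r + cabs e <= fb_r1 B -> holo t r (bh B al be e).
Proof.
move=> gB Aal Abe hr; have e0 := cabs_ge0 e.
rewrite /bh /bsh; case: (fb_vert B) => /=.
  apply: holoB; first by apply: (holo_sub (gb_holo gB Aal)); rewrite subr0; flra.
  by apply: holoD; [apply: (holo_sub (gb_holo gB Abe)); rewrite subr0; flra|exact: holo_const].
apply: holoB; last by apply: (holo_sub (gb_holo gB Abe)); rewrite subr0; flra.
apply: holo_shift; apply: (holo_sub (gb_holo gB Aal)); rewrite subr0.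
by have := cabsD t e; flra.
Qed.

(* Trivial for [sc = 1]; for [sc = cabs] it is what the transversal Lipschitz condition is used for. *)
Definition apriori B t := exists r K e1 : R, [/\ 0 < r, cabs t + r < fb_r1 B, 0 <= K, 0 < e1 &
  forall al be (e : C) (M : R), fb_A B al -> fb_A B be -> cabs e < e1 -> 0 <= M ->
  forall u v, cabs (u - t) < r -> cabs (v - t) < r ->
   cabs (bh B al be e u) <= M * sc e -> cabs (bh B al be e v) <= K * (M + 1) * sc e].

(** The radius [d] depends on [D], [c] and [t] only, not on the disc or the exponent with which
    smallness is known at [u]. Smallness is therefore open and closed along a plaque; the loss of
    the three circles theorem goes into [j * j']. *)
Lemma small_local D c t q : Flow D -> fb_A D c -> cabs t < fb_r1 D -> Meq q (gam D c t) -> box_nbhd D q ->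
  apriori D t -> exists2 d, 0 < d & forall u v, cabs (u - t) < d -> cabs (v - t) < d ->
  small (gam D c u) -> small (gam D c v).
Proof.
move=> F Ac ht E hb [r [K [e1 [r0 hr K0 e10 hap]]]].
have gD := flow_good F.
have [r1 r10 [hr1 hb1 hcl]] := plaque_close gD Ac ht (box_nbhd_Meq E hb).
have [r2 r20 [r21 r22 _]] := exists_min3 r0 r10 ltr01.
have d0 : 0 < r2 / 600 by flra.
have q2 : r2 / 600 <= r2 by flra.
exists (r2 / 600) => // u v hu hv su.
have ins w : cabs (w - t) < r2 / 600 -> cabs w < fb_r1 D by move=> hw; have := cabs_lerB w t; flra.
have [|rho [K1 [j [rho0 K10 j0 hs]]]] := small_box su F Ac (ins u hu) (Meq_refl _ _ _).
  by apply: hb1; flra.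
have rho2 : 0 < rho / 2 by flra.
have [j' [K2 [j'0 K21 htc]]] := three_circles_iter r20 rho2.
(* Dominates the a priori bound [K * (K1 + 1)] on the large disc as well as the factor [K1] of the
   given smallness, so that both bounds in the three circles theorem have the same prefactor. *)
pose M := K * (K1 + 1) + K1.
have M0 : 0 <= M by rewrite addr_ge0 // mulr_ge0 // addr_ge0.
exists D, c, v, (r2 / 600 - cabs (v - t)), (K2 * M), (j * j')%N; split.
  split=> //; [exact: ins|exact: Meq_refl|by apply: hb1; flra].
split; [by flra|by apply: mulr_ge0 => //; exact: le_trans ler01 K21|by rewrite muln_gt0 j0|].
move=> d' d'0; have [d2 d20 hd2] := hcl d' d'0.
have G0 : 0 < fb_r1 D - (cabs t + r2) by flra.
apply: evn_imp (evn_and (hs d2 d20) (evn_and (eps_lim e10) (eps_lim G0))) => n [[al [be [Aal Abe hal hbe hh]]] [he1 he2]].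
have ur2 := lt_le_trans hu q2; have ur := lt_le_trans ur2 r22.
have vr := lt_le_trans (lt_le_trans hv q2) r22.
have [k1 _ _] := hd2 al u Aal ur hal v vr; have [k2 _ _] := hd2 be u Abe ur hbe v vr.
exists al, be; split=> // w hw.
set s := sc (eps n) in hh *; set k := (N n %/ j)%N in hh.
have s0 : 0 <= s by exact: sc_ge0.
have p0 : 0 < (2 : R) ^+ k by apply: exprn_gt0.
have p1 : (1 : R) <= 2 ^+ k by rewrite exprn_ege1 // ler1n.
have K1s : K1 * s <= M * s by rewrite ler_wpM2r // /M lerDr mulr_ge0 // addr_ge0.
have hM z : cabs (z - t) < r2 -> cabs (bh D al be (eps n) z) <= M * s.
  move=> hz; apply: (@le_trans _ _ (K * (K1 + 1) * s)); last by rewrite ler_wpM2r // /M lerDl.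
  apply: (hap al be _ K1 Aal Abe he1 K10 u); [exact: lt_le_trans ur2 r21|exact: lt_le_trans hz r21|].
  apply: le_trans (hh u _) _; first by rewrite subrr cabs0.
  by rewrite -/s mulrA ler_pdivrMr // ler_peMr // mulr_ge0.
have hol : holo t r2 (bh D al be (eps n)) by apply: (bh_holo gD Aal Abe); flra.
have -> : K2 * M * (s / 2 ^+ (N n %/ (j * j'))) = K2 * (M * s) / 2 ^+ (k %/ j') by rewrite divnMA !mulrA.
apply: (htc t u _ (M * s) k hol hM (ltW hu)); last first.
  by have := cabs_distD v w t; rewrite [cabs (v - t)]cabsB; rewrite (cabsB v t) in hw *; flra.
move=> z hz; apply: le_trans (hh z _) _; first by flra.
by rewrite mulrA ler_wpM2r // invr_ge0 ltW.
Qed.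

Hypothesis HAP : forall q, X q -> exists D c t,
  [/\ Flow D, fb_A D c, cabs t < fb_r1 D, Meq q (gam D c t) & box_nbhd D q] /\ apriori D t.

(** Along each plaque of a chain smallness is locally constant. The boxes of [HAP], which carry the
    a priori bound, need not be those of the chain: [flow_param] passes between them. *)
Lemma small_leaf p q : X p -> leaf p q -> small p -> small q.
Proof.
move=> Xp lpq; elim: lpq Xp => {p q} [p q [B [a [AB [Aa [pa qa]]]]]|//|p x q lpx IH1 lxq IH2] Xp sp; last first.
  by apply: IH2; [exact: (leaf_X hL Xp lpx)|exact: IH1].
have F := atlas_flow hL AB; have gB := flow_good F.
have [t1 [ht1 E1]] := (inPlaqueE _ _ _ _ _).1 pa.
have [t2 [ht2 E2]] := (inPlaqueE _ _ _ _ _).1 qa.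
apply: small_Meq (Meq_sym E2) _; move: (small_Meq E1 sp).
have sh t : cabs t < fb_r1 B -> cabs (t - 0) < fb_r1 B by rewrite subr0.
apply: (@disc_connected _ 0 (fb_r1 B) (fun t => small (gam B a t))); [|exact: sh|exact: sh].
move=> z; rewrite subr0 => hz.
have [D [c [t [[FD Ac ht E hb] hap]]]] := HAP (gb_X gB Aa hz).
have [d d0 hd] := small_local FD Ac ht E hb hap.
have [phi [e [e0 hphi phiz hp]]] := flow_param hom1 hom hL F FD Aa Ac hz ht E.
have cphi : ccont phi z by apply: (holo_cont hphi); rewrite subrr cabs0.
have [d' d'0 hd'] := cphi d d0; rewrite phiz in hd'.
exists (Num.min e d'); first by rewrite lt_min e0.
move=> w _; rewrite lt_min => /andP[we wd'].
have [_ _ Ew] := hp w we; have hw := hd' w wd'.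
have tt : cabs (t - t) < d by rewrite subrr cabs0.
split=> [s1|s1].
  by apply: small_Meq (Meq_sym Ew) _; apply: hd tt hw _; exact: small_Meq E s1.
by apply: small_Meq (Meq_sym E) _; apply: hd hw tt _; exact: small_Meq Ew s1.
Qed.

End Propagation.

Section NoSmall.
Variable R : realType.
Local Notation C := R[i].
Variables om1 om2 : C.
Hypothesis hom1 : om1 != 0.
Hypothesis hom : cim (om2 / om1) != 0.
Variable L : Lamination R.
Hypothesis hL : is_lamination om1 om2 L.
Implicit Types (z w l t y a b c : C) (p q x : Mpt R) (B : FlowBox R).
Local Notation inLat := (inLat om1 om2).
Local Notation Meq := (Meq om1 om2).
Local Notation Mclose := (Mclose om1 om2).
Local Notation inPlaque := (inPlaque om1 om2).
Local Notation X := (lam_X L).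
Local Notation leaf := (leaf om1 om2 L).
Local Notation gam B a t := (bpt B t (bg B a t)).
Local Notation Flow := (flow_box_of om1 om2 L).
Local Notation box_nbhd := (box_nbhd om1 om2 X).
Hypothesis hnc : no_compact_leaf om1 om2 L.
Variables (eps : nat -> C) (N : nat -> nat) (sc : C -> R).
Hypothesis sc_ge0 : forall e, 0 <= sc e.
Hypothesis eps_neq0 : forall n, eps n != 0.
Hypothesis eps_lim : forall d : R, 0 < d -> evn (fun n => cabs (eps n) < d).
Hypothesis rate : forall j (d : R), (0 < j)%N -> 0 < d ->
  evn (fun n => sc (eps n) / 2 ^+ (N n %/ j) <= d * cabs (eps n)).

Lemma rate_scaled (K d : R) j : 0 <= K -> (0 < j)%N -> 0 < d ->
  evn (fun n => K * (sc (eps n) / 2 ^+ (N n %/ j)) <= d * cabs (eps n)).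
Proof.
move=> K0 j0 d0; have K1 : 0 < K + 1 by flra.
apply: evn_imp (rate j0 (divr_gt0 d0 K1)) => n h.
have r0 : 0 <= sc (eps n) / 2 ^+ (N n %/ j) by rewrite divr_ge0 // exprn_ge0.
apply: (@le_trans _ _ ((K + 1) * (sc (eps n) / 2 ^+ (N n %/ j)))); first by rewrite ler_wpM2r //; flra.
apply: le_trans (_ : (K + 1) * (d / (K + 1) * cabs (eps n)) <= _); first by rewrite ler_wpM2l // ltW.
by rewrite mulrA mulrCA divff ?mulr1 // gt_eqF.
Qed.

(** Hurwitz's theorem in quantitative form. With U = g_al - g_be, smallness gives |U + e g_a'| <=
    (3/8) m |e| near [t]. So |U| >= (5/8) m |e| on an annulus, and also at [t] since U has no zero;
    but g_a' vanishes at [t], where |U| <= (3/8) m |e|. *)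
Lemma tangency_not_small B a t : Flow B -> fb_A B a -> cabs t < fb_r1 B -> box_nbhd B (gam B a t) ->
  fb_vert B = false -> deriv (bg B a) t = 0 -> ~ small om1 om2 L eps N sc (gam B a t).
Proof.
move=> F Aa ht hb vB dt sm; have gB := flow_good F.
have [r0 r00 [hr _ hcl]] := plaque_close gB Aa ht hb.
have [rho [K [j [rho0 K0 j0 hs]]]] := small_box hom1 hom hL sc_ge0 eps_lim rate sm F Aa ht (Meq_refl _ _ _) hb.
have [d0 d00 hd0] := deriv_nonzero_annulus hom1 hom hL hnc F Aa ht.
have [q q0 [q1 q2 q3]] := exists_min3 r00 rho0 d00.
pose s := q / 8; have s0 : 0 < s by rewrite /s; flra.
have [s1 s2 s3] : [/\ 8 * s <= r0, 8 * s <= rho & 8 * s <= d0] by rewrite /s; split; flra.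
clearbody s; clear q1 q2 q3 q0 q.
have [m m0 hm] := hd0 s s0 ltac:(flra); clear hd0.
have ga : holo t r0 (bg B a) by apply: (holo_sub (gb_holo gB Aa)); rewrite subr0; flra.
have [K2 K20 hK2] := holo_second_order ga (ltac:(flra) : 0 < r0 / 2) (ltac:(flra) : r0 / 2 < r0).
have e0 : 0 < m * r0 / 128 by apply: divr_gt0 => //; apply: mulr_gt0.
have [d2 d20 hd2] := hcl _ e0.
have m8 : 0 < m / 8 by flra.
have K21 : 0 < K2 + 1 by flra.
have [n0 /(_ n0 (leqnn _)) [[al [be [Aal Abe hal _ hh]]] [he1 [he2 hrt]]]] :=
  evn_and (hs d2 d20) (evn_and (eps_lim s0) (evn_and (eps_lim (divr_gt0 m8 K21)) (rate_scaled K0 j0 m8))).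
set e := eps n0 in he1 he2 hrt hh.
have eg0 : 0 < cabs e by rewrite cabs_gt0 eps_neq0.
have tt : cabs (t - t) < r0 by rewrite subrr cabs0.
have hphi u : cabs (u - t) < r0 -> cabs (bg B al u - bg B a u) <= m * r0 / 128.
  by move=> hu; have [/ltW] := hd2 al t Aal tt hal u hu.
have gal : holo t r0 (bg B al) by apply: (holo_sub (gb_holo gB Aal)); rewrite subr0; flra.
have gbe : holo t r0 (bg B be) by apply: (holo_sub (gb_holo gB Abe)); rewrite subr0; flra.
have hK2e : K2 * cabs e <= m / 8.
  by move: he2; rewrite ltr_pdivlMr // mulrDr mulr1 mulrC; flra.
pose U u := bg B al u - bg B be u.
(* Three errors of [m / 8 * cabs e]: the assumed smallness of [bh], the second-order remainder of
   g_a, and the increment over [e] of g_al - g_a, which is small by closeness of the plaques. *)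
have key u : cabs (u - t) <= 2 * s -> cabs (U u + e * deriv (bg B a) u) <= 3 * (m / 8) * cabs e.
  move=> hu.
  have ue : cabs (u + e - t) < r0 / 2.
    by rewrite addrAC; apply: le_lt_trans (cabsD _ _) _; flra.
  have u2 : cabs (u - t) < r0 / 2 by flra.
  have ue' : cabs (u + e - t) < r0 by flra.
  have u2' : cabs (u - t) < r0 by flra.
  have [_] := hK2 u (u + e) u2 ue; rewrite [u + e - u]addrC addKr => k1.
  have k2 := cauchy_lipschitz (holoB gal ga) hphi u2' ue'; rewrite [u + e - u]addrC addKr in k2.
  have k3 := hh u (ltac:(flra)); rewrite /bh /bsh vB /= in k3.
  have k4 : K2 * cabs e ^+ 2 <= m / 8 * cabs e by rewrite expr2 mulrA ler_wpM2r // ltW.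
  have k5 : 8 * (m * r0 / 128) / (r0 - cabs (u - t)) <= m / 8.
    rewrite ler_pdivrMr; last by flra.
    by have : m * (r0 / 2) <= m * (r0 - cabs (u - t)) by [rewrite ler_wpM2l ?(ltW m0) //; flra]; flra.
  have k6 := ler_wpM2r (ltW eg0) k5.
  have -> : U u + e * deriv (bg B a) u = (bg B al (u + e) - bg B be u) +
     (- (bg B a (u + e) - bg B a u - e * deriv (bg B a) u) +
      - (bg B al (u + e) - bg B a (u + e) - (bg B al u - bg B a u))) by rewrite /U; ring.
  apply: le_trans (cabsD _ _) _; have := cabsD (- (bg B a (u + e) - bg B a u - e * deriv (bg B a) u))
     (- (bg B al (u + e) - bg B a (u + e) - (bg B al u - bg B a u))).
  by rewrite !cabsN; move: k1 k2 k3 k4 k6 hrt; flra.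
have low u : s <= cabs (u - t) <= 2 * s -> 5 * (m / 8) * cabs e <= cabs (U u).
  move=> hu; have k1 := hm u hu; have /andP[_ hu2] := hu; have k2 := key u hu2.
  have := cabsD (U u + e * deriv (bg B a) u) (- U u); rewrite addrC addKr cabsM cabsN.
  have k3 := ler_wpM2l (ltW eg0) k1.
  by move: k2 k3; flra.
have lowp : 0 < 5 * (m / 8) * cabs e by apply: mulr_gt0 => //; flra.
(* The lower bound on the annulus excludes [al = be], and distinct plaques do not meet. *)
have Unz u : cabs (u - t) < r0 -> U u != 0.
  move=> hu; rewrite subr_eq0; apply/eqP => E.
  have Eab : al = be by apply: (gb_neq gB Aal Abe _ E); have := cabs_lerB u t; flra.
  have := low (t + (s%:C)%C); rewrite [t + _]addrC addrK cabsR gtr0_norm // /U Eab subrr cabs0.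
  by move=> /(_ ltac:(apply/andP; split; flra)); flra.
have sr : 2 * s < r0 by flra.
have := min_modulus (holoB gal gbe) s0 sr lowp Unz low (z := t).
rewrite subrr cabs0 => /(_ ltac:(flra)) k1.
have := key t; rewrite subrr cabs0 dt mulr0 addr0 => /(_ ltac:(flra)).
have := mulr_gt0 m8 eg0; rewrite /U; move: k1; flra.
Qed.

Hypothesis HAP : forall q, X q -> exists D c t,
  [/\ Flow D, fb_A D c, cabs t < fb_r1 D, Meq q (gam D c t) & box_nbhd D q] /\ apriori sc D t.

Lemma not_small q : X q -> ~ small om1 om2 L eps N sc q.
Proof.
move=> Xq sq; have [B [a [t [[F Aa ht hb lq] [vB dt]]]]] := tangency_exists hom1 hom hL hnc Xq.
exact: (tangency_not_small F Aa ht hb vB dt (small_leaf hom1 hom hL sc_ge0 eps_lim rate HAP Xq lq sq)).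
Qed.

End NoSmall.

(** * Intersections of a plaque with a translated plaque *)

Section Apriori.
Variable R : realType.
Local Notation C := R[i].
Variables om1 om2 : C.
Hypothesis hom1 : om1 != 0.
Hypothesis hom : cim (om2 / om1) != 0.
Variable L : Lamination R.
Hypothesis hL : is_lamination om1 om2 L.
Implicit Types (z w l t y a b c : C) (p q x : Mpt R) (B : FlowBox R).
Local Notation inLat := (inLat om1 om2).
Local Notation Meq := (Meq om1 om2).
Local Notation Mclose := (Mclose om1 om2).
Local Notation inPlaque := (inPlaque om1 om2).
Local Notation X := (lam_X L).
Local Notation leaf := (leaf om1 om2 L).
Local Notation gam B a t := (bpt B t (bg B a t)).
Local Notation Flow := (flow_box_of om1 om2 L).
Local Notation box_nbhd := (box_nbhd om1 om2 X).

Lemma bsh_fst B (e t y : C) : cabs ((bsh B e (t, y)).1) <= cabs t + cabs e.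
Proof.
rewrite /bsh; case: (fb_vert B) => /=; last exact: cabsD.
by have := cabs_ge0 e; flra.
Qed.

Lemma bsh_snd B (e t y : C) : cabs ((bsh B e (t, y)).2) <= cabs y + cabs e.
Proof.
rewrite /bsh; case: (fb_vert B) => /=; first exact: cabsD.
by have := cabs_ge0 e; flra.
Qed.

Lemma apriori_bounded B t : good_box om1 om2 X B -> cabs t < fb_r1 B -> apriori (fun=> 1) B t.
Proof.
move=> gB ht; have [M M0 hM] := gb_bound gB; set g := fb_r1 B - cabs t.
have g0 : 0 < g by rewrite subr_gt0.
have [e1 e10 [e1a e1b _]] := exists_min3 (divr_gt0 g0 (ltac:(flra) : (0 : R) < 4)) ltr01 ltr01.
exists (g / 4), (2 * M + 1), e1; split => //; [by flra|by rewrite /g in g0 *; flra|by flra|].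
move=> al be e M1 Aal Abe he M10 u v _ hv _; rewrite mulr1 /bh.
have vr : cabs v < cabs t + g / 4 by have := cabs_lerB v t; flra.
have k1 := bsh_fst B e v (bg B be v); have k2 := bsh_snd B e v (bg B be v).
have k3 : cabs (bg B be v) <= M by apply: hM => //; rewrite /g in vr g0 *; flra.
have k4 : cabs (bg B al (bsh B e (v, bg B be v)).1) <= M by apply: hM => //; rewrite /g in e1a vr g0 *; flra.
have k5 : 2 * M + 1 <= (2 * M + 1) * (M1 + 1) by apply: ler_peMr; flra.
apply: le_trans (cabsD _ _) _; rewrite cabsN; flra.
Qed.

(** Two values of g_al - g_be differ by a factor at most K^2, through the distance of the labels,
    and [bh] differs from g_al - g_be by O(|e|): once it is O(|e|) at one point, it is so throughout
    the disc. *)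
Lemma apriori_lipschitz B t (K : R) : good_box om1 om2 X B -> cabs t < fb_r1 B -> 0 < K ->
  (forall a b s, fb_A B a -> fb_A B b -> a <> b -> cabs s < fb_r1 B ->
     cabs (a - b) / K < dtrans B a b s /\ dtrans B a b s < K * cabs (a - b)) ->
  apriori (@cabs R) B t.
Proof.
move=> gB ht K0 hK; set g := fb_r1 B - cabs t.
have g0 : 0 < g by rewrite subr_gt0.
have [|Lg Lg0 hLg] := @gb_lipschitz _ om1 om2 X B (cabs t + g / 4) gB; first by rewrite /g in g0 *; flra.
have dE a b s : dtrans B a b s = cabs (bg B a s - bg B b s).
  by rewrite /dtrans /bg; congr (cabs _); ring.
have comp a b u v : fb_A B a -> fb_A B b -> cabs u < fb_r1 B -> cabs v < fb_r1 B ->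
    cabs (bg B a v - bg B b v) <= K ^+ 2 * cabs (bg B a u - bg B b u).
  move=> Aa Ab hu hv; have [->|/eqP ab] := eqVneq a b; first by rewrite !subrr cabs0 mulr0.
  have [k1 _] := hK a b u Aa Ab ab hu; have [_ k2] := hK a b v Aa Ab ab hv.
  rewrite !dE in k1 k2; move: k1; rewrite ltr_pdivrMr // => k1.
  apply: le_trans (ltW k2) _; rewrite expr2 -mulrA ler_wpM2l ?(ltW K0) // mulrC; exact: ltW.
have near al be (e : C) u : fb_A B al -> fb_A B be -> cabs e < g / 4 -> cabs u < cabs t + g / 4 ->
    cabs (bh B al be e u - (bg B al u - bg B be u)) <= (Lg + 1) * cabs e.
  move=> Aal Abe he hu; rewrite /bh /bsh; have eg := cabs_ge0 e; have Le := mulr_ge0 (ltW Lg0) eg.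
  case: (fb_vert B) => /=.
    have -> : bg B al u - (bg B be u + e) - (bg B al u - bg B be u) = - e by ring.
    by rewrite cabsN; flra.
  have -> : bg B al (u + e) - bg B be u - (bg B al u - bg B be u) = bg B al (u + e) - bg B al u by ring.
  have ue : cabs (u + e) < fb_r1 B by have := cabsD u e; rewrite /g in he hu g0; flra.
  have := hLg al u (u + e) Aal (ltW hu) ue; rewrite [u + e - u]addrC addKr; flra.
exists (g / 4), ((K ^+ 2 + 1) * (Lg + 1)), (g / 4).
have KK : 0 <= K ^+ 2 by rewrite exprn_ge0 // ltW.
split => //; [by flra|by rewrite /g in g0 *; flra|by apply: mulr_ge0; flra|by flra|].
move=> al be e M Aal Abe he M0 u v hu hv h.
have ut : cabs u < cabs t + g / 4 by have := cabs_lerB u t; flra.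
have vt : cabs v < cabs t + g / 4 by have := cabs_lerB v t; flra.
have ur : cabs u < fb_r1 B by rewrite /g in ut g0 *; flra.
have vr : cabs v < fb_r1 B by rewrite /g in vt g0 *; flra.
have k1 := near al be e u Aal Abe he ut; have k2 := near al be e v Aal Abe he vt.
have k3 := comp al be u v Aal Abe ur vr.
have k4 := cabs_distD (bh B al be e u) (bg B al u - bg B be u) 0.
rewrite !subr0 (cabsB _ (bh _ _ _ _ _)) in k4.
have k5 := cabs_distD (bg B al v - bg B be v) (bh B al be e v) 0.
rewrite !subr0 in k5.
have k6 : K ^+ 2 * cabs (bg B al u - bg B be u) <= K ^+ 2 * ((M + (Lg + 1)) * cabs e).
  by rewrite ler_wpM2l //; flra.
have eg := cabs_ge0 e.
have k7 : 0 <= (K ^+ 2 * (M * Lg) + (Lg + 1) * M) * cabs e.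
  apply: mulr_ge0 => //; apply: addr_ge0; apply: mulr_ge0 => //; last by flra.
  by apply: mulr_ge0 => //; exact: ltW.
move: k1 k2 k3 k5 k6 k7; clear; nra.
Qed.

End Apriori.

(** * Smaller flow boxes recentred at a given point *)

Section LocalBox.
Variable R : realType.
Local Notation C := R[i].
Variables om1 om2 : C.
Hypothesis hom1 : om1 != 0.
Hypothesis hom : cim (om2 / om1) != 0.
Variable L : Lamination R.
Hypothesis hL : is_lamination om1 om2 L.
Implicit Types (z w l t y a b c : C) (p q x : Mpt R) (B : FlowBox R).
Local Notation inLat := (inLat om1 om2).
Local Notation Meq := (Meq om1 om2).
Local Notation Mclose := (Mclose om1 om2).
Local Notation inPlaque := (inPlaque om1 om2).
Local Notation X := (lam_X L).
Local Notation leaf := (leaf om1 om2 L).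
Local Notation gam B a t := (bpt B t (bg B a t)).
Local Notation Flow := (flow_box_of om1 om2 L).
Local Notation box_nbhd := (box_nbhd om1 om2 X).

Section Recentre.
Variables (D : FlowBox R) (t0 : C).

(** The recentred box labels plaques by their transverse coordinate at [t0]; this recovers the label
    in [D]. *)
Definition label_of (a' : C) : C := xget 0 [set a | fb_A D a /\ bg D a t0 = a'].

(* [rw] only serves as a bound, so it can be chosen large. *)
Definition recbox (y0 : C) (eta r rz rw : R) : FlowBox R := {|
  fb_vert := fb_vert D; fb_chart := fb_chart D;
  fb_z0 := if fb_vert D then fb_z0 D else fb_z0 D + t0;
  fb_w0 := if fb_vert D then fb_w0 D + t0 else fb_w0 D;
  fb_rz := rz; fb_rw := rw; fb_r1 := r;
  fb_A := fun a' => exists a, [/\ fb_A D a, bg D a t0 = a' & cabs (a' - y0) < eta];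
  fb_f := fun a' t => bg D (label_of a') (t0 + t) - a' |}.

Lemma label_ofP a : good_box om1 om2 X D -> cabs t0 < fb_r1 D -> fb_A D a -> label_of (bg D a t0) = a.
Proof.
move=> gD ht Aa; rewrite /label_of; case: xgetP => [b _ [Ab E]|h].
  exact: gb_neq gD Ab Aa ht E.
by case: (h a).
Qed.

Lemma rec_bg y0 eta r rz rw a' t :
  bg (recbox y0 eta r rz rw) a' t = bg D (label_of a') (t0 + t).
Proof. by rewrite /bg /= addrC subrK. Qed.

Lemma rec_bpt y0 eta r rz rw t y :
  bpt (recbox y0 eta r rz rw) t y = bpt D (t0 + t) y.
Proof. by rewrite !bptE /bz /bw /=; case: (fb_vert D); rewrite addrA. Qed.

Lemma rec_inPlaque y0 eta r rz rw a' p : inPlaque (recbox y0 eta r rz rw) a' p <->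
  exists t, cabs (t - t0) < r /\ Meq p (gam D (label_of a') t).
Proof.
rewrite inPlaqueE; split=> -[t [ht E]].
  by exists (t0 + t); rewrite [t0 + t - t0]addrC addKr; rewrite rec_bpt rec_bg in E.
by exists (t - t0); rewrite rec_bpt rec_bg [t0 + _]addrC subrK.
Qed.

Lemma rec_flow y0 eta r : Flow D -> cabs t0 < fb_r1 D -> 0 < r -> cabs t0 + r < fb_r1 D ->
  exists rz rw : R, r <= 1 -> (~~ fb_vert D -> cabs t0 + r < fb_rz D) -> Flow (recbox y0 eta r rz rw).
Proof.
move=> F ht r0 hr; have gD := flow_good F.
have [M M0 hM] := gb_bound gD.
(* In a horizontal box the base point moves by [t0] on the torus, which shrinks the disc where the
   projection is injective. [M + 1] exceeds the transverse coordinate and, as [r <= 1], also the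
   parameter. *)
exists (if fb_vert D then fb_rz D else fb_rz D - cabs t0), (M + 1) => r1 hrz.
have ins t : cabs t < r -> cabs (t0 + t) < fb_r1 D by move=> h; have := cabsD t0 t; flra.
have lab a' : fb_A (recbox y0 eta r (if fb_vert D then fb_rz D else fb_rz D - cabs t0) (M + 1)) a' ->
   fb_A D (label_of a') /\ bg D (label_of a') t0 = a'.
  by move=> [a [Aa <- _]]; rewrite label_ofP.
set B := recbox _ _ _ _ _ in lab *.
have pl a' p : fb_A B a' -> inPlaque B a' p -> inPlaque D (label_of a') p.
  move=> _ /rec_inPlaque [t [h E]]; apply/inPlaqueE; exists t; split=> //.
  by have := ins (t - t0) h; rewrite addrC subrK.
have [_ [_ [_ [zinj _]]]] := gD.
split; last first.
  move=> a' p q Aa' pa qa; case: F => _ h; apply: (h (label_of a')); [by case: (lab _ Aa')|exact: pl|exact: pl].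
have rz0 : 0 < fb_rz B.
  rewrite /B /=; case: ifP => [_|/negbT/hrz h]; last by flra.
  by case: gD => _ [].
split=> //; split=> //; split; first by rewrite /B /=; flra.
split.
  rewrite /B /= => z z'; case: ifP => v hz hz'; first exact: zinj.
  have sh w : cabs (w - (fb_z0 D + t0)) < fb_rz D - cabs t0 -> cabs (w - fb_z0 D) < fb_rz D.
    by move=> h; have := cabs_distD (fb_z0 D + t0) w (fb_z0 D); rewrite [_ + t0 - _]addrC addKr; flra.
  by apply: zinj; exact: sh.
have dom a' t : fb_A B a' -> cabs t < r -> cabs (bg B a' t) <= M.
  by move=> Aa' h; rewrite rec_bg; apply: hM; [case: (lab _ Aa')|exact: ins].
split.
  move=> a' Aa'; have [Al <-] := lab a' Aa'; rewrite [fb_rw B]/=.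
  by have := hM _ _ Al ht; flra.
split.
  move=> a' t Aa' h; have [Al E] := lab a' Aa'; rewrite /fb_coord -/(bg B a' t).
  have h' : cabs t < r := h; have d1 := dom a' t Aa' h; have d2 := gb_dom gD Al (ins t h).
  rewrite rec_bg in d1 *; move: d2; rewrite /bz /B /=; case: ifP => v d2 /=; split=> //; try (by flra).
  by have := hrz (negbT v); flra.
split.
  move=> a' Aa'; have [Al E] := lab a' Aa'; split; first by rewrite /= addr0 E subrr.
  apply/holo_discP; apply: holoB; last exact: holo_const.
  apply: (holo_ext (f := fun t => bg D (label_of a') (t + t0))); first by move=> z _; rewrite addrC.
  by apply: holo_shift; apply: (holo_sub (gb_holo gD Al)); rewrite /= add0r subr0; flra.
split.
  move=> a' e Aa' e0; have e2 : 0 < e / 2 by flra.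
  have rr : 0 < (cabs t0 + r + fb_r1 D) / 2 by have := cabs_ge0 t0; flra.
  have [d d0 hd] := gb_harnack gD rr (ltac:(flra)) e2.
  exists (Num.min d (e / 2)); split; first by rewrite lt_min d0.
  move=> b' t Ab'; rewrite lt_min => /andP[h1 h2] h.
  have [Ala Ea] := lab a' Aa'; have [Alb Eb] := lab b' Ab'.
  rewrite /B /=.
  have k1 := hd _ _ t0 (t0 + t) Ala Alb; rewrite Ea Eb in k1.
  have {}k1 : cabs (bg D (label_of a') (t0 + t) - bg D (label_of b') (t0 + t)) < e / 2.
    by apply: k1 => //; have := ins t h; have := cabsD t0 t; rewrite /= in h; flra.
  have -> : bg D (label_of a') (t0 + t) - a' - (bg D (label_of b') (t0 + t) - b') =
     (bg D (label_of a') (t0 + t) - bg D (label_of b') (t0 + t)) + - (a' - b') by ring.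
  by apply: le_lt_trans (cabsD _ _) _; rewrite cabsN; flra.
split.
  move=> a' p Aa' /(pl _ _ Aa') /inPlaqueE [t [h E]]; have [Al _] := lab a' Aa'.
  by apply: (lam_inv hL) (gb_X gD Al h) (Meq_sym E).
move=> a' b' p Aa' Ab' ab pa pb; apply: ab.
have [Ala <-] := lab a' Aa'; have [Alb <-] := lab b' Ab'.
by rewrite (gb_disj gD Ala Alb (pl _ _ Aa' pa) (pl _ _ Ab' pb)).
Qed.

Lemma rec_nbhd c eta r rz rw : good_box om1 om2 X D -> fb_A D c -> cabs t0 < fb_r1 D -> 0 < eta -> 0 < r ->
  box_nbhd D (gam D c t0) -> box_nbhd (recbox (bg D c t0) eta r rz rw) (gam D c t0).
Proof.
move=> gD Ac ht eta0 r0 hb.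
have [d d0 hd] := (box_nbhd_coord (lam_inv hL) gD ht (gb_dom gD Ac ht)).1 hb.
have [|Lg Lg0 hLg] := @gb_lipschitz _ om1 om2 X D ((cabs t0 + fb_r1 D) / 2) gD; first by flra.
have L1 : 0 < Lg + 1 by flra.
have g0 : 0 < (fb_r1 D - cabs t0) / 2 by flra.
have [m1 m10 [m1a m1b m1c]] := exists_min3 d0 r0 (divr_gt0 eta0 L1).
have [m m0 [ma mb _]] := exists_min3 m10 g0 ltr01.
have [d1 d10 hd1] := @box_point _ om1 om2 L D t0 (bg D c t0) m gD m0.
exists d1; split=> // x Xx /hd1 [t [y [E h1 h2]]].
have [a Aa ya] := hd t y ltac:(flra) ltac:(flra) (lam_inv hL Xx E).
have tm : cabs t <= (cabs t0 + fb_r1 D) / 2 by have := cabs_lerB t t0; flra.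
have k1 := hLg a t t0 Aa tm ht; rewrite -ya (cabsB t0) in k1.
have k2 : Lg * cabs (t - t0) <= Lg * m by rewrite ler_wpM2l ?(ltW Lg0) // ltW.
have k3 : m * (Lg + 1) <= eta.
  by apply: le_trans (_ : m1 * (Lg + 1) <= _); [rewrite ler_wpM2r // ltW|rewrite -ler_pdivlMr].
exists (bg D a t0); split.
  by exists a; split=> //; have := cabs_distD y (bg D a t0) (bg D c t0); flra.
apply/rec_inPlaque; exists t; split; first by flra.
by rewrite label_ofP // -ya.
Qed.

End Recentre.
End LocalBox.

Section LocalBound.
Variable R : realType.
Local Notation C := R[i].
Variables om1 om2 : C.
Hypothesis hom1 : om1 != 0.
Hypothesis hom : cim (om2 / om1) != 0.
Variable L : Lamination R.
Hypothesis hL : is_lamination om1 om2 L.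
Implicit Types (z w l t y a b c : C) (p q x : Mpt R) (B : FlowBox R).
Local Notation inLat := (inLat om1 om2).
Local Notation Meq := (Meq om1 om2).
Local Notation Mclose := (Mclose om1 om2).
Local Notation inPlaque := (inPlaque om1 om2).
Local Notation X := (lam_X L).
Local Notation leaf := (leaf om1 om2 L).
Local Notation gam B a t := (bpt B t (bg B a t)).
Local Notation Flow := (flow_box_of om1 om2 L).
Local Notation box_nbhd := (box_nbhd om1 om2 X).
Variable sc : C -> R.

(** Intersection points distinct in the surface have distinct parameters on the plaque [b], and
    these are zeros of [bh], to which Jensen's bound applies. Radius and constants are fixed before
    the width [eta] of the box. *)
Lemma local_zeros D c t0 : Flow D -> fb_A D c -> cabs t0 < fb_r1 D -> apriori sc D t0 ->
  exists eta0 r K e1 : R, [/\ 0 < eta0, 0 < r, 0 <= K, 0 < e1 &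
   [/\ r <= 1, cabs t0 + r < fb_r1 D, ~~ fb_vert D -> cabs t0 + r < fb_rz D &
   forall eta rz rw a b e n (g : 'I_n -> Mpt R), eta <= eta0 -> (0 < n)%N ->
   let B := recbox D t0 (bg D c t0) eta r rz rw in
   fb_A B a -> fb_A B b -> cabs e < e1 -> (forall i, plaque_inter om1 om2 B a b e (g i)) ->
   (forall i j, Meq (g i) (g j) -> i = j) ->
   forall z, cabs (z - t0) < r -> cabs (bh D (label_of D t0 a) (label_of D t0 b) e z) <= K * (sc e / 2 ^+ n)]].
Proof.
move=> F Ac ht [rA [K [eA [rA0 hrA K0 eA0 hap]]]]; have gD := flow_good F.
set y0 := bg D c t0.
have hz : cabs (bz D t0 y0) < fb_rz D := gb_dom gD Ac ht.
set G := fb_rz D - cabs (bz D t0 y0); have G0 : 0 < G by rewrite subr_gt0.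
have [|Lg Lg0 hLg] := @gb_lipschitz _ om1 om2 X D ((cabs t0 + fb_r1 D) / 2) gD; first by flra.
have L1 : 0 < Lg + 1 by flra.
have G4 : 0 < G / 4 by flra.
have g0 : 0 < (fb_r1 D - cabs t0) / 2 by flra.
(* [rA / 16] is the margin required by [zeros_bound]; the first term keeps the plaques and their
   translates where the coordinates of [D] are injective. *)
have [r1 r10 [r1a r1b r1c]] := exists_min3 (divr_gt0 G4 L1) (ltac:(flra) : 0 < rA / 16) g0.
have [r r0 [ra rb _]] := exists_min3 r10 ltr01 ltr01.
have gA : 0 < fb_r1 D - (cabs t0 + rA) by flra.
have [e1 e10 [e1a e1b e1c]] := exists_min3 eA0 G4 gA.
have rL : (Lg + 1) * r <= G / 4.
  by apply: le_trans (_ : (Lg + 1) * r1 <= _); [rewrite ler_wpM2l // ltW|rewrite mulrC -ler_pdivlMr].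
have rG : r <= G / 4 by apply: le_trans rL; rewrite ler_peMl ?(ltW r0) //; flra.
exists (G / 4), r, K, e1; split => //; split => //; [by flra|by move=> v; rewrite /G /bz (negbTE v) in rG G4; flra|].
move=> eta rz rw a b e n g heta n0 B Aa Ab he hg ginj.
have [al [Aal alE hal]] := Aa; have [be [Abe beE hbe]] := Ab.
have la : label_of D t0 a = al by rewrite -alE (label_ofP gD).
have lb : label_of D t0 b = be by rewrite -beE (label_ofP gD).
rewrite la lb.
have H i : exists u, [/\ cabs (u - t0) < r, bh D al be e u = 0 & Meq (g i) (Phi e (gam D be u))].
  have [/rec_inPlaque [s [hs Es]] [p' [/rec_inPlaque [u [hu Eu]] E]]] := hg i.
  rewrite la in Es; rewrite lb in Eu.
  have E' := Meq_trans E (Phi_Meq e Eu).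
  exists u; split => //; have := Meq_trans (Meq_sym Es) E'; rewrite Phi_bpt => E2.
  have um : cabs u <= (cabs t0 + fb_r1 D) / 2 by have := cabs_lerB u t0; flra.
  have k1 := hLg be u t0 Abe um ht; rewrite beE (cabsB t0) (cabsB b) in k1.
  have k2 : Lg * cabs (u - t0) <= Lg * r by rewrite ler_wpM2l ?(ltW Lg0) // ltW.
  have k3 := cabs_distD b (bg D be u) y0.
  have k4 : cabs (bg D be u - y0) < G / 2 by flra.
  have k5 : cabs (u - t0) < G / 2 by flra.
  have [b1 b2] := bsh_near D k5 k4 (ltac:(flra) : cabs e < G / 2).
  have sr : cabs s < fb_r1 D by have := cabs_lerB s t0; flra.
  have [|e1' e2'] := bpt_inj gD (gb_dom gD Aal sr) (bz_near b1 b2 _) E2; first by rewrite /G; flra.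
  by rewrite /bh -e1' -e2' subrr.
have [u hu] := choice H.
have uinj : injective u.
  move=> i j E; apply: ginj; have [_ _ h1] := hu i; have [_ _ h2] := hu j.
  by apply: Meq_trans h1 _; rewrite E; exact: Meq_sym.
pose zs := [seq u i | i <- enum 'I_n].
have zn : size zs = n by rewrite size_map size_enum_ord.
have hol : holo t0 rA (bh D al be e) by apply: (bh_holo gD Aal Abe); flra.
have [hu0 z0 _] := hu (Ordinal n0).
(* There is at least one zero as [0 < n], so the a priori estimate applies with [M = 0]. *)
have hM z : cabs (z - t0) < rA -> cabs (bh D al be e z) <= K * sc e.
  move=> hz'; have -> : K * sc e = K * (0 + 1) * sc e by rewrite add0r mulr1.
  apply: (hap al be e 0 Aal Abe _ _ (u (Ordinal n0)) z); [flra|by []|flra|by []|].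
  by rewrite z0 cabs0 mul0r.
move=> z hzr; rewrite mulrA -zn; apply: (@zeros_bound _ t0 rA r) => //; [by flra| | |by flra].
  by rewrite map_inj_uniq // enum_uniq.
by move=> w /mapP [i _ ->]; have [] := hu i.
Qed.

Hypothesis hnc : no_compact_leaf om1 om2 L.
Hypothesis sc_ge0 : forall e, 0 <= sc e.
(** [om] is the gauge of the bound to be proved: 1 with [sc] the modulus in the Lipschitz case,
    log(1 / |e|) with [sc = 1] otherwise. By [om_rate], too many intersections relative to the gauge
    beat |e| for every loss [j] of exponent. *)
Variables (om : C -> R) (w0 : R).
Hypothesis w00 : 0 < w0.
Hypothesis om_ge1 : forall e, 0 < cabs e -> cabs e < w0 -> 1 <= om e.
Hypothesis om_rate : forall j (d : R), (0 < j)%N -> 0 < d -> exists k0 (e0 : R), 0 < e0 /\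
  forall k e n, (k0 <= k)%N -> 0 < cabs e -> cabs e < e0 -> k%:R * om e <= n%:R ->
  sc e / 2 ^+ (n %/ j) <= d * cabs e.
Hypothesis HAP : forall q, X q -> exists D c t,
  [/\ Flow D, fb_A D c, cabs t < fb_r1 D, Meq q (gam D c t) & box_nbhd D q] /\ apriori sc D t.

Definition card_bound B (A e0 : R) := forall e, 0 < cabs e -> cabs e < e0 ->
  forall a b, fb_A B a -> fb_A B b -> card_lt om1 om2 (plaque_inter om1 om2 B a b e) (A * om e).

Lemma evn_inv (d : R) : 0 < d -> evn (fun k => (k.+1%:R : R)^-1 < d).
Proof.
move=> d0; have [k] := ltr_add_invr d0; rewrite add0r => hk; exists k => n kn.
by apply: le_lt_trans hk; rewrite lef_pV2 ?posrE ?ltr0Sn // ler_nat.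
Qed.

(** Failure for all boxes around [p] is tested on recentred boxes of fixed radius and shrinking
    width, with growing constant and shrinking translations. The resulting sequence makes [p] a
    small point, against [not_small]. *)
Lemma local_bound p : X p -> exists B (A e0 : R), [/\ Flow B, box_nbhd B p, 0 < A, 0 < e0 & card_bound B A e0].
Proof.
move=> Xp; apply: contrapT => none.
have [D [c [t0 [[F Ac ht E hb] hap]]]] := HAP Xp; have gD := flow_good F.
have [eta0 [r [K [e1 [eta00 r0 K0 e10 [r1 hr hrz hz]]]]]] := local_zeros F Ac ht hap.
(* What a violation at stage [k] leaves behind: a translation, a number of intersections at least
   [k + 1] times the gauge, and two plaques within [1 / (k + 1)] of the plaque of [p] with the bound
   of [local_zeros]. *)
pose P k (en : C * nat) := [/\ 0 < cabs en.1, cabs en.1 < k.+1%:R^-1, k.+1%:R * om en.1 <= en.2%:R &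
  exists al be, [/\ fb_A D al, fb_A D be, cabs (bg D al t0 - bg D c t0) < k.+1%:R^-1,
    cabs (bg D be t0 - bg D c t0) < k.+1%:R^-1 &
    forall u, cabs (u - t0) < r -> cabs (bh D al be en.1 u) <= K * (sc en.1 / 2 ^+ en.2)]].
have H k : exists en, P k en.
  apply: contrapT => no; apply: none.
  have k0 : 0 < k.+1%:R^-1 :> R by rewrite invr_gt0 ltr0Sn.
  have [eta etap [eta1 eta2 _]] := exists_min3 eta00 k0 ltr01.
  have [rz [rw hflow]] := rec_flow hL (bg D c t0) eta F ht r0 hr.
  have [e0 e00 [e0a e0b e0c]] := exists_min3 k0 w00 e10.
  exists (recbox D t0 (bg D c t0) eta r rz rw), k.+1%:R, e0; split => //; first exact: hflow.
    by apply: box_nbhd_Meq (Meq_sym E) _; apply: rec_nbhd => //; exact: box_nbhd_Meq E hb.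
  move=> e ep he a b Aa Ab n g hg ginj; rewrite ltNge; apply/negP => hle; apply: no.
  have n0 : (0 < n)%N.
    rewrite -(ltr0n R); apply: lt_le_trans hle; rewrite mulr_gt0 ?ltr0Sn //.
    by apply: lt_le_trans ltr01 (om_ge1 ep _); exact: lt_le_trans he e0b.
  exists (e, n); split => //=; first exact: lt_le_trans he e0a.
  have [al [Aal alE hal]] := Aa; have [be [Abe beE hbe]] := Ab.
  exists al, be; rewrite alE beE; split => //; [exact: lt_le_trans hal eta2|exact: lt_le_trans hbe eta2|].
  have := hz eta rz rw a b e n g eta1 n0 Aa Ab (lt_le_trans he e0c) hg ginj.
  by rewrite -{1}alE -{1}beE !(label_ofP gD).
have [f hf] := choice H.
pose eps k := (f k).1; pose N k := (f k).2.
have eps_neq0 k : eps k != 0 by rewrite -cabs_gt0; have [] := hf k.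
have eps_lim (d : R) : 0 < d -> evn (fun k => cabs (eps k) < d).
  by move=> d0; apply: evn_imp (evn_inv d0) => k; apply: lt_trans; have [] := hf k.
have rate j (d : R) : (0 < j)%N -> 0 < d -> evn (fun k => sc (eps k) / 2 ^+ (N k %/ j) <= d * cabs (eps k)).
  move=> j0 d0; have [k0 [e0 [e00 h]]] := om_rate j0 d0.
  have [k1 hk1] := eps_lim e0 e00.
  exists (maxn k0 k1) => k; rewrite geq_max => /andP[h1 h2]; have [h3 _ h4 _] := hf k.
  by apply: (h k.+1) => //; [exact: leqW|exact: hk1].
apply: (not_small hom1 hom hL hnc sc_ge0 eps_neq0 eps_lim rate HAP Xp).
(* No exponent has been lost yet, hence [j = 1]. *)
exists D, c, t0, r, K, 1%N; split=> //; split=> // d d0.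
apply: evn_imp (evn_inv d0) => k hk; have [_ _ _ [al [be [Aal Abe h1 h2 h3]]]] := hf k.
by exists al, be; split=> //; [exact: lt_trans h1 hk|exact: lt_trans h2 hk|rewrite divn1].
Qed.

Lemma cover_bound : exists (n : nat) (b : nat -> FlowBox R) (A e0 : R), [/\ 0 < A, 0 < e0,
  forall i, (i < n)%N -> Flow (b i) /\ card_bound (b i) A e0 &
  forall q, X q -> exists2 i, (i < n)%N & box_nbhd (b i) q].
Proof.
pose P (U : Mset R) := exists (n : nat) (b : nat -> FlowBox R) (A e0 : R), [/\ 0 < A, 0 < e0,
  forall i, (i < n)%N -> Flow (b i) /\ card_bound (b i) A e0 &
  forall q, U q -> exists2 i, (i < n)%N & box_nbhd (b i) q].
apply: (@Mcompact_ind _ om1 om2 hom1 hom X (lam_closed hL) P).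
- by move=> U U' UU' [n [b [A [e0 [? ? ? h]]]]]; exists n, b, A, e0; split=> // q /UU'; exact: h.
- move=> U U' [n [b [A [e0 [A0 e00 h1 h2]]]]] [n' [b' [A' [e0' [A'0 e0'0 h1' h2']]]]].
  have [m m0 [m1 m2 m3]] := exists_min3 e00 e0'0 w00.
  have mono B (A1 e2 : R) : m <= e2 -> A1 <= A + A' -> card_bound B A1 e2 -> card_bound B (A + A') m.
    move=> me AA h e ep em a c Aa Ac k g hg ginj.
    apply: lt_le_trans (h e ep (lt_le_trans em me) a c Aa Ac k g hg ginj) _.
    by rewrite ler_wpM2r //; have := om_ge1 ep (lt_le_trans em m3); flra.
  exists (n + n')%N, (fun i => if (i < n)%N then b i else b' (i - n)%N), (A + A'), m; split=> //; first by flra.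
    move=> i hi; case: ifPn => h; first by have [f1 f2] := h1 i h; split=> //; apply: mono f2; flra.
    have [|f1 f2] := h1' (i - n)%N; first by rewrite ltn_subLR // leqNgt.
    by split=> //; apply: mono f2; flra.
  move=> q [/h2 [i hi hq]|/h2' [i hi hq]].
    by exists i; [exact: ltn_addr|rewrite hi].
  by exists (n + i)%N; [rewrite ltn_add2l|rewrite ltnNge leq_addr /= addKn].
- by exists 0%N, (fun=> {| fb_vert := true; fb_chart := true; fb_z0 := 0; fb_w0 := 0; fb_rz := 0; fb_rw := 0;
    fb_r1 := 0; fb_A := fun=> True; fb_f := fun _ _ => 0 |}), 1, 1; split.
move=> q Xq; have [B [A [e0 [F hb A0 e00 h]]]] := local_bound Xq.
have [d d0 hd] := box_nbhd_open hb; exists d => //.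
exists 1%N, (fun=> B), A, e0; split=> // x [_ xq]; exists 0%N => //; exact: hd.
Qed.

End LocalBound.

(** * Growth rates for the two gauges *)

Section Rates.
Variable R : realType.
Local Notation C := R[i].

Lemma rate_lipschitz (j : nat) (d : R) : (0 < j)%N -> 0 < d -> exists k0 (e0 : R), 0 < e0 /\
  forall k (e : C) n, (k0 <= k)%N -> 0 < cabs e -> cabs e < e0 -> k%:R * (1 : R) <= n%:R ->
  cabs e / 2 ^+ (n %/ j) <= d * cabs e.
Proof.
move=> j0 d0; have [|m hm] := @seq_exp_lt R (1 / 2) d _ d0; first by apply/andP; split; flra.
exists (m * j)%N, 1; split=> // k e n hk ep _; rewrite mulr1 ler_nat => kn.
have mn : (m <= n %/ j)%N by rewrite leq_divRL //; exact: leq_trans hk kn.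
rewrite mulrC ler_wpM2r ?cabs_ge0 //; apply: le_trans (ltW hm).
by rewrite mul1r exprVn lef_pV2 ?posrE ?exprn_gt0 // ler_weXn2l //; flra.
Qed.

Lemma expR_half_le2 : expR (1 / 2) <= 2 :> R.
Proof.
have := @expR_ge1Dx R (- (1 / 2)); rewrite expRN => h.
have p0 := @expR_gt0 R (1 / 2).
rewrite -[X in _ <= X]invrK -[X in X <= _]invrK lef_pV2 ?posrE ?invr_gt0 //.
by apply: le_trans h; flra.
Qed.

(** Write |e| = exp(-x) with x >= 1. From n >= 5 j x the quotient n / j is at least 4 x after
    rounding down, since 1 <= x. As 2 >= exp(1/2), 2^(n / j) >= exp(2 x) = |e|^(-2), and |e| < d
    gives the rest. *)
Lemma rate_log (j : nat) (d : R) : (0 < j)%N -> 0 < d -> exists k0 (e0 : R), 0 < e0 /\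
  forall k (e : C) n, (k0 <= k)%N -> 0 < cabs e -> cabs e < e0 -> k%:R * ln (1 / cabs e) <= n%:R ->
  1 / 2 ^+ (n %/ j) <= d * cabs e.
Proof.
move=> j0 d0; exists (5 * j)%N, (Num.min d (expR (-1))).
split=> [|k e n hk ep]; first by rewrite lt_min d0 expR_gt0.
rewrite lt_min => /andP[ed e1]; rewrite div1r lnV ?posrE // => hn.
set x := - ln (cabs e) in hn.
have xE : cabs e = expR (- x) by rewrite opprK lnK.
have x1 : 1 <= x by rewrite lerNr -[leRHS]expRK ler_ln ?posrE ?expR_gt0 //; exact: ltW.
clearbody x.
have h1 : 4 * x <= (n %/ j)%:R.
  have h2 : n%:R < (((n %/ j).+1 * j)%N%:R : R) by rewrite ltr_nat ltn_ceil.
  have h3 : (5 * j)%:R * x <= n%:R.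
    by apply: le_trans hn; rewrite ler_wpM2r ?ler_nat //; flra.
  rewrite natrM mulrAC in h3; rewrite natrM in h2.
  have : 5 * x < (n %/ j).+1%:R by rewrite -(ltr_pM2r (_ : 0 < j%:R)) ?ltr0n //; exact: le_lt_trans h3 h2.
  by rewrite -natr1; flra.
apply: (@le_trans _ _ (cabs e * cabs e)); last by rewrite ler_wpM2r // ltW.
rewrite xE -expRD -opprD expRN div1r lef_pV2 ?posrE ?expR_gt0 ?exprn_gt0 //.
apply: (@le_trans _ _ (expR ((n %/ j)%:R * (1 / 2)))).
  by rewrite ler_expR; flra.
by rewrite expRM_natl lerXn2r ?nnegrE ?expR_ge0 // expR_half_le2.
Qed.

Lemma ln_inv_ge1 (x : R) : 0 < x -> x < expR (-1) -> 1 <= ln (1 / x).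
Proof.
by move=> x0 h; rewrite div1r lnV ?posrE // lerNr -[leRHS]expRK ler_ln ?posrE ?expR_gt0 // ltW.
Qed.

End Rates.

(** * The two covers and the conclusion *)

Section Main.
Variable R : realType.
Local Notation C := R[i].
Variables om1 om2 : C.
Hypothesis hom1 : om1 != 0.
Hypothesis hom : cim (om2 / om1) != 0.
Variable L : Lamination R.
Hypothesis hL : is_lamination om1 om2 L.
Implicit Types (z w l t y a b c : C) (p q x : Mpt R) (B : FlowBox R).
Local Notation inLat := (inLat om1 om2).
Local Notation Meq := (Meq om1 om2).
Local Notation Mclose := (Mclose om1 om2).
Local Notation inPlaque := (inPlaque om1 om2).
Local Notation X := (lam_X L).
Local Notation leaf := (leaf om1 om2 L).
Local Notation gam B a t := (bpt B t (bg B a t)).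
Local Notation Flow := (flow_box_of om1 om2 L).
Local Notation box_nbhd := (box_nbhd om1 om2 X).
Hypothesis hnc : no_compact_leaf om1 om2 L.

Lemma cover_bound_log : exists (n : nat) (b : nat -> FlowBox R) (A e0 : R), [/\ 0 < A, 0 < e0,
  forall i, (i < n)%N -> Flow (b i) /\ card_bound om1 om2 (fun e => ln (1 / cabs e)) (b i) A e0 &
  forall q, X q -> exists2 i, (i < n)%N & box_nbhd (b i) q].
Proof.
apply: (@cover_bound R om1 om2 hom1 hom L hL (fun=> 1) hnc _ (fun e => ln (1 / cabs e)) (expR (-1))) => //.
- by move=> e ep he; exact: ln_inv_ge1.
- exact: rate_log.
move=> q Xq; have [D AD hb] := atlas_box hL Xq; have F := atlas_flow hL AD.
have [c Ac qc] := box_nbhd_plaque hb Xq.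
have [t [ht E]] := (inPlaqueE _ _ _ _ _).1 qc.
by exists D, c, t; split => //; exact: apriori_bounded (flow_good F) ht.
Qed.

(** The a priori bound is available only in the boxes that come with the Lipschitz condition, which
    may be foreign to the atlas; the cover obtained consists of recentred pieces of them. *)
Lemma cover_bound_lipschitz : transversally_lipschitz om1 om2 L ->
  exists (n : nat) (b : nat -> FlowBox R) (A e0 : R), [/\ 0 < A, 0 < e0,
  forall i, (i < n)%N -> Flow (b i) /\ card_bound om1 om2 (fun=> 1) (b i) A e0 &
  forall q, X q -> exists2 i, (i < n)%N & box_nbhd (b i) q].
Proof.
move=> [n [cov [K [K0 [[Fc hc] hK]]]]].
apply: (@cover_bound R om1 om2 hom1 hom L hL (@cabs R) hnc _ (fun=> 1) 1) => //.
- exact: cabs_ge0.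
- exact: rate_lipschitz.
move=> q Xq; have [i hb] := hc q Xq; have F := Fc i.
have [c Ac qc] := box_nbhd_plaque hb Xq.
have [t [ht E]] := (inPlaqueE _ _ _ _ _).1 qc.
exists (cov i), c, t; split => //; apply: (apriori_lipschitz (flow_good F) ht K0) => a b s.
exact: hK.
Qed.

End Main.

Theorem theorem4p2 (R : realType) (om1 om2 : R[i])
  (* T^1 = C / (Z om1 + Z om2) is an elliptic curve: om1, om2 R-linearly independent *)
  (hom1 : om1 != 0) (hom : cim (om2 / om1) != 0)
  (L : Lamination R)
  (hL : is_lamination om1 om2 L)
  (hnc : no_compact_leaf om1 om2 L)
  (hmin : unique_minimal_set om1 om2 L) :
  exists (n : nat) (cov : 'I_n -> FlowBox R),
    flow_box_cover om1 om2 L cov /\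
    exists (N : nat) (eps0 A : R), 0 < eps0 /\ 0 < A /\
      forall eps : R[i], 0 < cabs eps -> cabs eps < eps0 ->
      forall (i : 'I_n) (a b : R[i]), fb_A (cov i) a -> fb_A (cov i) b ->
        (transversally_lipschitz om1 om2 L ->
           card_lt om1 om2 (plaque_inter om1 om2 (cov i) a b eps) N%:R) /\
        card_lt om1 om2 (plaque_inter om1 om2 (cov i) a b eps) (A * ln (1 / cabs eps)).
Proof.
(* The cover is chosen according to the case: pieces of the Lipschitz cover, or pieces of atlas
   boxes. *)
have [hLip|nLip] := pselect (transversally_lipschitz om1 om2 L).
  have [n [b [A [e0 [A0 e00 hb hc]]]]] := cover_bound_lipschitz hom1 hom hL hnc hLip.
  exists n, (fun i => b i); split.
    split=> [i|q /hc [i hi hq]]; first by have [] := hb i (ltn_ord i).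
    by exists (Ordinal hi).
  (* Below exp(-1) the logarithm is at least 1, so the constant bound [A] also gives the logarithmic
     one. *)
  have [e1 e10 [e1a e1b _]] := exists_min3 e00 (expR_gt0 (-1)) e00.
  exists (Num.truncn A).+1, e1, A; split=> //; split=> // e ep he i a c Aa Ac.
  have h := (hb i (ltn_ord i)).2 e ep (lt_le_trans he e1a) a c Aa Ac; rewrite mulr1 in h.
  split=> [_|] k g hg ginj; apply: lt_le_trans (h k g hg ginj) _.
    by apply: ltW; exact: truncnS_gt.
  by rewrite ler_peMr ?(ltW A0) // ln_inv_ge1 //; exact: lt_le_trans he e1b.
have [n [b [A [e0 [A0 e00 hb hc]]]]] := cover_bound_log hom1 hom hL hnc.
exists n, (fun i => b i); split.
  split=> [i|q /hc [i hi hq]]; first by have [] := hb i (ltn_ord i).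
  by exists (Ordinal hi).
(* Any [N] will do here, as the premise of the first bound is false. *)
exists 0%N, e0, A; split=> //; split=> // e ep he i a c Aa Ac; split; first by move/nLip.
exact: (hb i (ltn_ord i)).2 e ep he a c Aa Ac.
Qed.
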